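(* For $n=3$ the algebra $\mathcal{A}$ of differential invariants of the $\mathcal{G}$-action on $\tilde{\mathcal{E}}$ (degenerate Kundt metrics) is generated by the differential invariants $I_1,I_{2a},I_{2c}$ and the invariant derivations $$\nabla_1=\frac{I_1}{I_{2a}I_{2b}}\cdot\frac{Q}{W_v}\,\mathcal{D}_v,\qquad \nabla_2=\frac{1}{W_v}\left(\mathcal{D}_x-\frac{K_{2a}}{I_{2a}}W\,\mathcal{D}_v\right),$$ $$\nabla_3=\frac{2I_{2a}}{I_1}\cdot\frac{1}{QW_v}\left(K_{2b}W\,\mathcal{D}_x-I_{2b}h\,\mathcal{D}_u+R\,\mathcal{D}_v\right),$$ where $$I_1=\frac{W_v^2}{h},\quad I_{2a}=H_{vv},\quad I_{2b}=\frac{W_vh_x-2hW_{xv}}{h^2},\quad K_{2a}=\frac{H_{xv}-W_{uv}}{W},\quad K_{2b}=\frac{W_vh_u-2hW_{uv}}{Wh},$$ $$Q=\frac{(2I_{2a}K_{2b}+I_{2b}K_{2a}-I_{2a}I_{2b})W}{I_1},\qquad R=\frac{I_{2b}HW_v^2}{I_1}-\frac{\left(I_{2b}I_{2a}^2-2K_{2a}(I_{2b}-2K_{2b})I_{2a}+I_{2b}K_{2a}^2\right)W^2}{4I_{2a}^2},$$ $$\begin{aligned}I_{2c}=\frac{1}{Q^2}\Big(&\frac{\left(I_1^2h_u(WW_v+h_u)-\left(h_x(H_vW-H_x+W_u)I_1^2-W_v^4I_{2b}H\right)\right)I_{2a}I_{2b}}{W_v^2}\\&-2\left(W_vH_x+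(h_u-W_x)H_v+H_{xx}-W_{ux}+h_{uu}\right)I_1I_{2a}I_{2b}\\&-W^2I_1\left(K_{2b}(I_{2b}-K_{2b})I_{2a}-2I_{2b}K_{2a}^2\right)\Big).\end{aligned}$$
   Context: Three-dimensional degenerate Kundt metrics in adapted coordinates $(u,x,v)$ are $g=du\,(dv+H\,du+W\,dx)+h\,dx^2$ with $H,W$ functions of $(u,x,v)$, $h=h(u,x)>0$, $W_{vv}=0$, $H_{vvv}=0$. Let $\pi$ be the trivial bundle over $\mathbb{R}^3(u,x,v)$ with fiber coordinates $H,W,h$ ($h>0$). $\tilde{\mathcal{E}}^k\subset J^k\pi$ is given by those of the equations $h_v=0$, $W_{vv}=0$, $H_{vvv}=0$ and all their total derivatives that have order $\le k$; $\tilde{\mathcal{E}}^\infty$ is the infinite prolongation. $\mathcal{G}$ is the Lie pseudogroup of local diffeomorphisms $(u,x,v)\mapsto(C(u),A(u,x),v/C'(u)+B(u,x))$ with $A_x\neq0$, $C'\ne0$; it acts on metrics $du(dv+Hdu+Wdx)+h\,dx^2$, hence on $J^0\pi$ (so that $g$, viewed as a horizontal symmetric 2-form on $\pi$, is invariant), and the action prolongs to jets preserving $\tilde{\mathcal{E}}^k$. Subscripts on $H,W,h$ denote jet variables; $\mathcal{D}_u,\mathcal{D}_x,\mathcal{D}_v$ are the total derivatives. A differential invariant of order $\le k$ is a function on $\tilde{\mathcal{E}}^k$ constant on $\mathcal{G}$-orbits, which is rational in the jet variables (and polynomial in jet variables of sufficiently high order); $\mathcal{A}$ is the union over $k$ of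 the spaces of these. An invariant derivation is a horizontal vector field (combination of total derivatives with coefficients functions on some $\tilde{\mathcal{E}}^r$) invariant under $\mathcal{G}$. ''$\mathcal{A}$ is generated by invariants $I_a$ and invariant derivations $\nabla_b$'' is meant in the Lie–Tresse sense: $\mathcal{A}$ is generated by the $I_a$ and all their iterated derivatives $\nabla_{b_1}\cdots\nabla_{b_t}I_a$, so that generic $\mathcal{G}$-orbits in $\tilde{\mathcal{E}}^\infty$ are separated by these functions. *)

(* Defs.v *)
From HB Require Import structures.
From mathcomp Require Import all_boot all_order all_algebra.
From mathcomp Require Import all_classical all_reals all_analysis.
Set Implicit Arguments.
Unset Strict Implicit.
Unset Printing Implicit Defensive.
Import Order.TTheory GRing.Theory Num.Theory numFieldNormedType.Exports.
Local Open Scope classical_set_scope.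
Local Open Scope ring_scope.

(* Base points and tangent vectors of R^3(u,x,v) are row vectors. *)
Definition iu : 'I_3 := @Ordinal 3 0 isT.
Definition ix : 'I_3 := @Ordinal 3 1 isT.
Definition iv : 'I_3 := @Ordinal 3 2 isT.

Definition row3 (R : realType) (a b c : R) : 'rV[R]_3 :=
  \row_(i < 3) [:: a; b; c]`_i.

Inductive comp := cH | cW | ch.

(* [jcoord th c i j l] is the jet variable c_{u^i x^j v^l}. Points of J^k are
   represented by elements of this type, of which only the jet variables of
   order i + j + l <= k are relevant; the elements themselves are the points of
   J^oo. *)
Record jet (R : realType) := Jet {
  jbase : 'rV[R]_3;
  jcoord :> comp -> nat -> nat -> nat -> R
}.

Section Sections.
Context (R : realType).

Fixpoint pderiv (s : seq 'I_3) (f : 'rV[R]_3 -> R) : 'rV[R]_3 -> R :=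
  if s is i :: s' then fun p => 'D_(delta_mx 0 i) (pderiv s' f) p else f.

Definition smooth_near (a : 'rV[R]_3) (f : 'rV[R]_3 -> R) : Prop :=
  \forall p \near a, forall s, differentiable (pderiv s f) p.

Definition section_near (a : 'rV[R]_3) (s : comp -> 'rV[R]_3 -> R) : Prop :=
  (forall c, smooth_near a (s c)) /\ (\forall p \near a, 0 < s ch p).

Definition is_jet (k : nat) (a : 'rV[R]_3) (s : comp -> 'rV[R]_3 -> R)
    (th : jet R) : Prop :=
  jbase th = a /\
  forall c i j l, (i + j + l <= k)%N ->
    th c i j l = pderiv (nseq i iu ++ nseq j ix ++ nseq l iv) (s c) a.

(* The quadratic form xi |-> g(xi, xi) of the metric
   g = du (dv + H du + W dx) + h dx^2. *)
Definition kundt (y : comp -> R) (xi : 'rV[R]_3) : R :=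
  xi 0 iu * (xi 0 iv + y cH * xi 0 iu + y cW * xi 0 ix) + y ch * xi 0 ix ^+ 2.

(* The germ of phi at a belongs to the pseudogroup G. *)
Definition in_G (a : 'rV[R]_3) (phi : 'rV[R]_3 -> 'rV[R]_3) : Prop :=
  exists (C : R -> R) (A B : R -> R -> R),
  [/\ [/\ smooth_near a (fun p => C (p 0 iu)),
          smooth_near a (fun p => A (p 0 iu) (p 0 ix)) &
          smooth_near a (fun p => B (p 0 iu) (p 0 ix))],
      \forall p \near a, derive1 C ((p : 'rV[R]_3) 0 iu) != 0,
      \forall p \near a, derive1 (A ((p : 'rV[R]_3) 0 iu)) (p 0 ix) != 0 &
      \forall p \near a,
        phi p = row3 (C (p 0 iu)) (A (p 0 iu) (p 0 ix))
                  (p 0 iv / derive1 C (p 0 iu) + B (p 0 iu) (p 0 ix))].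

(* The prolongation of phi to J^k maps th to th'. The transform s' of a section
   s is characterised by phi^* g_{s'} = g_s. *)
Definition prolong (k : nat) (phi : 'rV[R]_3 -> 'rV[R]_3) (th th' : jet R)
    : Prop :=
  exists s s' : comp -> 'rV[R]_3 -> R,
  [/\ section_near (jbase th) s, section_near (phi (jbase th)) s',
      is_jet k (jbase th) s th, is_jet k (phi (jbase th)) s' th' &
      \forall p \near jbase th, forall xi : 'rV[R]_3,
        kundt (s' ^~ (phi p)) ('d phi p xi) = kundt (s ^~ p) xi].

(* Membership in the degenerate Kundt equation of order k; the open condition
   h > 0 is part of the definition of the bundle. *)
Definition eqE (k : nat) (th : jet R) : Prop :=
  [/\ 0 < th ch 0%N 0%N 0%N,
      forall i j l, (i + j + l.+1 <= k)%N -> th ch i j l.+1 = 0,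
      forall i j l, (i + j + l.+2 <= k)%N -> th cW i j l.+2 = 0 &
      forall i j l, (i + j + l.+3 <= k)%N -> th cH i j l.+3 = 0].

Definition eqEoo (th : jet R) : Prop := forall k, eqE k th.

End Sections.

Section Functions.
Context (R : realType).

(* The R-subalgebra of functions generated by a family of functions. *)
Inductive subalg (G : (jet R -> R) -> Prop) : (jet R -> R) -> Prop :=
| subalg_gen f : G f -> subalg G f
| subalg_cst c : subalg G (fun _ => c)
| subalg_add f g : subalg G f -> subalg G g -> subalg G (fun th => f th + g th)
| subalg_mul f g : subalg G f -> subalg G g -> subalg G (fun th => f th * g th).

Definition coordinate (k : nat) (f : jet R -> R) : Prop :=
  (exists a, f = fun th => jbase th 0 a) \/
  (exists c i j l, (i + j + l <= k)%N /\ f = fun th => th c i j l).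

Definition jetpoly (k : nat) : (jet R -> R) -> Prop :=
  subalg (coordinate k).

(* For a polynomial S: S is not identically zero on the equation, so that
   {S != 0} is a nonempty Zariski-open, "generic", subset of it. *)
Definition nonzero (S : jet R -> R) : Prop :=
  exists th, eqEoo th /\ S th != 0.

(* F is a differential invariant of order <= k, rational in the jet variables
   of order <= l and polynomial in those of order > l. The values of F where
   the denominator S vanishes are irrelevant. *)
Definition diff_invariant (l k : nat) (F : jet R -> R) : Prop :=
  exists P S : jet R -> R,
  [/\ jetpoly k P, jetpoly (minn l k) S, nonzero S,
      forall th, eqE k th -> S th != 0 -> F th = P th / S th &
      forall phi th th', eqE k th -> eqE k th' ->
        in_G (jbase th) phi -> prolong k phi th th' ->
        S th != 0 -> S th' != 0 -> F th' = F th].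

Definition algA (l : nat) (F : jet R -> R) : Prop :=
  exists k, diff_invariant l k F.

(* Line through th in J^oo whose direction is the lift of xi to the Cartan
   distribution, i.e. xi_u D_u + xi_x D_x + xi_v D_v at th. *)
Definition hline (th : jet R) (xi : 'rV[R]_3) (t : R) : jet R :=
  Jet (jbase th + t *: xi)
    (fun c i j l => th c i j l +
       t * (xi 0 iu * th c i.+1 j l + xi 0 ix * th c i j.+1 l
            + xi 0 iv * th c i j l.+1)).

Definition total_deriv (a : 'I_3) (F : jet R -> R) : jet R -> R :=
  fun th => derive1 (fun t : R => F (hline th (delta_mx 0 a) t)) 0.

(* A horizontal vector field is given by its coefficients with respect to the
   total derivatives D_u, D_x, D_v. *)
Definition hfield := jet R -> 'rV[R]_3.

Definition hderiv (nabla : hfield) (F : jet R -> R) : jet R -> R :=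
  fun th => \sum_(a < 3) nabla th 0 a * total_deriv a F th.

(* A horizontal field is the Cartan lift of its projection to the base, and
   prolongations preserve the Cartan distribution, so the pushforward by the
   prolongation of phi amounts to applying the differential of phi to the
   coefficient vector. *)
Definition invariant_derivation (r : nat) (nabla : hfield) : Prop :=
  exists (P : 'I_3 -> jet R -> R) (S : jet R -> R),
  [/\ forall a, jetpoly r (P a), jetpoly r S, nonzero S,
      forall th, eqE r th -> S th != 0 -> forall a, nabla th 0 a = P a th / S th &
      forall phi th th', eqE r th -> eqE r th' ->
        in_G (jbase th) phi -> prolong r phi th th' ->
        S th != 0 -> S th' != 0 -> nabla th' = 'd phi (jbase th) (nabla th)].

End Functions.

Section Invariants.
Context (R : realType) (th : jet R).

Local Notation H := (th cH 0%N 0%N 0%N).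
Local Notation Hv := (th cH 0%N 0%N 1%N).
Local Notation Hx := (th cH 0%N 1%N 0%N).
Local Notation Hvv := (th cH 0%N 0%N 2%N).
Local Notation Hxv := (th cH 0%N 1%N 1%N).
Local Notation Hxx := (th cH 0%N 2%N 0%N).
Local Notation W := (th cW 0%N 0%N 0%N).
Local Notation Wu := (th cW 1%N 0%N 0%N).
Local Notation Wx := (th cW 0%N 1%N 0%N).
Local Notation Wv := (th cW 0%N 0%N 1%N).
Local Notation Wuv := (th cW 1%N 0%N 1%N).
Local Notation Wxv := (th cW 0%N 1%N 1%N).
Local Notation Wux := (th cW 1%N 1%N 0%N).
Local Notation h := (th ch 0%N 0%N 0%N).
Local Notation hu := (th ch 1%N 0%N 0%N).
Local Notation hx := (th ch 0%N 1%N 0%N).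
Local Notation huu := (th ch 2%N 0%N 0%N).

Definition I1 : R := Wv ^+ 2 / h.
Definition I2a : R := Hvv.
Definition I2b : R := (Wv * hx - 2 * h * Wxv) / h ^+ 2.
Definition K2a : R := (Hxv - Wuv) / W.
Definition K2b : R := (Wv * hu - 2 * h * Wuv) / (W * h).
Definition Qf : R := (2 * I2a * K2b + I2b * K2a - I2a * I2b) * W / I1.
Definition Rf : R :=
  I2b * H * Wv ^+ 2 / I1
  - (I2b * I2a ^+ 2 - 2 * K2a * (I2b - 2 * K2b) * I2a + I2b * K2a ^+ 2) * W ^+ 2
    / (4 * I2a ^+ 2).
Definition I2c : R :=
  1 / Qf ^+ 2 *
  ((I1 ^+ 2 * hu * (W * Wv + hu)
    - (hx * (Hv * W - Hx + Wu) * I1 ^+ 2 - Wv ^+ 4 * I2b * H))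
     * I2a * I2b / Wv ^+ 2
   - 2 * (Wv * Hx + (hu - Wx) * Hv + Hxx - Wux + huu) * I1 * I2a * I2b
   - W ^+ 2 * I1 * (K2b * (I2b - K2b) * I2a - 2 * I2b * K2a ^+ 2)).

Definition nabla1 : 'rV[R]_3 :=
  row3 0 0 (I1 / (I2a * I2b) * (Qf / Wv)).
Definition nabla2 : 'rV[R]_3 :=
  (1 / Wv) *: row3 0 1 (- (K2a / I2a * W)).
Definition nabla3 : 'rV[R]_3 :=
  (2 * I2a / I1 * (1 / (Qf * Wv))) *: row3 (- (I2b * h)) (K2b * W) Rf.

End Invariants.

(* The functions nabla_{b_1} ... nabla_{b_t} I_a. *)
Inductive iterated (R : realType) : nat -> (jet R -> R) -> Prop :=
| iterated_I1 : iterated 0 (@I1 R)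
| iterated_I2a : iterated 0 (@I2a R)
| iterated_I2c : iterated 0 (@I2c R)
| iterated_nabla1 t F : iterated t F -> iterated t.+1 (hderiv (@nabla1 R) F)
| iterated_nabla2 t F : iterated t F -> iterated t.+1 (hderiv (@nabla2 R) F)
| iterated_nabla3 t F : iterated t F -> iterated t.+1 (hderiv (@nabla3 R) F).

(* Main.v *)
(* The formulas become regular at W = 0 when K2a and K2b are replaced by K2a W and
   K2b W. A generic solution of the equation is brought by the pseudogroup to a
   normal form: x is I1 up to a constant, v is the invariant ratio [rho], and the
   v-linear part H1 of H vanishes along the line x = 0, which is achieved by
   solving C'' = - H1 C'. On normal sections the derivations are
     nabla_1 = e v d_v,  nabla_2 = (1 / W_v) (d_x - (w + b v) d_v),
     nabla_3 = - (2 / (I1 e)) ((1 / v) (d_u - H d_v) + (I1 e^2 / 4) v d_v)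
   with e and b invariant and w the v-free part of W. Applied to I2c, their
   commutators recover w and the v-free part of H, so that the whole jet of a
   normal section at (0, 0, 1) is rational in the iterated derivatives of the
   invariants, which separates orbits. An arbitrary invariant is evaluated on the
   pullback of the normal form by one fixed transformation, where it is a rational
   function of that jet; its denominator involves jets of bounded order only. *)
Require Import Defs.
From HB Require Import structures.
From mathcomp Require Import all_boot all_order all_algebra.
From mathcomp Require Import all_classical all_reals all_analysis.
From mathcomp Require Import ring lra zify.
Set Implicit Arguments.
Unset Strict Implicit.
Unset Printing Implicit Defensive.
Import Order.TTheory GRing.Theory Num.Theory numFieldNormedType.Exports.
Local Open Scope classical_set_scope.
Local Open Scope ring_scope.

(** * Partial derivatives in three variables and their symmetry *)

Section Differentiability.
Context {R : realType}.
Local Notation V := 'rV[R]_3.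
Implicit Types (f g : V -> R) (p h : V) (c : 'I_3 -> R).

(** Normalising means solving equations by the implicit function theorem and one linear differential
    equation, so jets are first realised by germs of solutions; Borel's lemma supplies these at
    every point of the infinite prolongation. The domain [denr != 0] is used throughout because a
    transformation multiplies [denr] by a nonzero factor, whereas it shifts [W]: the set where [W]
    is nonzero is not a union of orbits, and the normal form of a point may leave it. The
    commutators never see the v-linear part of [H]: a change of the parameter u preserves the
    normalisation of x and v but shifts this part by [C'' / C']. Its u-derivatives are therefore
    removed by the choice of [C]; its x-derivative is forced by the normalisation of v. A
    differential invariant is controlled only where its own denominator is nonzero, and that
    denominator may vanish on all normalised jets, which form a thin set. The fixed transformation
    is the one that normalises some point with nonzero denominator, so after pullback the
    denominator does not vanish identically. *)

Definition pd (i : 'I_3) f : V -> R := fun p => 'D_(delta_mx 0 i) f p.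

Lemma norm_coord h i : `|h 0 i| <= `|h|.
Proof.
rewrite [leRHS]/Num.norm /= mx_normrE; apply: (le_bigmax_cond _ (fun ij => `|h ij.1 ij.2|) (j := (0, i))) => //.
Qed.

Lemma norm_le_coord h (e : R) : 0 <= e -> (forall i, `|h 0 i| <= e) -> `|h| <= e.
Proof.
move=> e0 he; rewrite [leLHS]/Num.norm /= mx_normrE; apply: bigmax_le => // -[i j] _ /=.
by rewrite (ord1 i).
Qed.

Lemma norm_lt_coord h (e : R) : 0 < e -> (forall i, `|h 0 i| < e) -> `|h| < e.
Proof.
move=> e0 he; rewrite [ltLHS]/Num.norm /= mx_normrE; apply: bigmax_lt => // -[i j] _ /=.
by rewrite (ord1 i).
Qed.

Lemma nbhsE (p : V) (P : V -> Prop) :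
  (\forall q \near p, P q) <-> exists2 d, 0 < d & forall h, `|h| < d -> P (p + h).
Proof.
split.
  move=> /nbhs_normP[d /= d0 Hd]; exists d => // h hd; apply: Hd => /=.
  by rewrite opprD addrA subrr add0r normrN.
case=> d d0 Hd; apply/nbhs_normP; exists d => // q /= qd.
by rewrite -(addrNK p q) addrC; apply: Hd; rewrite distrC.
Qed.

(** Frechet differentiability as an epsilon-delta estimate with explicit partial derivatives [c],
    which is the form in which remainders at several points can be added and compared.
    [lapp_is_diff] and [diff_lapp] translate in both directions. *)
Definition lapp f p c := forall e, 0 < e -> exists2 d, 0 < d &
  forall h, `|h| < d -> `|f (p + h) - f p - \sum_i c i * h 0 i| <= e * `|h|.

Definition lin3 c : V -> R := fun h => \sum_i c i * h 0 i.

Lemma lin3_linear c : linear (lin3 c).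
Proof.
move=> a u v; rewrite /lin3 scaler_sumr -big_split; apply: eq_bigr => i _ /=.
by rewrite !mxE mulrDr mulrCA.
Qed.

HB.instance Definition _ c := GRing.isLinear.Build R V R *:%R (lin3 c) (lin3_linear c).

Lemma lin3_continuous c : continuous (lin3 c).
Proof.
rewrite /lin3; apply: continuous_big => [|i _ h]; first exact: add_continuous.
by apply: (@continuousM R V (cst (c i)) (fun x : V => x 0 i)); [exact: cst_continuous | exact: coord_continuous].
Qed.

Lemma lapp_is_diff f p c : lapp f p c -> is_diff p f (lin3 c).
Proof.
move=> H.
have Ho : f \o shift p = cst (f p) + lin3 c +o_ (0 : V) id.
  apply/eqaddoP => _/posnumP[e]; have [//|d d0 Hd] := H e%:num.
  apply/nbhsE; exists d => // h hd; rewrite add0r.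
  by have := Hd h hd; rewrite /= !fctE /= (addrC h) opprD addrA.
have Hu := diff_unique (@lin3_continuous c) Ho.
apply: DiffDef => //; apply/diff_locallyP; rewrite Hu; split => //.
exact: lin3_continuous.
Qed.

Lemma diff_lapp f p : differentiable f p -> lapp f p (pd ^~ f ^~ p).
Proof.
move=> df e e0; have := diff_locally df => /eqaddoP /(_ e e0) /nbhsE [d d0 Hd].
exists d => // h hd; have := Hd h hd; rewrite add0r /= !fctE /= (addrC h) opprD addrA.
suff -> : 'd f p h = \sum_i pd i f p * h 0 i by [].
rewrite {1}(row_sum_delta h) linear_sum; apply: eq_bigr => i _.
by rewrite linearZ /= mulrC /pd deriveE.
Qed.

Lemma diffsum f p h : differentiable f p -> 'd f p h = \sum_i pd i f p * h 0 i.
Proof.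
move=> df; rewrite {1}(row_sum_delta h) linear_sum; apply: eq_bigr => i _.
by rewrite linearZ /= mulrC /pd deriveE.
Qed.

Lemma lapp_pd f p c : lapp f p c -> differentiable f p /\ forall i, pd i f p = c i.
Proof.
move=> /lapp_is_diff [df Hd]; split => // i; rewrite /pd deriveE // Hd /lin3.
rewrite (bigD1 i) //= mxE !eqxx mulr1 big1 ?addr0 // => j ji.
by rewrite mxE eqxx (negbTE ji) mulr0.
Qed.

Lemma near_eq_diff f g p : (\forall q \near p, f q = g q) ->
  differentiable f p -> differentiable g p.
Proof.
move=> /nbhsE[d d0 Hd] /diff_lapp H; apply: (proj1 (lapp_pd (c := pd ^~ f ^~ p) _)).
move=> e e0; have [d' d'0 Hd'] := H e e0; exists (Num.min d d') => [|h].
  by rewrite lt_min d0.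
rewrite lt_min => /andP[h1 h2]; have := Hd' h h2.
by rewrite -!Hd //; have := Hd 0; rewrite normr0 addr0 => ->.
Qed.

Lemma near_eq_pd i f g p : (\forall q \near p, f q = g q) -> pd i f p = pd i g p.
Proof. exact: near_eq_derive. Qed.

Lemma is_derive_line f p h (t : R) : differentiable f (p + t *: h) ->
  is_derive t (1 : R) (fun s : R => f (p + s *: h)) (\sum_i pd i f (p + t *: h) * h 0 i).
Proof.
move=> df; rewrite -diffsum //.
have dl : is_diff t (fun s : R => p + s *: h) (fun s => s *: h).
  have := is_diffD (is_diff_cst p t) (is_diff_scalel t h) => /is_diff_eq; apply.
  by rewrite funeqE => s /=; rewrite fctE add0r.
have dfi := differentiableP df.
have := @is_diff_comp _ _ _ _ _ _ f _ t dl dfi => -[dc Hc].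
split; first by apply/derivable1_diffP.
by rewrite deriveE // Hc /= scale1r.
Qed.

Lemma mvt_line f p h : (forall t : R, 0 <= t <= 1 -> differentiable f (p + t *: h)) ->
  exists2 t : R, 0 < t < 1 & f (p + h) - f p = \sum_i pd i f (p + t *: h) * h 0 i.
Proof.
move=> H; have [||t] := @MVT R (fun s => f (p + s *: h))
   (fun t => \sum_i pd i f (p + t *: h) * h 0 i) 0 1 ltr01.
- move=> t; rewrite in_itv /= => /andP[t0 t1]; apply: is_derive_line.
  by apply: H; rewrite !ltW.
- apply: derivable_within_continuous => t; rewrite in_itv /= => Ht.
  by have [] := is_derive_line (H t Ht).
rewrite in_itv /= scale1r scale0r addr0 subr0 mulr1 => Ht ->; by exists t.
Qed.

Lemma delta_norm i : `|delta_mx 0 i : V| <= 1.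
Proof.
apply: norm_le_coord => // j; rewrite mxE eqxx /=; case: (j == i) => /=; by rewrite ?normr1 ?normr0.
Qed.

Lemma delta_scale_norm i (a : R) : 0 <= a -> `|a *: delta_mx 0 i : V| <= a.
Proof.
by move=> a0; rewrite normrZ ger0_norm // -[leRHS]mulr1; apply: ler_wpM2l; rewrite ?delta_norm.
Qed.

Lemma lsum_delta c i (t : R) : \sum_j c j * (t *: delta_mx 0 i : V) 0 j = c i * t.
Proof.
rewrite (bigD1 i) //= !mxE !eqxx mulr1 big1 ?addr0 // => j ji.
by rewrite !mxE eqxx (negbTE ji) !mulr0.
Qed.

Lemma pd_eq0_line f p i (t : R) :
  (forall s : R, 0 <= s <= 1 -> differentiable f (p + (s * t) *: delta_mx 0 i) /\
     pd i f (p + (s * t) *: delta_mx 0 i) = 0) ->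
  f (p + t *: delta_mx 0 i) = f p.
Proof.
move=> H; have [] := @mvt_line f p (t *: delta_mx 0 i).
  by move=> s s01; rewrite scalerA; exact: (H s s01).1.
move=> s /andP[s0 s1]; rewrite scalerA lsum_delta (H s _).2 ?mul0r; last by rewrite !ltW.
by move/eqP; rewrite subr_eq0 => /eqP.
Qed.

Lemma pdD f g p i : differentiable f p -> differentiable g p ->
  pd i (fun q => f q + g q) p = pd i f p + pd i g p.
Proof. by move=> df dg; rewrite /pd -deriveD //; exact: diff_derivable. Qed.

Lemma pdB f g p i : differentiable f p -> differentiable g p ->
  pd i (fun q => f q - g q) p = pd i f p - pd i g p.
Proof. by move=> df dg; rewrite /pd -deriveB //; exact: diff_derivable. Qed.

Lemma pdM f g p i : differentiable f p -> differentiable g p ->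
  pd i (fun q => f q * g q) p = f p * pd i g p + g p * pd i f p.
Proof. by move=> df dg; rewrite /pd -deriveM //; exact: diff_derivable. Qed.

Lemma pdV f p i : f p != 0 -> differentiable f p ->
  pd i (fun q => (f q)^-1) p = - (f p) ^- 2 * pd i f p.
Proof. by move=> f0 df; exact: (deriveV f0 (diff_derivable df : derivable f p (delta_mx 0 i))). Qed.

Lemma pd_cst (k : R) p i : pd i (fun=> k) p = 0.
Proof. exact: derive_cst. Qed.

Lemma pd_shift f p w i : differentiable f (p + w) ->
  pd i (fun q => f (q + w)) p = pd i f (p + w).
Proof.
move=> /diff_lapp H; apply: (lapp_pd (c := pd ^~ f ^~ (p + w)) _).2 => e e0.
by have [d d0 Hd] := H e e0; exists d => // h hd; rewrite (addrAC p h); exact: Hd.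
Qed.

(** The arithmetic of [mixed_diff], with values of functions replaced by numbers. The two remainders
    add up to at most [e / 3 * (2 * s + 1) * t], which is below [e * t] since [s < 1]. *)
Lemma mixed_bound (a b c s t z0 z1 e : R) : 0 < s -> s < 1 -> 0 < t -> 0 < e ->
  `|z1| <= e / 3 * ((s + 1) * t) -> `|z0| <= e / 3 * ((s + 0) * t) ->
  `|t * (a + s * t * b + 1 * t * c + z1 - (a + s * t * b + 0 * t * c + z0)) - t ^+ 2 * c|
    <= e * t ^+ 2.
Proof.
move=> s0 s1 t0 e0 Hz1 Hz0.
have -> : t * (a + s * t * b + 1 * t * c + z1 - (a + s * t * b + 0 * t * c + z0)) - t ^+ 2 * c
  = t * (z1 - z0) by ring.
rewrite normrM (gtr0_norm t0) expr2 mulrCA; apply: ler_wpM2l; first exact: ltW.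
apply: (le_trans (ler_normB _ _)); apply: le_trans (lerD Hz1 Hz0) _.
have -> : e / 3 * ((s + 1) * t) + e / 3 * ((s + 0) * t) = e * t * ((s + 1 + (s + 0)) / 3) by field.
rewrite -[leRHS]mulr1; apply: ler_wpM2l; first by rewrite mulr_ge0 // ltW.
by rewrite ler_pdivrMr // mul1r; lra.
Qed.

(** The mean value theorem in direction [i], applied to the increment of [f] in direction [j], turns
    the second difference into a difference of two values of [pd i f]; both are then expanded to
    first order at [p]. *)
Lemma mixed_diff f p i j : (\forall q \near p, differentiable f q) ->
  differentiable (pd i f) p ->
  forall e, 0 < e -> exists2 d, 0 < d & forall t : R, 0 < t < d ->
   `|f (p + t *: delta_mx 0 i + t *: delta_mx 0 j) - f (p + t *: delta_mx 0 i)
     - f (p + t *: delta_mx 0 j) + f p - t ^+ 2 * pd j (pd i f) p| <= e * t ^+ 2.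
Proof.
move=> /nbhsE[d0 d00 H0] /diff_lapp H1 e e0.
have [|d1 d10 H1'] := H1 (e / 3); first by rewrite divr_gt0.
exists (Num.min d0 d1 / 2); first by rewrite divr_gt0 // lt_min d00.
move=> t /andP[t0]; rewrite ltr_pdivlMr // lt_min => /andP[td0 td1].
pose g q := f (q + t *: delta_mx 0 j) - f q.
have small (s r : R) : 0 <= s <= 1 -> 0 <= r <= 1 ->
    `|(s * t) *: delta_mx 0 i + (r * t) *: delta_mx 0 j : V| <= (s + r) * t.
  move=> /andP[s0 s1] /andP[r0 r1]; apply: (le_trans (ler_normD _ _)).
  have st0 : 0 <= s * t by rewrite mulr_ge0 // ltW.
  have rt0 : 0 <= r * t by rewrite mulr_ge0 // ltW.
  by rewrite mulrDl; apply: lerD; exact: delta_scale_norm.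
have sd (s r : R) : 0 <= s <= 1 -> 0 <= r <= 1 -> (s + r) * t < Num.min d0 d1.
  move=> /andP[s0 s1] /andP[r0 r1]; apply: le_lt_trans (_ : t * 2 < _).
    by rewrite mulrC; apply: ler_wpM2l; [rewrite ltW | lra].
  by rewrite lt_min td0.
have H0q (s r : R) : 0 <= s <= 1 -> 0 <= r <= 1 ->
    differentiable f (p + ((s * t) *: delta_mx 0 i + (r * t) *: delta_mx 0 j)).
  move=> s01 r01; apply: H0; apply: le_lt_trans (small _ _ s01 r01) _.
  by have := sd s r s01 r01; rewrite lt_min => /andP[].
have z01 : 0 <= (0 : R) <= 1 by rewrite lexx ler01.
have o01 : 0 <= (1 : R) <= 1 by rewrite lexx ler01.
have dg (s : R) : 0 <= s <= 1 -> differentiable g (p + s *: (t *: delta_mx 0 i)).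
  move=> s01; rewrite /g scalerA; apply: differentiableB.
    apply: (differentiable_comp (f := fun q : V => q + t *: delta_mx 0 j) (g := f)) => //.
    by have := H0q s 1 s01 o01; rewrite mul1r addrA.
  by have := H0q s 0 s01 z01; rewrite mul0r scale0r addr0.
have [s /andP[s0 s1]] := mvt_line dg; rewrite lsum_delta /g => Hm.
have s01 : 0 <= s <= 1 by rewrite !ltW.
have -> : f (p + t *: delta_mx 0 i + t *: delta_mx 0 j) - f (p + t *: delta_mx 0 i)
     - f (p + t *: delta_mx 0 j) + f p = t * pd i g (p + s *: (t *: delta_mx 0 i)).
  rewrite mulrC -Hm; move: (f _) (f _) (f _) (f _) => a b c d; ring.
have Eg : pd i g (p + s *: (t *: delta_mx 0 i)) =
   pd i f (p + ((s * t) *: delta_mx 0 i + (1 * t) *: delta_mx 0 j)) -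
   pd i f (p + ((s * t) *: delta_mx 0 i + (0 * t) *: delta_mx 0 j)).
  have h1 := H0q s 1 s01 o01; have h0 := H0q s 0 s01 z01.
  move: h1 h0; rewrite mul1r mul0r scale0r addr0 addrA scalerA => h1 h0.
  rewrite pdB ?pd_shift //.
  by apply: (differentiable_comp (f := fun q : V => q + t *: delta_mx 0 j) (g := f)).
rewrite Eg.
have B (r : R) : 0 <= r <= 1 -> exists2 z, `|z| <= e / 3 * ((s + r) * t) &
   pd i f (p + ((s * t) *: delta_mx 0 i + (r * t) *: delta_mx 0 j)) =
   pd i f p + s * t * pd i (pd i f) p + r * t * pd j (pd i f) p + z.
  move=> r01; pose h := (s * t) *: delta_mx 0 i + (r * t) *: delta_mx 0 j : V.
  exists (pd i f (p + h) - pd i f p - \sum_k pd k (pd i f) p * h 0 k).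
    apply: le_trans (H1' h _) _.
      apply: le_lt_trans (small _ _ s01 r01) _.
      by have := sd s r s01 r01; rewrite lt_min => /andP[].
    by apply: ler_wpM2l (small _ _ s01 r01); rewrite ltW // divr_gt0.
  have -> : \sum_k pd k (pd i f) p * h 0 k = s * t * pd i (pd i f) p + r * t * pd j (pd i f) p.
    rewrite -/(lin3 (fun k => pd k (pd i f) p) h) linearD /= /lin3 !lsum_delta.
    by rewrite (mulrC (s * t)) (mulrC (r * t)).
  rewrite -/h; move: (pd i f (p + h)) (pd i f p) (s * t * _) (r * t * _) => A1 A2 A3 A4; ring.
have [z1 Hz1 ->] := B 1 o01; have [z0 Hz0 ->] := B 0 z01.
exact: mixed_bound.
Qed.

(** The second difference is symmetric in [i] and [j], and by [mixed_diff] both mixed derivatives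
    are its limit after division by [t ^+ 2]. *)
Lemma schwarz f p i j : (\forall q \near p, differentiable f q) ->
  differentiable (pd i f) p -> differentiable (pd j f) p ->
  pd i (pd j f) p = pd j (pd i f) p.
Proof.
move=> Hn Hi Hj; apply/eqP; rewrite -subr_eq0 -normr_le0; apply/ler_addgt0Pr => e e0.
have e20 : 0 < e / 2 by rewrite divr_gt0.
have [d1 d10 H1] := mixed_diff j Hn Hi e20.
have [d2 d20 H2] := mixed_diff i Hn Hj e20.
pose t : R := Num.min d1 d2 / 2.
have t0 : 0 < t by rewrite divr_gt0 // lt_min d10.
have tm : t < Num.min d1 d2.
  by rewrite ltr_pdivrMr // mulr2n mulrDr mulr1 ltrDl lt_min d10.
move: tm; rewrite lt_min => /andP[t1 t2].
have := H1 t; rewrite t0 t1 => /(_ isT); have := H2 t; rewrite t0 t2 => /(_ isT).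
rewrite [p + _ + _]addrAC; set a := f _; set b := f _; set c := f _; set d := f p.
move=> A1 A2; rewrite add0r -(ler_pM2r (exprn_gt0 2 t0)) -[t ^+ 2 in leLHS]gtr0_norm ?exprn_gt0 // -normrM.
have {A1 A2} := lerD A2 A1; rewrite -mulrDl -splitr; apply: le_trans.
rewrite -[X in _ <= _ + X]normrN; apply: le_trans (ler_normD _ _).
by rewrite le_eqVlt; apply/orP; left; apply/eqP; congr `|_|; move: a b c d (pd i _ p) (pd j _ p) (t ^+ 2) => *; ring.
Qed.

End Differentiability.

(** * The chain rule in coordinates *)

Section ChainRule.
Context {R : realType}.
Local Notation V := 'rV[R]_3.
Implicit Types (f g : V -> R) (Phi : V -> V) (p h : V).

Lemma diff_row Phi p : (forall j, differentiable (fun q => Phi q 0 j) p) -> differentiable Phi p.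
Proof.
move=> H.
have -> : Phi = \sum_j (fun q => Phi q 0 j *: (delta_mx 0 j : V)).
  apply/funext => q; rewrite [LHS]row_sum_delta.
  by elim/big_rec2 : _ => // j x F _ ->.
apply: differentiable_sum => j; apply: (differentiableZl (k := fun q => Phi q 0 j)).
exact: H.
Qed.

Lemma pd_coord i j p : pd i (fun q : V => q 0 j : R) p = (i == j)%:R.
Proof.
apply: (lapp_pd (c := fun i => (i == j)%:R) _).2 => e e0; exists 1 => // k _.
rewrite mxE (bigD1 j) //= eqxx mul1r big1 => [|l /negbTE ->]; last by rewrite mul0r.
by rewrite addr0 (addrC (p 0 j)) addrK subrr normr0 mulr_ge0 // ltW.
Qed.

Lemma diff_coord Phi p j h : differentiable Phi p ->
  differentiable (fun q => Phi q 0 j) p /\ 'd Phi p h 0 j = 'd (fun q => Phi q 0 j) p h.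
Proof.
move=> dP.
have dc : differentiable (fun q : V => q 0 j : R) (Phi p) by exact: differentiable_coord.
have [dP' Hc] := @is_diff_comp _ _ _ _ Phi _ (fun q : V => q 0 j : R) _ p
   (differentiableP dP) (differentiableP dc).
split; first exact: dP'.
rewrite [RHS](_ : _ = ('d (fun q : V => q 0 j : R) (Phi p) \o 'd Phi p) h); last by rewrite -Hc.
rewrite /= diffsum // (bigD1 j) //= pd_coord eqxx mul1r big1 ?addr0 // => k /negbTE kj.
by rewrite pd_coord kj mul0r.
Qed.

Lemma chain_rule f Phi p : differentiable f (Phi p) ->
  (forall j, differentiable (fun q => Phi q 0 j) p) ->
  differentiable (fun q => f (Phi q)) p /\
  forall i, pd i (fun q => f (Phi q)) p = \sum_j pd j f (Phi p) * pd i (fun q => Phi q 0 j) p.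
Proof.
move=> df dP; have dPhi := diff_row dP.
have dfP : differentiable (fun q => f (Phi q)) p by exact: (differentiable_comp dPhi df).
split => // i; rewrite {1}/pd deriveE // [LHS](_ : _ = 'd f (Phi p) ('d Phi p (delta_mx 0 i))).
  rewrite diffsum //; apply: eq_bigr => j _.
  by rewrite (diff_coord j _ dPhi).2 /pd (deriveE _ (dP j)).
have [_ Hc] := @is_diff_comp _ _ _ _ Phi _ f _ p (differentiableP dPhi) (differentiableP df).
by rewrite [RHS](_ : _ = ('d f (Phi p) \o 'd Phi p) (delta_mx 0 i)) // -Hc.
Qed.

End ChainRule.

(** * Smooth functions on open sets *)

Section Smooth.
Context {R : realType}.
Local Notation V := 'rV[R]_3.
Implicit Types (f g : V -> R) (Phi : V -> V) (p h : V) (U W : set V).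

Definition smooth_on U f := forall p, U p -> forall s, differentiable (pderiv s f) p.

Lemma open_near U p : open U -> U p -> \forall q \near p, U q.
Proof. by move=> oU Up; exact: open_nbhs_nbhs. Qed.

Lemma pd_eq_on U f g i p : open U -> (forall q, U q -> f q = g q) -> U p -> pd i f p = pd i g p.
Proof.
move=> oU fg Up; apply: near_eq_pd; apply: filterS (open_near oU Up) => q; exact: fg.
Qed.

(** Coinduction for smoothness: if a class of differentiable functions contains, up to equality on
    [U], the partial derivatives of its members, then it contains all iterated ones. *)
Lemma smooth_coind U (P : (V -> R) -> Prop) : open U ->
  (forall f, P f -> (forall p, U p -> differentiable f p) /\
     forall i, exists2 g, P g & forall p, U p -> pd i f p = g p) ->
  forall f, P f -> smooth_on U f.
Proof.
move=> oU H f Pf.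
have K s : exists2 g, P g & forall p, U p -> pderiv s f p = g p.
  elim: s => [|i s [g Pg fg]]; first by exists f.
  have [_ /(_ i)[g' Pg' gg']] := H g Pg; exists g' => // p Up.
  by rewrite -gg' //; exact: (pd_eq_on _ oU fg).
move=> p Up s; have [g Pg fg] := K s; have [dg _] := H g Pg.
apply: near_eq_diff (dg p Up); apply: filterS (open_near oU Up) => q Uq.
by rewrite fg.
Qed.

Inductive falg U (G : (V -> R) -> Prop) : (V -> R) -> Prop :=
| falg_gen f : G f -> falg U G f
| falg_cst c : falg U G (fun=> c)
| falg_add f g : falg U G f -> falg U G g -> falg U G (fun p => f p + g p)
| falg_mul f g : falg U G f -> falg U G g -> falg U G (fun p => f p * g p)
| falg_inv f : falg U G f -> (forall p, U p -> f p != 0) -> falg U G (fun p => (f p)^-1)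
| falg_eq f g : falg U G f -> (forall p, U p -> f p = g p) -> falg U G g.

Lemma falg_sum U G n (F : 'I_n -> V -> R) : (forall i, falg U G (F i)) ->
  falg U G (fun p => \sum_i F i p).
Proof.
elim: n F => [|n IH] F HF.
  by apply: falg_eq (falg_cst U G 0) _ => p _; rewrite big_ord0.
apply: falg_eq (falg_add (HF ord0) (IH (fun i => F (lift ord0 i)) _)) _ => // p _.
by rewrite big_ord_recl.
Qed.

(** By [smooth_coind] and the rules of differentiation only the generators have to be examined.
    Implicit functions, primitives and exponentials are shown to be smooth in this way: their
    derivatives are expressions in themselves and in known smooth functions. *)
Lemma falg_smooth U G : open U ->
  (forall f, G f -> forall p, U p -> differentiable f p) ->
  (forall f, G f -> forall i, falg U G (pd i f)) ->
  forall f, falg U G f -> smooth_on U f.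
Proof.
move=> oU G1 G2; apply: smooth_coind => // f; elim => {f} [f Gf|c|f g Hf [df If] Hg [dg Ig]|f g Hf [df If] Hg [dg Ig]|f Hf [df If] f0|f g Hf [df If] fg].
- by split => [|i]; [exact: G1|exists (pd i f) => //; exact: G2].
- split=> [p _|i]; first exact: differentiable_cst.
  by exists (fun=> 0) => [|p _]; [exact: falg_cst|exact: pd_cst].
- split=> [p Up|i]; first exact: differentiableD (df p Up) (dg p Up).
  have [f' Pf' ff'] := If i; have [g' Pg' gg'] := Ig i.
  exists (fun p => f' p + g' p) => [|p Up]; first exact: falg_add.
  by rewrite pdD ?ff' ?gg' //; [exact: df|exact: dg].
- split=> [p Up|i]; first exact: differentiableM (df p Up) (dg p Up).
  have [f' Pf' ff'] := If i; have [g' Pg' gg'] := Ig i.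
  exists (fun p => f p * g' p + g p * f' p) => [|p Up].
    by apply: falg_add; apply: falg_mul.
  by rewrite pdM ?ff' ?gg' //; [exact: df|exact: dg].
- split=> [p Up|i]; first exact: differentiableV (df p Up) (f0 p Up).
  have [f' Pf' ff'] := If i.
  exists (fun p => (-1) * ((f p)^-1 * (f p)^-1) * f' p) => [|p Up].
    apply: falg_mul => //; apply: falg_mul; first exact: falg_cst.
    by apply: falg_mul; apply: falg_inv.
  rewrite pdV ?ff' //; [|exact: f0|exact: df].
  by rewrite mulN1r -expr2 exprVn.
- split=> [p Up|i].
    by apply: near_eq_diff (df p Up); apply: filterS (open_near oU Up) => q Uq; exact: fg.
  have [f' Pf' ff'] := If i; exists f' => // p Up; rewrite -ff' //; apply: (pd_eq_on _ oU) => // q Uq.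
  by rewrite fg.
Qed.

Lemma pderiv_cat s t f : pderiv (s ++ t) f = pderiv s (pderiv t f).
Proof. by elim: s => //= i s ->. Qed.

Lemma smooth_pderiv U f s : smooth_on U f -> smooth_on U (pderiv s f).
Proof. by move=> sf p Up t; rewrite -pderiv_cat; exact: sf. Qed.

Lemma smooth_pd U f i : smooth_on U f -> smooth_on U (pd i f).
Proof. exact: (@smooth_pderiv U f [:: i]). Qed.

Lemma smooth_diff U f p : smooth_on U f -> U p -> differentiable f p.
Proof. by move=> sf Up; exact: (sf p Up [::]). Qed.

Lemma smooth_sub U W f : U `<=` W -> smooth_on W f -> smooth_on U f.
Proof. by move=> UW sf p /UW; exact: sf. Qed.

Lemma falg_smooth_on U f : open U -> falg U (smooth_on U) f -> smooth_on U f.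
Proof.
move=> oU; apply: falg_smooth => // {}f sf; first by move=> p; exact: smooth_diff.
by move=> i; apply: falg_gen; exact: smooth_pd.
Qed.

Lemma smooth_cst U c : open U -> smooth_on U (fun=> c).
Proof. by move=> oU; apply: falg_smooth_on => //; exact: falg_cst. Qed.

Lemma smooth_add U f g : open U -> smooth_on U f -> smooth_on U g -> smooth_on U (fun p => f p + g p).
Proof. by move=> oU sf sg; apply: falg_smooth_on => //; apply: falg_add; exact: falg_gen. Qed.

Lemma smooth_mul U f g : open U -> smooth_on U f -> smooth_on U g -> smooth_on U (fun p => f p * g p).
Proof. by move=> oU sf sg; apply: falg_smooth_on => //; apply: falg_mul; exact: falg_gen. Qed.

Lemma smooth_inv U f : open U -> smooth_on U f -> (forall p, U p -> f p != 0) ->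
  smooth_on U (fun p => (f p)^-1).
Proof. by move=> oU sf f0; apply: falg_smooth_on => //; apply: falg_inv => //; exact: falg_gen. Qed.

Lemma smooth_eq U f g : open U -> smooth_on U f -> (forall p, U p -> f p = g p) -> smooth_on U g.
Proof. by move=> oU sf fg; apply: falg_smooth_on => //; apply: falg_eq fg; exact: falg_gen. Qed.

Lemma smooth_opp U f : open U -> smooth_on U f -> smooth_on U (fun p => - f p).
Proof.
move=> oU sf; apply: smooth_eq (smooth_mul oU (smooth_cst (-1) oU) sf) _ => // p _.
by rewrite mulN1r.
Qed.

Lemma smooth_sum U n (F : 'I_n -> V -> R) : open U -> (forall i, smooth_on U (F i)) ->
  smooth_on U (fun p => \sum_i F i p).
Proof. by move=> oU sF; apply: falg_smooth_on => //; apply: falg_sum => i; exact: falg_gen. Qed.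

Lemma smooth_coord U i : open U -> smooth_on U (fun p => p 0 i).
Proof.
move=> oU; apply: (@falg_smooth U (fun f => f = fun p => p 0 i)) => //; last exact: falg_gen.
- by move=> f -> p _; exact: differentiable_coord.
- by move=> f -> j; apply: falg_eq (falg_cst _ _ (j == i)%:R) _ => p _; rewrite pd_coord.
Qed.

Lemma smooth_comp U W Phi f : open U -> (forall p, U p -> W (Phi p)) ->
  (forall i, smooth_on U (fun p => Phi p 0 i)) -> smooth_on W f -> smooth_on U (fun p => f (Phi p)).
Proof.
move=> oU UW sP sf; pose G g := smooth_on U g \/ exists2 f, smooth_on W f & g = fun p => f (Phi p).
apply: (@falg_smooth U G) => //; last by apply: falg_gen; right; exists f.
- move=> k0 [sg p Up|[k sk ->] p Up]; first exact: smooth_diff Up.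
  by apply: (chain_rule _ _).1 => [|j]; [exact: smooth_diff (UW _ Up)|exact: smooth_diff Up].
- move=> k0 [sg i|[k sk ->] i]; first by apply: falg_gen; left; exact: smooth_pd.
  apply: (@falg_eq _ _ (fun p => \sum_j pd j k (Phi p) * pd i (fun q => Phi q 0 j) p)).
    apply: falg_sum => j; apply: falg_mul; apply: falg_gen.
      by right; exists (pd j k) => //; exact: smooth_pd.
    by left; exact: smooth_pd.
  move=> p Up; rewrite (chain_rule _ _).2 // => [|j]; last exact: smooth_diff Up.
  exact: smooth_diff (UW _ Up).
Qed.

Lemma pderiv_eq_on U f g s p : open U -> (forall q, U q -> f q = g q) -> U p ->
  pderiv s f p = pderiv s g p.
Proof.
move=> oU fg; elim: s p => [|i s IH] p Up /=; first exact: fg.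
exact: (pd_eq_on _ oU).
Qed.

Lemma near_eq_pderiv f g s p : (\forall q \near p, f q = g q) -> pderiv s f p = pderiv s g p.
Proof.
move=> H; apply: (@pderiv_eq_on (interior [set q | f q = g q])) => //; first exact: open_interior.
by move=> q; exact: nbhs_singleton.
Qed.

Lemma pd_pderivC U f i s p : open U -> smooth_on U f -> U p ->
  pd i (pderiv s f) p = pderiv s (pd i f) p.
Proof.
move=> oU sf; elim: s p => [|j s IH] p Up //=.
rewrite -/(pd j (pderiv s f)) -/(pd j (pderiv s (pd i f))) -/(pd i (pd j _)) schwarz.
- exact: (pd_eq_on _ oU IH).
- by apply: filterS (open_near oU Up) => q Uq; exact: sf.
- exact: (sf p Up (i :: s)).
- exact: (sf p Up (j :: s)).
Qed.

(** Only the multiplicities of the directions matter, which is why three exponents suffice to index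
    jet coordinates. *)
Lemma pderiv_perm U f s t p : open U -> smooth_on U f -> U p -> perm_eq s t ->
  pderiv s f p = pderiv t f p.
Proof.
move=> oU sf; elim: s t p => [|i s IH] t p Up st.
  by move: st; rewrite perm_sym => /perm_nilP ->.
have it : i \in t by rewrite -(perm_mem st) mem_head.
move: st; case/splitPr: it => t1 t2 /perm_trans/(_ (permEl (perm_catCA t1 [:: i] t2))).
rewrite /= perm_cons => st.
rewrite pderiv_cat /= -(@pd_pderivC U) //; last exact: smooth_pderiv.
by apply: (pd_eq_on _ oU) => // q Uq; rewrite -pderiv_cat; exact: IH.
Qed.

Lemma smooth_nearP a f : smooth_near a f <-> exists U, [/\ open U, U a & smooth_on U f].
Proof.
split=> [H|[U [oU Ua sf]]].
  exists (interior [set p | forall s, differentiable (pderiv s f) p]); split => //.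
    exact: open_interior.
  by move=> p /nbhs_singleton.
by apply: filterS (open_near oU Ua) => p Up; exact: sf.
Qed.

End Smooth.

(** * Solving an equation for one coordinate *)

Section ImplicitFunction.
Context {R : realType}.
Local Notation V := 'rV[R]_3.
Implicit Types (f : V -> R) (p q h : V) (U : set V).

Definition upd (i : 'I_3) q (t : R) : V := (q - q 0 i *: delta_mx 0 i) + t *: delta_mx 0 i.

Lemma updE i q t j : upd i q t 0 j = if j == i then t else q 0 j.
Proof.
rewrite /upd !mxE /=; case: (j == i) / eqP => [->|_]; last by rewrite !mulr0 subr0 addr0.
by rewrite !mulr1 subrr add0r.
Qed.

Lemma coordB p q j : (p - q) 0 j = p 0 j - q 0 j.
Proof. by rewrite !mxE. Qed.

Lemma addB_K p q : p + (q - p) = q.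
Proof. by rewrite addrC subrK. Qed.

Lemma coordD p q j : (p + q) 0 j = p 0 j + q 0 j.
Proof. by rewrite mxE. Qed.

Lemma upd_id i q : upd i q (q 0 i) = q.
Proof. by rewrite /upd subrK. Qed.

Lemma upd_upd i q s t : upd i (upd i q s) t = upd i q t.
Proof. by apply/rowP => j; rewrite !updE; case: eqP. Qed.

Lemma segment_ball p0 p h (d t : R) : `|p - p0| < d -> `|p + h - p0| < d -> 0 <= t <= 1 ->
  `|p + t *: h - p0| < d.
Proof.
move=> h1 h2 /andP[t0 t1].
have -> : p + t *: h - p0 = (1 - t) *: (p - p0) + t *: (p + h - p0).
  by apply/rowP => j; rewrite !mxE; ring.
apply: le_lt_trans (ler_normD _ _) _; rewrite !normrZ ger0_norm ?subr_ge0 // ger0_norm //.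
have [t_0|t_0] := eqVneq t 0; first by rewrite t_0 subr0 mul1r mul0r addr0.
have tp : 0 < t by rewrite lt_neqAle eq_sym t_0.
rewrite [ltRHS](_ : d = (1 - t) * d + t * d); last by ring.
by apply: ler_ltD; [apply: ler_wpM2l; rewrite ?subr_ge0 // ltW|rewrite ltr_pM2l].
Qed.

Lemma diff_continuous_near f p (e : R) : differentiable f p -> 0 < e ->
  exists2 d, 0 < d & forall q, `|q - p| < d -> `|f q - f p| < e.
Proof.
move=> /differentiable_continuous; move/cvgrPdist_lt => /(_ e) H /H /nbhsE[d d0 Hd].
exists d => // q qd; have := Hd (q - p) qd.
by rewrite (addrC p) subrK distrC.
Qed.

(** Multiplication by the sign of the derivative at [p0] treats increasing and decreasing functions
    at once; half the absolute value of that derivative is the lower bound [m]. *)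
Lemma implicit_bounds U f p0 i : open U -> U p0 -> smooth_on U f -> pd i f p0 != 0 ->
  exists d m M : R, [/\ 0 < d, 0 < m, 0 < M,
   forall p, `|p - p0| < d -> U p &
   forall p, `|p - p0| < d -> m <= Num.sg (pd i f p0) * pd i f p /\ forall j, `|pd j f p| <= M].
Proof.
move=> oU Up0 sf D0; have /nbhsE[d0 d00 H0] := open_near oU Up0.
pose m := `|pd i f p0| / 2; have m0 : 0 < m by rewrite divr_gt0 // normr_gt0.
have H1 j : exists2 d, 0 < d & forall q, `|q - p0| < d -> `|pd j f q - pd j f p0| < Num.min m 1.
  by apply: diff_continuous_near; [exact: (sf _ Up0 [:: j])|rewrite lt_min m0 ltr01].
have [d' d'0 H2] : exists2 d, 0 < d & forall j q, `|q - p0| < d -> `|pd j f q - pd j f p0| < Num.min m 1.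
  have [da da0 Ha] := H1 iu; have [db db0 Hb] := H1 ix; have [dc dc0 Hc] := H1 iv.
  exists (Num.min da (Num.min db dc)) => [|j q]; first by rewrite !lt_min da0 db0.
  rewrite !lt_min => /and3P[qa qb qc].
  have : [|| j == iu, j == ix | j == iv] by case: j => -[|[|[|[]]]].
  by move=> /or3P[] /eqP ->; rewrite -lt_min; [exact: Ha|exact: Hb|exact: Hc].
exists (Num.min d0 d'), m, (1 + \sum_j `|pd j f p0|); split => //.
- by rewrite lt_min d00.
- by rewrite ltr_pwDl // sumr_ge0.
- by move=> p; rewrite lt_min => /andP[pd0 _]; have := H0 _ pd0; rewrite addrC subrK.
move=> p; rewrite lt_min => /andP[_ pd']; split.
  have := H2 i p pd'; rewrite lt_min => /andP[Hm _].
  have E : Num.sg (pd i f p0) * pd i f p0 = m + m by rewrite -normrEsg /m -splitr.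
  rewrite -[pd i f p](subrK (pd i f p0)) mulrDr E addrA.
  rewrite lerDr -[leLHS](subrr (m)) addrC lerD2l.
  have : `|Num.sg (pd i f p0) * (pd i f p - pd i f p0)| <= m.
    by rewrite normrM normr_sg D0 mul1r ltW.
  by rewrite ler_norml => /andP[].
move=> j; have := H2 j p pd'; rewrite lt_min => /andP[_ H3].
rewrite -[pd j f p](subrK (pd j f p0)); apply: le_trans (ler_normD _ _) _.
apply: lerD; first exact: ltW.
by rewrite (bigD1 j) //= lerDl sumr_ge0.
Qed.

Lemma sum_bound (c : 'I_3 -> R) h (M b : R) : 0 <= M -> (forall j, `|c j| <= M) ->
  (forall j, `|h 0 j| <= b) -> `|\sum_j c j * h 0 j| <= 3 * M * b.
Proof.
move=> M0 cM hb; apply: le_trans (ler_norm_sum _ _ _) _.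
apply: le_trans (_ : \sum_(j < 3) (M * b) <= _).
  by apply: ler_sum => j _; rewrite normrM ler_pM.
by rewrite sumr_const card_ord -[leLHS]mulr_natl mulrA.
Qed.

Lemma implicit_quotient (D ai ai' hi S S' : R) : D != 0 -> S = - D * S' ->
  hi - (D * (ai' - ai) + S) = - D * (ai' - ai - (D^-1 * hi + S')).
Proof. by move=> D0 ->; field. Qed.

Lemma quotient_cancel (D Dj x : R) : D != 0 -> Dj * x = - D * (- Dj / D * x).
Proof. by move=> D0; field. Qed.

(** This is the inverse function theorem for the map that replaces coordinate [i] of a point by the
    value of [f]. As a single coordinate changes, the intermediate value theorem gives existence and
    strict monotonicity gives uniqueness; the Lipschitz bound [lipP] then converts the first order
    expansion of [f] into one of [a]. *)
Theorem implicit_function U f p0 i : open U -> U p0 -> smooth_on U f -> pd i f p0 != 0 ->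
  exists a N, [/\ open N, N (upd i p0 (f p0)), smooth_on N a,
    forall q, N q -> U (upd i q (a q)) /\ f (upd i q (a q)) = q 0 i &
    \forall p \near p0, a (upd i p (f p)) = p 0 i].
Proof.
move=> oU Up0 sf D0; have [d [m [M [d0 m0 M0 dU dB]]]] := implicit_bounds oU Up0 sf D0.
set s := Num.sg _ in dB.
have s0 : s != 0 by rewrite sgr_eq0.
have ns : `|s| = 1 by rewrite normr_sg D0.
have df p : `|p - p0| < d -> differentiable f p by move=> /dU; exact: smooth_diff.
have mvt p h : `|p - p0| < d -> `|p + h - p0| < d ->
    exists2 x, `|x - p0| < d & f (p + h) - f p = \sum_j pd j f x * h 0 j.
  move=> hp hh; have [|t /andP[t0 t1] E] := @mvt_line _ f p h.
    by move=> t t01; apply: df; exact: segment_ball.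
  by exists (p + t *: h) => //; apply: segment_ball => //; rewrite !ltW.
have lip p h (b : R) : `|p - p0| < d -> `|p + h - p0| < d -> (forall j, `|h 0 j| <= b) ->
    `|f (p + h) - f p| <= 3 * M * b.
  move=> hp hh hb; have [x xd ->] := mvt p h hp hh.
  by apply: sum_bound => // [|j]; [exact: ltW|exact: (dB x xd).2].
have inj p h (b : R) : `|p - p0| < d -> `|p + h - p0| < d -> 0 <= b ->
    (forall j, j != i -> `|h 0 j| <= b) -> m * `|h 0 i| <= `|f (p + h) - f p| + 3 * M * b.
  move=> hp hh b0 hb; have [x xd ->] := mvt p h hp hh.
  have [mx Mx] := dB x xd; rewrite (bigD1 i) //=.
  set S := \sum_(j | _) _.
  have HS : `|S| <= 3 * M * b.
    have -> : S = \sum_j pd j f x * (\row_j (if j == i then 0 else h 0 j)) 0 j.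
      rewrite [RHS](bigD1 i) //= mxE eqxx mulr0 add0r; apply: eq_bigr => j /negbTE ji.
      by rewrite mxE ji.
    apply: sum_bound => // [|j]; first exact: ltW.
    by rewrite mxE; case: ifPn => [_|/hb //]; rewrite normr0.
  have : m * `|h 0 i| <= `|pd i f x * h 0 i|.
    rewrite normrM; apply: ler_wpM2r => //; apply: le_trans mx _.
    by apply: le_trans (ler_norm _) _; rewrite normrM ns mul1r.
  move=> /le_trans; apply; rewrite -[X in `|X| <= _](addrK S).
  by apply: le_trans (ler_normB _ _) _; apply: lerD.
pose r := d / 2; have r0 : 0 < r by rewrite divr_gt0.
have rd : r < d by rewrite ltr_pdivrMr // mulr_natr mulr2n ltrDl.
(* Within [eta] the other coordinates change [f] by at most [3 * M * eta] and the target value moves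
   by less than [eta]. By [em] a step of length [r] in direction [i], which changes [f] by at least
   [m * r], outweighs both. *)
pose eta := Num.min (r / 2) (m * r / (3 * M + 1)).
have e0 : 0 < eta by rewrite lt_min !divr_gt0 // ?mulr_gt0 // addr_gt0 // mulr_gt0.
have er : eta <= r.
  by rewrite ge_min; apply/orP; left; rewrite ler_pdivrMr // mulr_natr mulr2n lerDl ltW.
have em : (3 * M + 1) * eta <= m * r.
  by rewrite mulrC -ler_pdivlMr ?addr_gt0 ?mulr_gt0 // ge_min lexx orbT.
pose q0 := upd i p0 (f p0).
pose N : set V := ball q0 eta.
have oN : open N by exact: ball_open.
have NE q : N q <-> `|q - q0| < eta by rewrite /N -ball_normE /= distrC.
have Nj q j : N q -> j != i -> `|q 0 j - p0 0 j| < eta.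
  by move=> /NE qe /negbTE ji; apply: le_lt_trans qe; have := norm_coord (q - q0) j; rewrite coordB updE ji.
have Ni q : N q -> `|q 0 i - f p0| < eta.
  by move=> /NE; apply: le_lt_trans; have := norm_coord (q - q0) i; rewrite coordB updE eqxx.
have Bupd q t : N q -> `|t - p0 0 i| <= r -> `|upd i q t - p0| < d.
  move=> Nq tr; apply: norm_lt_coord => // j; rewrite coordB updE.
  case: eqP => [->|/eqP ji]; first exact: le_lt_trans rd.
  by apply: lt_trans (Nj q j Nq ji) _; exact: le_lt_trans rd.
have Bp0 t : `|t - p0 0 i| <= r -> `|upd i p0 t - p0| < d.
  move=> tr; apply: norm_lt_coord => // j; rewrite coordB updE.
  by case: eqP => [->|/eqP ji]; [exact: le_lt_trans rd|rewrite subrr normr0].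
have exa q : N q -> exists t, `|t - p0 0 i| <= r /\ f (upd i q t) = q 0 i.
  move=> Nq.
  have cmp t : `|t - p0 0 i| <= r -> `|f (upd i q t) - f (upd i p0 t)| <= 3 * M * eta.
    move=> tr; have := @lip (upd i p0 t) (upd i q t - upd i p0 t) eta (Bp0 t tr).
    rewrite addB_K; apply; first exact: Bupd.
    move=> j; rewrite coordB !updE; case: eqP => [_|/eqP ji].
      by rewrite subrr normr0 ltW.
    by rewrite ltW // Nj.
  have inc (c : R) : `|c| = r -> exists2 k : R, m <= k & s * (f (upd i p0 (p0 0 i + c)) - f p0) = k * c.
    move=> cr; have [||x xd] := @mvt p0 (c *: delta_mx 0 i).
    - by rewrite subrr normr0.
    - rewrite addrAC subrr add0r; apply: le_lt_trans rd.
      by rewrite normrZ cr -[leRHS]mulr1; apply: ler_wpM2l; rewrite ?delta_norm // ltW.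
    rewrite lsum_delta => E; exists (s * pd i f x); first exact: (dB x xd).1.
    have -> : upd i p0 (p0 0 i + c) = p0 + c *: delta_mx 0 i.
      by rewrite /upd scalerDl addrA subrK.
    by rewrite E mulrA.
  have nr : `|p0 0 i + r - p0 0 i| <= r by rewrite addrAC subrr add0r gtr0_norm.
  have nr' : `|p0 0 i - r - p0 0 i| <= r by rewrite addrAC subrr add0r normrN gtr0_norm.
  have [k1 mk1 E1] := inc r (gtr0_norm r0).
  have [k2 mk2 E2] : exists2 k : R, m <= k & s * (f (upd i p0 (p0 0 i - r)) - f p0) = k * (- r).
    by apply: inc; rewrite normrN gtr0_norm.
  have sb (x y : R) : `|x| <= y -> - y <= s * x <= y.
    by move=> xy; rewrite -ler_norml normrM ns mul1r.
  have /andP[c1 _] := sb _ _ (cmp _ nr); have /andP[_ c2] := sb _ _ (cmp _ nr').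
  have /andP[c3 c4] := sb _ _ (ltW (Ni q Nq)).
  have [] := @IVT R (fun t => s * f (upd i q t)) (p0 0 i - r) (p0 0 i + r) (s * q 0 i).
  - lra.
  - apply: derivable_within_continuous => t; rewrite in_itv /= => /andP[t1 t2].
    apply: derivableM; first exact: derivable_cst.
    have dt : `|t - p0 0 i| <= r by rewrite ler_distlC; apply/andP; split; lra.
    by have [] := is_derive_line (df _ (Bupd q t Nq dt)).
  - have h1 : m * r <= k1 * r by rewrite ler_pM2r.
    have h2 : m * r <= k2 * r by rewrite ler_pM2r.
    rewrite ge_min le_max; apply/andP; split; apply/orP; [left|right].
      move: c2 c3 E2 h2 em; rewrite !mulrBr mulrDl mul1r mulrN => c2 c3 E2 h2 em; lra.
    move: c1 c4 E1 h1 em; rewrite !mulrBr mulrDl mul1r => c1 c4 E1 h1 em; lra.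
  move=> t; rewrite in_itv /= => /andP[t1 t2] /(mulfI s0) E; exists t; split => //.
  by rewrite ler_distlC; apply/andP; split; lra.
(* A root is chosen; where none exists the value is the default 0, which cannot happen on [N]. *)
pose a q := xget 0 [set t | `|t - p0 0 i| <= r /\ f (upd i q t) = q 0 i].
have aP q : N q -> `|a q - p0 0 i| <= r /\ f (upd i q (a q)) = q 0 i.
  by move=> /exa; exact: xgetPex.
pose P q := upd i q (a q).
have PE q j : P q 0 j = if j == i then a q else q 0 j by rewrite /P updE.
have BP q : N q -> `|P q - p0| < d by move=> Nq; apply: Bupd => //; exact: (aP q Nq).1.
have UP q : N q -> U (P q) by move=> Nq; apply: dU; exact: BP.
have DP q : N q -> m <= `|pd i f (P q)|.
  move=> Nq; apply: le_trans (dB _ (BP q Nq)).1 _; apply: le_trans (ler_norm _) _.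
  by rewrite normrM ns mul1r.
have DP0 q : N q -> pd i f (P q) != 0.
  by move=> Nq; rewrite -normr_gt0; exact: lt_le_trans (DP q Nq).
pose K := 1 + (1 + 3 * M) / m.
have K0 : 0 < K by rewrite addr_gt0 // divr_gt0 // addr_gt0 // mulr_gt0.
have lipP q h : N q -> N (q + h) -> `|P (q + h) - P q| <= K * `|h|.
  move=> Nq Nqh; apply: norm_le_coord => [|j]; first by rewrite mulr_ge0 // ltW.
  have hj l : l != i -> (P (q + h) - P q) 0 l = h 0 l.
    by move=> /negbTE li; rewrite coordB !PE li coordD addrAC subrr add0r.
  have [->|ji] := eqVneq j i; last first.
    rewrite hj //; apply: le_trans (norm_coord _ _) _.
    by rewrite ler_peMl // lerDl divr_ge0 ?addr_ge0 ?mulr_ge0 // ltW.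
  have := @inj (P q) (P (q + h) - P q) `|h| (BP q Nq).
  rewrite addB_K (aP q Nq).2 (aP _ Nqh).2 => /(_ (BP _ Nqh) (normr_ge0 _)) H.
  have {H} : m * `|(P (q + h) - P q) 0 i| <= (1 + 3 * M) * `|h|.
    rewrite mulrDl mul1r; apply: le_trans (H _) _; first by move=> l li; rewrite hj // norm_coord.
    by apply: lerD => //; rewrite coordD addrAC subrr add0r norm_coord.
  rewrite mulrC -ler_pdivlMr // => /le_trans; apply.
  by rewrite mulrAC; apply: ler_wpM2r => //; rewrite lerDr.
(* These partial derivatives are forced by differentiating the identity [f (P q) = q 0 i]. *)
pose c q (j : 'I_3) := if j == i then (pd i f (P q))^-1 else - pd j f (P q) / pd i f (P q).
have la q : N q -> lapp a q (c q).
  move=> Nq e e_0.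
  have e1 : 0 < e * m / K by rewrite divr_gt0 // mulr_gt0.
  have [d1 d10 H1] := diff_lapp (df _ (BP q Nq)) e1.
  have /nbhsE[d2 d20 H2] := open_near oN Nq.
  exists (Num.min d2 (d1 / K)) => [|h]; first by rewrite lt_min d20 divr_gt0.
  rewrite lt_min ltr_pdivlMr // => /andP[/H2 Nqh hd].
  have HL := lipP q h Nq Nqh.
  have := H1 (P (q + h) - P q); rewrite addB_K => H.
  have {}H := le_trans (H _) (ler_wpM2l (ltW e1) HL).
  have {H} : `|f (P (q + h)) - f (P q) - \sum_j pd j f (P q) * (P (q + h) - P q) 0 j| <= e * m * `|h|.
    rewrite [leRHS](_ : _ = e * m / K * (K * `|h|)); last by rewrite mulrA divfK ?gt_eqF.
    by apply: H; apply: le_lt_trans HL _; rewrite mulrC.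
  rewrite (aP q Nq).2 (aP _ Nqh).2 (coordD q h i) [_ + h 0 i - _]addrAC subrr add0r.
  have -> : h 0 i - \sum_j pd j f (P q) * (P (q + h) - P q) 0 j =
     - pd i f (P q) * (a (q + h) - a q - \sum_j c q j * h 0 j).
    rewrite (bigD1 i) //= [in RHS](bigD1 i) //= /c eqxx coordB !PE eqxx.
    apply: implicit_quotient; first exact: DP0.
    rewrite mulr_sumr; apply: eq_bigr => j /negbTE ji.
    rewrite ji coordB !PE ji (coordD q h j) [_ + h 0 j - _]addrAC subrr add0r.
    by apply: quotient_cancel; exact: DP0.
  rewrite normrM normrN [X in _ <= X]mulrC mulrCA => H.
  have := le_trans (ler_wpM2r (normr_ge0 _) (DP q Nq)) H.
  by rewrite [e * (_ * _)]mulrA [e * _ * m]mulrC ler_pM2l.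
exists a, N; split => //.
- by apply/NE; rewrite subrr normr0.
(* The derivatives of [a] are rational in functions [k (P q)] with [k] smooth, and by the chain rule
   the derivatives of those are again expressions of the same kind. *)
- pose G (g : V -> R) := g = a \/ exists2 k, smooth_on U k & g = fun q => k (P q).
  apply: (@falg_smooth _ N G) => //; last by apply: falg_gen; left.
  + move=> g [->|[k sk ->]] q Nq; first exact: (lapp_pd (la q Nq)).1.
    apply: (chain_rule _ _).1 => [|j]; first exact: smooth_diff (UP q Nq).
    have [->|ji] := eqVneq j i.
      apply: (near_eq_diff (f := a)); last exact: (lapp_pd (la q Nq)).1.
      by near=> x; rewrite PE eqxx.
    apply: (near_eq_diff (f := fun q => q 0 j)); last exact: differentiable_coord.
    by near=> x; rewrite PE (negbTE ji).
  + have fa j : falg N G (pd j a).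
      apply: (@falg_eq _ _ _ (fun q => c q j)); last by move=> q Nq; rewrite (lapp_pd (la q Nq)).2.
      have iD : falg N G (fun q => (pd i f (P q))^-1).
        apply: falg_inv => //; apply: falg_gen; right; exists (pd i f) => //; exact: smooth_pd.
      rewrite /c; case: eqP => [_|_] //.
      apply: (@falg_eq _ _ _ (fun q => -1 * pd j f (P q) * (pd i f (P q))^-1)); last first.
        by move=> q _; rewrite mulN1r.
      apply: falg_mul => //; apply: falg_mul; first exact: falg_cst.
      by apply: falg_gen; right; exists (pd j f) => //; exact: smooth_pd.
    move=> g [->|[k sk ->]] j; first exact: fa.
    apply: (@falg_eq _ _ _ (fun q => \sum_l pd l k (P q) * (if l == i then pd j a q else (j == l)%:R))).
      apply: falg_sum => l; apply: falg_mul.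
        by apply: falg_gen; right; exists (pd l k) => //; exact: smooth_pd.
      by case: eqP => _; [exact: fa|exact: falg_cst].
    move=> q Nq; rewrite (chain_rule _ _).2.
    * apply: eq_bigr => l _; congr (_ * _); case: eqP => [->|/eqP/negbTE li].
        by apply: near_eq_pd; near=> x; rewrite PE eqxx.
      rewrite -(@pd_coord _ j l q); apply: near_eq_pd; near=> x.
      by rewrite PE li.
    * exact: smooth_diff (UP q Nq).
    * move=> l; have [->|li] := eqVneq l i.
        apply: (near_eq_diff (f := a)); last exact: (lapp_pd (la q Nq)).1.
        by near=> x; rewrite PE eqxx.
      apply: (near_eq_diff (f := fun q => q 0 l)); last exact: differentiable_coord.
      by near=> x; rewrite PE (negbTE li).
- by move=> q Nq; split; [exact: UP|exact: (aP q Nq).2].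
have [d3 d30 H3] := diff_continuous_near (smooth_diff sf Up0) e0.
apply/nbhsE; exists (Num.min eta d3) => [|h]; first by rewrite lt_min e0.
rewrite lt_min => /andP[he hd]; have H3' := H3 (p0 + h).
have Nq : N (upd i (p0 + h) (f (p0 + h))).
  apply/NE; apply: norm_lt_coord => // j; rewrite coordB !updE.
  case: eqP => [_|_]; first by apply: H3'; rewrite addrAC subrr add0r.
  by rewrite coordD addrAC subrr add0r; apply: le_lt_trans (norm_coord _ _) he.
have [a1 a2] := aP _ Nq.
set q := upd i (p0 + h) _ in Nq a1 a2 *.
move: a2; rewrite /q upd_upd updE eqxx -/q => a2.
have Bh : `|p0 + h - p0| < d.
  by rewrite addrAC subrr add0r; apply: lt_trans he _; apply: le_lt_trans er rd.
have Bu : `|p0 + h + (upd i (p0 + h) (a q) - (p0 + h)) - p0| < d.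
  rewrite addB_K; have := Bupd q (a q) Nq a1.
  by rewrite /q upd_upd.
have := @inj (p0 + h) _ 0 Bh Bu (lexx _).
rewrite addB_K a2 subrr normr0 mulr0 addr0 => H.
have {}H := H _; apply/eqP; rewrite -subr_eq0 -normr_le0 -(pmulr_rle0 _ m0).
apply: le_trans (H _) => [|j ji]; first by rewrite coordB updE eqxx.
by rewrite coordB updE (negbTE ji) subrr normr0.
Unshelve. all: by end_near. Qed.

End ImplicitFunction.

(** * Termwise differentiation of series of functions *)

Section SmoothSeries.
Context {R : realType}.
Local Notation V := 'rV[R]_3.
Implicit Types (f g : V -> R) (p h : V).

Lemma series_half_bound (u : R^nat) (K : R) : (forall n, `|u n| <= K * 2^-1 ^+ n) ->
  cvgn (series u) /\ `|limn (series u)| <= 2 * K.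
Proof.
move=> uK; have half : `|2^-1 : R| < 1 by rewrite gtr0_norm ?invr_gt0 // invf_lt1 // ltr1n.
have cg := @cvg_geometric_series R K 2^-1 half.
have cg' : cvgn (series (geometric K 2^-1)) by exact: is_cvg_geometric_series.
have K0 n : 0 <= K * 2^-1 ^+ n by apply: le_trans (uK n).
have cn : cvgn [normed series u].
  exact: (@series_le_cvg R _ _ (fun n => normr_ge0 (u n)) K0 uK cg').
split; first exact: normed_cvg.
apply: le_trans (lim_series_norm cn) _; have -> : 2 * K = limn (series (geometric K 2^-1)).
  by rewrite (cvg_lim _ cg) //; field.
exact: (@lim_series_le _ (fun n => `|u n|) (geometric K 2^-1) cn cg' uK).
Qed.

(** The mean value theorem is used twice, and each use costs a factor 3 for the number of
    coordinates. *)
Lemma taylor2_bound g p h (B : R) : 0 <= B -> (forall q, differentiable g q) ->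
  (forall i q, differentiable (pd i g) q) -> (forall i j q, `|pd j (pd i g) q| <= B) ->
  `|g (p + h) - g p - \sum_i pd i g p * h 0 i| <= 9 * B * `|h| ^+ 2.
Proof.
move=> B0 dg dg' bB; have [t /andP[t0 t1] ->] := @mvt_line _ g p h (fun t _ => dg _).
rewrite -sumrB; under eq_bigr do rewrite -mulrBl.
have -> : 9 * B * `|h| ^+ 2 = 3 * (3 * B * `|h|) * `|h| by rewrite expr2; ring.
apply: sum_bound => [|i|i]; [by rewrite !mulr_ge0| |exact: norm_coord].
have [s _ ->] := @mvt_line _ (pd i g) p (t *: h) (fun t _ => dg' i _).
apply: sum_bound => // j; apply: le_trans (norm_coord _ _) _.
by rewrite normrZ gtr0_norm // ler_piMl // ltW.
Qed.

Variables (t : nat -> V -> R) (K : seq 'I_3 -> R).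
Hypothesis dt : forall n s p, differentiable (pderiv s (t n)) p.
Hypothesis bt : forall n s p, `|pderiv s (t n) p| <= K s * 2^-1 ^+ n.

Definition series_pderiv s p := limn (series (fun n => pderiv s (t n) p)).

Lemma lapp_series s p : lapp (series_pderiv s) p (fun i => series_pderiv (i :: s) p).
Proof.
have K0 s' : 0 <= K s'.
  by have := le_trans (normr_ge0 _) (@bt 0%N s' 0); rewrite expr0 mulr1.
have cv s' q : series (fun n => pderiv s' (t n) q) @ \oo --> series_pderiv s' q.
  exact: (series_half_bound (fun n => bt n s' q)).1.
pose K2 := \sum_i \sum_j K (j :: i :: s).
have K2b i j : K (j :: i :: s) <= K2.
  rewrite /K2 (bigD1 i) //= (bigD1 j) //= -addrA lerDl addr_ge0 ?sumr_ge0 // => k _.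
  by rewrite sumr_ge0.
have K20 : 0 <= K2 by apply: sumr_ge0 => i _; exact: sumr_ge0.
(* Summing [taylor2_bound] over the series bounds the remainder by [18 * K2] times the square of the
   norm of [h]; the summand 1 keeps the denominator positive. *)
move=> e e0; exists (e / (18 * K2 + 1)) => [|h]; first by rewrite divr_gt0 // ltr_wpDl // mulr_ge0.
rewrite ltr_pdivlMr ?ltr_wpDl ?mulr_ge0 // => hd.
pose u n := pderiv s (t n) (p + h) - pderiv s (t n) p - \sum_i pderiv (i :: s) (t n) p * h 0 i.
have cu : series u @ \oo --> series_pderiv s (p + h) - series_pderiv s p -
     \sum_i series_pderiv (i :: s) p * h 0 i.
  have -> : series u = (fun n => series (fun n => pderiv s (t n) (p + h)) n -
      series (fun n => pderiv s (t n) p) n - \sum_i series (fun n => pderiv (i :: s) (t n) p) n * h 0 i).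
    apply/funext => n; rewrite /series /= !sumrB; congr (_ - _).
    by rewrite exchange_big; apply: eq_bigr => i _; rewrite mulr_suml.
  apply: cvgB; first by apply: cvgB; exact: cv.
  apply: cvg_big => [|i _]; first exact: add_continuous.
  by apply: cvgM; [exact: cv|exact: cvg_cst].
rewrite -(cvg_lim _ cu) //.
apply: le_trans (series_half_bound (K := 9 * K2 * `|h| ^+ 2) _).2 _ => [n|].
  rewrite [leRHS](_ : _ = 9 * (K2 * 2^-1 ^+ n) * `|h| ^+ 2); last by ring.
  apply: taylor2_bound => [|q|i q|i j q]; [by rewrite mulr_ge0 ?exprn_ge0| exact: dt|exact: (dt n (i :: s))|].
  by apply: le_trans (bt n (j :: i :: s) q) _; apply: ler_wpM2r; rewrite ?exprn_ge0.
rewrite [leLHS](_ : _ = `|h| * (18 * K2) * `|h|); last by rewrite expr2; ring.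
apply: ler_wpM2r => //; apply: le_trans (ltW hd); apply: ler_wpM2l => //.
by rewrite lerDl.
Qed.

Lemma pderiv_series s : pderiv s (series_pderiv [::]) = series_pderiv s.
Proof.
elim: s => [//|i s IH] /=; apply/funext => p; rewrite IH.
exact: (lapp_pd (@lapp_series s p)).2.
Qed.

Lemma smooth_series : smooth_on setT (series_pderiv [::]).
Proof. by move=> p _ s; rewrite pderiv_series; exact: (lapp_pd (@lapp_series s p)).1. Qed.

End SmoothSeries.

Section PderivAlgebra.
Context {R : realType}.
Local Notation V := 'rV[R]_3.
Implicit Types (f g : V -> R) (U : set V).

Lemma pderiv_cons i s f p : pderiv (i :: s) f p = pd i (pderiv s f) p.
Proof. by []. Qed.

Lemma pderivD U f g s p : open U -> smooth_on U f -> smooth_on U g -> U p ->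
  pderiv s (fun q => f q + g q) p = pderiv s f p + pderiv s g p.
Proof.
move=> oU sf sg; elim: s p => [//|i s IH] p Up.
by rewrite !pderiv_cons (pd_eq_on (g := fun q => pderiv s f q + pderiv s g q) _ oU) // pdD //; [exact: sf|exact: sg].
Qed.

Lemma pderivZ U (c : R) f s p : open U -> smooth_on U f -> U p ->
  pderiv s (fun q => c * f q) p = c * pderiv s f p.
Proof.
move=> oU sf; elim: s p => [//|i s IH] p Up.
rewrite !pderiv_cons (pd_eq_on (g := fun q => c * pderiv s f q) _ oU) //.
rewrite (@pdM _ (fun=> c) (pderiv s f)) ?pd_cst ?mulr0 ?addr0 //.
exact: sf.
Qed.

Lemma pderiv_cst (c : R) s p : pderiv s (fun=> c) p = if s is [::] then c else 0.
Proof.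
elim: s p => [//|i s IH] p; rewrite pderiv_cons.
have -> : pderiv s (fun=> c) = fun=> (if s is [::] then c else 0) by apply/funext => q.
exact: pd_cst.
Qed.

Lemma pderiv_sum U n (F : 'I_n -> V -> R) s p : open U -> (forall i, smooth_on U (F i)) -> U p ->
  pderiv s (fun q => \sum_i F i q) p = \sum_i pderiv s (F i) p.
Proof.
move=> oU; elim: n F => [|n IH] F sF Up.
  rewrite (_ : (fun q => _) = fun=> 0); last by apply/funext => q; rewrite big_ord0.
  by rewrite big_ord0 pderiv_cst; case: s.
rewrite (_ : (fun q => _) = fun q => F ord0 q + \sum_i F (lift ord0 i) q); last first.
  by apply/funext => q; rewrite big_ord_recl.
by rewrite (@pderivD U) // ?IH // ?big_ord_recl //; apply: smooth_sum.
Qed.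

Lemma chain1 (g : R -> R) f p (dg : R) : differentiable f p -> is_derive (f p) (1 : R) g dg ->
  differentiable (fun q => g (f q)) p /\ forall i, pd i (fun q => g (f q)) p = dg * pd i f p.
Proof.
move=> df Hg; have dgd : differentiable g (f p) by apply/derivable1_diffP; case: Hg.
have [dc Hc] := @is_diff_comp _ _ _ _ f _ g _ p (differentiableP df) (differentiableP dgd).
split=> [|i]; first exact: dc.
have Hg1 : derivable g (f p) 1 by case: Hg.
have Hv : derive1 g (f p) = dg by rewrite derive1E; case: Hg.
rewrite /pd -[fun q => g (f q)]/(g \o f) (deriveE _ df) (deriveE _ dc) Hc /= (deriv1E Hg1) Hv.
exact: mulrC.
Qed.

End PderivAlgebra.

(** * Borel's lemma in the variables u and x *)

Section Borel.
Context {R : realType}.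
Local Notation V := 'rV[R]_3.
Implicit Types (f g : V -> R) (p h : V).
Variable a : V.

(** Powers of sines take the place of monomials with cutoff functions: their derivatives are bounded
    on the whole line, and differentiation preserves the total degree [k + l], so the bounds are
    explicit. *)
Definition trig (b : R) (k l : nat) (x0 x : R) : R := sin (b * (x - x0)) ^+ k * cos (b * (x - x0)) ^+ l.

Lemma is_derive_trig b k l x0 x : is_derive x (1 : R) (trig b k l x0)
  (b * (k%:R * trig b k.-1 l.+1 x0 x - l%:R * trig b k.+1 l.-1 x0 x)).
Proof.
have dl : is_derive x (1 : R) (fun x => b * (x - x0)) b.
  have H : is_derive x (1 : R) (b *: (id - cst x0)) (b *: (1 - 0)) by exact: is_deriveZ.
  by apply: (is_derive_eq (H : is_derive x (1 : R) (fun x => b * (x - x0)) _)); rewrite subr0; exact: mulr1.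
have ds : is_derive x (1 : R) (fun x => sin (b * (x - x0))) (b * cos (b * (x - x0))).
  by have := @is_derive1_comp R sin (fun x => b * (x - x0)) _ _ _ (is_derive_sin _) dl; rewrite mulrC.
have dc : is_derive x (1 : R) (fun x => cos (b * (x - x0))) (b * - sin (b * (x - x0))).
  by have := @is_derive1_comp R cos (fun x => b * (x - x0)) _ _ _ (is_derive_cos _) dl; rewrite mulrC.
have H := is_deriveM (is_deriveX k ds) (is_deriveX l dc).
have -> : trig b k l x0 = (fun x => sin (b * (x - x0))) ^+ k * (fun x => cos (b * (x - x0))) ^+ l.
  by apply/funext => y; rewrite /trig !fctE.
apply: (is_derive_eq H); rewrite /trig !fctE.
rewrite -![_ *: _]/(_ * _) /=; set S := sin _; set C := cos _.
by move: {H ds dc dl} S C => S C; case: k l => [|k] [|l] /=; rewrite ?exprS; ring.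
Qed.

Definition mono (b : R) (k l m n : nat) : V -> R :=
  fun p => trig b k l (a 0 iu) (p 0 iu) * trig b m n (a 0 ix) (p 0 ix).

Lemma mono_diff b k l m n p : differentiable (mono b k l m n) p.
Proof.
apply: differentiableM.
  exact: (chain1 (differentiable_coord _ _ _) (is_derive_trig b k l (a 0 iu) _)).1.
exact: (chain1 (differentiable_coord _ _ _) (is_derive_trig b m n (a 0 ix) _)).1.
Qed.

Lemma pd_mono b k l m n i p : pd i (mono b k l m n) p =
  if i == iu then b * (k%:R * mono b k.-1 l.+1 m n p - l%:R * mono b k.+1 l.-1 m n p)
  else if i == ix then b * (m%:R * mono b k l m.-1 n.+1 p - n%:R * mono b k l m.+1 n.-1 p)
  else 0.
Proof.
have [d1 E1] := chain1 (differentiable_coord p 0 iu) (is_derive_trig b k l (a 0 iu) (p 0 iu)).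
have [d2 E2] := chain1 (differentiable_coord p 0 ix) (is_derive_trig b m n (a 0 ix) (p 0 ix)).
rewrite /mono pdM // E1 E2 !pd_coord.
by case: i => -[|[|[|[]]]] // H; rewrite /=; ring.
Qed.

Lemma smooth_mono b k l m n : smooth_on setT (mono b k l m n).
Proof.
apply: (@falg_smooth _ _ (fun f => exists k l m n, f = mono b k l m n)) => //; first exact: openT.
- by move=> _ [? [? [? [? ->]]]] p _; exact: mono_diff.
- move=> _ [{}k [{}l [{}m [{}n ->]]]] i.
  have M k' l' m' n' (c : R) : falg setT (fun f => exists k l m n, f = mono b k l m n) (fun p => c * mono b k' l' m' n' p).
    by apply: falg_mul; [exact: falg_cst|apply: falg_gen; exists k', l', m', n'].
  apply: falg_eq (_ : falg _ _ (fun p => if i == iu then b * (k%:R * mono b k.-1 l.+1 m n p + (- l%:R) * mono b k.+1 l.-1 m n p)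
  else if i == ix then b * (m%:R * mono b k l m.-1 n.+1 p + (- n%:R) * mono b k l m.+1 n.-1 p)
  else 0)) _; last by move=> p _; rewrite pd_mono !mulNr.
  by case: eqP => _; [|case: eqP => _]; [| |exact: falg_cst]; (apply: falg_mul; [exact: falg_cst|exact: falg_add]).
- by apply: falg_gen; exists k, l, m, n.
Qed.

Lemma smooth_monoZ (c : R) b k l m n : smooth_on setT (fun p => c * mono b k l m n p).
Proof. by apply: smooth_mul; [exact: openT|apply: smooth_cst; exact: openT|exact: smooth_mono]. Qed.

Lemma pderiv_mono b k l m n i s p : pderiv (i :: s) (mono b k l m n) p =
  if i == iu then b * (k%:R * pderiv s (mono b k.-1 l.+1 m n) p - l%:R * pderiv s (mono b k.+1 l.-1 m n) p)
  else if i == ix then b * (m%:R * pderiv s (mono b k l m.-1 n.+1) p - n%:R * pderiv s (mono b k l m.+1 n.-1) p)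
  else 0.
Proof.
have oT := @openT V.
rewrite [LHS](@pd_pderivC _ setT) //; last exact: smooth_mono.
have D c c' k' l' m' n' k2 l2 m2 n2 : pderiv s (fun q => b * (c * mono b k' l' m' n' q - c' * mono b k2 l2 m2 n2 q)) p =
   b * (c * pderiv s (mono b k' l' m' n') p - c' * pderiv s (mono b k2 l2 m2 n2) p).
  have -> : (fun q => b * (c * mono b k' l' m' n' q - c' * mono b k2 l2 m2 n2 q)) =
     (fun q => (b * c) * mono b k' l' m' n' q + (- (b * c')) * mono b k2 l2 m2 n2 q).
    by apply/funext => q; ring.
  rewrite (@pderivD _ setT) ?(@pderivZ _ setT) //; do ?[exact: smooth_mono|exact: smooth_monoZ].
  by ring.
case: eqP => [->|/eqP/negbTE iu_]; last case: eqP => [->|/eqP/negbTE ix_].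
- by rewrite -D; congr pderiv; apply/funext => q; rewrite pd_mono.
- by rewrite -D; congr pderiv; apply/funext => q; rewrite pd_mono.
- have -> : pd i (mono b k l m n) = fun=> 0 by apply/funext => q; rewrite pd_mono iu_ ix_.
  by rewrite pderiv_cst; case: (s).
Qed.

Lemma mono_bound b k l m n s p : 0 <= b ->
  `|pderiv s (mono b k l m n) p| <= (b * (k + l + m + n)%:R) ^+ size s.
Proof.
move=> b0; elim: s k l m n => [|i s IH] k l m n.
  rewrite expr0 /mono /trig !normrM !normrX /=.
  by rewrite !mulr_ile1 ?mulr_ge0 ?exprn_ge0 // !exprn_ile1 // ?sin_max ?cos_max.
rewrite pderiv_mono; case: ifP => _; last case: ifP => _.
- rewrite normrM ger0_norm // [size _]/= exprS -mulrA; apply: ler_wpM2l => //.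
  apply: le_trans (ler_normB _ _) _; rewrite !normrM !normr_nat.
  apply: le_trans (_ : (k + l)%:R * (b * (k + l + m + n)%:R) ^+ size s <= _); last first.
    by apply: ler_wpM2r; rewrite ?exprn_ge0 ?mulr_ge0 // ler_nat -addnA leq_addr.
  rewrite natrD mulrDl; apply: lerD.
    case: k => [|k]; first by rewrite !mul0r.
    by apply: ler_wpM2l => //; have := IH k l.+1 m n; rewrite addnS addSn.
  case: l => [|l]; first by rewrite !mul0r.
  by apply: ler_wpM2l => //; have := IH k.+1 l m n; rewrite addnS addSn.
- rewrite normrM ger0_norm // [size _]/= exprS -mulrA; apply: ler_wpM2l => //.
  apply: le_trans (ler_normB _ _) _; rewrite !normrM !normr_nat.
  apply: le_trans (_ : (m + n)%:R * (b * (k + l + m + n)%:R) ^+ size s <= _); last first.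
    by apply: ler_wpM2r; rewrite ?exprn_ge0 ?mulr_ge0 // ler_nat -addnA leq_addl.
  rewrite natrD mulrDl; apply: lerD.
    case: m => [|m]; first by rewrite !mul0r.
    by apply: ler_wpM2l => //; have := IH k l m n.+1; rewrite !addnS !addSn.
  case: n => [|n]; first by rewrite !mul0r.
  by apply: ler_wpM2l => //; have := IH k l m.+1 n; rewrite !addnS !addSn.
- by rewrite normr0 exprn_ge0 // mulr_ge0.
Qed.

Lemma count_ux i j : (count_mem iu (nseq i iu ++ nseq j ix) = i) *
  (count_mem ix (nseq i iu ++ nseq j ix) = j).
Proof. by rewrite !count_cat !count_nseq /= !mul1n !mul0n addn0 add0n. Qed.

(** Each derivative lowers the exponent of the sine in its variable by at most one, and a product
    that still contains a sine vanishes at [a]. *)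
Lemma mono_flat b k l m n s : (count_mem iu s < k)%N || (count_mem ix s < m)%N ->
  pderiv s (mono b k l m n) a = 0.
Proof.
have shrink x y : (x.+1 < y)%N -> (x < y.+1)%N && (x < y.-1)%N.
  by case: y => // y; rewrite ltnS /= => h; rewrite h andbT (leq_trans h (leqW (leqnSn y))).
elim: s k l m n => [|i s IH] k l m n.
  rewrite /= /mono /trig !subrr !mulr0 !sin0.
  by case/orP => [|] /prednK <-; rewrite !exprS !mul0r ?mulr0.
rewrite pderiv_mono /=; have [->|iu_] := eqVneq i iu; last have [_|ix_] := eqVneq i ix.
- rewrite /= add1n add0n => H.
  rewrite !IH ?mulr0 ?subrr ?mulr0 //; apply/orP; case/orP: H => H; try by right.
    by left; have /andP[] := shrink _ _ H.
  by left; have /andP[] := shrink _ _ H.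
- rewrite /= add1n add0n => H.
  rewrite !IH ?mulr0 ?subrr ?mulr0 //; apply/orP; case/orP: H => H; try by left.
    by right; have /andP[] := shrink _ _ H.
  by right; have /andP[] := shrink _ _ H.
- by [].
Qed.

Lemma mono_lead b k l m n :
  pderiv (nseq k iu ++ nseq m ix) (mono b k l m n) a = b ^+ (k + m) * (k`! * m`!)%:R.
Proof.
elim: k l => [|k IH] l.
  elim: m n => [|m IH] n.
    by rewrite /= /mono /trig !subrr !mulr0 !cos0 !expr0 !expr1n !mulr1.
  have := pderiv_mono b 0 l m.+1 n ix (nseq m ix) a; rewrite /= => ->.
  have := IH n.+1; rewrite /= => ->.
  rewrite mono_flat; last first.
    by apply/orP; right; rewrite (count_ux 0 m).
  by rewrite mulr0 subr0 !add0n exprS fact0 !mul1n factS natrM; ring.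
have := pderiv_mono b k.+1 l m n iu (nseq k iu ++ nseq m ix) a; rewrite /= => ->.
rewrite IH mono_flat; last first.
  by apply/orP; left; rewrite count_ux.
by rewrite mulr0 subr0 addSn exprS factS -mulnA (natrM _ k.+1); ring.
Qed.

Variable c : nat -> nat -> R.

(** What the partial sum [P] still misses in order [n]: terms added for lower orders have
    uncontrolled derivatives of higher order, which must be subtracted. The factorials come from
    [mono_lead]. *)
Definition bcoef n P (i : nat) : R :=
  (c i (n - i) - pderiv (nseq i iu ++ nseq (n - i) ix) P a) / (i`! * (n - i)`!)%:R.
(** With the factor [b ^- n] of [bstep] the derivatives of order [n] at [a] do not depend on the
    frequency [b], while those of order below [n] are of size [1 / b] everywhere. This [b] makes the
    latter at most [2 ^- n]. *)
Definition bfreq n P : R := 1 + 2 ^+ n * (\sum_(i < n.+1) `|bcoef n P i|) * n%:R ^+ n.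
Definition bstep n P : V -> R := fun p =>
  \sum_(i < n.+1) (bcoef n P i * bfreq n P ^- n) * mono (bfreq n P) i 0 (n - i) 0 p.

Fixpoint bpart n : V -> R :=
  if n is m.+1 then fun p => bpart m p + bstep m (bpart m) p else fun=> 0.
Definition bterm n := bstep n (bpart n).

Lemma bfreq_ge1 n P : 1 <= bfreq n P.
Proof. by rewrite lerDl !mulr_ge0 ?exprn_ge0 ?sumr_ge0. Qed.

Lemma bfreq_gt0 n P : 0 < bfreq n P.
Proof. exact: lt_le_trans (bfreq_ge1 n P). Qed.

Lemma smooth_bstep n P : smooth_on setT (bstep n P).
Proof. by apply: smooth_sum => [|i]; [exact: openT|exact: smooth_monoZ]. Qed.

Lemma pderiv_bstep n P s p : pderiv s (bstep n P) p =
  \sum_(i < n.+1) (bcoef n P i * bfreq n P ^- n) * pderiv s (mono (bfreq n P) i 0 (n - i) 0) p.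
Proof.
rewrite (@pderiv_sum _ setT) //; [|exact: openT|by move=> i; exact: smooth_monoZ].
apply: eq_bigr => i _; rewrite (@pderivZ _ setT) //; [exact: openT|exact: smooth_mono].
Qed.

Lemma bstep_bound n P s p : `|pderiv s (bstep n P) p| <=
  (\sum_(i < n.+1) `|bcoef n P i|) * bfreq n P ^- n * (bfreq n P * n%:R) ^+ size s.
Proof.
rewrite pderiv_bstep mulr_suml mulr_suml; apply: le_trans (ler_norm_sum _ _ _) _.
apply: ler_sum => i _; rewrite !normrM; apply: ler_pM; rewrite ?mulr_ge0 //.
  by rewrite ler_wpM2l // gtr0_norm // invr_gt0 exprn_gt0 // bfreq_gt0.
have -> : n%:R = (i + 0 + (n - i) + 0)%:R :> R by rewrite !addn0 subnKC // -ltnS.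
by apply: mono_bound; rewrite ltW // bfreq_gt0.
Qed.

Lemma bstep_small n P s p : (size s < n)%N -> `|pderiv s (bstep n P) p| <= 2^-1 ^+ n.
Proof.
move=> sn; apply: le_trans (bstep_bound _ _ _ _) _.
set S := \sum_(i < _) _; set b := bfreq n P; have b1 : 1 <= b by exact: bfreq_ge1.
have b0 : 0 < b by exact: bfreq_gt0.
have S0 : 0 <= S by exact: sumr_ge0.
have n0 : (0 < n)%N by exact: leq_ltn_trans sn.
have n1 : 1 <= n%:R :> R by rewrite ler1n.
apply: le_trans (_ : S * b^-1 * n%:R ^+ n <= _).
  rewrite -!mulrA; apply: ler_wpM2l => //; rewrite exprMn mulrA; apply: ler_pM.
  - by rewrite mulr_ge0 ?invr_ge0 ?exprn_ge0 // ltW.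
  - by rewrite exprn_ge0.
  - rewrite mulrC ler_pdivrMr ?exprn_gt0 // -(subnKC sn) addSn exprS mulKf ?gt_eqF //.
    by rewrite exprD ler_peMr ?exprn_ge0 ?(ltW b0) // exprn_ege1.
  - by apply: ler_weXn2l => //; exact: ltnW.
rewrite mulrAC ler_pdivrMr // exprVn -ler_pdivrMl ?invr_gt0 ?exprn_gt0 // invrK.
by rewrite /b /bfreq mulrA lerDr ler01.
Qed.

Lemma series_bterm s : series (fun n => pderiv s (bterm n) a) = fun n => pderiv s (bpart n) a.
Proof.
apply/funext => n; elim: n => [|n IH].
  by rewrite /series /= big_geq // pderiv_cst; case: s.
rewrite /series /= big_nat_recr //= -[X in X + _]/(series _ n) IH (@pderivD _ setT) //.
- exact: openT.
- elim: n {IH} => [|n IH]; first by apply: smooth_cst; exact: openT.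
  by apply: smooth_add => //; [exact: openT|exact: smooth_bstep].
- exact: smooth_bstep.
Qed.

Lemma bpart_jet i j n : (i + j < n)%N -> pderiv (nseq i iu ++ nseq j ix) (bpart n) a = c i j.
Proof.
have sP m : smooth_on setT (bpart m).
  elim: m => [|m IH]; first by apply: smooth_cst; exact: openT.
  by apply: smooth_add => //; [exact: openT|exact: smooth_bstep].
elim: n => [//|n IH]; rewrite ltnS leq_eqVlt => /orP[/eqP ijn|ijn] /=.
  rewrite (@pderivD _ setT) //; [|exact: openT|exact: smooth_bstep].
  rewrite pderiv_bstep.
  have lin : (i < n.+1)%N by rewrite -ijn ltnS leq_addr.
  rewrite (bigD1 (Ordinal lin)) //= big1 => [|k ki].
    have nj : (n - i = j)%N by rewrite -ijn addKn.
    rewrite nj mono_lead addr0 ijn -mulrA mulKf; last by rewrite expf_neq0 // gt_eqF // bfreq_gt0.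
    rewrite /bcoef nj divfK; first by rewrite addrC subrK.
    by rewrite pnatr_eq0 -lt0n muln_gt0 !fact_gt0.
  rewrite mono_flat ?mulr0 // !count_ux.
  have : (k : nat) != i by apply: contra ki => /eqP ki; apply/eqP/val_inj.
  rewrite neq_ltn => /orP[ki'|ki']; apply/orP; [right|by left].
  by rewrite ltn_subRL -[X in (_ < X)%N]ijn ltn_add2r.
rewrite (@pderivD _ setT) //; [|exact: openT|exact: smooth_bstep].
rewrite IH // pderiv_bstep big1 ?addr0 // => k _.
rewrite mono_flat ?mulr0 // !count_ux.
case: (ltnP i k) => //= ki; rewrite ltn_subRL; apply: leq_ltn_trans ijn.
by rewrite leq_add2r.
Qed.

Theorem borel : exists f : V -> R, [/\ smooth_on setT f, forall p, pd iv f p = 0 &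
  forall i j, pderiv (nseq i iu ++ nseq j ix) f a = c i j].
Proof.
pose B n (s : seq 'I_3) := (\sum_(i < n.+1) `|bcoef n (bpart n) i|) * bfreq n (bpart n) ^- n
   * (bfreq n (bpart n) * n%:R) ^+ size s.
have B0 n s : 0 <= B n s.
  by rewrite !mulr_ge0 ?exprn_ge0 ?invr_ge0 ?exprn_ge0 ?mulr_ge0 ?sumr_ge0 // ltW // bfreq_gt0.
(* For terms with [n] above [size s] the bound 1 suffices by [bstep_small]. The finitely many others
   are added, each with the factor [2 ^+ n] that compensates the required decay. *)
pose K s : R := 1 + \sum_(n < (size s).+1) B n s * 2 ^+ n.
have bt n s p : `|pderiv s (bterm n) p| <= K s * 2^-1 ^+ n.
  have [sn|ns] := ltnP (size s) n.
    apply: le_trans (bstep_small _ _ sn) _; rewrite ler_peMl ?exprn_ge0 ?invr_ge0 //.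
    by rewrite lerDl sumr_ge0 // => i _; rewrite mulr_ge0 ?exprn_ge0.
  apply: le_trans (bstep_bound _ _ _ _) _; rewrite -/(B n s).
  rewrite exprVn ler_pdivlMr ?exprn_gt0 // /K.
  have ns' : (n < (size s).+1)%N by [].
  rewrite (bigD1 (Ordinal ns')) //= addrCA lerDl addr_ge0 // sumr_ge0 // => i _.
  by rewrite mulr_ge0 ?exprn_ge0.
have dt n s p : differentiable (pderiv s (bterm n)) p by exact: smooth_bstep.
exists (series_pderiv bterm [::]); split.
- exact: (smooth_series dt bt).
- move=> p; have -> : pd iv (series_pderiv bterm [::]) = series_pderiv bterm [:: iv] by exact: (pderiv_series dt bt [:: iv]).
  rewrite /series_pderiv (_ : series _ = fun=> 0) ?lim_cst //.
  apply/funext => n; rewrite /series /= big1 // => k _.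
  rewrite [LHS](pderiv_bstep k (bpart k) [:: iv] p).
  by rewrite big1 // => l _; rewrite pderiv_cons [pderiv [::] _]/= pd_mono /= mulr0.
- move=> i j; rewrite (pderiv_series dt bt) /series_pderiv series_bterm.
  apply: lim_near_cst => //.
  by near=> n; apply: bpart_jet; near: n; exact: nbhs_infty_gt.
Unshelve. all: by end_near. Qed.

End Borel.

(** * The pseudogroup: composition and inverses *)

Section Pseudogroup.
Context {R : realType}.
Local Notation V := 'rV[R]_3.
Implicit Types (f : V -> R) (p q a : V) (U : set V) (phi : V -> V).

Lemma ax_cases (j : 'I_3) : [\/ j = iu, j = ix | j = iv].
Proof.
by case: j => -[|[|[|//]]] H; [apply: Or31|apply: Or32|apply: Or33]; apply: val_inj.
Qed.

Lemma row3u (x y z : R) : row3 x y z 0 iu = x. Proof. by rewrite mxE. Qed.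
Lemma row3x (x y z : R) : row3 x y z 0 ix = y. Proof. by rewrite mxE. Qed.
Lemma row3v (x y z : R) : row3 x y z 0 iv = z. Proof. by rewrite mxE. Qed.
Definition row3E := (row3u, row3x, row3v).

Lemma eq_row3 p q : p 0 iu = q 0 iu -> p 0 ix = q 0 ix -> p 0 iv = q 0 iv -> p = q.
Proof. by move=> hu hx hv; apply/rowP => j; case: (ax_cases j) => ->. Qed.


Lemma sum3 (F : 'I_3 -> R) : \sum_i F i = F iu + F ix + F iv.
Proof.
rewrite !big_ord_recl big_ord0 addr0 addrA; congr (_ + _ + _); congr F; exact: val_inj.
Qed.

Lemma pd_slice i f p : pd i f p = derive1 (fun t => f (upd i p t)) (p 0 i).
Proof.
rewrite /pd /derive /derive1; set F := (fun _ : R => _); set G := (fun _ : R => _).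
suff -> : F = G by [].
rewrite funeqE => h; rewrite /F /G /= /upd scalerDl addrCA subrK.
by [].
Qed.

Lemma derive1_const (k : R) x : derive1 (fun=> k) x = 0.
Proof. exact: derive1_cst. Qed.

(** The functions [C], [A], [B] of one or two variables are viewed on the three-dimensional base, so
    that one notion of smoothness and of partial derivative serves for all. *)
Definition hat1 (C : R -> R) : V -> R := fun p => C (p 0 iu).
Definition hat2 (A : R -> R -> R) : V -> R := fun p => A (p 0 iu) (p 0 ix).

Lemma pd_hat1 C i p : pd i (hat1 C) p = if i == iu then derive1 C (p 0 iu) else 0.
Proof.
rewrite pd_slice; have [->|ii] := eqVneq i iu.
  have -> // : (fun t => hat1 C (upd iu p t)) = C.
  by apply/funext => t; rewrite /hat1 updE eqxx.
rewrite (_ : (fun t => hat1 C (upd i p t)) = fun=> C (p 0 iu)) ?derive1_const //.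
by apply/funext => t; rewrite /hat1 updE eq_sym (negbTE ii).
Qed.

Lemma pd_hat2v A p : pd iv (hat2 A) p = 0.
Proof.
rewrite pd_slice (_ : (fun t => _) = fun=> A (p 0 iu) (p 0 ix)) ?derive1_const //.
by apply/funext => t; rewrite /hat2 !updE.
Qed.

Lemma pd_hat2x A p : pd ix (hat2 A) p = derive1 (A (p 0 iu)) (p 0 ix).
Proof.
rewrite pd_slice (_ : (fun t => _) = A (p 0 iu)) //.
by apply/funext => t; rewrite /hat2 !updE.
Qed.

Definition gauge U C A B := [/\ open U, smooth_on U (hat1 C), smooth_on U (hat2 A),
  smooth_on U (hat2 B) & forall p, U p -> pd iu (hat1 C) p != 0 /\ pd ix (hat2 A) p != 0].

Definition gmap (C : R -> R) (A B : R -> R -> R) : V -> V := fun p =>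
  row3 (hat1 C p) (hat2 A p) (p 0 iv / pd iu (hat1 C) p + hat2 B p).

Lemma near_open a (P : V -> Prop) : (\forall p \near a, P p) ->
  exists U, [/\ open U, U a & forall p, U p -> P p].
Proof.
move=> H; exists (interior [set p | P p]); split => //; first exact: open_interior.
by move=> p /nbhs_singleton.
Qed.

Lemma in_GP a phi : in_G a phi <-> exists U C A B,
  [/\ gauge U C A B, U a & forall p, U p -> phi p = gmap C A B p].
Proof.
split=> [[C [A [B [[sC sA sB] C0 A0 phiE]]]]|[U [C [A [B [[oU sC sA sB D0] Ua phiE]]]]]].
  have [U [oU Ua HU]] := near_open (filterI (filterI sC sA) (filterI sB (filterI C0 (filterI A0 phiE)))).
  exists U, C, A, B; split => //.
    split=> // p Up; have [[s1 s2] [s3 [c0 [a0 pE]]]] := HU p Up; do ?[exact: s1|exact: s2|exact: s3].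
    by rewrite pd_hat1 eqxx pd_hat2x.
  move=> p Up; have [_ [_ [_ [_ ->]]]] := HU p Up.
  by rewrite /gmap pd_hat1 eqxx.
exists C, A, B; split.
- by split; apply: filterS (open_near oU Ua) => p; [exact: sC|exact: sA|exact: sB].
- by apply: filterS (open_near oU Ua) => p Up; have [] := D0 p Up; rewrite pd_hat1 eqxx.
- by apply: filterS (open_near oU Ua) => p Up; have [_] := D0 p Up; rewrite pd_hat2x.
- apply: filterS (open_near oU Ua) => p Up; rewrite (phiE p Up) /gmap pd_hat1 eqxx.
  reflexivity.
Qed.

Lemma gauge_sub U W C A B : open W -> W `<=` U -> gauge U C A B -> gauge W C A B.
Proof.
move=> oW WU [oU sC sA sB D0]; split => //; do ?[exact: smooth_sub WU _].
by move=> p /WU; exact: D0.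
Qed.

Lemma gmap_smooth U C A B i : gauge U C A B -> smooth_on U (fun p => gmap C A B p 0 i).
Proof.
move=> [oU sC sA sB D0]; case: (ax_cases i) => ->.
- by apply: smooth_eq sC _ => // p _; rewrite row3E.
- by apply: smooth_eq sA _ => // p _; rewrite row3E.
- apply: (@smooth_eq _ _ (fun p => p 0 iv * (pd iu (hat1 C) p)^-1 + hat2 B p)) => //; last first.
    by move=> p _; rewrite row3E.
  apply: smooth_add => //; apply: smooth_mul => //; first exact: smooth_coord.
  by apply: smooth_inv => //; [exact: smooth_pd|move=> p /D0[]].
Qed.

Lemma diff_near_cont phi a : differentiable phi a -> forall P : V -> Prop,
  (\forall q \near phi a, P q) -> \forall p \near a, P (phi p).
Proof. by move=> /differentiable_continuous H P HP; exact: H HP. Qed.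

Lemma gmap_near U C A B a (P : V -> Prop) : gauge U C A B -> U a ->
  (\forall q \near gmap C A B a, P q) -> \forall p \near a, P (gmap C A B p).
Proof.
move=> G Ua; apply: diff_near_cont; apply: diff_row => j.
exact: smooth_diff (gmap_smooth j G) Ua.
Qed.

Lemma pd_gmap U C A B i p : gauge U C A B -> U p ->
  [/\ pd i (fun q => gmap C A B q 0 iu) p = pd i (hat1 C) p,
      pd i (fun q => gmap C A B q 0 ix) p = pd i (hat2 A) p &
      pd i (fun q => gmap C A B q 0 iv) p =
        (i == iv)%:R / pd iu (hat1 C) p - p 0 iv / pd iu (hat1 C) p ^+ 2 * pd i (pd iu (hat1 C)) p
        + pd i (hat2 B) p].
Proof.
move=> [oU sC sA sB D0] Up; split.
- by congr (pd i _ p); apply/funext => q; rewrite row3E.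
- by congr (pd i _ p); apply/funext => q; rewrite row3E.
have [c0 _] := D0 p Up.
have dc := sC p Up [:: iu].
have -> : (fun q => gmap C A B q 0 iv) = (fun q => q 0 iv * (pd iu (hat1 C) q)^-1 + hat2 B q).
  by apply/funext => q; rewrite row3E.
rewrite pdD; [|apply: differentiableM; [exact: differentiable_coord|exact: differentiableV]|exact: smooth_diff Up].
rewrite pdM; [|exact: differentiable_coord|exact: differentiableV].
rewrite pd_coord pdV //; congr (_ + _); move: (i == iv)%:R => k.
by field.
Qed.

Lemma in_G_near a phi : in_G a phi -> \forall p \near a, in_G p phi.
Proof.
move=> /in_GP[U [C [A [B [G Ua pE]]]]]; have [oU _ _ _ _] := G.
by apply: filterS (open_near oU Ua) => p Up; apply/in_GP; exists U, C, A, B.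
Qed.


Lemma in_G_diff a phi : in_G a phi -> differentiable phi a.
Proof.
move=> /in_GP[U [C [A [B [G Ua pE]]]]]; apply: diff_row => j.
apply: near_eq_diff (smooth_diff (gmap_smooth j G) Ua); have [oU _ _ _ _] := G.
by apply: filterS (open_near oU Ua) => p Up; rewrite pE.
Qed.

Lemma in_G_cvg a phi (P : V -> Prop) : in_G a phi -> (\forall q \near phi a, P q) ->
  \forall p \near a, P (phi p).
Proof. by move=> /in_G_diff d; exact: (diff_near_cont d). Qed.

Lemma in_G_comp a phi psi : in_G a phi -> in_G (phi a) psi -> in_G a (psi \o phi).
Proof.
move=> Gphi /in_GP[U' [C' [A' [B' [G' U'a pE']]]]].
have [oU' sC' sA' sB' D0'] := G'.
have phiU' := in_G_cvg Gphi (open_near oU' U'a).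
have /in_GP[U0 [C [A [B [G0 U0a pE0]]]]] := Gphi.
have [W [oW Wa HW]] := near_open phiU'.
pose U := U0 `&` W.
have oU : open U by apply: openI => //; case: G0.
have G : gauge U C A B by apply: gauge_sub G0 => // p [].
have [_ sC sA sB D0] := G.
have pE p : U p -> phi p = gmap C A B p by move=> [U0p _]; exact: pE0.
have UU' p : U p -> U' (gmap C A B p) by move=> Up; rewrite -pE //; apply: HW; case: Up.
have sgm i : smooth_on U (fun p => gmap C A B p 0 i) by exact: gmap_smooth.
have dgm p j : U p -> differentiable (fun p => gmap C A B p 0 j) p by move=> Up; exact: smooth_diff Up.
pose C2 := C' \o C; pose A2 x y := A' (C x) (A x y).
pose B2 x y := B x y / derive1 C' (C x) + B' (C x) (A x y).
have hC2 : hat1 C2 = fun p => hat1 C' (gmap C A B p).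
  by apply/funext => p; rewrite /hat1 row3E.
have hA2 : hat2 A2 = fun p => hat2 A' (gmap C A B p).
  by apply/funext => p; rewrite /hat2 !row3E.
have pC2 p : U p -> pd iu (hat1 C2) p = pd iu (hat1 C') (gmap C A B p) * pd iu (hat1 C) p.
  move=> Up; rewrite hC2 (chain_rule _ _).2; [|exact: smooth_diff (UU' p Up)|by move=> j; exact: dgm].
  have [g1 g2 g3] := pd_gmap iu G Up.
  by rewrite sum3 g1 !pd_hat1 /= !mul0r !addr0.
have pA2 p : U p -> pd ix (hat2 A2) p = pd ix (hat2 A') (gmap C A B p) * pd ix (hat2 A) p.
  move=> Up; rewrite hA2 (chain_rule _ _).2; [|exact: smooth_diff (UU' p Up)|by move=> j; exact: dgm].
  have [g1 g2 g3] := pd_gmap ix G Up.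
  by rewrite sum3 g1 g2 !pd_hat1 pd_hat2v /= mulr0 mul0r add0r addr0.
apply/in_GP; exists U, C2, A2, B2; split => //.
  split => //.
  - by rewrite hC2; exact: smooth_comp sC'.
  - by rewrite hA2; exact: smooth_comp sA'.
  - apply: (@smooth_eq _ _ (fun p => hat2 B p * (pd iu (hat1 C') (gmap C A B p))^-1 + hat2 B' (gmap C A B p))) => //.
      apply: smooth_add => //; last exact: smooth_comp sB'.
      apply: smooth_mul => //; apply: smooth_inv => //; last by move=> p /UU' /D0'[].
      by apply: (smooth_comp (f := pd iu (hat1 C'))) => //; [exact: UU'|exact: smooth_pd].
    by move=> p _; rewrite /hat2 pd_hat1 eqxx !row3E.
  - move=> p Up; rewrite pC2 // pA2 // !mulf_eq0 !negb_or.
    by have [-> ->] := D0 p Up; have [-> ->] := D0' _ (UU' p Up).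
move=> p Up /=; rewrite pE' ?pE //; last exact: UU'.
apply: eq_row3; first by rewrite [LHS]row3E [RHS]row3E hC2.
  by rewrite [LHS]row3E [RHS]row3E hA2.
rewrite [LHS]row3E [RHS]row3E pC2 //.
have -> : gmap C A B p 0 iv = p 0 iv / pd iu (hat1 C) p + hat2 B p by rewrite row3E.
have -> : hat2 B2 p = hat2 B p / pd iu (hat1 C') (gmap C A B p) + hat2 B' (gmap C A B p).
  by rewrite /hat2 /B2 pd_hat1 eqxx !row3E.
have [c0 _] := D0 p Up; have [c0' _] := D0' _ (UU' p Up).
move: (hat2 B' _) => z; move: (pd iu _ _) c0' => c' c0'; move: (hat2 B p) (pd iu _ p) c0 (p 0 iv) => b c c0 v.
by field; rewrite c0 c0'.
Qed.


(** The transformation is triangular: [C] is inverted first, then [A] with u already known, each by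
    [implicit_function], and v is given by an explicit formula. *)
Lemma in_G_inv a phi : in_G a phi -> exists psi,
  [/\ in_G (phi a) psi, \forall p \near a, psi (phi p) = p & \forall q \near phi a, phi (psi q) = q].
Proof.
move=> Gphi; have /in_GP[U [C [A [B [G Ua pE]]]]] := Gphi.
have [oU sC sA sB D0] := G; have [c0 a0] := D0 a Ua.
have [ga [Nc [oNc Nca sga Hga nga]]] := implicit_function oU Ua sC c0.
have [al [NA [oNA NAa sal Hal nal]]] := implicit_function oU Ua sA a0.
pose ax := a 0 ix; pose av := a 0 iv.
have oT := @openT V.
(* [implicit_function] returns functions of all three coordinates. Freezing the others at their
   values at [a] makes [g2] a function of u alone and, through [r2], [a2] a function of u and x, as
   membership in the pseudogroup demands. *)
pose r1 q : V := row3 (q 0 iu) ax av.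
have r1a : r1 (phi a) = upd iu a (hat1 C a).
  by apply: eq_row3; rewrite /r1 row3E updE // pE // row3E.
have sr1 W : open W -> forall i, smooth_on W (fun q => r1 q 0 i).
  move=> oW i; case: (ax_cases i) => ->.
  - by apply: smooth_eq (smooth_coord iu oW) _ => // q _; rewrite row3E.
  - by apply: smooth_eq (smooth_cst ax oW) _ => // q _; rewrite row3E.
  - by apply: smooth_eq (smooth_cst av oW) _ => // q _; rewrite row3E.
have cr1 (W : set V) b : open W -> W (r1 b) -> \forall q \near b, W (r1 q).
  move=> oW Wb; apply: (diff_near_cont (phi := r1)); last exact: open_near.
  by apply: diff_row => j; exact: (smooth_diff (sr1 setT oT j)).
have [W1 [oW1 W1a HW1]] : exists W, [/\ open W, W (phi a) & forall q, W q -> Nc (r1 q)].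
  by apply: near_open; apply: cr1 => //; rewrite r1a.
pose g2 q := ga (r1 q).
have sg2 : smooth_on W1 g2 by apply: smooth_comp sga => //; exact: sr1.
have g2a : g2 (phi a) = a 0 iu by rewrite /g2 r1a; exact: nbhs_singleton nga.
have Cg2 q : W1 q -> C (g2 q) = q 0 iu.
  by move=> /HW1/Hga[_]; rewrite /hat1 updE eqxx row3E.
pose r2 q : V := row3 (g2 q) (q 0 ix) av.
have sr2 i : smooth_on W1 (fun q => r2 q 0 i).
  case: (ax_cases i) => ->.
  - by apply: smooth_eq sg2 _ => // q _; rewrite row3E.
  - by apply: smooth_eq (smooth_coord ix oW1) _ => // q _; rewrite row3E.
  - by apply: smooth_eq (smooth_cst av oW1) _ => // q _; rewrite row3E.
have r2a : r2 (phi a) = upd ix a (hat2 A a).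
  by apply: eq_row3; rewrite /r2 row3E updE // pE // row3E.
have cW (W : set V) (r : V -> V) W' : open W -> open W' -> W' (phi a) -> W (r (phi a)) ->
   (forall i, smooth_on W' (fun q => r q 0 i)) ->
   exists W2, [/\ open W2, W2 (phi a), W2 `<=` W' & forall q, W2 q -> W (r q)].
  move=> oW oW' W'a Wr sr.
  have [W2 [oW2 W2a H2]] : exists W2, [/\ open W2, W2 (phi a) & forall q, W2 q -> W' q /\ W (r q)].
    apply: near_open; apply: filterI; first exact: open_near.
    apply: (diff_near_cont (phi := r)); last exact: open_near.
    by apply: diff_row => j; exact: (smooth_diff (sr j)).
  by exists W2; split => // q /H2[].
have [W2 [oW2 W2a W21 HW2]] : exists W2, [/\ open W2, W2 (phi a), W2 `<=` W1 & forall q, W2 q -> NA (r2 q)].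
  by apply: cW => //; rewrite r2a.
pose a2 q := al (r2 q).
have sa2 : smooth_on W2 a2 by apply: smooth_comp sal => // i; exact: smooth_sub W21 _.
have a2a : a2 (phi a) = a 0 ix by rewrite /a2 r2a; exact: nbhs_singleton nal.
have Aa2 q : W2 q -> A (g2 q) (a2 q) = q 0 ix.
  by move=> /HW2/Hal[_]; rewrite /hat2 !updE /= !row3E.
pose r3 q : V := row3 (g2 q) (a2 q) av.
have r3a : r3 (phi a) = a by apply: eq_row3; rewrite row3E.
have sr3 i : smooth_on W2 (fun q => r3 q 0 i).
  case: (ax_cases i) => ->.
  - by apply: smooth_eq (smooth_sub W21 sg2) _ => // q _; rewrite row3E.
  - by apply: smooth_eq sa2 _ => // q _; rewrite row3E.
  - by apply: smooth_eq (smooth_cst av oW2) _ => // q _; rewrite row3E.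
have [W3 [oW3 W3a W32 HW3]] : exists W2', [/\ open W2', W2' (phi a), W2' `<=` W2 & forall q, W2' q -> U (r3 q)].
  by apply: cW => //; rewrite r3a.
have W31 : W3 `<=` W1 by move=> q /W32/W21.
(* Solving [v' = v / C' + B] for v gives [v = v' * C' - B * C'], where [C'] is the reciprocal of the
   derivative of [C2]; hence the formula for [B2]. *)
pose C2 x := g2 (row3 x ax av); pose A2 x y := a2 (row3 x y av).
pose B2 x y := - B (C2 x) (A2 x y) * derive1 C (C2 x).
have hC2 : hat1 C2 = g2 by apply/funext => q; rewrite /hat1 /C2 /g2 /r1 row3E.
have g2i q q' : q 0 iu = q' 0 iu -> g2 q = g2 q' by move=> E; rewrite /g2 /r1 E.
have hA2 : hat2 A2 = a2.
  by apply/funext => q; rewrite /hat2 /A2 /a2 /r2 (@g2i _ q) !row3E.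
have hr3 q : hat1 C (r3 q) = C (g2 q) by rewrite /hat1 row3E.
have smr3 i : smooth_on W3 (fun q => r3 q 0 i) by exact: smooth_sub W32 _.
have dr3 q j : W3 q -> differentiable (fun q => r3 q 0 j) q by move=> W3q; exact: smooth_diff W3q.
have nearW q : W3 q -> \forall x \near q, W3 x by exact: open_near.
have pC2 q : W3 q -> pd iu (hat1 C) (r3 q) * pd iu g2 q = 1.
  move=> W3q; have E : pd iu (fun q => hat1 C (r3 q)) q = 1.
    rewrite -[RHS](_ : pd iu (fun q : V => q 0 iu) q = 1); last by rewrite pd_coord eqxx.
    by apply: near_eq_pd; apply: filterS (nearW q W3q) => x W3x; rewrite hr3 Cg2 //; exact: W31.
  have [_ CR] := chain_rule (smooth_diff sC (HW3 q W3q)) (fun j => dr3 q j W3q).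
  rewrite -E (CR iu) sum3 !pd_hat1 /= !mul0r !addr0; congr (_ * pd iu _ q).
  by apply/funext => x; rewrite row3E.
have pg2x q : pd ix g2 q = 0 by rewrite -hC2 pd_hat1.
have pA2 q : W3 q -> pd ix (hat2 A) (r3 q) * pd ix a2 q = 1.
  move=> W3q; have E : pd ix (fun q => hat2 A (r3 q)) q = 1.
    rewrite -[RHS](_ : pd ix (fun q : V => q 0 ix) q = 1); last by rewrite pd_coord eqxx.
    apply: near_eq_pd; apply: filterS (nearW q W3q) => x W3x.
    by rewrite /hat2 !row3E Aa2 //; exact: W32.
  have [_ CR] := chain_rule (smooth_diff sA (HW3 q W3q)) (fun j => dr3 q j W3q).
  rewrite -E (CR ix) sum3 pd_hat2v mul0r addr0.
  have -> : pd ix (fun q => r3 q 0 iu) q = 0.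
    by rewrite -(pg2x q); congr (pd ix _ q); apply/funext => x; rewrite row3E.
  rewrite mulr0 add0r; congr (_ * pd ix _ q).
  by apply/funext => x; rewrite row3E.
have G2 : gauge W3 C2 A2 B2.
  split => //.
  - by rewrite hC2; exact: smooth_sub W31 _.
  - by rewrite hA2; exact: smooth_sub W32 _.
  - apply: (@smooth_eq _ _ (fun q => - (hat2 B (r3 q)) * pd iu (hat1 C) (r3 q))) => //.
      apply: smooth_mul => //; first by apply: smooth_opp => //; exact: smooth_comp sB.
      by apply: (smooth_comp (f := pd iu (hat1 C))) => //; [exact: HW3|exact: smooth_pd].
    move=> q _; rewrite /hat2 pd_hat1 eqxx !row3E /B2.
    by rewrite -/(hat1 C2 q) -/(hat2 A2 q) hC2 hA2.
  - move=> q W3q; rewrite hC2 hA2; split.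
      by apply/eqP => E; have := pC2 q W3q; rewrite E mulr0 => /esym/eqP; rewrite oner_eq0.
    by apply/eqP => E; have := pA2 q W3q; rewrite E mulr0 => /esym/eqP; rewrite oner_eq0.
pose psi := gmap C2 A2 B2.
have psiu q : psi q 0 iu = g2 q by rewrite row3E hC2.
have psix q : psi q 0 ix = a2 q by rewrite row3E hA2.
have psiv q : W3 q -> psi q 0 iv = (q 0 iv - hat2 B (r3 q)) * pd iu (hat1 C) (r3 q).
  move=> W3q; rewrite row3E hC2.
  have -> : hat2 B2 q = - hat2 B (r3 q) * pd iu (hat1 C) (r3 q).
    by rewrite /hat2 /B2 -/(hat1 C2 q) -/(hat2 A2 q) hC2 hA2 pd_hat1 eqxx !row3E.
  have [c0' _] := D0 _ (HW3 q W3q).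
  have -> : (pd iu g2 q)^-1 = pd iu (hat1 C) (r3 q).
    by apply: (mulIf (x := pd iu g2 q)); [|rewrite pC2 // mulVf //]; apply/eqP => E; have := pC2 q W3q; rewrite E mulr0 => /esym/eqP; rewrite oner_eq0.
  by rewrite mulrBl mulNr.
have hatr3 q : [/\ hat1 C (psi q) = hat1 C (r3 q), hat2 A (psi q) = hat2 A (r3 q),
    hat2 B (psi q) = hat2 B (r3 q) & pd iu (hat1 C) (psi q) = pd iu (hat1 C) (r3 q)].
  by rewrite !pd_hat1 /hat1 /hat2 !psiu !psix !row3E.
have psia : psi (phi a) = a.
  apply: eq_row3; rewrite ?psiu ?psix // psiv // r3a pE // row3E.
  by rewrite addrK divfK.
exists psi; split.
- by apply/in_GP; exists W3, C2, A2, B2.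
- have h1 : \forall p \near a, U p /\ W3 (phi p).
    by apply: filterI; [exact: open_near|apply: in_G_cvg => //; exact: open_near].
  have n1 : \forall p \near a, ga (upd iu (r1 p) (hat1 C (r1 p))) = r1 p 0 iu.
    apply: (@diff_near_cont r1 a _ (fun p => ga (upd iu p (hat1 C p)) = p 0 iu)).
      by apply: diff_row => j; exact: (smooth_diff (sr1 setT oT j)).
    by have -> : r1 a = a by apply: eq_row3; rewrite row3E.
  pose r4 p : V := row3 (p 0 iu) (p 0 ix) av.
  have n2 : \forall p \near a, al (upd ix (r4 p) (hat2 A (r4 p))) = r4 p 0 ix.
    apply: (@diff_near_cont r4 a _ (fun p => al (upd ix p (hat2 A p)) = p 0 ix)).
      apply: diff_row => j; case: (ax_cases j) => ->.
      - have -> : (fun q => r4 q 0 iu) = fun q => q 0 iu by apply/funext => q; rewrite row3E.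
        exact: differentiable_coord.
      - have -> : (fun q => r4 q 0 ix) = fun q => q 0 ix by apply/funext => q; rewrite row3E.
        exact: differentiable_coord.
      - have -> : (fun q => r4 q 0 iv) = fun q => av by apply/funext => q; rewrite row3E.
        exact: differentiable_cst.
    by have -> : r4 a = a by apply: eq_row3; rewrite row3E.
  apply: filterS (filterI h1 (filterI n1 n2)) => p [[Up W3p] [g1 g3]].
  have eu : g2 (phi p) = p 0 iu.
    rewrite /g2 -[RHS](row3u _ ax av) -/(r1 p) -g1; congr ga.
    by apply: eq_row3; rewrite updE /= ?row3E // pE // row3E /hat1 row3E.
  have ex_ : a2 (phi p) = p 0 ix.
    rewrite /a2 -[RHS](row3x (p 0 iu) _ av) -/(r4 p) -g3; congr al.
    by apply: eq_row3; rewrite updE /= /r2 ?row3E // pE // row3E /hat2 !row3E.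
  apply: eq_row3; rewrite ?psiu ?psix // psiv //.
  have -> : hat2 B (r3 (phi p)) = hat2 B p by rewrite /hat2 !row3E eu ex_.
  have -> : pd iu (hat1 C) (r3 (phi p)) = pd iu (hat1 C) p by rewrite !pd_hat1 row3E eu.
  by rewrite pE // row3E addrK divfK //; have [] := D0 p Up.
- have h2 : \forall q \near phi a, W3 q /\ U (psi q).
    apply: filterI; first exact: open_near.
    by apply: (gmap_near G2) => //; rewrite -/psi psia; exact: open_near.
  apply: filterS h2 => q [W3q Upq].
  have [e1 e2 e3 e4] := hatr3 q; have [c0' _] := D0 _ Upq.
  apply: eq_row3; rewrite pE // row3E.
  - by rewrite e1 hr3 Cg2 //; exact: W31.
  - by rewrite e2 /hat2 !row3E Aa2 //; exact: W32.
  - by rewrite e3 e4 psiv // mulfK ?subrK // -e4.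
Qed.

End Pseudogroup.

(** * Jets of sections and solutions of the Kundt equation *)

Section Jets.
Context {R : realType}.
Local Notation V := 'rV[R]_3.
Local Notation sect := (Defs.comp -> V -> R).
Implicit Types (f : V -> R) (p q a : V) (U W : set V) (s : sect).

Definition jt s p : jet R :=
  Jet p (fun c i j l => pderiv (nseq i iu ++ nseq j ix ++ nseq l iv) (s c) p).

Definition eqj k (th th' : jet R) := jbase th = jbase th' /\
  forall c i j l, (i + j + l <= k)%N -> th c i j l = th' c i j l.

Lemma is_jetE k a s th : is_jet k a s th <-> eqj k th (jt s a).
Proof. by split=> -[h1 h2]; split. Qed.

Lemma eqj_refl k th : eqj k th th. Proof. by []. Qed.

Lemma eqj_sym k th th' : eqj k th th' -> eqj k th' th.
Proof. by move=> [h1 h2]; split=> // c i j l ijl; rewrite h2. Qed.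

Lemma eqj_trans k th th' th'' : eqj k th th' -> eqj k th' th'' -> eqj k th th''.
Proof. by move=> [h1 h2] [h3 h4]; split=> [|c i j l ijl]; [rewrite h1|rewrite h2 // h4]. Qed.

Lemma eqj_le k k' th th' : (k' <= k)%N -> eqj k th th' -> eqj k' th th'.
Proof. by move=> kk [h1 h2]; split=> // c i j l ijl; apply: h2; exact: leq_trans kk. Qed.

Lemma jetpoly_eqj k (P : jet R -> R) th th' : jetpoly k P -> eqj k th th' -> P th = P th'.
Proof.
move=> HP [hb hc]; elim: HP => {P} [f|c|f g _ hf _ hg|f g _ hf _ hg] //.
- by case=> [[i ->]|[c [i [j [l [ijl ->]]]]]]; [rewrite hb|exact: hc].
- by rewrite hf hg.
- by rewrite hf hg.
Qed.

Lemma subalg_sub (G G' : (jet R -> R) -> Prop) P : (forall F, G F -> G' F) -> subalg G P -> subalg G' P.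
Proof.
move=> GG'; elim=> [f Gf|c|f g _ hf _ hg|f g _ hf _ hg].
- by apply: subalg_gen; exact: GG'.
- exact: subalg_cst.
- exact: subalg_add.
- exact: subalg_mul.
Qed.

Lemma jetpoly_le k k' (P : jet R -> R) : (k <= k')%N -> jetpoly k P -> jetpoly k' P.
Proof.
move=> kk; apply: subalg_sub => f [[i ->]|[c [i [j [l [ijl ->]]]]]]; first by left; exists i.
by right; exists c, i, j, l; split=> //; exact: leq_trans kk.
Qed.

Definition sect_on U s := forall c, smooth_on U (s c).

(** The number of v-derivatives that annihilates the component of a solution, which is a polynomial
    in v of smaller degree. *)
Definition axis (c : Defs.comp) : nat := match c with ch => 1 | cW => 2 | cH => 3 end.

Definition Esol U s := forall c p, U p -> pderiv (nseq (axis c) iv) (s c) p = 0.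

Lemma perm_nseq3 (t : seq 'I_3) :
  perm_eq t (nseq (count_mem iu t) iu ++ nseq (count_mem ix t) ix ++ nseq (count_mem iv t) iv).
Proof.
rewrite /perm_eq; apply/allP => i _ /=; rewrite !count_cat !count_nseq.
by case: (ax_cases i) => -> /=; rewrite !mul0n !mul1n ?addn0 ?add0n.
Qed.

Lemma pderiv_jt U s c t p : open U -> sect_on U s -> U p ->
  pderiv t (s c) p = jt s p c (count_mem iu t) (count_mem ix t) (count_mem iv t).
Proof. by move=> oU ss Up; rewrite /= (pderiv_perm oU (ss c) Up (perm_nseq3 t)). Qed.

Lemma pderiv0 U f t p : open U -> (forall q, U q -> f q = 0) -> U p -> pderiv t f p = 0.
Proof.
move=> oU f0 Up; rewrite (pderiv_eq_on (g := fun=> 0) t oU f0 Up) pderiv_cst.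
by case: t.
Qed.

Lemma Esol_pderiv U s c t p : open U -> sect_on U s -> Esol U s -> U p ->
  (axis c <= count_mem iv t)%N -> pderiv t (s c) p = 0.
Proof.
move=> oU ss Es Up h; rewrite (pderiv_perm oU (ss c) Up (perm_nseq3 t)).
rewrite -(subnK h) nseqD !pderiv_cat.
have := @pderiv0 U (pderiv (nseq (axis c) iv) (s c)) (nseq (count_mem iu t) iu ++ nseq (count_mem ix t) ix
   ++ nseq (count_mem iv t - axis c) iv) p oU (Es c) Up.
by rewrite !pderiv_cat.
Qed.

Lemma Esol_eqE U s p k : open U -> sect_on U s -> Esol U s -> U p -> 0 < s ch p -> Defs.eqE k (jt s p).
Proof.
move=> oU ss Es Up h0; split => // i j l _.
- by apply: (Esol_pderiv (c := ch) oU) => //; rewrite !count_cat !count_nseq /= mul1n !addnS.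
- by apply: (Esol_pderiv (c := cW) oU) => //; rewrite !count_cat !count_nseq /= mul1n !addnS.
- by apply: (Esol_pderiv (c := cH) oU) => //; rewrite !count_cat !count_nseq /= mul1n !addnS.
Qed.

End Jets.

(** * Symbolic differentiation of pulled back sections *)

Inductive ax := AU | AX | AV.
Definition ax_ord (i : ax) : 'I_3 := match i with AU => iu | AX => ix | AV => iv end.
Definition ax_eqb (i j : ax) : bool :=
  match i, j with AU, AU | AX, AX | AV, AV => true | _, _ => false end.

Lemma ax_eqbE i j : ax_eqb i j = (ax_ord i == ax_ord j).
Proof. by case: i j => -[]. Qed.

(* Symbolic expressions for the components of the pulled back section:
   [ex_gauge k t] is the derivative along t of the k-th of the functions C, A, B,
   [ex_sect c t] that of the component c at the image point, and [ex_inv] is 1 / C'. *)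
Inductive expr (T : Type) :=
| ex_0 | ex_cst of T | ex_v | ex_inv | ex_gauge of nat & seq ax | ex_sect of Defs.comp & seq ax
| ex_add of expr T & expr T | ex_mul of expr T & expr T.
Arguments ex_0 {T}. Arguments ex_v {T}. Arguments ex_inv {T}. Arguments ex_gauge {T}. Arguments ex_sect {T}.

Section Pullback.
Context {R : realType}.
Local Notation V := 'rV[R]_3.
Local Notation sect := (Defs.comp -> V -> R).
Local Notation ex := (expr R).
Implicit Types (e f : ex) (p q a : V) (U W : set V) (s : sect).

Definition gauge_kills (k : nat) (i : ax) : bool :=
  match k, i with 0, AU => false | 0, _ => true | _, AV => true | _, _ => false end.

Definition sect_kills (c : Defs.comp) (n : nat) : bool :=
  match c, n with ch, _.+1 | cW, _.+2 | cH, _.+3 => true | _, _ => false end.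

Lemma sect_killsE c n : sect_kills c n = (axis c <= n)%N.
Proof. by case: c; case: n => [|[|[|n]]]. Qed.

(** Discarding zeros during construction makes a derivative that vanishes for structural reasons
    reduce to [ex_0] itself, so that [pull_Esol] holds by computation. It also keeps the expressions
    handed to [field] small. *)
Definition sadd (e f : ex) : ex := match e, f with ex_0, _ => f | _, ex_0 => e | _, _ => ex_add e f end.
Definition smul (e f : ex) : ex := match e, f with ex_0, _ => ex_0 | _, ex_0 => ex_0 | _, _ => ex_mul e f end.

Definition dg i k t : ex := if gauge_kills k i then ex_0 else ex_gauge k (i :: t).

Definition dinv i : ex := match i with
  AU => ex_mul (ex_cst (-1)) (ex_mul (ex_mul ex_inv ex_inv) (ex_gauge 0 [:: AU; AU])) | _ => ex_0 end.

Definition dvmap i : ex := sadd (sadd (if ax_eqb i AV then ex_inv else ex_0) (smul ex_v (dinv i)))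
  (dg i 2 [::]).

(* [sol] tells whether the section solves the Kundt equation, so that its higher v-derivatives vanish. *)
Variable sol : bool.
Definition count_v (t : seq ax) := size [seq i <- t | ax_eqb AV i].
Definition dsect c j t : ex :=
  if sol && sect_kills c (count_v (j :: t)) then ex_0 else ex_sect c (j :: t).

Fixpoint dex (i : ax) (e : ex) : ex := match e with
| ex_0 => ex_0
| ex_cst _ => ex_0
| ex_v => if ax_eqb i AV then ex_cst 1 else ex_0
| ex_inv => dinv i
| ex_gauge k t => dg i k t
| ex_sect c t => sadd (sadd (smul (dsect c AU t) (dg i 0 [::])) (smul (dsect c AX t) (dg i 1 [::])))
    (smul (dsect c AV t) (dvmap i))
| ex_add e f => sadd (dex i e) (dex i f)
| ex_mul e f => sadd (smul e (dex i f)) (smul f (dex i e))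
end.

Variables (C : R -> R) (A B : R -> R -> R).
Definition gfun (k : nat) : V -> R := match k with 0 => hat1 C | 1 => hat2 A | _ => hat2 B end.

Fixpoint evx (s : sect) (e : ex) (p : V) : R := match e with
| ex_0 => 0
| ex_cst r => r
| ex_v => p 0 iv
| ex_inv => (pd iu (hat1 C) p)^-1
| ex_gauge k t => pderiv (map ax_ord t) (gfun k) p
| ex_sect c t => pderiv (map ax_ord t) (s c) (gmap C A B p)
| ex_add e f => evx s e p + evx s f p
| ex_mul e f => evx s e p * evx s f p
end.

Lemma evx_sadd s e f p : evx s (sadd e f) p = evx s e p + evx s f p.
Proof. by case: e; case: f => *; rewrite /= ?addr0 ?add0r. Qed.

Lemma evx_smul s e f p : evx s (smul e f) p = evx s e p * evx s f p.
Proof. by case: e; case: f => *; rewrite /= ?mulr0 ?mul0r. Qed.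

Variables (U W : set V) (s : sect).
Hypotheses (G : gauge U C A B) (oW : open W) (UW : forall p, U p -> W (gmap C A B p)).
Hypotheses (ss : sect_on W s) (Es : sol -> Esol W s).

Let oU : open U. Proof. by case: G. Qed.

Lemma smooth_gfun k : smooth_on U (gfun k).
Proof. by case: G => _ sC sA sB _; case: k => [|[|k]]. Qed.

Lemma smooth_evx e : smooth_on U (evx s e).
Proof.
elim: e => [|r| | |k t|c t|e He f Hf|e He f Hf] /=.
- exact: smooth_cst.
- exact: smooth_cst.
- exact: smooth_coord.
- by case: G => _ sC _ _ D0; apply: smooth_inv => //; [exact: smooth_pd|move=> p /D0[]].
- exact: smooth_pderiv (smooth_gfun k).
- apply: (smooth_comp (f := pderiv (map ax_ord t) (s c))) UW _ _ => //; last exact: smooth_pderiv.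
  by move=> i; exact: gmap_smooth G.
- exact: smooth_add.
- exact: smooth_mul.
Qed.

Lemma evx_dg i k t p : U p -> pd (ax_ord i) (evx s (ex_gauge k t)) p = evx s (dg i k t) p.
Proof.
move=> Up; rewrite /dg; case: ifPn => // kl.
have q0 q : pd (ax_ord i) (gfun k) q = 0.
  by case: k i kl => [|[|k]] [] // _; rewrite /= ?pd_hat1 ?pd_hat2v.
rewrite /= (pd_pderivC _ _ oU (smooth_gfun k)) //; exact: (pderiv0 _ oU).
Qed.

Lemma evx_dinv i p : U p -> pd (ax_ord i) (evx s ex_inv) p = evx s (dinv i) p.
Proof.
move=> Up; have [_ sC _ _ D0] := G; have [c0 _] := D0 p Up.
rewrite /= pdV //; last exact: (sC p Up [:: iu]).
have E : ax_ord i != iu -> pd (ax_ord i) (pd iu (hat1 C)) p = 0.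
  move=> ii; rewrite (@pd_pderivC _ U (hat1 C) (ax_ord i) [:: iu]) //.
  by apply: (pderiv0 [:: iu] oU) => // q _; rewrite pd_hat1 (negbTE ii).
case: i E => /= E; [|by rewrite E // mulr0|by rewrite E // mulr0].
by rewrite mulN1r mulNr -expr2 exprVn.
Qed.

Lemma count_vE t : count_mem iv (map ax_ord t) = count_v t.
Proof. by elim: t => //= i t ->; rewrite /count_v; case: i. Qed.

Lemma evx_dsect c j t p : U p ->
  pd (ax_ord j) (pderiv (map ax_ord t) (s c)) (gmap C A B p) = evx s (dsect c j t) p.
Proof.
move=> Up; rewrite /dsect sect_killsE; case: ifPn => [/andP[hs hc]|//].
apply: (@Esol_pderiv _ W s c (map ax_ord (j :: t))) => //; [exact: Es|exact: UW|].
by rewrite count_vE.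
Qed.

Lemma evx_dvmap i p : U p -> pd (ax_ord i) (fun q => gmap C A B q 0 iv) p = evx s (dvmap i) p.
Proof.
move=> Up.
have -> : (fun q => gmap C A B q 0 iv) = (fun q => q 0 iv * evx s ex_inv q + evx s (ex_gauge 2 [::]) q).
  by apply/funext => q; rewrite row3E.
have d1 := smooth_diff (smooth_evx ex_inv) Up; have d2 := smooth_diff (smooth_evx (ex_gauge 2 [::])) Up.
rewrite pdD //; last by apply: differentiableM => //; exact: differentiable_coord.
rewrite pdM //; last exact: differentiable_coord.
rewrite pd_coord evx_dinv // evx_dg // /dvmap !evx_sadd evx_smul /=.
have -> : evx s (if ax_eqb i AV then ex_inv else ex_0) p = (pd iu (hat1 C) p)^-1 * (ax_ord i == iv)%:R.
  by rewrite -[iv]/(ax_ord AV) -ax_eqbE; case: ax_eqb; rewrite /= ?mulr1 ?mulr0.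
by congr (_ + _); rewrite addrC.
Qed.

Lemma evx_dex i e p : U p -> pd (ax_ord i) (evx s e) p = evx s (dex i e) p.
Proof.
move=> Up; elim: e => [|r| | |k t|c t|e He f Hf|e He f Hf].
- exact: pd_cst.
- exact: pd_cst.
- by rewrite [LHS]pd_coord -[iv]/(ax_ord AV) -ax_eqbE /=; case: ax_eqb.
- exact: evx_dinv.
- exact: evx_dg.
- have [_ CR] := chain_rule (f := pderiv (map ax_ord t) (s c)) (ss c (UW Up) (map ax_ord t))
    (fun j => smooth_diff (gmap_smooth j G) Up).
  rewrite [LHS](CR (ax_ord i)) sum3 [dex _ _]/= !evx_sadd !evx_smul.
  rewrite -(evx_dsect c AU t Up) -(evx_dsect c AX t Up) -(evx_dsect c AV t Up).
  rewrite -(evx_dvmap i Up) -(evx_dg i 0 [::] Up) -(evx_dg i 1 [::] Up).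
  have -> : (fun q => gmap C A B q 0 iu) = hat1 C by apply/funext => q; rewrite row3E.
  have -> : (fun q => gmap C A B q 0 ix) = hat2 A by apply/funext => q; rewrite row3E.
  reflexivity.
- by rewrite [LHS](@pdD _ (evx s e) (evx s f)) ?He ?Hf ?evx_sadd //; exact: smooth_diff (smooth_evx _) Up.
- by rewrite [LHS](@pdM _ (evx s e) (evx s f)) ?He ?Hf /= ?evx_sadd ?evx_smul //; exact: smooth_diff (smooth_evx _) Up.
Qed.

Lemma evx_pderiv t e p : U p -> pderiv (map ax_ord t) (evx s e) p = evx s (foldr dex e t) p.
Proof.
elim: t p => [//|i t IH] p Up; rewrite map_cons pderiv_cons.
rewrite (pd_eq_on (g := evx s (foldr dex e t)) _ oU) //; exact: evx_dex.
Qed.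

End Pullback.

(** * Pullback of sections by the pseudogroup *)

Section PullSection.
Context {R : realType}.
Local Notation V := 'rV[R]_3.
Local Notation sect := (Defs.comp -> V -> R).
Local Notation ex := (expr R).
Implicit Types (e f : ex) (p q a : V) (U W : set V) (s : sect).

(** The coefficients of [du^2], [du dx] and [dx^2] after substituting [C' du] for [du],
    [A_u du + A_x dx] for [dx] and the differential of [v / C' + B] for [dv]. The factors [C'] and
    [1 / C'] cancel in [du dv], so the shape of the metric is preserved. *)
Definition pullx (c : Defs.comp) : ex :=
  let cu := ex_gauge 0 [:: AU] in let au := ex_gauge 1 [:: AU] in let ax := ex_gauge 1 [:: AX] in
  match c with
  | ch => ex_mul (ex_sect ch [::]) (ex_mul ax ax)
  | cW => ex_add (ex_mul cu (ex_add (ex_gauge 2 [:: AX]) (ex_mul (ex_sect cW [::]) ax)))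
            (ex_mul (ex_cst 2) (ex_mul (ex_sect ch [::]) (ex_mul au ax)))
  | cH => ex_add (ex_mul cu (ex_add (dvmap AU)
              (ex_add (ex_mul (ex_sect cH [::]) cu) (ex_mul (ex_sect cW [::]) au))))
            (ex_mul (ex_sect ch [::]) (ex_mul au au))
  end.

Definition pull C A B s : sect := fun c => evx C A B s (pullx c).

Lemma kundt_inj (y y' : Defs.comp -> R) : (forall xi, kundt y xi = kundt y' xi) -> forall c, y c = y' c.
Proof.
move=> H.
have h1 := H (row3 1 0 0); have h2 := H (row3 0 1 0); have h3 := H (row3 1 1 0).
move: h1 h2 h3; rewrite /kundt !row3E !(mul0r, mulr0, mul1r, mulr1, addr0, add0r, expr0n, expr1n) /=.
move=> h1 h2 h3 c.
by case: c => //; move: h3; rewrite h1 h2 => /addIr/addrI.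
Qed.

Lemma d_gmap U C A B p (xi : V) : gauge U C A B -> U p -> 'd (gmap C A B) p xi =
  row3 (pd iu (hat1 C) p * xi 0 iu) (pd iu (hat2 A) p * xi 0 iu + pd ix (hat2 A) p * xi 0 ix)
    ((pd iu (hat2 B) p - p 0 iv / pd iu (hat1 C) p ^+ 2 * pd iu (pd iu (hat1 C)) p) * xi 0 iu
      + pd ix (hat2 B) p * xi 0 ix + xi 0 iv / pd iu (hat1 C) p).
Proof.
move=> G Up; have [oU sC sA sB D0] := G; have [c0 _] := D0 p Up.
have dj j : differentiable (fun q => gmap C A B q 0 j) p by exact: smooth_diff (gmap_smooth j G) Up.
have dphi : differentiable (gmap C A B) p by exact: diff_row.
have E j : 'd (gmap C A B) p xi 0 j = \sum_i pd i (fun q => gmap C A B q 0 j) p * xi 0 i.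
  by rewrite (diff_coord j xi dphi).2 diffsum.
have [u1 u2 u3] := pd_gmap iu G Up; have [x1 x2 x3] := pd_gmap ix G Up; have [v1 v2 v3] := pd_gmap iv G Up.
have cx i : i != iu -> pd i (pd iu (hat1 C)) p = 0.
  move=> ii; rewrite (@pd_pderivC _ U (hat1 C) i [:: iu]) //.
  by apply: (pderiv0 [:: iu] oU) => // q _; rewrite pd_hat1 (negbTE ii).
apply: eq_row3; rewrite row3E E sum3.
- by rewrite u1 x1 v1 !pd_hat1 /= !mul0r !addr0.
- by rewrite u2 x2 v2 pd_hat2v mul0r addr0.
- rewrite u3 x3 v3 (cx ix) // (cx iv) // pd_hat2v /=.
  move: (pd iu (pd iu _) p) (pd iu (hat2 B) p) (pd ix (hat2 B) p) (pd iu _ p) c0 => c1 c2 c3 c4 c0.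
  by field.
Qed.

Lemma kundt_pull U C A B s p xi : gauge U C A B -> U p ->
  kundt (s ^~ (gmap C A B p)) ('d (gmap C A B) p xi) = kundt (pull C A B s ^~ p) xi.
Proof.
move=> G Up; have [oU sC sA sB D0] := G; have [c0 _] := D0 p Up.
rewrite (d_gmap xi G Up).
have PH : pull C A B s cH p = pd iu (hat1 C) p * (p 0 iv * (-1 * ((pd iu (hat1 C) p)^-1
   * (pd iu (hat1 C) p)^-1 * pd iu (pd iu (hat1 C)) p)) + pd iu (hat2 B) p
   + (s cH (gmap C A B p) * pd iu (hat1 C) p + s cW (gmap C A B p) * pd iu (hat2 A) p))
   + s ch (gmap C A B p) * (pd iu (hat2 A) p * pd iu (hat2 A) p) by [].
have PW : pull C A B s cW p = pd iu (hat1 C) p * (pd ix (hat2 B) p + s cW (gmap C A B p) * pd ix (hat2 A) p)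
   + 2 * (s ch (gmap C A B p) * (pd iu (hat2 A) p * pd ix (hat2 A) p)) by [].
have Ph : pull C A B s ch p = s ch (gmap C A B p) * (pd ix (hat2 A) p * pd ix (hat2 A) p) by [].
rewrite /kundt !row3E PH PW Ph.
move: (pd iu (hat2 A) p) (pd ix (hat2 A) p) (pd iu (hat2 B) p) (pd ix (hat2 B) p) => au ax bu bx.
move: (s cH _) (s cW _) (s ch _) (xi 0 iu) (xi 0 ix) (xi 0 iv) (p 0 iv) => H W h xu xx xv v.
move: (pd iu (pd iu _) p) (pd iu _ p) c0 => cuu cu c0.
by field.
Qed.


Lemma pull_smooth U W C A B s : gauge U C A B -> open W -> (forall p, U p -> W (gmap C A B p)) ->
  sect_on W s -> sect_on U (pull C A B s).
Proof. by move=> G oW UW ss c; exact: (smooth_evx G UW ss (pullx c)). Qed.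

Lemma map_ax (i j l : nat) :
  map ax_ord (nseq i AU ++ nseq j AX ++ nseq l AV) = nseq i iu ++ nseq j ix ++ nseq l iv.
Proof. by rewrite !map_cat !map_nseq. Qed.

Lemma pull_Esol U W C A B s : gauge U C A B -> open W -> (forall p, U p -> W (gmap C A B p)) ->
  sect_on W s -> Esol W s -> Esol U (pull C A B s).
Proof.
move=> G oW UW ss Es c p Up.
have -> : nseq (axis c) iv = map ax_ord (nseq (axis c) AV) by rewrite map_nseq.
rewrite (evx_pderiv (sol := true) G oW UW ss (fun _ => Es)) //.
by case: c.
Qed.

Lemma pull_pos U C A B s p : gauge U C A B -> U p -> 0 < s ch (gmap C A B p) -> 0 < pull C A B s ch p.
Proof.
move=> [_ _ _ _ D0] Up h0; have [_ a0] := D0 p Up; rewrite /pull /= mulr_gt0 //.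
by rewrite -expr2 exprn_even_gt0.
Qed.

Fixpoint orderx (e : ex) : nat := match e with
| ex_sect _ t => size t
| ex_add e f => maxn (orderx e) (orderx f)
| ex_mul e f => maxn (orderx e) (orderx f)
| _ => 0 end.

Lemma orderx_sadd e f : (orderx (sadd e f) <= maxn (orderx e) (orderx f))%N.
Proof. by case: e; case: f => *; rewrite /= ?maxn0 ?max0n. Qed.

Lemma orderx_smul e f : (orderx (smul e f) <= maxn (orderx e) (orderx f))%N.
Proof. by case: e; case: f => *; rewrite /= ?maxn0 ?max0n. Qed.

Lemma orderx_dg i k t : orderx (@dg R i k t) = 0%N.
Proof. by rewrite /dg; case: ifP. Qed.

Lemma orderx_dinv i : orderx (@dinv R i) = 0%N. Proof. by case: i. Qed.

Lemma orderx_dvmap i : orderx (@dvmap R i) = 0%N.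
Proof. by case: i. Qed.

Lemma orderx_sadd_le e f n : (orderx e <= n)%N -> (orderx f <= n)%N -> (orderx (sadd e f) <= n)%N.
Proof. by move=> en fn; apply: leq_trans (orderx_sadd _ _) _; rewrite geq_max en. Qed.

Lemma orderx_smul_le e f n : (orderx e <= n)%N -> (orderx f <= n)%N -> (orderx (smul e f) <= n)%N.
Proof. by move=> en fn; apply: leq_trans (orderx_smul _ _) _; rewrite geq_max en. Qed.

Lemma orderx_dex i e : (orderx (dex false i e) <= (orderx e).+1)%N.
Proof.
elim: e => [|r| | |k t|c t|e He f Hf|e He f Hf]; cbn [dex orderx] => //.
- by case: i.
- by rewrite orderx_dinv.
- by rewrite orderx_dg.
- by do ?[apply: orderx_sadd_le]; apply: orderx_smul_le; rewrite ?orderx_dg ?orderx_dvmap.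
- by apply: orderx_sadd_le; [apply: leq_trans He _|apply: leq_trans Hf _]; rewrite ltnS ?leq_maxl ?leq_maxr.
- apply: orderx_sadd_le; apply: orderx_smul_le.
  + by apply: leq_trans (leq_maxl _ _) (leqnSn _).
  + by apply: leq_trans Hf _; rewrite ltnS leq_maxr.
  + by apply: leq_trans (leq_maxr _ _) (leqnSn _).
  + by apply: leq_trans He _; rewrite ltnS leq_maxl.
Qed.

Lemma orderx_foldr e t : (orderx (foldr (dex false) e t) <= orderx e + size t)%N.
Proof.
elim: t => [|i t IH] /=; first by rewrite addn0.
by apply: leq_trans (orderx_dex _ _) _; rewrite addnS ltnS.
Qed.

Lemma evx_jetpoly C A B e a k : (orderx e <= k)%N -> exists2 M, jetpoly k M &
  forall s W, open W -> W (gmap C A B a) -> sect_on W s -> evx C A B s e a = M (jt s (gmap C A B a)).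
Proof.
elim: e => [|r| | |n t|c t|e He f Hf|e He f Hf] /= ek.
- by exists (fun=> 0) => //; exact: subalg_cst.
- by exists (fun=> r) => //; exact: subalg_cst.
- by exists (fun=> a 0 iv) => //; exact: subalg_cst.
- by exists (fun=> (pd iu (hat1 C) a)^-1) => //; exact: subalg_cst.
- by exists (fun=> pderiv (map ax_ord t) (gfun C A B n) a) => //; exact: subalg_cst.
- exists (fun th : jet R => th c (count_mem iu (map ax_ord t)) (count_mem ix (map ax_ord t)) (count_mem iv (map ax_ord t))).
    apply: subalg_gen; right; do 4 eexists; split=> //.
    apply: leq_trans ek; rewrite -(size_map ax_ord t).
    by rewrite (perm_size (perm_nseq3 (map ax_ord t))) !size_cat !size_nseq addnA.
  by move=> s W oW Wa ss; exact: (pderiv_jt _ _ oW ss Wa).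
- move: ek; rewrite geq_max => /andP[/He[M HM EM] /Hf[N HN EN]].
  exists (fun th => M th + N th); first exact: subalg_add.
  by move=> s W oW Wa ss; rewrite (EM s W) // (EN s W).
- move: ek; rewrite geq_max => /andP[/He[M HM EM] /Hf[N HN EN]].
  exists (fun th => M th * N th); first exact: subalg_mul.
  by move=> s W oW Wa ss; rewrite (EM s W) // (EN s W).
Qed.

(** The flag [false] retains derivatives that vanish only on solutions, so the polynomial [M] is the
    same for all sections; its order is that of the coordinate because [dex] raises [orderx] by at
    most one. *)
Lemma pull_jet U C A B a c i j l : gauge U C A B -> U a ->
  exists2 M, jetpoly (i + j + l) M & forall s W, open W -> W (gmap C A B a) -> sect_on W s ->
    jt (pull C A B s) a c i j l = M (jt s (gmap C A B a)).
Proof.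
move=> G Ua; pose t := nseq i AU ++ nseq j AX ++ nseq l AV.
have [|M HM EM] := @evx_jetpoly C A B (foldr (dex false) (pullx c) t) a (i + j + l).
  apply: leq_trans (orderx_foldr _ _) _; rewrite !size_cat !size_nseq addnA.
  have -> : orderx (pullx c) = 0%N by case: c.
  by rewrite add0n addnA.
exists M => // s W oW Wa ss; rewrite -(EM s W) //=.
have [U' [oU' U'a HU']] := near_open (gmap_near G Ua (open_near oW Wa)).
have oUU : open (U `&` U') by apply: openI => //; case: G.
have G' : gauge (U `&` U') C A B by apply: gauge_sub G => // q [].
rewrite -map_ax -(evx_pderiv (sol := false) G' oW _ ss) //.
by move=> q [_ /HU'].
Qed.

Lemma pull_eqj U C A B a s s' W W' k : gauge U C A B -> U a -> open W -> open W' ->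
  W (gmap C A B a) -> W' (gmap C A B a) -> sect_on W s -> sect_on W' s' ->
  eqj k (jt s (gmap C A B a)) (jt s' (gmap C A B a)) -> eqj k (jt (pull C A B s) a) (jt (pull C A B s') a).
Proof.
move=> G Ua oW oW' Wa W'a ss ss' E; split => // c i j l ijl.
have [M HM EM] := pull_jet c i j l G Ua.
by rewrite (EM s W) // (EM s' W') //; apply: jetpoly_eqj HM _; exact: eqj_le E.
Qed.

End PullSection.

(** * Realising jets by solutions, and groupoid laws for prolongations *)

Section Realization.
Context {R : realType}.
Local Notation V := 'rV[R]_3.
Local Notation sect := (Defs.comp -> V -> R).
Implicit Types (f : V -> R) (p q a : V) (U W : set V) (s : sect) (th : jet R) (phi psi : V -> V).

Definition section_on U s := [/\ open U, sect_on U s & forall p, U p -> 0 < s ch p].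

Lemma section_nearP a s : section_near a s <-> exists2 U, section_on U s & U a.
Proof.
split=> [[ss h0]|[U [oU ss h0] Ua]]; last first.
  split=> [c|]; first by apply: filterS (open_near oU Ua) => p Up; exact: ss.
  exact: filterS (open_near oU Ua).
have [U [oU Ua HU]] := near_open (filterI (filterI (ss cH) (ss cW)) (filterI (ss ch) h0)).
exists U => //; split=> // [c p Up|p /HU[_ []] //].
by have [[h1 h2] [h3 _]] := HU p Up; case: c.
Qed.

Definition sol_near a s := exists U, [/\ section_on U s, Esol U s & U a].

Lemma sol_section a s : sol_near a s -> section_near a s.
Proof. by move=> [U [sU _ Ua]]; apply/section_nearP; exists U. Qed.

Lemma sol_near_near a s : sol_near a s -> \forall p \near a, sol_near p s.
Proof. by move=> [U [[oU ss h0] Es Ua]]; apply: filterS (open_near oU Ua) => p Up; exists U. Qed.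

Lemma sol_near_eqE a s k : sol_near a s -> Defs.eqE k (jt s a).
Proof. by move=> [U [[oU ss h0] Es Ua]]; apply: (Esol_eqE k oU ss Es Ua); exact: h0. Qed.

Definition vmono a (l : nat) : V -> R := fun p => (p 0 iv - a 0 iv) ^+ l / l`!%:R.

Lemma smooth_vmono a l : smooth_on setT (vmono a l).
Proof.
have oT := @openT V.
have sX : smooth_on setT (fun p => (p 0 iv - a 0 iv) ^+ l).
  elim: l => [|l IH]; first exact: smooth_cst.
  apply: (@smooth_eq _ _ (fun p => (p 0 iv + - a 0 iv) * (p 0 iv - a 0 iv) ^+ l)) => // [|p _]; last by rewrite exprS.
  by apply: smooth_mul => //; apply: smooth_add => //; [exact: smooth_coord|exact: smooth_cst].
by apply: smooth_mul => //; exact: smooth_cst.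
Qed.

Lemma pd_vmono a l i p : pd i (vmono a l) p = if l is l'.+1 then (i == iv)%:R * vmono a l' p else 0.
Proof.
have dX m : differentiable (fun p : V => (p 0 iv - a 0 iv) ^+ m) p.
  apply: (@near_eq_diff _ (fun p => vmono a m p * m`!%:R)); last first.
    by apply: differentiableM; [exact: smooth_diff (smooth_vmono a m) _|exact: differentiable_cst].
  by near=> q; rewrite /vmono divfK // pnatr_eq0 -lt0n fact_gt0.
have d0 : differentiable (fun p : V => p 0 iv - a 0 iv) p.
  by have := dX 1%N; under eq_fun do rewrite expr1.
have pX m : pd i (fun p : V => (p 0 iv - a 0 iv) ^+ m) p = m%:R * (p 0 iv - a 0 iv) ^+ m.-1 * (i == iv)%:R.
  elim: m => [|m IH].
    by rewrite mul0r mul0r -[RHS](pd_cst 1 p i); congr (pd i _ p); apply/funext => q; rewrite expr0.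
  have -> : (fun p : V => (p 0 iv - a 0 iv) ^+ m.+1) =
     (fun p => (p 0 iv - a 0 iv) * (p 0 iv - a 0 iv) ^+ m) by apply/funext => q; rewrite exprS.
  rewrite (@pdM _ (fun p : V => p 0 iv - a 0 iv)) // IH.
  rewrite (@pdB _ (fun p : V => p 0 iv) (fun=> a 0 iv)) ?pd_cst ?pd_coord; last 2 first.
  - exact: differentiable_coord.
  - exact: differentiable_cst.
  move: (p 0 iv - a 0 iv) (i == iv)%:R => x k; case: m {IH} => [|m] /=; rewrite ?expr0 ?exprS; first by ring.
  by rewrite -[m.+2]addn1 natrD; ring.
rewrite (@pdM _ (fun p : V => (p 0 iv - a 0 iv) ^+ l) (fun=> (l`!%:R)^-1)) ?pd_cst ?pX; last 2 first.
- exact: dX.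
- exact: differentiable_cst.
case: l => [|l]; first by rewrite !mul0r !mulr0 addr0.
rewrite /vmono factS natrM.
have h1 : l.+1%:R != 0 :> R by rewrite pnatr_eq0.
have h2 : l`!%:R != 0 :> R by rewrite pnatr_eq0 -lt0n fact_gt0.
move: l.+1%:R l`!%:R h1 h2 => m n h1 h2 /=; move: ((_ - _) ^+ l) (_ == _)%:R => x k.
by field; rewrite h1 h2.
Unshelve. all: by end_near. Qed.

Lemma pd_mul_vmono a f l i p : smooth_on setT f ->
  pd i (fun q => f q * vmono a l q) p = f p * pd i (vmono a l) p + pd i f p * vmono a l p.
Proof.
by move=> sf; rewrite pdM ?[vmono a l p * _]mulrC //; [exact: smooth_diff sf _|exact: smooth_diff (smooth_vmono a l) _].
Qed.

Lemma pderiv_iv_vmono a f k l : smooth_on setT f -> (forall p, pd iv f p = 0) ->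
  pderiv (nseq k iv) (fun q => f q * vmono a l q) =
  if (k <= l)%N then (fun q => f q * vmono a (l - k) q) else fun=> 0.
Proof.
move=> sf fv; elim: k => [|k IH]; first by rewrite subn0.
apply/funext => p; rewrite pderiv_cons IH; case: (leqP k l) => kl; last first.
  by rewrite pd_cst leqNgt ltnS (ltnW kl).
rewrite pd_mul_vmono // fv mul0r addr0 pd_vmono; move: kl; rewrite leq_eqVlt => /orP[/eqP <-|kl].
  by rewrite subnn mulr0 ltnn.
by rewrite kl -(subnSK kl) eqxx mul1r.
Qed.

Lemma pderiv_ux_vmono a f l t : smooth_on setT f -> iv \notin t ->
  pderiv t (fun q => f q * vmono a l q) = fun q => pderiv t f q * vmono a l q.
Proof.
move=> sf; elim: t => [//|i t IH]; rewrite inE negb_or => /andP[ii it].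
apply/funext => p; rewrite pderiv_cons IH // pd_mul_vmono; last exact: smooth_pderiv.
rewrite pd_vmono; move: (l) => [|l']; by rewrite ?[i == iv]eq_sym ?(negbTE ii) ?mul0r ?mulr0 add0r.
Qed.

Lemma pos_near f a : differentiable f a -> 0 < f a -> \forall p \near a, 0 < f p.
Proof.
move=> df f0; have [d d0 Hd] := diff_continuous_near df f0.
apply/nbhsE; exists d => // h hd; have := Hd (a + h).
rewrite addrAC subrr add0r => /(_ hd); rewrite ltr_norml => /andP[+ _].
by rewrite ltrBrDr addNr.
Qed.

Lemma neq0_near f a : differentiable f a -> f a != 0 -> \forall p \near a, f p != 0.
Proof.
move=> df f0; have h : 0 < `|f a| by rewrite normr_gt0.
have [d d0 Hd] := diff_continuous_near df h.
apply/nbhsE; exists d => // k hd; have := Hd (a + k).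
rewrite addrAC subrr add0r => /(_ hd) H; apply/eqP => E; move: H.
by rewrite E sub0r normrN ltxx.
Qed.

(** On the equation each component is a polynomial in v of degree below [axis c], so applying
    Borel's lemma in u and x to each of its finitely many coefficients gives an actual solution. *)
Lemma realize th : eqEoo th -> exists s, sol_near (jbase th) s /\
  forall c i j l, jt s (jbase th) c i j l = th c i j l.
Proof.
move=> Eth; set a := jbase th; have oT := @openT V.
have [F HF] : exists F : Defs.comp -> nat -> V -> R, forall c l, [/\ smooth_on setT (F c l),
    forall p, pd iv (F c l) p = 0 &
    forall i j, pderiv (nseq i iu ++ nseq j ix) (F c l) a = th c i j l].
  pose P (cl : Defs.comp * nat) f := [/\ smooth_on setT f, forall p, pd iv f p = 0 &
    forall i j, pderiv (nseq i iu ++ nseq j ix) f a = th cl.1 i j cl.2].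
  have [F HF] := choice (fun cl : Defs.comp * nat => borel a (fun i j => th cl.1 i j cl.2)).
  by exists (fun c l => F (c, l)) => c l; exact: (HF (c, l)).
pose s c p := \sum_(l < axis c) F c l p * vmono a l p.
have sF c l : smooth_on setT (fun p => F c l p * vmono a l p).
  by apply: smooth_mul => //; [case: (HF c l)|exact: smooth_vmono].
have ss : sect_on setT s by move=> c; apply: smooth_sum.
have Es : Esol setT s.
  move=> c p _; rewrite (pderiv_sum _ oT) // big1 // => l _.
  have [h1 h2 h3] := HF c l.
  by rewrite pderiv_iv_vmono // leqNgt ltn_ord.
have Z c i j l : (axis c <= l)%N -> th c i j l = 0.
  have [h1 h2 h3 h4] := Eth (i + j + l)%N.
  case: c => lc; [have E : l = (l - 3).+3 by rewrite -[RHS]addn3 subnK|have E : l = (l - 2).+2 by rewrite -[RHS]addn2 subnK|have E : l = (l - 1).+1 by rewrite -[RHS]addn1 subnK].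
  - by rewrite E h4 // -E.
  - by rewrite E h3 // -E.
  - by rewrite E h2 // -E.
have js c i j l : jt s a c i j l = th c i j l.
  rewrite /= (pderiv_sum _ oT) //.
  have E m : pderiv (nseq i iu ++ nseq j ix ++ nseq l iv) (fun p => F c m p * vmono a m p) a =
     if m == l then th c i j l else 0.
    have [h1 h2 h3] := HF c m.
    rewrite catA pderiv_cat pderiv_iv_vmono //; case: (leqP l m) => lm; last first.
      by rewrite (pderiv0 _ oT) // (ltn_eqF lm).
    rewrite pderiv_ux_vmono //; last by rewrite mem_cat !mem_nseq !negb_or !negb_and; apply/andP; split; apply/orP; right.
    rewrite h3 /vmono subrr; have [->|ml] := eqVneq m l; first by rewrite subnn expr0 fact0 divr1 mulr1.
    have -> : (m - l)%N = (m - l).-1.+1 by rewrite prednK // subn_gt0 ltn_neqAle eq_sym ml.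
    by rewrite exprS !mul0r mulr0.
  under eq_bigr do rewrite E.
  case: (ltnP l (axis c)) => lc.
    by rewrite (bigD1 (Ordinal lc)) //= eqxx big1 ?addr0 // => m /negbTE; rewrite -val_eqE /= => ->.
  rewrite big1 => [|m _]; last by rewrite ltn_eqF // (leq_trans _ lc).
  by rewrite Z.
have h0 : 0 < s ch a.
  have := js ch 0 0 0; rewrite /= => ->; by have [] := Eth 0.
have [W [oW Wa HW]] := near_open (pos_near (smooth_diff (ss ch) (I : setT a)) h0).
exists s; split=> //; exists W; split=> //; last by move=> c p _; exact: Es.
by split=> // c; exact: smooth_sub (ss c).
Qed.

Definition rel_sect a phi s s' := \forall p \near a, forall xi : V,
  kundt (s' ^~ (phi p)) ('d phi p xi) = kundt (s ^~ p) xi.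

Lemma near_eq_d phi psi p (xi : V) : (\forall q \near p, phi q = psi q) -> differentiable phi p ->
  'd phi p xi = 'd psi p xi.
Proof.
move=> E dphi; have dj j := (diff_coord j xi dphi).1.
have Ej j : \forall q \near p, phi q 0 j = psi q 0 j by apply: filterS E => q ->.
have dj' j := near_eq_diff (Ej j) (dj j); have dpsi := diff_row dj'.
apply/rowP => j; have e1 := (diff_coord j xi dphi).2; have e2 := (diff_coord j xi dpsi).2.
apply: (etrans e1); apply: (etrans _ (esym e2)).
rewrite (diffsum _ (dj j)) (diffsum _ (dj' j)); apply: eq_bigr => i _; congr (_ * _).
exact: near_eq_pd.
Qed.

Lemma near2 a (P : V -> Prop) : (\forall p \near a, P p) -> \forall p \near a, \forall q \near p, P q.
Proof.
by move=> /near_open[U [oU Ua HU]]; apply: filterS (open_near oU Ua) => p Up; exact: filterS (open_near oU Up).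
Qed.

Lemma rel_pull U C A B a phi s s' : gauge U C A B -> U a -> (forall p, U p -> phi p = gmap C A B p) ->
  rel_sect a phi s s' <-> \forall p \near a, forall c, s c p = pull C A B s' c p.
Proof.
move=> G Ua pE; have [oU _ _ _ _] := G.
have K p xi : U p -> kundt (s' ^~ (phi p)) ('d phi p xi) = kundt (pull C A B s' ^~ p) xi.
  move=> Up; have Ep : \forall q \near p, gmap C A B q = phi q.
    by apply: filterS (open_near oU Up) => q Uq; rewrite pE.
  have dG : differentiable (gmap C A B) p.
    by apply: diff_row => j; exact: smooth_diff (gmap_smooth j G) Up.
  by rewrite -(near_eq_d xi Ep dG) (pE p Up) (kundt_pull s' xi G Up).
split=> H; apply: filterS (filterI H (open_near oU Ua)) => p [Hp Up].
  by apply: kundt_inj => xi; rewrite -Hp K.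
by move=> xi; rewrite K //; rewrite /kundt !Hp.
Qed.

Lemma pull_ex a phi s' : in_G a phi -> section_near (phi a) s' ->
  exists s, [/\ section_near a s, rel_sect a phi s s' & sol_near (phi a) s' -> sol_near a s].
Proof.
move=> /in_GP[U [C [A [B [G Ua pE]]]]] s'n.
have K W : section_on W s' -> W (phi a) -> exists U', [/\ open U', U' a, gauge U' C A B,
    forall p, U' p -> W (gmap C A B p) & section_on U' (pull C A B s')].
  move=> [oW ss' h0] Wa; rewrite (pE a Ua) in Wa.
  have [U1 [oU1 U1a H1]] := near_open (gmap_near G Ua (open_near oW Wa)).
  have oU : open (U `&` U1) by apply: openI => //; case: G.
  have G' : gauge (U `&` U1) C A B by apply: gauge_sub G => // p [].
  exists (U `&` U1); split=> //; first by move=> p [_ /H1].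
  split=> //; first by apply: (pull_smooth G' oW _ ss') => p [_ /H1].
  by move=> p [Up U1p]; apply: (pull_pos G Up); apply: h0; exact: H1.
exists (pull C A B s'); split.
- have /section_nearP[W sW Wa] := s'n; have [U' [oU' U'a G' _ sU']] := K W sW Wa.
  by apply/section_nearP; exists U'.
- by apply/(rel_pull _ _ G Ua pE); near=> p.
- move=> [W [sW EW Wa]]; have [U' [oU' U'a G' UW' sU']] := K W sW Wa.
  exists U'; split=> //; have [oW ss' _] := sW.
  exact: pull_Esol G' oW UW' ss' EW.
Unshelve. all: by end_near. Qed.

Lemma near_eq_jt a s s' : (\forall p \near a, forall c, s c p = s' c p) -> jt s a = jt s' a.
Proof.
move=> E; rewrite /jt; congr Jet; apply/funext => c; apply/funext => i; apply/funext => j; apply/funext => l.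
by apply: near_eq_pderiv; apply: filterS E => p.
Qed.

(** The k-jet of a pullback depends only on the k-jet of the section. This allows the sections that
    witness [prolong] to be exchanged for others. *)
Lemma rel_jets a phi s1 s2 s1' s2' k : in_G a phi -> section_near (phi a) s1' -> section_near (phi a) s2' ->
  rel_sect a phi s1 s1' -> rel_sect a phi s2 s2' -> eqj k (jt s1' (phi a)) (jt s2' (phi a)) ->
  eqj k (jt s1 a) (jt s2 a).
Proof.
move=> /in_GP[U [C [A [B [G Ua pE]]]]]; rewrite (pE a Ua).
move=> /section_nearP[W1 [oW1 ss1 _] W1a] /section_nearP[W2 [oW2 ss2 _] W2a].
move=> /(rel_pull _ _ G Ua pE)/near_eq_jt -> /(rel_pull _ _ G Ua pE)/near_eq_jt -> E.
exact: pull_eqj G Ua oW1 oW2 W1a W2a ss1 ss2 E.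
Qed.

(** Coordinates of order above [k] are arbitrary in a point of the equation of order [k]; with zeros
    there it becomes a point of the infinite prolongation and can be realised. *)
Definition truncj k th : jet R :=
  Jet (jbase th) (fun c i j l => if (i + j + l <= k)%N then th c i j l else 0).

Lemma truncj_eqEoo k th : Defs.eqE k th -> eqEoo (truncj k th).
Proof.
move=> [h1 h2 h3 h4] m; split=> //= i j l _; case: ifP => // H; by [apply: h2|apply: h3|apply: h4].
Qed.

Lemma eqj_eqE k th th' : eqj k th th' -> Defs.eqE k th -> Defs.eqE k th'.
Proof.
move=> [_ E] [h1 h2 h3 h4]; split=> [|i j l H|i j l H|i j l H]; rewrite -E //.
- exact: h2.
- exact: h3.
- exact: h4.
Qed.

Lemma realize_k k th : Defs.eqE k th -> exists2 s, sol_near (jbase th) s & eqj k th (jt s (jbase th)).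
Proof.
move=> /truncj_eqEoo/realize[s [sn js]]; exists s => //; split=> // c i j l ijl.
by have := js c i j l; rewrite /= ijl.
Qed.

(** The sections in [prolong] may fail to solve the equation. A solution with jet [th'] is pulled
    back instead, and [rel_jets] shows that the result still has jet [th]. *)
Lemma prolong_E k phi th th' : in_G (jbase th) phi -> prolong k phi th th' -> Defs.eqE k th' ->
  exists s s', [/\ sol_near (jbase th) s, sol_near (phi (jbase th)) s', eqj k th (jt s (jbase th)),
    eqj k th' (jt s' (phi (jbase th))) & rel_sect (jbase th) phi s s'].
Proof.
move=> Gphi [s [s' [sn sn' /is_jetE js /is_jetE js' rel]]] E'.
have b' : jbase th' = phi (jbase th) by case: js'.
have [s2' sol2' j2'] := realize_k E'; rewrite b' in sol2' j2'.
have [s2 [sn2 rel2 sol2]] := pull_ex Gphi (sol_section sol2').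
exists s2, s2'; split=> //; first exact: sol2.
apply: eqj_trans js _; apply: (rel_jets Gphi _ _ rel rel2) => //; first exact: sol_section.
exact: eqj_trans (eqj_sym js') j2'.
Qed.

Lemma prolong_jt a phi s s' : in_G a phi -> section_near a s -> section_near (phi a) s' ->
  rel_sect a phi s s' -> forall n, prolong n phi (jt s a) (jt s' (phi a)).
Proof. by move=> Gphi sn sn' rel n; exists s, s'; split=> //; apply/is_jetE. Qed.

Lemma prolong_eqj k phi th1 th1' th2 th2' : eqj k th1 th2 -> eqj k th1' th2' ->
  prolong k phi th1 th1' -> prolong k phi th2 th2'.
Proof.
move=> E E' [s [s' [sn sn' js js' rel]]].
have b : jbase th1 = jbase th2 by case: E.
exists s, s'; rewrite -b; split=> //.
  by apply/is_jetE/(eqj_trans (eqj_sym E))/is_jetE.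
by apply/is_jetE/(eqj_trans (eqj_sym E'))/is_jetE.
Qed.

Lemma prolong_comp k phi psi th th1 th2 : in_G (jbase th) phi -> in_G (phi (jbase th)) psi ->
  prolong k phi th th1 -> prolong k psi th1 th2 -> prolong k (psi \o phi) th th2.
Proof.
move=> Gphi Gpsi [s [s1 [sn sn1 /is_jetE js /is_jetE js1 rel]]] [s1' [s2 []]].
have b1 : jbase th1 = phi (jbase th) by case: js1.
rewrite b1 => sn1' sn2 /is_jetE js1' js2 rel2.
(* The two given relations share only a jet at the middle point, not a section. Pulling [s1'] back
   by [phi] produces a section composable with the second relation and with the same k-jet as
   [s]. *)
have [t [tn trel _]] := pull_ex Gphi sn1'.
have n0 : \forall q \near phi (jbase th), (forall xi : V,
    kundt (s2 ^~ (psi q)) ('d psi q xi) = kundt (s1' ^~ q) xi) /\ in_G q psi.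
  by apply: filterI => //; exact: in_G_near.
have n2 := in_G_cvg Gphi n0.
exists t, s2; split; [exact: tn|exact: sn2| |by apply/is_jetE|].
  apply/is_jetE/(eqj_trans js)/(rel_jets Gphi sn1 sn1' rel trel).
  exact: eqj_trans (eqj_sym js1) js1'.
apply: filterS (filterI n2 (filterI trel (in_G_near Gphi))) => p [[r2 Gp2] [r1 Gp1]] xi.
have [_ Hc] := @is_diff_comp _ _ _ _ phi _ psi _ p (differentiableP (in_G_diff Gp1)) (differentiableP (in_G_diff Gp2)).
have -> : 'd (psi \o phi) p xi = 'd psi (phi p) ('d phi p xi).
  by rewrite -[RHS]/(('d psi (phi p) \o 'd phi p) xi) -Hc.
by rewrite -r1 -r2.
Qed.

Lemma prolong_inv k phi psi th th' : in_G (jbase th) phi -> in_G (phi (jbase th)) psi ->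
  (\forall p \near jbase th, psi (phi p) = p) ->
  (\forall q \near phi (jbase th), phi (psi q) = q) -> prolong k phi th th' -> prolong k psi th' th.
Proof.
move=> Gphi Gpsi /nbhs_singleton pp np [s [s' [sn sn' js js' rel]]].
have b' : jbase th' = phi (jbase th) by case: js'.
exists s', s; rewrite b' pp; split=> //.
have n0 : \forall p \near psi (phi (jbase th)), in_G p phi /\ (forall xi : V,
    kundt (s' ^~ (phi p)) ('d phi p xi) = kundt (s ^~ p) xi).
  by rewrite pp; exact: (filterI (in_G_near Gphi) rel).
have n1 := in_G_cvg Gpsi n0.
apply: filterS (filterI n1 (filterI (in_G_near Gpsi) (near2 np))) => q [[Gp r1] [Gq nq]] xi.
have [dc Hc] := @is_diff_comp _ _ _ _ psi _ phi _ q (differentiableP (in_G_diff Gq)) (differentiableP (in_G_diff Gp)).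
rewrite -r1 (nbhs_singleton nq); congr (kundt _ _).
rewrite -[LHS]/(('d phi (psi q) \o 'd psi q) xi) -Hc (near_eq_d xi (psi := id)) //.
by rewrite diff_val.
Qed.

End Realization.

(** * Pullback on the level of jets *)

Section JetPull.
Context {R : realType}.
Local Notation V := 'rV[R]_3.
Local Notation sect := (Defs.comp -> V -> R).
Local Notation ex := (expr R).
Implicit Types (th : jet R).

Definition cnt (i : ax) (t : seq ax) := size [seq j <- t | ax_eqb i j].

Lemma cntE i t : count_mem (ax_ord i) (map ax_ord t) = cnt i t.
Proof. by elim: t => //= j t ->; rewrite /cnt /= -ax_eqbE; case: i j => -[]. Qed.

Section Values.
Variables (gj : nat -> nat -> nat -> nat -> R) (v ic : R).

(** The derivatives of the transformation enter as free numbers [gj], [v] and [ic], so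
    transformation laws become identities between rational functions, within reach of [field]. *)
Fixpoint evj th (e : ex) : R := match e with
| ex_0 => 0
| ex_cst r => r
| ex_v => v
| ex_inv => ic
| ex_gauge k t => gj k (cnt AU t) (cnt AX t) (cnt AV t)
| ex_sect c t => th c (cnt AU t) (cnt AX t) (cnt AV t)
| ex_add e f => evj th e + evj th f
| ex_mul e f => evj th e * evj th f
end.

Definition pj th : jet R := Jet (jbase th) (fun c i j l =>
  evj th (foldr (dex true) (pullx c) (nseq i AU ++ nseq j AX ++ nseq l AV))).

End Values.

Lemma pj_pull U W C A B s a c i j l : gauge U C A B -> U a -> open W ->
  (forall p, U p -> W (gmap C A B p)) -> sect_on W s -> Esol W s ->
  jt (pull C A B s) a c i j l =
  pj (fun k i j l => pderiv (nseq i iu ++ nseq j ix ++ nseq l iv) (gfun C A B k) a) (a 0 iv)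
     (pd iu (hat1 C) a)^-1 (jt s (gmap C A B a)) c i j l.
Proof.
move=> G Ua oW UW ss Es; have [oU _ _ _ _] := G.
rewrite /jt /pj [LHS]/= [RHS]/= -map_ax (evx_pderiv (sol := true) G oW UW ss (fun _ => Es)) //.
elim: (foldr _ _ _) => [|r| | |k t|c' t|e He f Hf|e He f Hf] //=.
- by rewrite -!cntE (pderiv_perm oU (smooth_gfun G k) Ua (perm_nseq3 _)).
- by rewrite -!cntE (pderiv_perm oW (ss c') (UW a Ua) (perm_nseq3 _)).
- by rewrite He Hf.
- by rewrite He Hf.
Qed.

End JetPull.

(** * Regular forms of the invariants and their transformation laws *)

Section RegularInvariants.
Context {R : realType}.
Implicit Types (th : jet R).

Section Defs.
Variable th : jet R.
Local Notation H := (th cH 0%N 0%N 0%N).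
Local Notation Hv := (th cH 0%N 0%N 1%N).
Local Notation Hx := (th cH 0%N 1%N 0%N).
Local Notation Hvv := (th cH 0%N 0%N 2%N).
Local Notation Hxv := (th cH 0%N 1%N 1%N).
Local Notation Hxx := (th cH 0%N 2%N 0%N).
Local Notation W := (th cW 0%N 0%N 0%N).
Local Notation Wu := (th cW 1%N 0%N 0%N).
Local Notation Wx := (th cW 0%N 1%N 0%N).
Local Notation Wv := (th cW 0%N 0%N 1%N).
Local Notation Wuv := (th cW 1%N 0%N 1%N).
Local Notation Wxv := (th cW 0%N 1%N 1%N).
Local Notation Wux := (th cW 1%N 1%N 0%N).
Local Notation h := (th ch 0%N 0%N 0%N).
Local Notation hu := (th ch 1%N 0%N 0%N).
Local Notation hx := (th ch 0%N 1%N 0%N).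
Local Notation huu := (th ch 2%N 0%N 0%N).

(* The products [K2a W] and [K2b W] are regular at [W = 0]: in terms of them the
   invariants are defined, and are invariant, where [K2a] and [K2b] are not. *)
Definition k2a : R := Hxv - Wuv.
Definition k2b : R := (Wv * hu - 2 * h * Wuv) / h.
Definition kq : R := 2 * I2a th * k2b + I2b th * k2a - I2a th * I2b th * W.
Definition Qr : R := kq / I1 th.
Definition Rr : R := I2b th * H * h -
  (I2b th * I2a th ^+ 2 * W ^+ 2 - 2 * k2a * (I2b th * W - 2 * k2b) * I2a th + I2b th * k2a ^+ 2)
  / (4 * I2a th ^+ 2).
Definition Nr : R :=
  (hu * (W * Wv + hu) - hx * (Hv * W - Hx + Wu) + h ^+ 2 * I2b th * H) * (I2a th * I2b th)
  - 2 * h * (Wv * Hx + (hu - Wx) * Hv + Hxx - Wux + huu) * (I2a th * I2b th)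
  - h * (k2b * (I2b th * W - k2b) * I2a th - 2 * I2b th * k2a ^+ 2).
Definition I2cr : R := Nr * I1 th / (h * Qr ^+ 2).
Definition nabla1r : 'rV[R]_3 := row3 0 0 (I1 th / (I2a th * I2b th) * (Qr / Wv)).
Definition nabla2r : 'rV[R]_3 := row3 0 (1 / Wv) (1 / Wv * - (k2a / I2a th)).
Definition nabla3r : 'rV[R]_3 := let m := 2 * I2a th / I1 th * (1 / (Qr * Wv)) in
  row3 (m * - (I2b th * h)) (m * k2b) (m * Rr).

(** [I2bn] and [kqn] are the numerators of [I2b] and [kq] over [h ^+ 2]. Up to powers and constants,
    [denr] collects everything by which the regular formulas divide. *)
Definition I2bn : R := Wv * hx - 2 * h * Wxv.
Definition kqn : R := 2 * Hvv * (Wv * hu - 2 * h * Wuv) * h + I2bn * (Hxv - Wuv) - Hvv * I2bn * W.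
Definition denr : R := Wv * h * Hvv * I2bn * kqn.

Lemma denr_neq0 : denr != 0 -> [/\ Wv != 0, h != 0, I2a th != 0, I2b th != 0 & kq != 0].
Proof.
rewrite /denr; move=> d0; move: (d0); rewrite mulf_eq0 negb_or => /andP[d1 k0].
move: d1; rewrite mulf_eq0 negb_or => /andP[d1 b0].
move: d1; rewrite mulf_eq0 negb_or => /andP[d1 a0].
move: d1; rewrite mulf_eq0 negb_or => /andP[w0 h0].
have eb : I2b th = I2bn / h ^+ 2 by [].
have ek : kq = kqn / h ^+ 2 by rewrite /kq eb /k2b /kqn /k2a /I2a; field.
have h2 : (h ^+ 2)^-1 != 0 by rewrite invr_eq0 expf_eq0.
by split=> //; rewrite ?ek ?eb mulf_neq0.
Qed.

Lemma Qr_neq0 : denr != 0 -> Qr != 0.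
Proof.
move=> /denr_neq0[w0 h0 _ _ k0]; rewrite /Qr /I1 mulf_neq0 // invr_eq0 mulf_neq0 ?invr_eq0 //.
by rewrite expf_eq0 /=.
Qed.

Hypotheses (W0 : W != 0) (d0 : denr != 0).

Lemma K2a_reg : K2a th = k2a / W. Proof. by []. Qed.

Lemma K2b_reg : K2b th = k2b / W.
Proof. by have [_ h0 _ _ _] := denr_neq0 d0; rewrite /K2b /k2b; field; rewrite h0 W0. Qed.

Lemma Qf_reg : Qf th = Qr.
Proof.
have [w0 h0 _ _ _] := denr_neq0 d0; rewrite /Qf /Qr K2a_reg K2b_reg; congr (_ / _).
by rewrite /kq; field.
Qed.

Lemma Rf_reg : Rf th = Rr.
Proof.
have [w0 h0 a0 _ _] := denr_neq0 d0; rewrite /Rf /Rr K2a_reg K2b_reg /I1.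
move: (I2b th) (I2a th) a0 k2a k2b => b a a0 ka kb.
by field; rewrite h0 W0 w0 a0.
Qed.

Lemma I2c_reg : I2c th = I2cr.
Proof.
have [w0 h0 a0 b0 _] := denr_neq0 d0; have q0 := Qr_neq0 d0.
rewrite /I2c /I2cr Qf_reg K2a_reg K2b_reg /Nr /I1.
move: (I2b th) b0 (I2a th) a0 k2a k2b Qr q0 => b b0 a a0 ka kb q q0.
by field; rewrite h0 W0 w0 q0.
Qed.

Lemma nabla1_reg : nabla1 th = nabla1r.
Proof. by rewrite /nabla1 /nabla1r Qf_reg. Qed.

Lemma nabla2_reg : nabla2 th = nabla2r.
Proof.
rewrite /nabla2 /nabla2r K2a_reg; have [w0 h0 a0 _ _] := denr_neq0 d0.
apply/rowP => i; rewrite !mxE; case: (ax_cases i) => -> /=; rewrite ?mulr0 ?mulr1 //.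
by congr (_ * _); field; rewrite W0 a0.
Qed.

Lemma nabla3_reg : nabla3 th = nabla3r.
Proof.
rewrite /nabla3 /nabla3r K2b_reg Rf_reg Qf_reg.
by apply/rowP => i; rewrite !mxE; case: (ax_cases i) => -> //=; rewrite divfK.
Qed.

End Defs.

Section Transformation.
Variables (gj : nat -> nat -> nat -> nat -> R) (v : R) (th : jet R).
Local Notation c := (gj 0%N 1%N 0%N 0%N).
Local Notation ax := (gj 1%N 0%N 1%N 0%N).
Local Notation au := (gj 1%N 1%N 0%N 0%N).
Local Notation bx := (gj 2%N 0%N 1%N 0%N).
Hypotheses (c0 : c != 0) (ax0 : ax != 0).
Local Notation th' := (pj gj v c^-1 th).
Local Notation h := (th ch 0%N 0%N 0%N).
Local Notation Wv := (th cW 0%N 0%N 1%N).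
Hypothesis h0 : h != 0.

Definition dgauge (xi : 'rV[R]_3) : 'rV[R]_3 :=
  row3 (c * xi 0 iu) (au * xi 0 iu + ax * xi 0 ix)
    ((v * (-1 * (c^-1 * c^-1 * gj 0 2 0 0)) + gj 2 1 0 0) * xi 0 iu + bx * xi 0 ix + c^-1 * xi 0 iv).

Lemma tr_h : th' ch 0%N 0%N 0%N = h * (ax * ax). Proof. by []. Qed.

Lemma tr_W : th' cW 0%N 0%N 0%N = c * (bx + th cW 0%N 0%N 0%N * ax) + 2 * (h * (au * ax)).
Proof. by []. Qed.

Lemma tr_Wv : th' cW 0%N 0%N 1%N = Wv * ax.
Proof. by cbn; field. Qed.

Lemma tr_I1 : I1 th' = I1 th.
Proof. by rewrite /I1 tr_Wv tr_h; field; rewrite h0 ax0. Qed.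

Lemma tr_I2a : I2a th' = I2a th.
Proof. by rewrite /I2a; cbn; field. Qed.

Lemma tr_I2b : I2b th' = I2b th.
Proof. by rewrite /I2b tr_Wv tr_h; cbn; field; rewrite h0 ax0 c0. Qed.

Lemma tr_k2a : k2a th' = c * (ax * k2a th + I2a th * bx).
Proof. by rewrite /k2a /I2a; cbn; field. Qed.

Lemma tr_k2b : k2b th' = ax * (c * k2b th + au * h * I2b th).
Proof. by rewrite /k2b /I2b tr_Wv tr_h; cbn; field; rewrite h0 ax0 c0. Qed.

(** The shifts of [k2a] by [bx], of [k2b] by [au] and of [W] by both cancel in this combination. *)
Lemma tr_kq : kq th' = c * ax * kq th.
Proof. by rewrite /kq tr_k2a tr_k2b tr_I2a tr_I2b tr_W; ring. Qed.

Lemma tr_Qr : Qr th' = c * ax * Qr th.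
Proof. by rewrite /Qr tr_kq tr_I1 mulrA. Qed.

(** The factor is that of [h * Qr ^+ 2], and this is what makes [I2cr] invariant. *)
Lemma tr_Nr : Wv != 0 -> Nr th' = c ^+ 2 * ax ^+ 4 * Nr th.
Proof.
move=> w0; rewrite /Nr tr_k2a tr_k2b tr_I2a tr_I2b tr_W tr_Wv tr_h; cbn.
(* Trading [Wxv], [Wuv] and [Hxv] for [I2b], [k2b] and [k2a], whose transformation laws have already
   been inserted, leaves an identity in independent variables. *)
have e1 : th cW 0%N 1%N 1%N = (Wv * th ch 0%N 1%N 0%N - I2b th * h ^+ 2) / (2 * h).
  by rewrite /I2b; field.
have e2 : th cW 1%N 0%N 1%N = (Wv * th ch 1%N 0%N 0%N - h * k2b th) / (2 * h).
  by rewrite /k2b; field.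
have e3 : th cH 0%N 1%N 1%N = k2a th + th cW 1%N 0%N 1%N by rewrite /k2a subrK.
have e4 : th cH 0%N 0%N 2%N = I2a th by [].
rewrite e3 e4 e1 e2; move: (k2a th) (k2b th) (I2b th) (I2a th) => ka kb b a.
by field; rewrite h0 c0.
Qed.

Hypothesis d0 : denr th != 0.

Lemma tr_I2cr : I2cr th' = I2cr th.
Proof.
have [w0 _ a0 b0 k0] := denr_neq0 d0; have q0 := Qr_neq0 d0.
rewrite /I2cr tr_Nr // tr_I1 tr_Qr tr_h; move: (Nr th) (I1 th) (Qr th) q0 => N I q q0.
by field; rewrite q0 h0 ax0 c0.
Qed.

Lemma tr_nabla1 : nabla1r th = dgauge (nabla1r th').
Proof.
have [w0 _ a0 b0 k0] := denr_neq0 d0.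
rewrite /nabla1r /dgauge tr_I1 tr_I2a tr_I2b tr_Qr tr_Wv !row3E !mulr0 !add0r; congr row3.
move: (I1 th) (I2a th) a0 (I2b th) b0 (Qr th) => I a a0 b b0 q.
by field; rewrite w0 ax0 c0 a0 b0.
Qed.

Lemma tr_nabla2 : nabla2r th = dgauge (nabla2r th').
Proof.
have [w0 _ a0 b0 k0] := denr_neq0 d0.
rewrite /nabla2r /dgauge tr_k2a tr_I2a tr_Wv !row3E !mulr0 !add0r.
move: (I2a th) a0 (k2a th) => a a0 ka; congr row3; field; rewrite ?w0 ?ax0 ?a0 ?c0 //.
Qed.

Lemma tr_nabla3 : nabla3r th = dgauge (nabla3r th').
Proof.
have [w0 _ a0 b0 k0] := denr_neq0 d0; have q0 := Qr_neq0 d0.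
have i0 : I1 th != 0 by rewrite /I1 mulf_neq0 ?invr_eq0 // expf_eq0.
rewrite /nabla3r /dgauge /Rr tr_k2a tr_k2b tr_I2a tr_I2b tr_W tr_Wv tr_h tr_I1 tr_Qr !row3E; cbn.
move: (I2a th) a0 (k2a th) (k2b th) (I2b th) b0 (Qr th) q0 (I1 th) i0 => a a0 ka kb b b0 q q0 I i0.
by congr row3; field; rewrite ?w0 ?ax0 ?a0 ?c0 ?q0 ?i0.
Qed.

End Transformation.
End RegularInvariants.

(** * Polynomial and rational functions on the equation *)

Section JetFunctions.
Context {R : realType}.
Local Notation V := 'rV[R]_3.
Local Notation sect := (Defs.comp -> V -> R).
Implicit Types (th : jet R) (P F : jet R -> R) (s : sect) (U : set V) (phi : V -> V).

Lemma subalg_ext (G : (jet R -> R) -> Prop) F F' : (forall th, F th = F' th) -> subalg G F -> subalg G F'.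
Proof. by move=> E; have -> : F = F' by apply/funext. Qed.

Lemma subalg_opp (G : (jet R -> R) -> Prop) F : subalg G F -> subalg G (fun th => - F th).
Proof.
move=> HF; apply: subalg_ext (subalg_mul (subalg_cst _ (-1)) HF) => th; exact: mulN1r.
Qed.

Lemma subalg_exp (G : (jet R -> R) -> Prop) F n : subalg G F -> subalg G (fun th => F th ^+ n).
Proof.
move=> HF; elim: n => [|n IH]; first exact: subalg_cst.
by apply: subalg_ext (subalg_mul HF IH) => th; rewrite exprS.
Qed.

Lemma jetpoly_coord k c i j l : (i + j + l <= k)%N -> jetpoly k (fun th : jet R => th c i j l).
Proof. by move=> h; apply: subalg_gen; right; exists c, i, j, l. Qed.

Lemma delta_coord i j : (delta_mx 0 i : V) 0 j = (i == j)%:R.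
Proof. by rewrite mxE eqxx eq_sym. Qed.

(** One polynomial [T] serves both readings of the total derivative: the derivative along the line
    [hline], by which [total_deriv] is defined, and the derivative along the jets of a section, with
    which the proofs compute. *)
Lemma jetpoly_total i k P : jetpoly k P -> exists T, [/\ jetpoly k.+1 T,
  forall th, is_derive (0 : R) (1 : R) (fun t : R => P (hline th (delta_mx 0 i) t)) (T th) &
  forall U s, open U -> sect_on U s -> smooth_on U (fun q => P (jt s q)) /\
    forall p, U p -> pd i (fun q => P (jt s q)) p = T (jt s p)].
Proof.
elim=> {P} [f [[a ->]|[c [j [l [m [jlm ->]]]]]]|c|f g _ [Tf [hf df sf]] _ [Tg [hg dg sg]]|f g Hf [Tf [hf df sf]] Hg [Tg [hg dg sg]]].
- exists (fun=> (i == a)%:R); split; first exact: subalg_cst.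
    move=> th; have -> : (fun t : R => jbase (hline th (delta_mx 0 i) t) 0 a) =
        (fun t => jbase th 0 a + t * (i == a)%:R).
      by apply/funext => t; rewrite /= coordD mxE delta_coord.
    have H : is_derive (0 : R) (1 : R) (cst (jbase th 0 a) + (i == a)%:R *: id) (0 + (i == a)%:R *: (1 : R)).
      exact: is_deriveD.
    have -> : (fun t => jbase th 0 a + t * (i == a)%:R) = cst (jbase th 0 a) + (i == a)%:R *: id.
      by apply/funext => t; rewrite mulrC.
    by apply: (is_derive_eq H); rewrite add0r [LHS]mulr1.
  by move=> U s oU ss; split=> [|p Up]; [exact: smooth_coord|rewrite /= pd_coord].
- exists (fun th => (i == iu)%:R * th c j.+1 l m + (i == ix)%:R * th c j l.+1 m + (i == iv)%:R * th c j l m.+1).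
  split.
  + do ?[apply: subalg_add]; (apply: subalg_mul; first exact: subalg_cst);
      apply: jetpoly_coord; rewrite ?addSn ?addnS ?addSn //.
  + move=> th /=; set D := (D in is_derive _ _ _ D).
    rewrite !delta_coord -/D.
    have H : is_derive (0 : R) (1 : R) (cst (th c j l m) + D *: id) (0 + D *: (1 : R)) by exact: is_deriveD.
    have -> : (fun t => th c j l m + t * D) = cst (th c j l m) + D *: id.
      by apply/funext => t; rewrite mulrC.
    by apply: (is_derive_eq H); rewrite add0r [LHS]mulr1.
  + move=> U s oU ss; split=> [|p Up]; first exact: smooth_pderiv.
    rewrite [LHS](pderiv_jt c (i :: nseq j iu ++ nseq l ix ++ nseq m iv) oU ss Up) /= !count_cat !count_nseq.
    by case: (ax_cases i) => ->; rewrite /= !mul0n !mul1n ?addn0 ?add0n ?add1n ?mul1r ?mul0r ?addr0 ?add0r.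
- exists (fun=> 0); split; [exact: subalg_cst|by move=> th; exact: is_derive_cst|].
  by move=> U s oU ss; split=> [|p Up]; [exact: smooth_cst|exact: pd_cst].
- exists (fun th => Tf th + Tg th); split; first exact: subalg_add.
    by move=> th; exact: (is_deriveD (df th) (dg th)).
  move=> U s oU ss; have [s1 e1] := sf U s oU ss; have [s2 e2] := sg U s oU ss.
  split=> [|p Up]; first exact: smooth_add.
  by rewrite pdD ?e1 ?e2 //; [exact: smooth_diff s1 Up|exact: smooth_diff s2 Up].
- exists (fun th => f th * Tg th + g th * Tf th); split.
    by apply: subalg_add; apply: subalg_mul => //; apply: jetpoly_le (leqnSn k) _.
    move=> th; have := is_deriveM (df th) (dg th).
    have h0 : hline th (delta_mx 0 i) 0 = th.
      case: (th) => p x; rewrite /hline /= scale0r addr0; congr Jet.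
      by apply/funext => c; apply/funext => j; apply/funext => l; apply/funext => m; rewrite mul0r addr0.
    by rewrite h0.
  move=> U s oU ss; have [s1 e1] := sf U s oU ss; have [s2 e2] := sg U s oU ss.
  split=> [|p Up]; first exact: smooth_mul.
  by rewrite pdM ?e1 ?e2 //; [exact: smooth_diff s1 Up|exact: smooth_diff s2 Up].
Qed.

Lemma hline0 th (xi : V) : hline th xi 0 = th.
Proof.
case: th => p x; rewrite /hline /= scale0r addr0; congr Jet.
by apply/funext => c; apply/funext => j; apply/funext => l; apply/funext => m; rewrite mul0r addr0.
Qed.

Lemma jetpoly_I2bn k : (2 <= k)%N -> jetpoly k (@I2bn R).
Proof.
by move=> k2; do ?[apply: subalg_add|apply: subalg_opp|apply: subalg_mul|exact: subalg_cst];
  apply: jetpoly_coord; apply: leq_trans k2.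
Qed.

Lemma jetpoly_kqn k : (2 <= k)%N -> jetpoly k (@kqn R).
Proof.
by move=> k2; do ?[apply: subalg_add|apply: subalg_opp|apply: subalg_mul|exact: subalg_cst|exact: jetpoly_I2bn];
  apply: jetpoly_coord; apply: leq_trans k2.
Qed.

Lemma jetpoly_denr k : (2 <= k)%N -> jetpoly k (@denr R).
Proof.
move=> k2; do ?[apply: subalg_mul|exact: jetpoly_I2bn|exact: jetpoly_kqn];
  by apply: jetpoly_coord; apply: leq_trans k2.
Qed.

(** With powers of the single polynomial [denr] as only denominators, the class is closed under
    total derivatives by the quotient rule, the order growing by one and the domain staying the
    same. *)
Definition Rat k F := exists n P, jetpoly k P /\
  forall th, Defs.eqE k th -> denr th != 0 -> F th * denr th ^+ n = P th.

Lemma eqE_le k k' th : (k <= k')%N -> Defs.eqE k' th -> Defs.eqE k th.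
Proof.
move=> kk [h1 h2 h3 h4]; split=> // i j l H; [apply: h2|apply: h3|apply: h4]; exact: leq_trans kk.
Qed.

Lemma Rat_le k k' F : (k <= k')%N -> Rat k F -> Rat k' F.
Proof.
move=> kk [n [P [HP E]]]; exists n, P; split; first exact: jetpoly_le HP.
by move=> th /(eqE_le kk); exact: E.
Qed.

Lemma Rat_ext k F F' : (forall th, Defs.eqE k th -> denr th != 0 -> F th = F' th) -> Rat k F -> Rat k F'.
Proof.
move=> FF [n [P [HP E]]]; exists n, P; split=> // th Eth d0; rewrite -FF //; exact: E.
Qed.

Lemma Rat_poly k P : jetpoly k P -> Rat k P.
Proof. by move=> HP; exists 0%N, P; split=> // th _ _; rewrite expr0 mulr1. Qed.

Lemma Rat_cst k (c : R) : Rat k (fun=> c).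
Proof. by apply: Rat_poly; exact: subalg_cst. Qed.

Section RatOps.
Variable k : nat.
Hypothesis k2 : (2 <= k)%N.

Lemma Rat_add F F' : Rat k F -> Rat k F' -> Rat k (fun th => F th + F' th).
Proof.
move=> [n [P [HP E]]] [n' [P' [HP' E']]].
exists (n + n')%N, (fun th => P th * denr th ^+ n' + P' th * denr th ^+ n); split.
  by apply: subalg_add; apply: subalg_mul => //; apply: subalg_exp; exact: jetpoly_denr.
by move=> th Eth d0; rewrite -E // -E' // exprD; ring.
Qed.

Lemma Rat_mul F F' : Rat k F -> Rat k F' -> Rat k (fun th => F th * F' th).
Proof.
move=> [n [P [HP E]]] [n' [P' [HP' E']]].
exists (n + n')%N, (fun th => P th * P' th); split; first exact: subalg_mul.
by move=> th Eth d0; rewrite -E // -E' // exprD; ring.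
Qed.

Lemma Rat_opp F : Rat k F -> Rat k (fun th => - F th).
Proof.
by move=> HF; apply: Rat_ext (Rat_mul (Rat_cst k (-1)) HF) => th _ _; rewrite mulN1r.
Qed.

Lemma Rat_exp F n : Rat k F -> Rat k (fun th => F th ^+ n).
Proof.
move=> HF; elim: n => [|n IH]; first exact: Rat_cst.
by apply: Rat_ext (Rat_mul HF IH) => th _ _; rewrite exprS.
Qed.

Lemma Rat_sum n (F : 'I_n -> jet R -> R) : (forall i, Rat k (F i)) -> Rat k (fun th => \sum_i F i th).
Proof.
elim: n F => [|n IH] F HF; first by apply: Rat_ext (Rat_cst k 0) => th _ _; rewrite big_ord0.
apply: Rat_ext (Rat_add (HF ord0) (IH (fun i => F (lift ord0 i)) _)) => // th _ _.
by rewrite big_ord_recl.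
Qed.

Lemma Rat_factor F G : jetpoly k G -> (forall th, F th * G th = denr th) -> Rat k (fun th => (F th)^-1).
Proof.
move=> HG E; exists 1%N, G; split=> // th _ d0; rewrite expr1 -E mulKf //.
by apply: contraNneq d0 => F0; rewrite -E F0 mul0r.
Qed.

Local Notation jp := (ltac:(do ?[apply: subalg_add|apply: subalg_opp|apply: subalg_mul|exact: subalg_cst|exact: jetpoly_I2bn|exact: jetpoly_kqn];
  by apply: jetpoly_coord; apply: leq_trans k2)).

Lemma Rat_c c i j l : (i + j + l <= 2)%N -> Rat k (fun th => th c i j l).
Proof. by move=> h; apply: Rat_poly; apply: jetpoly_coord; exact: leq_trans k2. Qed.

Lemma Rat_Wv_inv : Rat k (fun th => (th cW 0%N 0%N 1%N)^-1).
Proof.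
apply: (@Rat_factor _ (fun th => th ch 0%N 0%N 0%N * th cH 0%N 0%N 2%N * I2bn th * kqn th)); first exact: jp.
by move=> th; rewrite /denr !mulrA.
Qed.

Lemma Rat_h_inv : Rat k (fun th => (th ch 0%N 0%N 0%N)^-1).
Proof.
apply: (@Rat_factor _ (fun th => th cW 0%N 0%N 1%N * th cH 0%N 0%N 2%N * I2bn th * kqn th)); first exact: jp.
by move=> th; rewrite /denr; ring.
Qed.

Lemma Rat_I2a_inv : Rat k (fun th => (I2a th)^-1).
Proof.
apply: (@Rat_factor _ (fun th => th cW 0%N 0%N 1%N * th ch 0%N 0%N 0%N * I2bn th * kqn th)); first exact: jp.
by move=> th; rewrite /denr /I2a; ring.
Qed.

Lemma Rat_I2bn_inv : Rat k (fun th => (I2bn th)^-1).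
Proof.
apply: (@Rat_factor _ (fun th => th cW 0%N 0%N 1%N * th ch 0%N 0%N 0%N * th cH 0%N 0%N 2%N * kqn th)); first exact: jp.
by move=> th; rewrite /denr; ring.
Qed.

Lemma Rat_kqn_inv : Rat k (fun th => (kqn th)^-1).
Proof.
apply: (@Rat_factor _ (fun th => th cW 0%N 0%N 1%N * th ch 0%N 0%N 0%N * th cH 0%N 0%N 2%N * I2bn th)); first exact: jp.
by move=> th; rewrite /denr; ring.
Qed.

Lemma kqE th : denr th != 0 -> kq th = kqn th / th ch 0%N 0%N 0%N ^+ 2.
Proof.
by move=> /denr_neq0[_ h0 _ _ _]; rewrite /kq /k2b /kqn /k2a /I2a /I2b -/(I2bn th); field.
Qed.

Lemma Rat_I1 : Rat k (@I1 R).
Proof. by apply: Rat_mul; [apply: Rat_exp; exact: Rat_c|exact: Rat_h_inv]. Qed.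

Lemma Rat_I1_inv : Rat k (fun th => (I1 th)^-1).
Proof.
apply: Rat_ext (Rat_mul (@Rat_c ch 0 0 0 isT) (Rat_exp 2 Rat_Wv_inv)) => // th _ /denr_neq0[w0 h0 _ _ _].
by rewrite /I1; field; rewrite h0 w0.
Qed.

Lemma Rat_I2a : Rat k (@I2a R).
Proof. exact: Rat_c. Qed.

Lemma Rat_I2b : Rat k (@I2b R).
Proof.
apply: Rat_ext (Rat_mul (Rat_poly (jetpoly_I2bn k2)) (Rat_exp 2 Rat_h_inv)) => th _ _.
by rewrite /I2b -/(I2bn th) exprVn.
Qed.

Lemma Rat_I2b_inv : Rat k (fun th => (I2b th)^-1).
Proof.
apply: Rat_ext (Rat_mul Rat_I2bn_inv (Rat_exp 2 (@Rat_c ch 0 0 0 isT))) => // th _ _.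
by rewrite /I2b -/(I2bn th) invfM invrK.
Qed.

Lemma Rat_k2a : Rat k (@k2a R).
Proof. by apply: Rat_add; [|apply: Rat_opp]; exact: Rat_c. Qed.

Lemma Rat_k2b : Rat k (@k2b R).
Proof.
apply: Rat_mul; last exact: Rat_h_inv.
by apply: Rat_add; [apply: Rat_mul|apply: Rat_opp; apply: Rat_mul; first apply: Rat_mul];
  do ?[exact: Rat_c|exact: Rat_cst].
Qed.

Lemma Rat_kq : Rat k (@kq R).
Proof.
by do ?[exact: Rat_cst|exact: Rat_k2a|exact: Rat_k2b|exact: Rat_I2a|exact: Rat_I2b|exact: Rat_c|apply: Rat_add|apply: Rat_opp|apply: Rat_mul].
Qed.

Lemma Rat_Qr : Rat k (@Qr R).
Proof. by apply: Rat_mul; [exact: Rat_kq|exact: Rat_I1_inv]. Qed.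

Lemma Rat_Qr_inv : Rat k (fun th => (Qr th)^-1).
Proof.
apply: Rat_ext (Rat_mul (Rat_mul Rat_kqn_inv (Rat_exp 2 (@Rat_c ch 0 0 0 isT))) Rat_I1) => // th _ d0.
by rewrite /Qr (kqE d0) !invfM !invrK.
Qed.

Ltac rat := do ?[exact: Rat_cst|exact: Rat_k2a
  |exact: Rat_k2b|exact: Rat_I2a|exact: Rat_I2b|exact: Rat_I1|exact: Rat_Qr|exact: Rat_c|exact: Rat_Wv_inv|exact: Rat_h_inv
  |exact: Rat_I2a_inv|exact: Rat_I2b_inv|exact: Rat_I1_inv|exact: Rat_Qr_inv
  |apply: Rat_add|apply: Rat_opp|apply: Rat_mul|apply: Rat_exp].

Lemma Rat_Rr : Rat k (@Rr R).
Proof.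
have H : Rat k (fun th => I2b th * th cH 0%N 0%N 0%N * th ch 0%N 0%N 0%N -
  (I2b th * I2a th ^+ 2 * th cW 0%N 0%N 0%N ^+ 2 - 2 * k2a th * (I2b th * th cW 0%N 0%N 0%N - 2 * k2b th) * I2a th
    + I2b th * k2a th ^+ 2) * (4^-1 * (I2a th)^-1 ^+ 2)) by rat.
by apply: Rat_ext H => th _ _; rewrite /Rr invfM exprVn.
Qed.

Lemma Rat_I2cr : Rat k (@I2cr R).
Proof.
have H : Rat k (@Nr R) by rewrite /Nr; rat.
apply: Rat_ext (Rat_mul (Rat_mul H Rat_I1) (Rat_mul Rat_h_inv (Rat_exp 2 Rat_Qr_inv))) => th _ _.
by rewrite exprVn -invfM.
Qed.

Lemma Rat_nabla1r i : Rat k (fun th => nabla1r th 0 i).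
Proof.
case: (ax_cases i) => ->.
- by apply: Rat_ext (Rat_cst k 0) => th _ _; rewrite row3E.
- by apply: Rat_ext (Rat_cst k 0) => th _ _; rewrite row3E.
have H : Rat k (fun th => I1 th * ((I2a th)^-1 * (I2b th)^-1) * (Qr th * (th cW 0%N 0%N 1%N)^-1)) by rat.
by apply: Rat_ext H => th _ _; rewrite row3E -invfM.
Qed.

Lemma Rat_nabla2r i : Rat k (fun th => nabla2r th 0 i).
Proof.
case: (ax_cases i) => ->.
- by apply: Rat_ext (Rat_cst k 0) => th _ _; rewrite row3E.
- by apply: Rat_ext Rat_Wv_inv => th _ _; rewrite row3E div1r.
have H : Rat k (fun th => (th cW 0%N 0%N 1%N)^-1 * - (k2a th * (I2a th)^-1)) by rat.
by apply: Rat_ext H => th _ _; rewrite row3E div1r.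
Qed.

Lemma Rat_nabla3r i : Rat k (fun th => nabla3r th 0 i).
Proof.
have M : Rat k (fun th => 2 * I2a th * (I1 th)^-1 * ((Qr th)^-1 * (th cW 0%N 0%N 1%N)^-1)) by rat.
case: (ax_cases i) => ->.
- have H : Rat k (fun th => - (I2b th * th ch 0%N 0%N 0%N)) by rat.
  by apply: Rat_ext (Rat_mul M H) => th _ _; rewrite row3E div1r -invfM.
- by apply: Rat_ext (Rat_mul M Rat_k2b) => th _ _; rewrite row3E div1r -invfM.
- by apply: Rat_ext (Rat_mul M Rat_Rr) => th _ _; rewrite row3E div1r -invfM.
Qed.

Lemma Rat_eqj F th th' : Rat k F -> eqj k th th' -> Defs.eqE k th -> denr th != 0 -> F th = F th'.
Proof.
move=> [n [P [HP E]]] e Eth d0.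
have e' : denr th = denr th' by exact: jetpoly_eqj (jetpoly_denr k2) e.
apply: (mulIf (expf_neq0 n d0)); rewrite E // [in RHS]e' E -?e' //; last exact: eqj_eqE Eth.
exact: jetpoly_eqj HP e.
Qed.

End RatOps.
End JetFunctions.

(** * Total derivatives of rational functions and invariance *)

Section RationalDerivatives.
Context {R : realType}.
Local Notation V := 'rV[R]_3.
Local Notation sect := (Defs.comp -> V -> R).
Implicit Types (th : jet R) (P F : jet R -> R) (s : sect) (U : set V) (phi : V -> V) (a : V).

Lemma is_derive_quot (X : normedModType R) (f g : X -> R) (x v : X) (f' g' : R) n :
  is_derive x v f f' -> is_derive x v g g' -> g x != 0 ->
  is_derive x v (fun t => f t / g t ^+ n) ((f' * g x - n%:R * f x * g') / g x ^+ n.+1).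
Proof.
move=> df dg g0; elim: n => [|n IH].
  have -> : (fun t => f t / g t ^+ 0) = f by apply/funext => t; rewrite expr0 divr1.
  by apply: (is_derive_eq df); rewrite expr1 mul0r mul0r subr0 mulfK.
have dV : is_derive x v (fun t => (g t)^-1) (- (g x) ^- 2 * g').
  have dgx : derivable g x v by case: dg.
  by split; [exact: derivableV|rewrite (deriveV g0 dgx) derive_val].
have H := is_deriveM IH dV.
have -> : (fun t => f t / g t ^+ n.+1) = (fun t => f t / g t ^+ n) * (fun t => (g t)^-1).
  by apply/funext => t; rewrite fctE exprS invfM mulrA mulrAC.
apply: (is_derive_eq H); rewrite /= -![_ *: _]/(_ * _).
rewrite -natr1; move: (n%:R : R) => m; have gn : g x ^+ n != 0 by exact: expf_neq0.
have K (z z' y y' G : R) : y != 0 -> G != 0 -> z / G * (- (y * y)^-1 * y') + y^-1 * ((z' * y - m * z * y') / (y * G)) =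
    (z' * y - (m + 1) * z * y') / (y * (y * G)) by move=> *; field; apply/andP.
by rewrite exprS [g x ^+ n.+2]exprS [g x ^+ n.+1]exprS; exact: K.
Qed.


Lemma derive_near_neq0 (f : R -> R) (d : R) : is_derive (0 : R) (1 : R) f d -> f 0 != 0 ->
  \forall t \near (0 : R), f t != 0.
Proof.
move=> [df _] f0; have /differentiable_continuous : differentiable f 0 by apply/derivable1_diffP.
move=> /cvgrPdist_lt /(_ `|f 0|); rewrite normr_gt0 => /(_ f0); apply: filterS => t /= H.
by apply: contraTneq H => ->; rewrite subr0 ltxx.
Qed.

Lemma derive_near_gt0 (f : R -> R) (d : R) : is_derive (0 : R) (1 : R) f d -> 0 < f 0 ->
  \forall t \near (0 : R), 0 < f t.
Proof.
move=> [df _] f0; have /differentiable_continuous : differentiable f 0 by apply/derivable1_diffP.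
move=> /cvgrPdist_lt /(_ _ f0); apply: filterS => t /= H.
by move: H; rewrite ltr_norml => /andP[_]; rewrite ltrBlDr ltrDl.
Qed.

(** The equations are linear and the velocity of [hline] consists of coordinates of one order more,
    so they persist for all [t]; only [h > 0] restricts to small [t]. A rational function known
    merely on the equation can thus be differentiated along the line. *)
Lemma hline_eqE k th i : Defs.eqE k.+1 th ->
  \forall t \near (0 : R), Defs.eqE k (hline th (delta_mx 0 i) t).
Proof.
move=> [h1 h2 h3 h4].
have [T [_ dT _]] := jetpoly_total i (@jetpoly_coord R 0 ch 0 0 0 isT).
have := derive_near_gt0 (dT th); rewrite hline0 => /(_ h1); apply: filterS => t ht.
split=> // a b l H /=.
- have Z (a' b' l' : nat) : (a' + b' + l' <= (a + b + l).+1)%N -> th ch a' b' l'.+1 = 0.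
    by move=> Z; apply: h2; rewrite addnS in H *; lia.
  by rewrite !Z ?mulr0 ?addr0 ?mulr0 ?addr0 //; lia.
- have Z (a' b' l' : nat) : (a' + b' + l' <= (a + b + l).+1)%N -> th cW a' b' l'.+2 = 0.
    by move=> Z; apply: h3; rewrite !addnS in H *; lia.
  by rewrite !Z ?mulr0 ?addr0 ?mulr0 ?addr0 //; lia.
- have Z (a' b' l' : nat) : (a' + b' + l' <= (a + b + l).+1)%N -> th cH a' b' l'.+3 = 0.
    by move=> Z; apply: h4; rewrite !addnS in H *; lia.
  by rewrite !Z ?mulr0 ?addr0 ?mulr0 ?addr0 //; lia.
Qed.

Lemma near_eq_derive1 (f g : R -> R) (x : R) : (\forall t \near x, f t = g t) -> derive1 f x = derive1 g x.
Proof. by move=> E; rewrite !derive1E; exact: near_eq_derive. Qed.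

Section Total.
Variables (k : nat) (F : jet R -> R).
Hypotheses (k2 : (2 <= k)%N) (HF : Rat k F).

Lemma denr_section a s : sol_near a s -> denr (jt s a) != 0 -> \forall p \near a, denr (jt s p) != 0.
Proof.
move=> [U [[oU ss _] _ Ua]] d0; have [T [_ _ sT]] := jetpoly_total iu (@jetpoly_denr R 2 isT).
have [sd _] := sT U s oU ss.
exact: (neq0_near (smooth_diff sd Ua) d0).
Qed.

Lemma Rat_section a s : sol_near a s -> denr (jt s a) != 0 -> smooth_near a (fun p => F (jt s p)).
Proof.
move=> sa d0; have [n [P [HP E]]] := HF.
have [U1 [oU1 U1a H1]] := near_open (filterI (sol_near_near sa) (denr_section sa d0)).
have [U2 [[oU2 ss _] _ U2a]] := sa.
have oU : open (U1 `&` U2) by exact: openI.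
have [T1 [_ _ sTP]] := jetpoly_total iu HP; have [T2 [_ _ sTd]] := jetpoly_total iu (@jetpoly_denr R k k2).
have [sP _] := sTP U2 s oU2 ss; have [sd _] := sTd U2 s oU2 ss.
apply/smooth_nearP; exists (U1 `&` U2); split=> //.
have sI : smooth_on (U1 `&` U2) (fun q => (denr (jt s q))^-1).
  apply: smooth_inv => //; last by move=> p [/H1[]].
  by apply: smooth_sub sd => p [].
have sIn m : smooth_on (U1 `&` U2) (fun q => (denr (jt s q))^-1 ^+ m).
  elim: m => [|m IH]; first exact: smooth_cst.
  by apply: (smooth_eq oU (smooth_mul oU sI IH)) => p _; rewrite exprS.
apply: (smooth_eq oU (smooth_mul oU (smooth_sub (fun p (h : (U1 `&` U2) p) => h.2) sP) (sIn n))) => p [U1p _].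
have [sp dp] := H1 p U1p.
by rewrite -E ?exprVn ?mulfK ?expf_neq0 //; exact: sol_near_eqE.
Qed.

Lemma Rat_total i : Rat k.+1 (total_deriv i F) /\
  forall a s, sol_near a s -> denr (jt s a) != 0 ->
    pd i (fun p => F (jt s p)) a = total_deriv i F (jt s a).
Proof.
have [n [P [HP E]]] := HF.
have [TP [hTP dP sP]] := jetpoly_total i HP; have [Td [hTd dd sd]] := jetpoly_total i (@jetpoly_denr R k k2).
have tE th : Defs.eqE k.+1 th -> denr th != 0 ->
    total_deriv i F th = (TP th * denr th - n%:R * P th * Td th) / denr th ^+ n.+1.
  move=> Eth d0; pose f (t : R) := hline th (delta_mx 0 i) t.
  have f0 : f 0 = th by exact: hline0.
  rewrite /total_deriv (near_eq_derive1 (g := fun t => P (f t) / denr (f t) ^+ n)).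
    have d0' : denr (f 0) != 0 by rewrite f0.
    have := is_derive_quot n (dP th) (dd th) d0'; rewrite -/(f 0) f0 => -[_ <-].
    by rewrite derive1E.
  have nd : \forall t \near (0 : R), denr (f t) != 0 by apply: (derive_near_neq0 (dd th)); rewrite -/(f 0) f0.
  apply: filterS (filterI nd (hline_eqE i Eth)) => t [dt Et].
  by rewrite -E // mulfK // expf_neq0.
split.
  exists n.+1, (fun th => TP th * denr th - n%:R * P th * Td th); split.
    apply: subalg_add; first by apply: subalg_mul => //; apply: jetpoly_denr; exact: leqW.
    apply: subalg_opp; apply: subalg_mul => //; apply: subalg_mul; first exact: subalg_cst.
    exact: jetpoly_le (leqnSn k) HP.
  by move=> th Eth d0; rewrite tE // divfK // expf_neq0.
move=> a s sa d0; rewrite tE //; last exact: sol_near_eqE.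
have [U [[oU ss h0] Es Ua]] := sa.
have [sPU ePU] := sP U s oU ss; have [sdU edU] := sd U s oU ss.
rewrite (@near_eq_pd _ i _ (fun p => P (jt s p) / denr (jt s p) ^+ n)).
  have H1 : is_derive a (delta_mx 0 i : V) (fun p => P (jt s p)) (TP (jt s a)).
    by split; [apply: diff_derivable; exact: smooth_diff sPU Ua|exact: ePU].
  have H2 : is_derive a (delta_mx 0 i : V) (fun p => denr (jt s p)) (Td (jt s a)).
    by split; [apply: diff_derivable; exact: smooth_diff sdU Ua|exact: edU].
  by have [_] := is_derive_quot n H1 H2 d0.
apply: filterS (filterI (sol_near_near sa) (denr_section sa d0)) => p [sp dp].
by rewrite -E ?mulfK ?expf_neq0 //; exact: sol_near_eqE.
Qed.

Lemma Rat_hderiv (nab : hfield R) : (forall i, Rat 2 (fun th => nab th 0 i)) -> Rat k.+1 (hderiv nab F).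
Proof.
move=> Hn; apply: Rat_sum => [|i]; first exact: leqW.
exact: (Rat_mul (F := fun th => nab th 0 i) (F' := total_deriv i F) (Rat_le (leqW k2) (Hn i)) (Rat_total i).1).
Qed.

Lemma hderiv_section (nab : hfield R) a s : sol_near a s -> denr (jt s a) != 0 ->
  hderiv nab F (jt s a) = \sum_i pd i (fun p => F (jt s p)) a * nab (jt s a) 0 i.
Proof. by move=> sa d0; apply: eq_bigr => i _; rewrite (Rat_total i).2 // mulrC. Qed.

End Total.

Definition Rinv k F := forall phi th th', Defs.eqE k th -> Defs.eqE k th' ->
  in_G (jbase th) phi -> prolong k phi th th' -> denr th != 0 -> denr th' != 0 -> F th' = F th.

Definition Rinv_field k (nab : hfield R) := forall phi th th', Defs.eqE k th -> Defs.eqE k th' ->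
  in_G (jbase th) phi -> prolong k phi th th' -> denr th != 0 -> denr th' != 0 ->
  nab th' = 'd phi (jbase th) (nab th).

Lemma prolong_le k k' phi th th' : (k <= k')%N -> prolong k' phi th th' -> prolong k phi th th'.
Proof.
move=> kk [s [s' [sn sn' /is_jetE js /is_jetE js' rel]]]; exists s, s'; split=> //.
  by apply/is_jetE; exact: eqj_le js.
by apply/is_jetE; exact: eqj_le js'.
Qed.

Lemma Rinv_le k k' F : (k <= k')%N -> Rinv k F -> Rinv k' F.
Proof.
move=> kk H phi th th' /(eqE_le kk) E /(eqE_le kk) E' G /(prolong_le kk) p; exact: (H phi th th').
Qed.

(** Along solutions related by [phi], invariance of [F] says that [F (jt s p)] equals
    [F (jt s' (phi p))] near the base point. Differentiating this identity by the chain rule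
    transports [nab] by the differential of [phi]. *)
Lemma Rinv_hderiv k F (nab : hfield R) : (2 <= k)%N -> Rat k F -> Rinv k F ->
  (forall i, Rat 2 (fun th => nab th 0 i)) -> Rinv_field 2 nab -> Rinv k.+1 (hderiv nab F).
Proof.
move=> k2 HF IF Hn In phi th th' Eth Eth' G pr d0 d0'.
have nabE : nab th' = 'd phi (jbase th) (nab th).
  have k2' : (2 <= k.+1)%N by exact: leqW.
  by apply: In => //; [exact: eqE_le Eth|exact: eqE_le Eth'|exact: prolong_le pr].
have k1 : (2 <= k.+1)%N by exact: leqW.
have [s [s' [sa sa' e e' rel]]] := prolong_E G pr Eth'.
set a := jbase th in G sa sa' e e' rel nabE *.
have RH := Rat_hderiv k2 HF Hn.
have d1 : denr (jt s a) != 0 by rewrite -(jetpoly_eqj (jetpoly_denr k1) e).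
have d1' : denr (jt s' (phi a)) != 0 by rewrite -(jetpoly_eqj (jetpoly_denr k1) e').
rewrite (Rat_eqj k1 RH e Eth d0) (Rat_eqj k1 RH e' Eth' d0').
rewrite (hderiv_section k2 HF) // (hderiv_section k2 HF) //.
have nE t t' : eqj k.+1 t t' -> Defs.eqE k.+1 t -> denr t != 0 -> nab t = nab t'.
  move=> ee Et dt; apply/rowP => i; apply: (Rat_eqj (F := fun th => nab th 0 i) k1 _ ee Et dt).
  exact: Rat_le (Hn i).
rewrite -(nE _ _ e') // -(nE _ _ e) // nabE.
have N : \forall p \near a, F (jt s p) = F (jt s' (phi p)).
  near=> p; have sp : sol_near p s by near: p; exact: sol_near_near.
  have Gp : in_G p phi by near: p; exact: in_G_near.
  have rp : rel_sect p phi s s' by near: p; exact: near2.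
  have sp' : sol_near (phi p) s' by near: p; exact: (in_G_cvg G (sol_near_near sa')).
  have dp' : denr (jt s' (phi p)) != 0 by near: p; exact: (in_G_cvg G (denr_section sa' d1')).
  have dp : denr (jt s p) != 0 by near: p; exact: denr_section.
  apply/esym; apply: (IF phi (jt s p) (jt s' (phi p))) => //; try exact: sol_near_eqE.
  by apply: prolong_jt => //; exact: sol_section.
have dphi := in_G_diff G; have dj j := (diff_coord j (nab th) dphi).1.
have /smooth_nearP[U [oU Ua sF]] := Rat_section k2 HF sa' d1'.
have [_ Hc] := chain_rule (smooth_diff sF Ua) dj.
under [RHS]eq_bigr do rewrite (near_eq_pd _ N) Hc mulr_suml.
rewrite exchange_big; apply: eq_bigr => j _.
rewrite (diff_coord j (nab th) dphi).2 (diffsum _ (dj j)) mulr_sumr.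
by apply: eq_bigr => i _; rewrite mulrA.
Unshelve. all: by end_near.
Qed.

(** Reduces invariance under the pseudogroup to algebra: both jets are replaced by jets of
    solutions, and the transformation enters through the numbers [gj] alone. *)
Lemma prolong_pj k phi th th' : in_G (jbase th) phi -> prolong k phi th th' -> Defs.eqE k th' ->
  exists gj v t', [/\ gj 0%N 1%N 0%N 0%N != 0, gj 1%N 0%N 1%N 0%N != 0, eqj k th' t',
    eqj k th (Jet (jbase th) (pj gj v (gj 0%N 1%N 0%N 0%N)^-1 t')) &
    forall xi, 'd phi (jbase th) xi = dgauge gj v xi].
Proof.
move=> G pr E'; have [s [s' [sa sa' e e' rel]]] := prolong_E G pr E'.
set a := jbase th in G sa sa' e e' rel *.
have /in_GP[U0 [C [A [B [G0 U0a pE0]]]]] := G.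
have [W [[oW ss' _] EW Wa]] := sa'.
have [U1 [oU1 U1a H1]] := near_open (in_G_cvg G (open_near oW Wa)).
have oU : open (U0 `&` U1) by apply: openI => //; case: G0.
have GU : gauge (U0 `&` U1) C A B by apply: gauge_sub G0 => // p [].
have Ua : (U0 `&` U1) a by [].
have pE p : (U0 `&` U1) p -> phi p = gmap C A B p by move=> [+ _]; exact: pE0.
have UW p : (U0 `&` U1) p -> W (gmap C A B p) by move=> Up; rewrite -pE //; apply: H1; case: Up.
have [_ _ _ _ D0] := GU; have [c0 a0] := D0 a Ua.
exists (fun k i j l => pderiv (nseq i iu ++ nseq j ix ++ nseq l iv) (gfun C A B k) a), (a 0 iv), (jt s' (phi a)).
split=> //.
- have Es := near_eq_jt ((rel_pull _ _ GU Ua pE).1 rel); rewrite Es in e.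
  apply: eqj_trans e _; split=> // c i j l _.
  by rewrite (pj_pull c i j l GU Ua oW UW ss' EW) -pE.
- move=> xi; have Ep : \forall q \near a, gmap C A B q = phi q.
    by apply: filterS (open_near oU Ua) => q Uq; rewrite pE.
  have dG : differentiable (gmap C A B) a.
    by apply: diff_row => j; exact: smooth_diff (gmap_smooth j GU) Ua.
  rewrite -(near_eq_d xi Ep dG) (d_gmap xi GU Ua) /dgauge /=.
  move: c0; rewrite -![derive (hat1 C) _ _]/(pd iu (hat1 C) _) -![derive (hat2 _) _ _]/(pd _ (hat2 _) _).
  set c := pd iu (hat1 C) a.
  have -> : 'D_(delta_mx 0 iu) (derive (hat1 C) ^~ (delta_mx 0 iu)) a = pd iu (pd iu (hat1 C)) a by [].
  move: c (pd iu (pd iu _) a) (pd iu (hat2 B) a) (pd ix (hat2 B) a) => c c2 bu bx c0; congr row3.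
  by field.
Qed.

Lemma Rinv_pj F : Rat 2 F -> (forall gj (v : R) (t : jet R), gj 0%N 1%N 0%N 0%N != 0 -> gj 1%N 0%N 1%N 0%N != 0 ->
   t ch 0%N 0%N 0%N != 0 -> denr t != 0 -> forall b, F (Jet b (pj gj v (gj 0%N 1%N 0%N 0%N)^-1 t)) = F t) -> Rinv 2 F.
Proof.
move=> HF H phi th th' E E' G pr d0 d0'.
have [gj [v [t' [c0 a0 e' e _]]]] := prolong_pj G pr E'.
have dt : denr t' != 0 by rewrite -(jetpoly_eqj (jetpoly_denr (leqnn 2)) e').
have [_ ht _ _ _] := denr_neq0 dt.
by rewrite (Rat_eqj _ HF e E) // (Rat_eqj _ HF e' E') // H.
Qed.

Lemma Rinv_field_pj (nab : hfield R) : (forall i, Rat 2 (fun th => nab th 0 i)) ->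
  (forall gj (v : R) (t : jet R), gj 0%N 1%N 0%N 0%N != 0 -> gj 1%N 0%N 1%N 0%N != 0 ->
   t ch 0%N 0%N 0%N != 0 -> denr t != 0 -> forall b,
   nab t = dgauge gj v (nab (Jet b (pj gj v (gj 0%N 1%N 0%N 0%N)^-1 t)))) -> Rinv_field 2 nab.
Proof.
move=> Hn H phi th th' E E' G pr d0 d0'.
have [gj [v [t' [c0 a0 e' e dphi]]]] := prolong_pj G pr E'.
have dt : denr t' != 0 by rewrite -(jetpoly_eqj (jetpoly_denr (leqnn 2)) e').
have [_ ht _ _ _] := denr_neq0 dt.
have nE t1 t2 : eqj 2 t1 t2 -> Defs.eqE 2 t1 -> denr t1 != 0 -> nab t1 = nab t2.
  by move=> ee Et d1; apply/rowP => i; exact: (Rat_eqj _ (Hn i) ee Et d1).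
by rewrite (nE _ _ e' E' d0') (nE _ _ e E d0) dphi -H.
Qed.

Lemma Rinv_I1 : Rinv 2 (@I1 R).
Proof. by apply: Rinv_pj; [exact: Rat_I1|move=> gj v t c0 a0 h0 d0 b; exact: tr_I1]. Qed.

Lemma Rinv_I2a : Rinv 2 (@I2a R).
Proof. by apply: Rinv_pj; [exact: Rat_I2a|move=> gj v t c0 a0 h0 d0 b; exact: tr_I2a]. Qed.

Lemma Rinv_I2cr : Rinv 2 (@I2cr R).
Proof. by apply: Rinv_pj; [exact: Rat_I2cr|move=> gj v t c0 a0 h0 d0 b; exact: tr_I2cr]. Qed.

Lemma Rinv_nabla1r : Rinv_field 2 (@nabla1r R).
Proof. by apply: Rinv_field_pj => [i|gj v t c0 a0 h0 d0 b]; [exact: Rat_nabla1r|exact: tr_nabla1]. Qed.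

Lemma Rinv_nabla2r : Rinv_field 2 (@nabla2r R).
Proof. by apply: Rinv_field_pj => [i|gj v t c0 a0 h0 d0 b]; [exact: Rat_nabla2r|exact: tr_nabla2]. Qed.

Lemma Rinv_nabla3r : Rinv_field 2 (@nabla3r R).
Proof. by apply: Rinv_field_pj => [i|gj v t c0 a0 h0 d0 b]; [exact: Rat_nabla3r|exact: tr_nabla3]. Qed.

End RationalDerivatives.

(** * Invariance of the generators and of the derivations *)

Section Claims.
Context {R : realType}.
Local Notation V := 'rV[R]_3.
Implicit Types (th : jet R) (P F : jet R -> R) (nab : hfield R).

(** The same iteration for the regular versions. Their domain [denr != 0] is preserved by the
    pseudogroup, so they can be evaluated on a normal form even if [W] vanishes there. *)
Inductive iteratedR : nat -> (jet R -> R) -> Prop :=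
| iteratedR_I1 : iteratedR 0 (@I1 R)
| iteratedR_I2a : iteratedR 0 (@I2a R)
| iteratedR_I2cr : iteratedR 0 (@I2cr R)
| iteratedR_nabla1 t F : iteratedR t F -> iteratedR t.+1 (hderiv (@nabla1r R) F)
| iteratedR_nabla2 t F : iteratedR t F -> iteratedR t.+1 (hderiv (@nabla2r R) F)
| iteratedR_nabla3 t F : iteratedR t F -> iteratedR t.+1 (hderiv (@nabla3r R) F).

Definition agree (T : Type) (F F' : jet R -> T) := forall th, th cW 0%N 0%N 0%N != 0 -> denr th != 0 -> F th = F' th.

(** Both conditions in [agree] are open along [hline], so functions that agree under them also have
    equal total derivatives there. *)
Lemma agree_hderiv nab nab' F F' : agree nab nab' -> agree F F' -> agree (hderiv nab F) (hderiv nab' F').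
Proof.
move=> En EF th w0 d0; rewrite /hderiv En //; apply: eq_bigr => i _; congr (_ * _).
have [T1 [_ dW _]] := jetpoly_total i (@jetpoly_coord R 0 cW 0 0 0 isT).
have [T2 [_ dd _]] := jetpoly_total i (@jetpoly_denr R 2 isT).
have nW := derive_near_neq0 (dW th); rewrite hline0 in nW.
have nd := derive_near_neq0 (dd th); rewrite hline0 in nd.
apply: near_eq_derive1; apply: filterS (filterI (nW w0) (nd d0)) => t [h1 h2]; exact: EF.
Qed.

Lemma agree_nabla1 : agree (@nabla1 R) (@nabla1r R).
Proof. by move=> th w0 d0; rewrite nabla1_reg. Qed.

Lemma agree_nabla2 : agree (@nabla2 R) (@nabla2r R).
Proof. by move=> th w0 d0; rewrite nabla2_reg. Qed.

Lemma agree_nabla3 : agree (@nabla3 R) (@nabla3r R).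
Proof. by move=> th w0 d0; rewrite nabla3_reg. Qed.

Lemma iterated_reg t F : iterated t F -> exists2 F', iteratedR t F' & agree F F'.
Proof.
elim=> {t F} [| | |t F _ [F' I' E]|t F _ [F' I' E]|t F _ [F' I' E]].
- by exists (@I1 R); [exact: iteratedR_I1|].
- by exists (@I2a R); [exact: iteratedR_I2a|].
- by exists (@I2cr R); [exact: iteratedR_I2cr|move=> th w0 d0; exact: I2c_reg].
- by exists (hderiv (@nabla1r R) F'); [exact: iteratedR_nabla1|exact: agree_hderiv agree_nabla1 E].
- by exists (hderiv (@nabla2r R) F'); [exact: iteratedR_nabla2|exact: agree_hderiv agree_nabla2 E].
- by exists (hderiv (@nabla3r R) F'); [exact: iteratedR_nabla3|exact: agree_hderiv agree_nabla3 E].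
Qed.

Lemma iteratedR_iterated t F : iteratedR t F -> exists2 F', iterated t F' & agree F' F.
Proof.
elim=> {t F} [| | |t F _ [F' I' E]|t F _ [F' I' E]|t F _ [F' I' E]].
- by exists (@I1 R); [exact: iterated_I1|].
- by exists (@I2a R); [exact: iterated_I2a|].
- by exists (@I2c R); [exact: iterated_I2c|move=> th w0 d0; exact: I2c_reg].
- by exists (hderiv (@nabla1 R) F'); [exact: iterated_nabla1|exact: agree_hderiv agree_nabla1 E].
- by exists (hderiv (@nabla2 R) F'); [exact: iterated_nabla2|exact: agree_hderiv agree_nabla2 E].
- by exists (hderiv (@nabla3 R) F'); [exact: iterated_nabla3|exact: agree_hderiv agree_nabla3 E].
Qed.

Lemma iteratedR_Rat t F : iteratedR t F -> Rat t.+2 F /\ Rinv t.+2 F.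
Proof.
elim=> {t F} [| | |t F _ [H1 H2]|t F _ [H1 H2]|t F _ [H1 H2]].
- by split; [exact: Rat_I1|exact: Rinv_I1].
- by split; [exact: Rat_I2a|exact: Rinv_I2a].
- by split; [exact: Rat_I2cr|exact: Rinv_I2cr].
- split; first by apply: Rat_hderiv => // i; exact: Rat_nabla1r.
  by apply: Rinv_hderiv => // [i|]; [exact: Rat_nabla1r|exact: Rinv_nabla1r].
- split; first by apply: Rat_hderiv => // i; exact: Rat_nabla2r.
  by apply: Rinv_hderiv => // [i|]; [exact: Rat_nabla2r|exact: Rinv_nabla2r].
- split; first by apply: Rat_hderiv => // i; exact: Rat_nabla3r.
  by apply: Rinv_hderiv => // [i|]; [exact: Rat_nabla3r|exact: Rinv_nabla3r].
Qed.

(* The 2-jet at the origin of the section [h = 1 + x], [W = 1 + v],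
   [H = 1 + v ^+ 2]. *)
Definition jet_ex : jet R := Jet 0 (fun c i j l => match c, i, j, l with
  | ch, 0, 0, 0 | ch, 0, 1, 0 | cW, 0, 0, 0 | cW, 0, 0, 1 | cH, 0, 0, 0 => 1%R
  | cH, 0, 0, 2 => 2%R
  | _, _, _, _ => 0%R end%N).

Lemma jet_ex_eqEoo : eqEoo jet_ex.
Proof. by move=> k; split=> [|i j l _|i j l _|i j l _] /=; [exact: ltr01|by case: i j => [|i] [|[|j]]..].
Qed.

Lemma jet_ex_denr : denr jet_ex = -4.
Proof. by rewrite /denr /kqn /I2bn /=; ring. Qed.

Lemma jet_ex_W : jet_ex cW 0%N 0%N 0%N = 1. Proof. by []. Qed.

Definition Wdenr n th := th cW 0%N 0%N 0%N * denr th ^+ n.+1.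

Lemma Wdenr_neq0 n th : Wdenr n th != 0 -> th cW 0%N 0%N 0%N != 0 /\ denr th != 0.
Proof. by rewrite /Wdenr mulf_eq0 negb_or expf_eq0 /= => /andP[]. Qed.

Lemma nonzero_Wdenr n : nonzero (Wdenr n).
Proof.
exists jet_ex; split; first exact: jet_ex_eqEoo.
by rewrite /Wdenr jet_ex_denr jet_ex_W mul1r expf_neq0 // oppr_eq0 pnatr_eq0.
Qed.

Lemma jetpoly_Wdenr n k : (2 <= k)%N -> jetpoly k (Wdenr n).
Proof. by move=> k2; apply: subalg_mul; [exact: jetpoly_coord|apply: subalg_exp; exact: jetpoly_denr]. Qed.

Lemma Rinv_diff_invariant l k F F' : (2 <= l)%N -> (2 <= k)%N -> Rat k F' -> Rinv k F' -> agree F F' ->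
  diff_invariant l k F.
Proof.
move=> l2 k2 [n [P [HP E]]] I' A; have lk : (2 <= minn l k)%N by rewrite leq_min l2.
exists (fun th => P th * (th cW 0%N 0%N 0%N * denr th)), (Wdenr n); split.
- by apply: subalg_mul => //; apply: subalg_mul; [exact: jetpoly_coord|exact: jetpoly_denr].
- exact: jetpoly_Wdenr.
- exact: nonzero_Wdenr.
- move=> th Eth /Wdenr_neq0[w0 d0]; rewrite A // -E // /Wdenr exprS.
  have := expf_neq0 n d0; move: (denr th ^+ n) => D D0.
  by move: (th cW _ _ _) w0 (denr th) d0 (F' th) => w w0 d d0 f; field; rewrite w0 d0 D0.
- move=> phi th th' Eth Eth' G pr /Wdenr_neq0[w0 d0] /Wdenr_neq0[w0' d0'].
  by rewrite !A //; exact: (I' phi th th').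
Qed.

Lemma Rinv_invariant_derivation nab nab' : (forall i, Rat 2 (fun th => nab' th 0 i)) -> Rinv_field 2 nab' ->
  agree nab nab' -> invariant_derivation 2 nab.
Proof.
move=> HR I' A.
have [n0 [P0 [HP0 E0]]] := HR iu; have [n1 [P1 [HP1 E1]]] := HR ix; have [n2 [P2 [HP2 E2]]] := HR iv.
pose D th n := denr th ^+ n.
exists (fun i th => (if i == iu then P0 th * D th (n1 + n2)%N else if i == ix then P1 th * D th (n0 + n2)%N
   else P2 th * D th (n0 + n1)%N) * (th cW 0%N 0%N 0%N * denr th)), (Wdenr (n0 + n1 + n2)); split.
- move=> i; case: (ax_cases i) => -> /=; do 2 apply: subalg_mul => //;
    by [apply: subalg_exp; exact: jetpoly_denr|exact: jetpoly_coord|exact: jetpoly_denr].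
- exact: jetpoly_Wdenr.
- exact: nonzero_Wdenr.
- move=> th Eth /Wdenr_neq0[w0 d0] i; rewrite A // /Wdenr exprS /D.
  have D0 n := expf_neq0 n d0.
  case: (ax_cases i) => -> /=; rewrite -?E0 -?E1 -?E2 // !exprD.
  + move: (th cW _ _ _) w0 (denr th) d0 (denr th ^+ n0) (D0 n0) (denr th ^+ n1) (D0 n1) (denr th ^+ n2) (D0 n2) (nab' th 0 iu).
    by move=> w w0 d d0 x x0 y y0 z z0 q; field; rewrite w0 d0 x0 y0 z0.
  + move: (th cW _ _ _) w0 (denr th) d0 (denr th ^+ n0) (D0 n0) (denr th ^+ n1) (D0 n1) (denr th ^+ n2) (D0 n2) (nab' th 0 ix).
    by move=> w w0 d d0 x x0 y y0 z z0 q; field; rewrite w0 d0 x0 y0 z0.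
  + move: (th cW _ _ _) w0 (denr th) d0 (denr th ^+ n0) (D0 n0) (denr th ^+ n1) (D0 n1) (denr th ^+ n2) (D0 n2) (nab' th 0 iv).
    by move=> w w0 d d0 x x0 y y0 z z0 q; field; rewrite w0 d0 x0 y0 z0.
- move=> phi th th' Eth Eth' G pr /Wdenr_neq0[w0 d0] /Wdenr_neq0[w0' d0'].
  by rewrite !A //; exact: (I' phi th th').
Qed.

(** A direct argument with denominator [h]: the general one through [denr] would need a denominator
    of order 2, where only order 1 is allowed. *)
Lemma diff_invariant_I1 : diff_invariant 1 1 (@I1 R).
Proof.
exists (fun th => th cW 0%N 0%N 1%N ^+ 2), (fun th => th ch 0%N 0%N 0%N); split=> //.
- by apply: subalg_exp; exact: jetpoly_coord.
- exact: jetpoly_coord.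
- by exists jet_ex; split; [exact: jet_ex_eqEoo|exact: oner_neq0].
move=> phi th th' E E' G pr h0 h0'.
have [gj [v [t' [c0 a0 [_ e'] [_ e] _]]]] := prolong_pj G pr E'.
have ht : t' ch 0%N 0%N 0%N != 0 by rewrite -e'.
have := tr_I1 v c0 a0 ht; rewrite /I1 -!e' //= => H.
by rewrite !e // -H.
Qed.

Lemma diff_invariant_I2a : diff_invariant 2 2 (@I2a R).
Proof.
exists (@I2a R), (fun=> 1); split; [exact: jetpoly_coord|exact: subalg_cst| | |].
- by exists jet_ex; split; [exact: jet_ex_eqEoo|exact: oner_neq0].
- by move=> th; rewrite divr1.
move=> phi th th' E E' G pr _ _.
have [gj [v [t' [c0 a0 [_ e'] [_ e] _]]]] := prolong_pj G pr E'.
by have := @tr_I2a R gj v t' c0; rewrite /I2a e' // e // => <-.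
Qed.

Lemma diff_invariant_I2c : diff_invariant 2 2 (@I2c R).
Proof.
by apply: (Rinv_diff_invariant (F' := @I2cr R)) => // [||th]; [exact: Rat_I2cr|exact: Rinv_I2cr|exact: I2c_reg].
Qed.

Lemma invariant_nabla1 : invariant_derivation 2 (@nabla1 R).
Proof. exact: Rinv_invariant_derivation (Rat_nabla1r (leqnn 2)) Rinv_nabla1r agree_nabla1. Qed.

Lemma invariant_nabla2 : invariant_derivation 2 (@nabla2 R).
Proof. exact: Rinv_invariant_derivation (Rat_nabla2r (leqnn 2)) Rinv_nabla2r agree_nabla2. Qed.

Lemma invariant_nabla3 : invariant_derivation 2 (@nabla3 R).
Proof. exact: Rinv_invariant_derivation (Rat_nabla3r (leqnn 2)) Rinv_nabla3r agree_nabla3. Qed.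

Lemma iterated_algA t F : iterated t F -> algA 2 F.
Proof.
move=> /iterated_reg[F' /iteratedR_Rat[HR I'] A]; exists t.+2; exact: Rinv_diff_invariant HR I' A.
Qed.

Definition segj th th' (t : R) : jet R := Jet (jbase th + t *: (jbase th' - jbase th))
  (fun c i j l => th c i j l + t * (th' c i j l - th c i j l)).

Lemma segj0 th th' : segj th th' 0 = th.
Proof.
case: th => b c; rewrite /segj /= scale0r addr0; congr Jet.
by do 4 (apply/funext => ?); rewrite mul0r addr0.
Qed.

Lemma segj1 th th' : segj th th' 1 = th'.
Proof.
case: th' => b c; rewrite /segj /= scale1r addrC subrK; congr Jet.
by do 4 (apply/funext => ?); rewrite mul1r addrC subrK.
Qed.

Lemma jetpoly_segment k P th th' : jetpoly k P -> exists p : {poly R}, forall t : R, p.[t] = P (segj th th' t).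
Proof.
elim=> {P} [f [[a ->]|[c [i [j [l [_ ->]]]]]]|c|f g _ [p Hp] _ [q Hq]|f g _ [p Hp] _ [q Hq]].
- exists ((jbase th 0 a)%:P + 'X * (jbase th' 0 a - jbase th 0 a)%:P) => t /=.
  by rewrite !hornerE !mxE.
- by exists ((th c i j l)%:P + 'X * (th' c i j l - th c i j l)%:P) => t /=; rewrite !hornerE.
- by exists c%:P => t; rewrite hornerE.
- by exists (p + q) => t; rewrite hornerD Hp Hq.
- by exists (p * q) => t; rewrite hornerM Hp Hq.
Qed.

Lemma poly_nonroot (p : {poly R}) : p != 0 -> exists t : R, [/\ 0 <= t, t <= 1 & p.[t] != 0].
Proof.
(* These are [size p] distinct points of the unit interval, one more than the degree of [p]. *)
move=> p0; pose s := [seq (i.+1%:R : R)^-1 | i <- iota 0 (size p)].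
have us : uniq s.
  rewrite map_inj_uniq ?iota_uniq // => i j /invr_inj/eqP.
  by rewrite eqr_nat => /eqP[].
have [/(max_poly_roots p0)|] := boolP (all (root p) s).
  by move=> /(_ us); rewrite size_map size_iota ltnn.
move=> /allPn[_ /mapP[i _ ->] r]; exists (i.+1%:R^-1); split=> //.
by rewrite invf_le1 ?ltr0n // ler1n.
Qed.

(** The equation is convex, being given by linear equations and [h > 0]. On the segment between the
    two points the polynomials restrict to nonzero polynomials in one variable, whose product has
    finitely many roots. *)
Lemma nonzero_mul k k' P P' : jetpoly k P -> jetpoly k' P' -> nonzero P -> nonzero P' ->
  nonzero (fun th => P th * P' th).
Proof.
move=> HP HP' [th [Eth P0]] [th' [Eth' P0']].
have [p Hp] := jetpoly_segment th th' HP; have [q Hq] := jetpoly_segment th th' HP'.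
have pq : p * q != 0.
  rewrite mulf_neq0 //.
    by apply: contraNneq P0 => p0; have := Hp 0; rewrite p0 horner0 segj0 => <-.
  by apply: contraNneq P0' => q0; have := Hq 1; rewrite q0 horner0 segj1 => <-.
have [t [t0 t1 r]] := poly_nonroot pq.
exists (segj th th' t); split; last by rewrite -Hp -Hq -hornerM; exact: r.
move=> n; have [h1 h2 h3 h4] := Eth n; have [h1' h2' h3' h4'] := Eth' n; split=> [|i j l H|i j l H|i j l H] /=.
- have -> : forall x y : R, x + t * (y - x) = (1 - t) * x + t * y by move=> x y; ring.
  have [->|tn] := eqVneq t 0; first by rewrite subr0 mul1r mul0r addr0.
  have tp : 0 < t by rewrite lt_def tn.
  by rewrite ltr_wpDl ?mulr_gt0 // mulr_ge0 ?subr_ge0 // ltW.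
- by rewrite h2 // h2' // subr0 mulr0 addr0.
- by rewrite h3 // h3' // subr0 mulr0 addr0.
- by rewrite h4 // h4' // subr0 mulr0 addr0.
Qed.

End Claims.

(** * Commutators of the frame on normal sections *)

Section FrameCommutators.
Context {R : realType}.
Local Notation V := 'rV[R]_3.
Variable U : set V.
Hypothesis oU : open U.
Implicit Types (f g : V -> R) (p : V).

Lemma on_pdD f g i p : smooth_on U f -> smooth_on U g -> U p ->
  pd i (fun q => f q + g q) p = pd i f p + pd i g p.
Proof. by move=> sf sg Up; apply: pdD; [exact: smooth_diff sf Up|exact: smooth_diff sg Up]. Qed.

Lemma on_pdB f g i p : smooth_on U f -> smooth_on U g -> U p ->
  pd i (fun q => f q - g q) p = pd i f p - pd i g p.
Proof. by move=> sf sg Up; apply: pdB; [exact: smooth_diff sf Up|exact: smooth_diff sg Up]. Qed.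

Lemma on_pdM f g i p : smooth_on U f -> smooth_on U g -> U p ->
  pd i (fun q => f q * g q) p = f p * pd i g p + g p * pd i f p.
Proof. by move=> sf sg Up; apply: pdM; [exact: smooth_diff sf Up|exact: smooth_diff sg Up]. Qed.

Lemma on_pdV f i p : smooth_on U f -> U p -> f p != 0 ->
  pd i (fun q => (f q)^-1) p = - (f p) ^- 2 * pd i f p.
Proof. by move=> sf Up f0; apply: pdV => //; exact: smooth_diff sf Up. Qed.

Lemma on_pdC f i j p : smooth_on U f -> U p -> pd i (pd j f) p = pd j (pd i f) p.
Proof. exact: (@pd_pderivC _ U f i [:: j]). Qed.

Lemma smooth_v : smooth_on U (fun p => p 0 iv). Proof. exact: smooth_coord. Qed.

(* On a normal section these fields are invariant multiples of nabla_1, nabla_2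
   and nabla_3, see [along_nabla1] and the lemmas that follow it. *)
Definition fE f p := p 0 iv * pd iv f p.
Definition fF w b f p := pd ix f p - (w p + p 0 iv * b p) * pd iv f p.
Definition fG Hf ka f p := (p 0 iv)^-1 * pd iu f p + (ka p * p 0 iv - Hf p * (p 0 iv)^-1) * pd iv f p.

Ltac sm := do ?[assumption|exact: smooth_v|exact: smooth_pd|apply: smooth_add|apply: smooth_opp|apply: smooth_mul].

(** The Euler field [v d_v] commutes with [b v d_v] and with [d_x], while its bracket with [d_v] is
    [- d_v]; only the term with [w] survives. *)
Lemma commutator_EF w b f p : smooth_on U w -> smooth_on U b -> smooth_on U f ->
  (forall p, U p -> pd iv w p = 0) -> (forall p, U p -> pd iv b p = 0) -> U p ->
  fE (fF w b f) p - fF w b (fE f) p = w p * pd iv f p.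
Proof.
move=> sw sb sf w0 b0 Up.
have sf' i : smooth_on U (pd i f) by exact: smooth_pd.
rewrite /fE /fF on_pdB ?on_pdM ?on_pdD ?on_pdM //; try by sm.
rewrite !pd_coord /= w0 // b0 // (on_pdC iv ix sf Up).
move: (pd iv (pd iv f) p) (pd ix (pd iv f) p) (pd ix f p) (pd iv f p) (w p) (b p) (p 0 iv) => *.
by ring.
Qed.

Hypothesis v0 : forall p, U p -> p 0 iv != 0.

Lemma smooth_vinv : smooth_on U (fun p => (p 0 iv)^-1).
Proof. by apply: smooth_inv => //; exact: smooth_v. Qed.

(** The part [(1 / v) d_u] has weight -1 under the Euler field, so adding [fG] removes the
    u-derivative and leaves a multiple of [d_v]. *)
Lemma commutator_EG Hf ka f p : smooth_on U Hf -> smooth_on U ka -> smooth_on U f ->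
  (forall p, U p -> pd iv ka p = 0) -> U p ->
  fE (fG Hf ka f) p - fG Hf ka (fE f) p + fG Hf ka f p =
  (Hf p * (p 0 iv)^-1 - pd iv Hf p + ka p * p 0 iv) * pd iv f p.
Proof.
move=> sH sk sf k0 Up; have sf' i : smooth_on U (pd i f) by exact: smooth_pd.
have si := smooth_vinv; have vp := v0 Up; have sv := smooth_v.
rewrite /fE /fG on_pdD ?on_pdM ?on_pdB ?on_pdM ?on_pdV //; try by sm.
rewrite !pd_coord /= k0 // (on_pdC iv iu sf Up).
move: (pd iv (pd iv f) p) (pd iu (pd iv f) p) (pd iu f p) (pd iv f p) (pd iv Hf p) (Hf p) (ka p) (p 0 iv) vp => a b c d h' h k v vp.
by field.
Qed.

End FrameCommutators.

(** * The derivations at a jet in normal form *)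

Section NormalFormJets.
Context {R : realType}.
Variables (th : jet R) (v X : R).
Local Notation H := (th cH 0%N 0%N 0%N).
Local Notation Hvv := (th cH 0%N 0%N 2%N).
Local Notation Hxvv := (th cH 0%N 1%N 2%N).
Local Notation W := (th cW 0%N 0%N 0%N).
Local Notation Wv := (th cW 0%N 0%N 1%N).
Local Notation Wuv := (th cW 1%N 0%N 1%N).
Local Notation Wxv := (th cW 0%N 1%N 1%N).
Local Notation h := (th ch 0%N 0%N 0%N).
Local Notation hu := (th ch 1%N 0%N 0%N).
Local Notation hx := (th ch 0%N 1%N 0%N).
(** [X] stands for [I1]: [j1] is its definition, [jx] and [ju] say that its x-derivative is 1 and
    its u-derivative 0, and [jk] is the normalisation of v. *)
Hypotheses (d0 : denr th != 0) (v0 : v != 0) (j1 : Wv ^+ 2 = X * h)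
  (jx : 2 * (Wv * Wxv) = h + X * hx) (ju : 2 * (Wv * Wuv) = X * hu)
  (jk : k2a th - I2a th * W = v * (Hxvv - I2a th * Wv)).

(** The coefficient e of the overview. On a normal section [ne_val] expresses it by [I2a] and its
    derivative along [nabla_2]. *)
Definition nfe := Hxvv / (I2a th * Wv) - 1.

Lemma nf_X : X = I1 th.
Proof. by have [w0 h0 _ _ _] := denr_neq0 d0; rewrite /I1 j1 mulfK. Qed.

Lemma nf_X0 : X != 0.
Proof. by have [w0 h0 _ _ _] := denr_neq0 d0; rewrite nf_X /I1 mulf_neq0 ?invr_eq0 // expf_neq0. Qed.

Lemma nf_h : h = Wv ^+ 2 / X.
Proof. by rewrite j1 mulrC mulKf // nf_X0. Qed.

(** The x-derivative of [I1] is always [- I2b * Wv], and in normal form it equals 1. *)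
Lemma nf_I2b : I2b th = - Wv^-1.
Proof.
have [w0 h0 _ _ _] := denr_neq0 d0; apply: (mulfI w0); rewrite mulrN mulfV // /I2b mulrA.
have -> : Wv * (Wv * hx - 2 * h * Wxv) = - h ^+ 2.
  have -> : Wv * (Wv * hx - 2 * h * Wxv) = Wv ^+ 2 * hx - h * (2 * (Wv * Wxv)) by ring.
  by rewrite j1 jx; ring.
by rewrite mulNr mulfV // expf_neq0.
Qed.

(** Up to the factor [- Wv / h], [k2b] is the u-derivative of [I1]. *)
Lemma nf_k2b : k2b th = 0.
Proof.
have [w0 h0 _ _ _] := denr_neq0 d0; apply: (mulfI w0); rewrite mulr0 /k2b mulrA.
have -> : Wv * (Wv * hu - 2 * h * Wuv) = Wv ^+ 2 * hu - h * (2 * (Wv * Wuv)) by ring.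
by rewrite j1 ju; ring.
Qed.

Lemma nf_kq : kq th = - (I2a th * nfe * v).
Proof.
have [w0 h0 a0 _ _] := denr_neq0 d0; rewrite /kq nf_k2b mulr0 add0r.
have -> : I2b th * k2a th - I2a th * I2b th * W = I2b th * (k2a th - I2a th * W) by ring.
by rewrite jk nf_I2b /nfe; field; rewrite a0 w0.
Qed.

Lemma nf_e0 : nfe != 0.
Proof.
have [_ _ _ _ k0] := denr_neq0 d0; apply: contraNneq k0 => e0.
by rewrite nf_kq e0 mulr0 mul0r oppr0.
Qed.

Lemma nf_nabla1 : nabla1r th = row3 0 0 (nfe * v).
Proof.
have [w0 h0 a0 _ _] := denr_neq0 d0; have X0 := nf_X0; rewrite nf_X in X0.
by rewrite /nabla1r /Qr nf_kq nf_I2b; congr row3; field; rewrite X0 w0 a0.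
Qed.

Lemma nf_nabla2 : nabla2r th = row3 0 (Wv^-1) (- (Wv^-1 * (W - v * Wv + v * (Hxvv / I2a th)))).
Proof.
have [w0 h0 a0 _ _] := denr_neq0 d0; rewrite /nabla2r.
have -> : k2a th = I2a th * W + v * (Hxvv - I2a th * Wv) by rewrite -jk; ring.
by congr row3; field; rewrite ?w0 ?a0.
Qed.

Lemma nf_nabla3 : nabla3r th = row3 (- (2 / (X * nfe)) * v^-1) 0
  (- (2 / (X * nfe)) * (X * nfe ^+ 2 / 4 * v - H * v^-1)).
Proof.
have [w0 h0 a0 _ _] := denr_neq0 d0; have X0 := nf_X0; have e0 := nf_e0.
rewrite /nabla3r /Rr /Qr nf_kq nf_I2b nf_k2b -nf_X nf_h mulr0.
have -> : k2a th = I2a th * W + v * (I2a th * Wv * nfe).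
  have -> : I2a th * Wv * nfe = Hxvv - I2a th * Wv by rewrite /nfe; field; rewrite a0 w0.
  by rewrite -jk; ring.
move: nfe e0 (I2a th) a0 Wv w0 => e e0 a a0 w w0.
by congr row3; field; rewrite ?X0 ?e0 ?w0 ?a0 ?v0.
Qed.

End NormalFormJets.

(** * Normal sections and functions generated by invariants *)

Section NormalForm.
Context {R : realType}.
Local Notation V := 'rV[R]_3.
Local Notation sect := (Defs.comp -> V -> R).
Implicit Types (th : jet R) (P Q F : jet R -> R) (nu : sect) (U : set V) (p : V) (f g : sect -> V -> R) (nab : hfield R).

Definition IR F := exists t, iteratedR t F.

Definition nI1 : jet R -> R := hderiv (@nabla2r R) (@I1 R).
Definition nI2a : jet R -> R := hderiv (@nabla2r R) (@I2a R).
Definition nI2c : jet R -> R := hderiv (@nabla1r R) (@I2cr R).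

(** Everything the reconstruction inverts. The first factor makes [I1] usable as the coordinate x,
    the fourth is [e * I2a] on normal sections and also occurs in the denominator of [rho], and the
    last allows the commutator identities on [I2c] to be solved for their coefficients. *)
Definition S0 th := nI1 th * I1 th * I2a th * (nI2a th - I2a th) * nI2c th.

(* The coordinates of a normal section are fixed by invariants: [x] is [I1] up to
   a constant, and the fourth condition says that [v] is the ratio [rho] below. *)
Definition normal nu U := [/\ section_on U nu, Esol U nu,
  exists c : R, forall p, U p -> I1 (jt nu p) = p 0 ix + c,
  forall p, U p -> k2a (jt nu p) - I2a (jt nu p) * jt nu p cW 0%N 0%N 0%N =
     p 0 iv * (jt nu p cH 0%N 1%N 2%N - I2a (jt nu p) * jt nu p cW 0%N 0%N 1%N) &
  forall p, U p -> [/\ p 0 iv != 0, denr (jt nu p) != 0 & S0 (jt nu p) != 0]].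

Lemma normal_open nu U : normal nu U -> open U.
Proof. by case=> -[]. Qed.

Lemma normal_sol nu U p : normal nu U -> U p -> sol_near p nu.
Proof. by case=> sn Es _ _ _ Up; exists U. Qed.

Lemma normal_smooth nu U c : normal nu U -> smooth_on U (nu c).
Proof. by case=> -[]. Qed.

Lemma IR_section nu U F : normal nu U -> IR F -> smooth_on U (fun p => F (jt nu p)).
Proof.
move=> N [t /iteratedR_Rat[HR _]] p Up; have [_ _ _ _ /(_ p Up)[_ d0 _]] := N.
have t2 : (2 <= t.+2)%N by [].
exact: (nbhs_singleton (Rat_section t2 HR (normal_sol N Up) d0)).
Qed.

Lemma subalg_section nu U P : normal nu U -> subalg IR P -> smooth_on U (fun p => P (jt nu p)).
Proof.
move=> N; have oU := normal_open N; elim=> {P} [F|c|F G _ sF _ sG|F G _ sF _ sG].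
- exact: IR_section.
- exact: smooth_cst.
- exact: smooth_add.
- exact: smooth_mul.
Qed.

Lemma IR_I1 : IR (@I1 R). Proof. by exists 0%N; exact: iteratedR_I1. Qed.
Lemma IR_I2a : IR (@I2a R). Proof. by exists 0%N; exact: iteratedR_I2a. Qed.
Lemma IR_I2cr : IR (@I2cr R). Proof. by exists 0%N; exact: iteratedR_I2cr. Qed.
Lemma IR_nI1 : IR nI1. Proof. by exists 1%N; apply: iteratedR_nabla2; exact: iteratedR_I1. Qed.
Lemma IR_nI2a : IR nI2a. Proof. by exists 1%N; apply: iteratedR_nabla2; exact: iteratedR_I2a. Qed.
Lemma IR_nI2c : IR nI2c. Proof. by exists 1%N; apply: iteratedR_nabla1; exact: iteratedR_I2cr. Qed.

Ltac sa := do ?[apply: subalg_gen; by [exact: IR_I1|exact: IR_I2a|exact: IR_I2cr|exact: IR_nI1|exact: IR_nI2a|exact: IR_nI2c]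
  |apply: subalg_opp|apply: subalg_add|apply: subalg_mul|exact: subalg_cst].

Lemma subalg_S0 : subalg IR S0.
Proof. by sa. Qed.

(** The same [n] and [P] serve for all normal sections; without this uniformity nothing could be
    concluded about two different orbits. *)
Definition gen f := exists n P, subalg IR P /\
  forall nu U p, normal nu U -> U p -> f nu p * S0 (jt nu p) ^+ n = P (jt nu p).

Lemma S0n_neq0 nu U p n : normal nu U -> U p -> S0 (jt nu p) ^+ n != 0.
Proof. by case=> _ _ _ _ H /H[_ _ s0]; exact: expf_neq0. Qed.

Lemma gen_ext f g : (forall nu U p, normal nu U -> U p -> f nu p = g nu p) -> gen f -> gen g.
Proof.
move=> fg [n [P [HP E]]]; exists n, P; split=> // nu U p N Up.
by rewrite -(fg _ _ _ N Up) (E _ _ _ N Up).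
Qed.

Lemma gen_subalg P : subalg IR P -> gen (fun nu p => P (jt nu p)).
Proof. by move=> HP; exists 0%N, P; split=> // nu U p _ _; rewrite expr0 mulr1. Qed.

Lemma gen_cst (c : R) : gen (fun _ _ => c).
Proof. exact: (gen_subalg (subalg_cst _ c)). Qed.

Lemma gen_add f g : gen f -> gen g -> gen (fun nu p => f nu p + g nu p).
Proof.
move=> [n [P [HP E]]] [m [Q [HQ E']]].
exists (n + m)%N, (fun th => P th * S0 th ^+ m + Q th * S0 th ^+ n); split.
  by apply: subalg_add; apply: subalg_mul => //; apply: subalg_exp; exact: subalg_S0.
move=> nu U p N Up; rewrite -(E _ _ _ N Up) -(E' _ _ _ N Up) exprD; ring.
Qed.

Lemma gen_mul f g : gen f -> gen g -> gen (fun nu p => f nu p * g nu p).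
Proof.
move=> [n [P [HP E]]] [m [Q [HQ E']]].
exists (n + m)%N, (fun th => P th * Q th); split; first exact: subalg_mul.
move=> nu U p N Up; rewrite -(E _ _ _ N Up) -(E' _ _ _ N Up) exprD; ring.
Qed.

Lemma gen_opp f : gen f -> gen (fun nu p => - f nu p).
Proof. by move=> Hf; apply: gen_ext (gen_mul (gen_cst (-1)) Hf) => nu U p _ _; rewrite mulN1r. Qed.

Lemma gen_inv F G : subalg IR G -> (forall th, F th * G th = S0 th) -> gen (fun nu p => (F (jt nu p))^-1).
Proof.
move=> HG E; exists 1%N, G; split=> // nu U p [_ _ _ _ /(_ p) H] Up; have [_ _ s0] := H Up.
by rewrite expr1 -E mulKf //; apply: contraNneq s0 => F0; rewrite -E F0 mul0r.
Qed.

Lemma gen_smooth nu U f : normal nu U -> gen f -> smooth_on U (f nu).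
Proof.
move=> N [n [P [HP E]]]; have oU := normal_open N.
have sS : smooth_on U (fun p => (S0 (jt nu p) ^+ n)^-1).
  apply: smooth_inv => //; first exact: (subalg_section N (subalg_exp n subalg_S0)).
  by move=> p Up; exact: S0n_neq0 N Up.
apply: (smooth_eq oU (smooth_mul oU (subalg_section N HP) sS)) => p Up.
by rewrite -(E _ _ _ N Up) mulfK // (S0n_neq0 n N Up).
Qed.

Definition along nab nu (f : V -> R) p := \sum_i pd i f p * nab (jt nu p) 0 i.

Section Along.
Variable nab : hfield R.
Hypothesis Hnab : forall t F, iteratedR t F -> iteratedR t.+1 (hderiv nab F).

Lemma along_subalg P : subalg IR P -> exists2 Q, subalg IR Q &
  forall nu U p, normal nu U -> U p -> along nab nu (fun q => P (jt nu q)) p = Q (jt nu p).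
Proof.
elim=> {P} [F [t It]|c|F G HF [F' sF EF] HG [G' sG EG]|F G HF [F' sF EF] HG [G' sG EG]].
- exists (hderiv nab F); first by apply: subalg_gen; exists t.+1; exact: Hnab.
  move=> nu U p N Up; have [HR _] := iteratedR_Rat It; have t2 : (2 <= t.+2)%N by [].
  have [_ _ _ _ /(_ p Up)[_ d0 _]] := N.
  by rewrite (hderiv_section t2 HR nab (normal_sol N Up) d0).
- exists (fun=> 0); first exact: subalg_cst.
  by move=> nu U p _ _; apply: big1 => i _; rewrite pd_cst mul0r.
- exists (fun th => F' th + G' th); first exact: subalg_add.
  move=> nu U p N Up; rewrite -(EF _ _ _ N Up) -(EG _ _ _ N Up) -big_split; apply: eq_bigr => i _ /=.
  by rewrite (on_pdD _ (subalg_section N HF) (subalg_section N HG) Up) mulrDl.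
- exists (fun th => F th * G' th + G th * F' th); first by apply: subalg_add; exact: subalg_mul.
  move=> nu U p N Up; rewrite -(EF _ _ _ N Up) -(EG _ _ _ N Up) !mulr_sumr -big_split; apply: eq_bigr => i _ /=.
  by rewrite (on_pdM _ (subalg_section N HF) (subalg_section N HG) Up) mulrDl !mulrA.
Qed.

(** The quotient rule for [P / S0 ^+ n], with [along_subalg] applied to numerator and
    denominator. *)
Lemma gen_along f : gen f -> gen (fun nu => along nab nu (f nu)).
Proof.
move=> [n [P [HP E]]]; have [P' HP' EP'] := along_subalg HP; have [S' HS' ES'] := along_subalg subalg_S0.
exists n.+1, (fun th => P' th * S0 th - n%:R * P th * S' th); split.
  apply: subalg_add; first by apply: subalg_mul => //; exact: subalg_S0.
  by apply: subalg_opp; do 2 apply: subalg_mul => //; exact: subalg_cst.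
move=> nu U p N Up; have oU := normal_open N; have [_ _ _ _ /(_ p Up)[_ _ s0]] := N.
rewrite -(EP' _ _ _ N Up) -(ES' _ _ _ N Up) /along !mulr_suml mulr_sumr -sumrB; apply: eq_bigr => i _.
have -> : pd i (f nu) p = (pd i (fun q => P (jt nu q)) p * S0 (jt nu p) -
    n%:R * P (jt nu p) * pd i (fun q => S0 (jt nu q)) p) / S0 (jt nu p) ^+ n.+1.
  rewrite (@pd_eq_on _ U _ (fun q => P (jt nu q) / S0 (jt nu q) ^+ n)) //; last first.
    by move=> q Uq; rewrite -(E _ _ _ N Uq) mulfK // (S0n_neq0 n N Uq).
  have H1 : is_derive p (delta_mx 0 i : V) (fun q => P (jt nu q)) (pd i (fun q => P (jt nu q)) p).
    by split=> //; apply: diff_derivable; exact: smooth_diff (subalg_section N HP) Up.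
  have H2 : is_derive p (delta_mx 0 i : V) (fun q => S0 (jt nu q)) (pd i (fun q => S0 (jt nu q)) p).
    by split=> //; apply: diff_derivable; exact: smooth_diff (subalg_section N subalg_S0) Up.
  by have [_] := is_derive_quot n H1 H2 s0.
rewrite mulrAC divfK ?expf_neq0 //.
move: (pd i _ p) (pd i _ p) (nab (jt nu p) 0 i) => x y z; ring.
Qed.

End Along.

(** Obtained by differentiating [W_v ^+ 2 = (x + c) * h] in x and in u. *)
Lemma I1_affine_jets nu U p (c : R) : open U -> sect_on U nu ->
  (forall q, U q -> I1 (jt nu q) = q 0 ix + c) -> (forall q, U q -> jt nu q ch 0%N 0%N 0%N != 0) -> U p ->
  let th := jt nu p in
  2 * (th cW 0%N 0%N 1%N * th cW 0%N 1%N 1%N) = th ch 0%N 0%N 0%N + I1 th * th ch 0%N 1%N 0%N /\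
  2 * (th cW 0%N 0%N 1%N * th cW 1%N 0%N 1%N) = I1 th * th ch 1%N 0%N 0%N.
Proof.
move=> oU ss Ec h0 Up th.
have E q : U q -> pd iv (nu cW) q * pd iv (nu cW) q = (q 0 ix + c) * nu ch q.
  by move=> Uq; have h0q := h0 q Uq; rewrite -Ec // /I1 divfK.
have sW : smooth_on U (pd iv (nu cW)) by exact: smooth_pd.
have sc : smooth_on U (fun q => q 0 ix + c).
  by apply: smooth_add => //; [exact: smooth_coord|exact: smooth_cst].
have D i : pd i (pd iv (nu cW)) p * pd iv (nu cW) p + pd i (pd iv (nu cW)) p * pd iv (nu cW) p =
    (p 0 ix + c) * pd i (nu ch) p + nu ch p * (i == ix)%:R.
  have := pd_eq_on i oU E Up; rewrite (on_pdM _ sW sW Up) (on_pdM _ sc (ss ch) Up).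
  rewrite (on_pdD _ (smooth_coord ix oU) (smooth_cst c oU) Up) pd_coord pd_cst addr0 => <-.
  by rewrite mulrC.
rewrite {}/th Ec //; split; [have := D ix|have := D iu]; rewrite /= ?mulr1 ?mulr0 ?addr0.
  rewrite -![pd ix (pd iv _) p]/(jt nu p cW 0%N 1%N 1%N) -![pd iv _ p]/(jt nu p cW 0%N 0%N 1%N).
  rewrite -![pd ix _ p]/(jt nu p ch 0%N 1%N 0%N) -![nu ch p]/(jt nu p ch 0%N 0%N 0%N).
  by move=> H; rewrite mulrC mulr_natr mulr2n [X in X + X]mulrC H addrC.
rewrite -![pd iu (pd iv _) p]/(jt nu p cW 1%N 0%N 1%N) -![pd iv _ p]/(jt nu p cW 0%N 0%N 1%N).
rewrite -![pd iu _ p]/(jt nu p ch 1%N 0%N 0%N).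
by move=> <-; rewrite mulrC mulr_natr mulr2n [X in X + X]mulrC.
Qed.

Section Values.
Variables (nu : sect) (U : set V) (p : V).
Hypotheses (N : normal nu U) (Up : U p).
Local Notation th := (jt nu p).

Lemma normal_j1 : th cW 0%N 0%N 1%N ^+ 2 = I1 th * th ch 0%N 0%N 0%N.
Proof.
have [_ _ _ _ /(_ p Up)[_ d0 _]] := N; have [_ h0 _ _ _] := denr_neq0 d0.
by rewrite /I1 divfK.
Qed.

Lemma normal_jxu : 2 * (th cW 0%N 0%N 1%N * th cW 0%N 1%N 1%N) = th ch 0%N 0%N 0%N + I1 th * th ch 0%N 1%N 0%N /\
  2 * (th cW 0%N 0%N 1%N * th cW 1%N 0%N 1%N) = I1 th * th ch 1%N 0%N 0%N.
Proof.
have [[oU ss _] _ [c Ec] _ Hg] := N; apply: (I1_affine_jets oU ss Ec) => // q /Hg[_ d0 _].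
by have [_ h0 _ _ _] := denr_neq0 d0.
Qed.

End Values.
End NormalForm.

(** * Reconstruction of a normal section from invariants *)

Section Generation.
Context {R : realType}.
Local Notation V := 'rV[R]_3.
Local Notation sect := (Defs.comp -> V -> R).
Implicit Types (th : jet R) (P Q F : jet R -> R) (nu : sect) (U : set V) (p : V) (f g : sect -> V -> R).

Definition nW1 nu : V -> R := pd iv (nu cW).
Definition na nu : V -> R := pd iv (pd iv (nu cH)).
Definition ne nu p : R := nfe (jt nu p).
Definition nw0 nu p : R := nu cW p - p 0 iv * nW1 nu p.
Definition nbeta nu p : R := pd ix (na nu) p / na nu p.
Definition nka nu p : R := I1 (jt nu p) * ne nu p ^+ 2 / 4.
(** If [H = H0 + H1 * v + a * v ^+ 2 / 2], this is [H1]. *)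
Definition nH1 nu p : R := pd iv (nu cH) p - p 0 iv * na nu p.
(** The test function for the commutators; [S0] guarantees that its derivative along [v d_v] does
    not vanish. *)
Definition nJ nu p : R := I2cr (jt nu p).

Section Values.
Variables (nu : sect) (U : set V).
Hypothesis N : normal nu U.
Let oU := normal_open N.

Lemma normal_pt p : U p -> [/\ p 0 iv != 0, denr (jt nu p) != 0 & S0 (jt nu p) != 0].
Proof. by case: N => _ _ _ _; apply. Qed.

Lemma normal_S0 p : U p -> [/\ nI1 (jt nu p) != 0, I1 (jt nu p) != 0, na nu p != 0,
   nI2a (jt nu p) - I2a (jt nu p) != 0 & nI2c (jt nu p) != 0].
Proof.
by move=> /normal_pt[_ _]; rewrite /S0 !mulf_eq0 !negb_or => /andP[/andP[/andP[/andP[? ?] ?] ?] ?].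
Qed.

Lemma normal_W1 p : U p -> nW1 nu p != 0.
Proof. by move=> /normal_pt[_ /denr_neq0[w0 _ _ _ _] _]. Qed.

Lemma smooth_W1 : smooth_on U (nW1 nu).
Proof. by apply: smooth_pd; exact: normal_smooth N. Qed.

Lemma smooth_a : smooth_on U (na nu).
Proof. by do 2 apply: smooth_pd; exact: normal_smooth N. Qed.

Lemma W1_v p : U p -> pd iv (nW1 nu) p = 0.
Proof. by case: N => _ Es _ _ _; exact: (Es cW). Qed.

Lemma a_v p : U p -> pd iv (na nu) p = 0.
Proof. by case: N => _ Es _ _ _; exact: (Es cH). Qed.

Lemma v_neq0 p : U p -> p 0 iv != 0.
Proof. by case/normal_pt. Qed.

Lemma smooth_w0 : smooth_on U (nw0 nu).
Proof.
apply: smooth_add => //; first exact: normal_smooth N.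
by apply: smooth_opp => //; apply: smooth_mul => //; [exact: smooth_coord|exact: smooth_W1].
Qed.

Lemma w0_v p : U p -> pd iv (nw0 nu) p = 0.
Proof.
move=> Up; have sv := smooth_coord iv oU.
rewrite (on_pdB _ (normal_smooth cW N) (smooth_mul oU sv smooth_W1) Up) (on_pdM _ sv smooth_W1 Up).
by rewrite (W1_v Up) pd_coord /= mulr1 mulr0 add0r subrr.
Qed.

Lemma smooth_ainv : smooth_on U (fun p => (na nu p)^-1).
Proof. by apply: smooth_inv => //; [exact: smooth_a|move=> p /normal_S0[]]. Qed.

Lemma smooth_beta : smooth_on U (nbeta nu).
Proof. by apply: smooth_mul => //; [apply: smooth_pd; exact: smooth_a|exact: smooth_ainv]. Qed.

Lemma ax_v p : U p -> pd iv (pd ix (na nu)) p = 0.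
Proof. by move=> Up; rewrite (on_pdC oU iv ix smooth_a Up) (pd_eq_on ix oU a_v Up) pd_cst. Qed.

Lemma beta_v p : U p -> pd iv (nbeta nu) p = 0.
Proof.
move=> Up; have [_ _ a0 _ _] := normal_S0 Up.
rewrite (on_pdM _ (smooth_pd ix smooth_a) smooth_ainv Up) (on_pdV _ smooth_a Up a0).
have K (a b c d e : R) : d = 0 -> e = 0 -> a * (b * d) + c * e = 0 by move=> -> ->; ring.
exact: K (a_v Up) (ax_v Up).
Qed.

Lemma smooth_X : smooth_on U (fun p => I1 (jt nu p)).
Proof. exact: (IR_section N (@IR_I1 R)). Qed.

Lemma X_pd i p : U p -> pd i (fun q => I1 (jt nu q)) p = (i == ix)%:R.
Proof.
move=> Up; have [_ _ [c Ec] _ _] := N.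
rewrite (pd_eq_on i oU Ec Up) (on_pdD _ (smooth_coord ix oU) (smooth_cst c oU) Up).
by rewrite pd_coord pd_cst addr0.
Qed.

Lemma normal_j2 p : U p -> k2a (jt nu p) - na nu p * nu cW p = p 0 iv * (pd ix (na nu) p - na nu p * nW1 nu p).
Proof. by case: N => _ _ _ + _; apply. Qed.

Lemma along_nabla1 (f : V -> R) p : U p -> along (@nabla1r R) nu f p = ne nu p * fE f p.
Proof.
move=> Up; have [jx ju] := normal_jxu N Up; have [v0 d0 _] := normal_pt Up.
rewrite /along (nf_nabla1 d0 (normal_j1 N Up) jx ju (normal_j2 Up)).
by rewrite sum3 !row3E /fE; move: (pd iu f p) (pd ix f p) (pd iv f p) (p 0 iv) => *; rewrite /ne; ring.
Qed.

Lemma along_nabla2 (f : V -> R) p : U p -> along (@nabla2r R) nu f p = (nW1 nu p)^-1 * fF (nw0 nu) (nbeta nu) f p.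
Proof.
move=> Up; have [jx ju] := normal_jxu N Up; have [v0 d0 _] := normal_pt Up.
rewrite /along (nf_nabla2 d0 (normal_j2 Up)) sum3 !row3E mulr0 add0r /fF mulrN [_ * pd iv f p]mulrC.
rewrite -[jt nu p cW 0%N 0%N 1%N]/(nW1 nu p) -[jt nu p cH 0%N 1%N 2%N]/(pd ix (na nu) p).
rewrite -[I2a (jt nu p)]/(na nu p) -[jt nu p cW 0%N 0%N 0%N]/(nu cW p) -/(nbeta nu p) -/(nw0 nu p).
move: (nW1 nu p) (nw0 nu p) (nbeta nu p) (pd ix f p) (pd iv f p) (p 0 iv) => *; ring.
Qed.

Lemma along_nabla3 (f : V -> R) p : U p -> along (@nabla3r R) nu f p = - (2 / (I1 (jt nu p) * ne nu p)) * fG (nu cH) (nka nu) f p.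
Proof.
move=> Up; have [jx ju] := normal_jxu N Up; have [v0 d0 _] := normal_pt Up.
rewrite /along (nf_nabla3 d0 v0 (normal_j1 N Up) jx ju (normal_j2 Up)) sum3 !row3E mulr0 addr0 /fG.
rewrite -[jt nu p cH 0%N 0%N 0%N]/(nu cH p) -/(ne nu p) -/(nka nu p).
move: (pd iu f p) (pd iv f p) (2 / _) (nka nu p) (p 0 iv)^-1 (p 0 iv) (nu cH p) => *; ring.
Qed.

Lemma hderiv_along nab F p : Rat 2 F -> U p -> hderiv nab F (jt nu p) = along nab nu (fun q => F (jt nu q)) p.
Proof. by move=> HF Up; have [_ d0 _] := normal_pt Up; exact: (hderiv_section (leqnn 2) HF nab (normal_sol N Up) d0). Qed.

Lemma nI1_val p : U p -> nI1 (jt nu p) = (nW1 nu p)^-1.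
Proof.
move=> Up; rewrite /nI1 hderiv_along ?along_nabla2 //; last exact: Rat_I1.
by rewrite /fF !(X_pd _ Up) /= mulr0 subr0 mulr1.
Qed.

Lemma nI2a_val p : U p -> nI2a (jt nu p) = (nW1 nu p)^-1 * pd ix (na nu) p.
Proof.
move=> Up; rewrite /nI2a hderiv_along ?along_nabla2 //; last exact: Rat_I2a.
by rewrite /fF -/(na nu) (a_v Up) mulr0 subr0.
Qed.

Lemma nI2c_val p : U p -> nI2c (jt nu p) = ne nu p * fE (nJ nu) p.
Proof. by move=> Up; rewrite /nI2c hderiv_along ?along_nabla1 //; exact: Rat_I2cr. Qed.

Lemma ne_val p : U p -> ne nu p = (nI2a (jt nu p) - I2a (jt nu p)) / I2a (jt nu p).
Proof.
move=> Up; rewrite nI2a_val // /ne /nfe -[jt nu p cH 0%N 1%N 2%N]/(pd ix (na nu) p) -[I2a _]/(na nu p).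
rewrite -[jt nu p cW 0%N 0%N 1%N]/(nW1 nu p); have [_ _ a0 _ _] := normal_S0 Up; have w0 := normal_W1 Up.
by move: (na nu p) a0 (nW1 nu p) w0 => a a0 w w0; field; rewrite a0 w0.
Qed.

Lemma ne_neq0 p : U p -> ne nu p != 0.
Proof.
move=> Up; have [_ _ a0 e0 _] := normal_S0 Up.
by rewrite ne_val // mulf_neq0 // invr_eq0.
Qed.

End Values.

Local Notation gF F := (fun nu p => F (jt nu p)).

Lemma gen_I1 : gen (gF (@I1 R)). Proof. by apply: gen_subalg; apply: subalg_gen; exact: IR_I1. Qed.
Lemma gen_I2a : gen na. Proof. by apply: (@gen_subalg R (@I2a R)); apply: subalg_gen; exact: IR_I2a. Qed.
Lemma gen_J : gen nJ. Proof. by apply: (@gen_subalg R (@I2cr R)); apply: subalg_gen; exact: IR_I2cr. Qed.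

Ltac sa := do ?[apply: subalg_gen; by [exact: IR_I1|exact: IR_I2a|exact: IR_I2cr|exact: IR_nI1|exact: IR_nI2a|exact: IR_nI2c]
  |apply: subalg_opp|apply: subalg_add|apply: subalg_mul|exact: subalg_cst].

Lemma gen_I1_inv : gen (fun nu p => (I1 (jt nu p))^-1).
Proof.
apply: (@gen_inv R (@I1 R) (fun th => nI1 th * I2a th * (nI2a th - I2a th) * nI2c th)); first by sa.
by move=> th; rewrite /S0; ring.
Qed.

(** Since x is [I1] up to a constant, differentiating [I1] along [nabla_2] gives [1 / W_v]. *)
Lemma gen_W1 : gen nW1.
Proof.
have H : gen (fun nu p => (nI1 (jt nu p))^-1).
  apply: (@gen_inv R (@nI1 R) (fun th => I1 th * I2a th * (nI2a th - I2a th) * nI2c th)); first by sa.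
  by move=> th; rewrite /S0; ring.
by apply: gen_ext H => nu U p N Up; rewrite (nI1_val N Up) invrK.
Qed.

Lemma gen_I2a_inv : gen (fun nu p => (na nu p)^-1).
Proof.
apply: (@gen_inv R (@I2a R) (fun th => nI1 th * I1 th * (nI2a th - I2a th) * nI2c th)); first by sa.
by move=> th; rewrite /S0; ring.
Qed.

Lemma gen_e : gen ne.
Proof.
have H : gen (gF (fun th => nI2a th - I2a th)) by apply: (@gen_subalg R (fun th => nI2a th - I2a th)); sa.
by apply: gen_ext (gen_mul H gen_I2a_inv) => nu U p N Up; rewrite (ne_val N Up).
Qed.

Lemma gen_e_inv : gen (fun nu p => (ne nu p)^-1).
Proof.
have H : gen (fun nu p => (nI2a (jt nu p) - I2a (jt nu p))^-1).
  apply: (@gen_inv R (fun th => nI2a th - I2a th) (fun th => nI1 th * I1 th * I2a th * nI2c th)); first by sa.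
  by move=> th; rewrite /S0; ring.
by apply: gen_ext (gen_mul H gen_I2a) => nu U p N Up; rewrite (ne_val N Up) invf_div mulrC.
Qed.

Lemma gen_beta : gen nbeta.
Proof.
have H : gen (gF (@nI2a R)) by apply: gen_subalg; sa.
apply: gen_ext (gen_mul (gen_mul H gen_W1) gen_I2a_inv) => nu U p N Up.
by rewrite (nI2a_val N Up) [_^-1 * _]mulrC divfK // (normal_W1 N Up).
Qed.

Lemma gen_ka : gen nka.
Proof.
by apply: gen_ext (gen_mul (gen_mul gen_I1 (gen_mul gen_e gen_e)) (gen_cst 4^-1)) => nu U p _ _.
Qed.

Lemma gen_E f : gen f -> gen (fun nu => fE (f nu)).
Proof.
move=> Hf; apply: gen_ext (gen_mul (gen_along (@iteratedR_nabla1 R) Hf) gen_e_inv) => nu U p N Up.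
by rewrite (along_nabla1 N) // mulrAC mulfV ?mul1r // (ne_neq0 N Up).
Qed.

Lemma gen_F f : gen f -> gen (fun nu => fF (nw0 nu) (nbeta nu) (f nu)).
Proof.
move=> Hf; apply: gen_ext (gen_mul gen_W1 (gen_along (@iteratedR_nabla2 R) Hf)) => nu U p N Up.
by rewrite (along_nabla2 N) // mulrA mulfV ?mul1r // (normal_W1 N Up).
Qed.

Lemma gen_G f : gen f -> gen (fun nu => fG (nu cH) (nka nu) (f nu)).
Proof.
move=> Hf; apply: gen_ext (gen_mul (gen_mul (gen_cst (- (1/2))) (gen_mul gen_I1 gen_e)) (gen_along (@iteratedR_nabla3 R) Hf)) => nu U p N Up.
rewrite (along_nabla3 N) //; have e0 := ne_neq0 N Up; have [_ x0 _ _ _] := normal_S0 N Up.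
by move: (fG _ _ _ _) (ne nu p) e0 (I1 _) x0 => g e e0 x x0; field; rewrite e0 x0.
Qed.

Lemma gen_EJ_inv : gen (fun nu p => (fE (nJ nu) p)^-1).
Proof.
have H : gen (fun nu p => (nI2c (jt nu p))^-1).
  apply: (@gen_inv R (@nI2c R) (fun th => nI1 th * I1 th * I2a th * (nI2a th - I2a th))); first by sa.
  by move=> th; rewrite /S0; ring.
apply: gen_ext (gen_mul gen_e H) => nu U p N Up.
by rewrite (nI2c_val N Up) invfM mulrA mulfV ?mul1r // (ne_neq0 N Up).
Qed.

Lemma EJ_neq0 nu U p : normal nu U -> U p -> fE (nJ nu) p != 0.
Proof.
move=> N Up; have [_ _ _ _] := normal_S0 N Up; rewrite (nI2c_val N Up).
by rewrite mulf_eq0 negb_or => /andP[].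
Qed.

Definition nw nu p : R := nw0 nu p / p 0 iv.

(** On [nJ] the commutator of [commutator_EF] is [nw0] times the v-derivative, so the quotient by
    [fE (nJ nu)] is [nw0 / v]. *)
Lemma gen_w : gen nw.
Proof.
have H := gen_mul (gen_add (gen_E (gen_F gen_J)) (gen_opp (gen_F (gen_E gen_J)))) gen_EJ_inv.
apply: gen_ext H => nu U p N Up; have oU := normal_open N.
rewrite (commutator_EF oU (smooth_w0 N) (smooth_beta N) (gen_smooth N gen_J) (w0_v N) (beta_v N) Up).
have := EJ_neq0 N Up; rewrite /fE /nw mulf_eq0 negb_or => /andP[v0 J0].
by move: (nw0 nu p) (p 0 iv) v0 (pd iv _ _) J0 => w v v0 j j0; field; rewrite v0 j0.
Qed.

(** If [H = H0 + H1 * v + a * v ^+ 2 / 2], this is [H0 / v ^+ 2 - a / 2]. The part [H1] cancels, so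
    it has to be carried along separately. *)
Definition nr nu p : R := nu cH p / p 0 iv ^+ 2 - pd iv (nu cH) p / p 0 iv.

Lemma nka_v nu U p : normal nu U -> U p -> pd iv (nka nu) p = 0.
Proof.
move=> N Up; have oU := normal_open N.
have se : smooth_on U (fun q => nbeta nu q / nW1 nu q).
  apply: smooth_mul => //; first exact: smooth_beta.
  by apply: smooth_inv => //; [exact: smooth_W1|move=> q; exact: normal_W1].
have sX := smooth_X N; have s1 := smooth_cst (1 : R) oU; have s4 := smooth_cst (4^-1 : R) oU.
have se' : smooth_on U (fun q => nbeta nu q / nW1 nu q - 1) by apply: smooth_add => //; exact: smooth_cst.
have see := smooth_mul oU se' se'.
have E q : U q -> nka nu q = I1 (jt nu q) * ((nbeta nu q / nW1 nu q - 1) * (nbeta nu q / nW1 nu q - 1)) * 4^-1.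
  move=> Uq; rewrite /nka /ne /nfe -[jt nu q cH 0%N 1%N 2%N]/(pd ix (na nu) q) -[I2a _]/(na nu q).
  by rewrite -[jt nu q cW 0%N 0%N 1%N]/(nW1 nu q) /nbeta invfM expr2 -!mulrA.
have e0 : pd iv (fun q => nbeta nu q / nW1 nu q - 1) p = 0.
  rewrite (on_pdB _ se s1 Up) (on_pdM _ (smooth_beta N) _ Up); last first.
    by apply: smooth_inv => //; [exact: smooth_W1|move=> q; exact: normal_W1].
  by rewrite (on_pdV _ (smooth_W1 N) Up (normal_W1 N Up)) (W1_v N Up) (beta_v N Up) pd_cst !mulr0 addr0 subr0.
rewrite (pd_eq_on iv oU E Up) (on_pdM _ (smooth_mul oU sX see) s4 Up) (on_pdM _ sX see Up) (on_pdM _ se' se' Up).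
by rewrite e0 (X_pd N _ Up) pd_cst /= !(mulr0, addr0, add0r).
Qed.

Lemma gen_r : gen nr.
Proof.
have H := gen_mul (gen_add (gen_add (gen_E (gen_G gen_J)) (gen_opp (gen_G (gen_E gen_J)))) (gen_G gen_J)) gen_EJ_inv.
apply: gen_ext (gen_add H (gen_opp gen_ka)) => nu U p N Up; have oU := normal_open N.
rewrite (commutator_EG oU (v_neq0 N) (normal_smooth cH N) (gen_smooth N gen_ka) (gen_smooth N gen_J) _ Up) => [|q Uq]; last exact: nka_v N Uq.
have := EJ_neq0 N Up; rewrite /fE /nr mulf_eq0 negb_or => /andP[v0 J0].
by move: (nka nu p) (p 0 iv) v0 (pd iv (nJ _) _) J0 (pd iv _ _) (nu cH p) => w v v0 j j0 h h'; field; rewrite v0 j0.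
Qed.

(* Besides the generators this algebra needs only [v], its inverse and the
   u-derivatives of [nH1] to be closed under total derivatives: by [H1_x] the
   x-derivative of [nH1] is expressible. *)
Inductive nf_alg : (sect -> V -> R) -> Prop :=
| nf_alg_gen f : gen f -> nf_alg f
| nf_alg_v : nf_alg (fun _ p => p 0 iv)
| nf_alg_vinv : nf_alg (fun _ p => (p 0 iv)^-1)
| nf_alg_H1 i : nf_alg (fun nu => pderiv (nseq i iu) (nH1 nu))
| nf_alg_add f g : nf_alg f -> nf_alg g -> nf_alg (fun nu p => f nu p + g nu p)
| nf_alg_mul f g : nf_alg f -> nf_alg g -> nf_alg (fun nu p => f nu p * g nu p)
| nf_alg_ext f g : (forall nu U p, normal nu U -> U p -> f nu p = g nu p) -> nf_alg f -> nf_alg g.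

Lemma smooth_H1 nu U : normal nu U -> smooth_on U (nH1 nu).
Proof.
move=> N; have oU := normal_open N; apply: smooth_add => //; first by apply: smooth_pd; exact: normal_smooth N.
by apply: smooth_opp => //; apply: smooth_mul => //; [exact: smooth_coord|exact: smooth_a].
Qed.

Lemma nf_alg_smooth f nu U : nf_alg f -> normal nu U -> smooth_on U (f nu).
Proof.
move=> Hf N; have oU := normal_open N; elim: Hf => {f} [f Hf| | |i|f g _ sf _ sg|f g _ sf _ sg|f g E _ sf].
- exact: gen_smooth N Hf.
- exact: smooth_coord.
- exact: (smooth_vinv oU (v_neq0 N)).
- by apply: smooth_pderiv; exact: smooth_H1.
- exact: smooth_add.
- exact: smooth_mul.
- by apply: (smooth_eq oU sf) => p Up; exact: E N Up.
Qed.

Lemma nf_alg_opp f : nf_alg f -> nf_alg (fun nu p => - f nu p).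
Proof. by move=> Hf; apply: nf_alg_ext (nf_alg_mul (nf_alg_gen (gen_cst (-1))) Hf) => nu U p _ _; rewrite mulN1r. Qed.

Lemma nf_alg_pd_alg i : (forall f, gen f -> nf_alg (fun nu => pd i (f nu))) ->
  (forall n, nf_alg (fun nu => pd i (pderiv (nseq n iu) (nH1 nu)))) ->
  forall f, nf_alg f -> nf_alg (fun nu => pd i (f nu)).
Proof.
move=> Hg HH f; elim=> {f} [f Hf| | |n|f g Hf If Hg' Ig|f g Hf If Hg' Ig|f g E Hf If].
- exact: Hg.
- by apply: nf_alg_ext (nf_alg_gen (gen_cst (i == iv)%:R)) => nu U p _ _; rewrite pd_coord.
- apply: nf_alg_ext (nf_alg_mul (nf_alg_gen (gen_cst (- (i == iv)%:R))) (nf_alg_mul nf_alg_vinv nf_alg_vinv)) => nu U p N Up.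
  have oU := normal_open N.
  by rewrite (on_pdV _ (smooth_v oU) Up (v_neq0 N Up)) pd_coord -invfM -expr2 mulrC mulrN mulNr.
- exact: HH.
- apply: nf_alg_ext (nf_alg_add If Ig) => nu U p N Up.
  by rewrite (on_pdD _ (nf_alg_smooth Hf N) (nf_alg_smooth Hg' N) Up).
- apply: nf_alg_ext (nf_alg_add (nf_alg_mul Hf Ig) (nf_alg_mul Hg' If)) => nu U p N Up.
  by rewrite (on_pdM _ (nf_alg_smooth Hf N) (nf_alg_smooth Hg' N) Up).
- by apply: nf_alg_ext If => nu U p N Up; exact: pd_eq_on (normal_open N) (fun q => E nu U q N) Up.
Qed.

Lemma H1_v nu U p : normal nu U -> U p -> pd iv (nH1 nu) p = 0.
Proof.
move=> N Up; have oU := normal_open N; have sH := normal_smooth cH N.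
rewrite (on_pdB _ (smooth_pd iv sH) (smooth_mul oU (smooth_v oU) (smooth_a N)) Up).
by rewrite (on_pdM _ (smooth_v oU) (smooth_a N) Up) (a_v N Up) pd_coord /= mulr0 add0r mulr1 subrr.
Qed.

Lemma nf_alg_pd_v f : nf_alg f -> nf_alg (fun nu => pd iv (f nu)).
Proof.
apply: nf_alg_pd_alg => {}f => [Hf|].
  apply: nf_alg_ext (nf_alg_mul nf_alg_vinv (nf_alg_gen (gen_E Hf))) => nu U p N Up.
  by rewrite /fE mulKf // (v_neq0 N Up).
apply: nf_alg_ext (nf_alg_gen (gen_cst 0)) => nu U p N Up; have oU := normal_open N.
by rewrite (pd_pderivC _ _ oU (smooth_H1 N) Up) (pderiv0 _ oU (fun q => @H1_v nu U q N) Up).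
Qed.

Lemma nf_alg_H : nf_alg (fun nu => nu cH).
Proof.
have Mv2 := nf_alg_mul nf_alg_v nf_alg_v.
apply: nf_alg_ext (nf_alg_add (nf_alg_mul Mv2 (nf_alg_gen gen_r)) (nf_alg_mul nf_alg_v (nf_alg_add (nf_alg_H1 0) (nf_alg_mul nf_alg_v (nf_alg_gen gen_I2a))))) => nu U p N Up.
rewrite /= /nr /nH1; have := v_neq0 N Up; move: (p 0 iv) (na nu p) (pd iv _ p) (nu cH p) => v a h h' v0.
by field.
Qed.

Lemma nf_alg_pd_u f : nf_alg f -> nf_alg (fun nu => pd iu (f nu)).
Proof.
apply: nf_alg_pd_alg => {}f => [Hf|]; last exact: (nf_alg_H1 f.+1).
have M1 := nf_alg_add (nf_alg_mul (nf_alg_gen gen_ka) nf_alg_v) (nf_alg_opp (nf_alg_mul nf_alg_H nf_alg_vinv)).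
apply: nf_alg_ext (nf_alg_add (nf_alg_mul nf_alg_v (nf_alg_gen (gen_G Hf))) (nf_alg_opp (nf_alg_mul M1 (nf_alg_gen (gen_E Hf))))) => nu U p N Up.
rewrite /fG /fE; have := v_neq0 N Up; move: (p 0 iv) (nka nu p) (pd iv _ p) (pd iu _ p) (nu cH p) => v a h h' H v0.
by field.
Qed.

(** The normalisation of v determines [H_xv], hence the x-derivative of [H1], as the sum of the
    u-derivative of [W_v] and [na * nw0]. The right-hand side writes this sum with generated
    quantities, using that [W_v] is free of v. *)
Lemma H1_x nu U p : normal nu U -> U p ->
  pd ix (nH1 nu) p = p 0 iv * (fG (nu cH) (nka nu) (nW1 nu) p + na nu p * nw nu p).
Proof.
move=> N Up; have oU := normal_open N; have sH := normal_smooth cH N; have v0 := v_neq0 N Up.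
rewrite (on_pdB _ (smooth_pd iv sH) (smooth_mul oU (smooth_v oU) (smooth_a N)) Up).
rewrite (on_pdM _ (smooth_v oU) (smooth_a N) Up) pd_coord /= mulr0 addr0 /fG (W1_v N Up) mulr0 addr0.
have -> : p 0 iv * ((p 0 iv)^-1 * pd iu (nW1 nu) p + na nu p * nw nu p) = pd iu (nW1 nu) p + na nu p * nw0 nu p.
  by rewrite /nw; move: (pd iu _ p) (na nu p) (nw0 nu p) (p 0 iv) v0 => x y z v v0; field.
have := normal_j2 N Up; rewrite /k2a -[jt nu p cH 0%N 1%N 1%N]/(pd ix (pd iv (nu cH)) p).
rewrite -[jt nu p cW 1%N 0%N 1%N]/(pd iu (nW1 nu) p) /nw0.
move: (pd ix (na nu) p) (pd iu _ p) (pd ix _ p) (na nu p) (nu cW p) (nW1 nu p) (p 0 iv) => c b a d e f g E.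
have -> : a = (a - b - d * e) + b + d * e by ring.
by rewrite E; ring.
Qed.

Lemma nf_alg_pd_x f : nf_alg f -> nf_alg (fun nu => pd ix (f nu)).
Proof.
apply: nf_alg_pd_alg => {}f => [Hf|].
  apply: nf_alg_ext (nf_alg_gen (gen_add (gen_F Hf) (gen_mul (gen_add gen_w gen_beta) (gen_E Hf)))) => nu U p N Up.
  rewrite /fF /fE /nw; have := v_neq0 N Up; move: (p 0 iv) (nw0 nu p) (pd iv _ p) (pd ix _ p) (nbeta nu p) => v a h h' H v0.
  by field.
have M0 : nf_alg (fun nu => pd ix (nH1 nu)).
  have M1 := nf_alg_mul nf_alg_v (nf_alg_gen (gen_add (gen_G gen_W1) (gen_mul gen_I2a gen_w))).
  by apply: nf_alg_ext M1 => nu U p N Up; rewrite (H1_x N Up).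
have M n : nf_alg (fun nu => pderiv (nseq n iu) (pd ix (nH1 nu))).
  by elim: n => [|n IH] //; exact: nf_alg_pd_u IH.
by apply: nf_alg_ext (M f) => nu U p N Up; rewrite (pd_pderivC _ _ (normal_open N) (smooth_H1 N) Up).
Qed.

Lemma nf_alg_comp c : nf_alg (fun nu => nu c).
Proof.
case: c; first exact: nf_alg_H.
- apply: nf_alg_ext (nf_alg_mul nf_alg_v (nf_alg_gen (gen_add gen_w gen_W1))) => nu U p N Up.
  by rewrite /nw /nw0; have := v_neq0 N Up; move: (p 0 iv) (nu cW p) (nW1 nu p) => v a b v0; field.
- apply: nf_alg_ext (nf_alg_gen (gen_mul (gen_mul gen_W1 gen_W1) gen_I1_inv)) => nu U p N Up.
  have := normal_j1 N Up; have [_ x0 _ _ _] := normal_S0 N Up.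
  rewrite -[jt nu p cW 0%N 0%N 1%N]/(nW1 nu p) -[jt nu p ch _ _ _]/(nu ch p) expr2 => ->.
  by rewrite mulrC mulKf.
Qed.

Lemma nf_alg_pderiv s f : nf_alg f -> nf_alg (fun nu => pderiv s (f nu)).
Proof.
move=> Hf; elim: s => [//|i s IH] /=.
by case: (ax_cases i) => ->; [exact: nf_alg_pd_u IH|exact: nf_alg_pd_x IH|exact: nf_alg_pd_v IH].
Qed.

(** Setting v to 1 and the u-derivatives of [nH1] to 0 removes exactly those generators of [nf_alg]
    that are not expressed by invariants. *)
Lemma nf_alg_eval f : nf_alg f -> exists n P, subalg IR P /\ forall nu U p, normal nu U -> U p -> p 0 iv = 1 ->
  (forall i, pderiv (nseq i iu) (nH1 nu) p = 0) -> f nu p * S0 (jt nu p) ^+ n = P (jt nu p).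
Proof.
elim=> {f} [f [n [P [HP E]]]| | |i|f g _ [n [P [HP E]]] _ [m [Q [HQ E']]]|f g _ [n [P [HP E]]] _ [m [Q [HQ E']]]|f g E' _ [n [P [HP E]]]].
- by exists n, P; split=> // nu U p N Up _ _; exact: E N Up.
- by exists 0%N, (fun=> 1); split=> [|nu U p _ _ -> _]; [exact: subalg_cst|rewrite expr0 mulr1].
- by exists 0%N, (fun=> 1); split=> [|nu U p _ _ -> _]; [exact: subalg_cst|rewrite expr0 mulr1 invr1].
- by exists 0%N, (fun=> 0); split=> [|nu U p _ _ _ ->]; [exact: subalg_cst|rewrite mul0r].
- exists (n + m)%N, (fun th => P th * S0 th ^+ m + Q th * S0 th ^+ n); split.
    by apply: subalg_add; apply: subalg_mul => //; apply: subalg_exp; exact: subalg_S0.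
  by move=> nu U p N Up v1 h1; rewrite -(E _ _ _ N Up) // -(E' _ _ _ N Up) // exprD; ring.
- exists (n + m)%N, (fun th => P th * Q th); split; first exact: subalg_mul.
  by move=> nu U p N Up v1 h1; rewrite -(E _ _ _ N Up) // -(E' _ _ _ N Up) // exprD; ring.
- by exists n, P; split=> // nu U p N Up v1 h1; rewrite -(E' _ _ _ N Up) (E _ _ _ N Up).
Qed.

(* At a point with [v = 1] where [nH1] is flat in the direction [u], the whole jet
   of a normal section is a rational function of the iterated derivatives. *)
Lemma normal_jet c i j l : exists n P, subalg IR P /\ forall nu U p, normal nu U -> U p -> p 0 iv = 1 ->
  (forall i, pderiv (nseq i iu) (nH1 nu) p = 0) -> jt nu p c i j l * S0 (jt nu p) ^+ n = P (jt nu p).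
Proof. exact: nf_alg_eval (nf_alg_pderiv (nseq i iu ++ nseq j ix ++ nseq l iv) (nf_alg_comp c)). Qed.

End Generation.

(** * Pushing a solution forward to a normal section *)

Section Pushforward.
Context {R : realType}.
Local Notation V := 'rV[R]_3.
Local Notation sect := (Defs.comp -> V -> R).
Implicit Types (th : jet R) (s nu : sect) (U : set V) (a p q : V) (phi psi : V -> V).

(** By [rho_affine] this differs from v by a function of u and x, and its value before a
    transformation is [C'] times the value after it. It thus behaves like the coordinate v and can
    replace it. *)
Definition rho th : R := kq th / (I2b th * (th cW 0%N 0%N 1%N * (nI2a th - I2a th))).

Lemma denrE th : th ch 0%N 0%N 0%N != 0 -> denr th =
  th cW 0%N 0%N 1%N * th ch 0%N 0%N 0%N * I2a th * (I2b th * th ch 0%N 0%N 0%N ^+ 2) * (kq th * th ch 0%N 0%N 0%N ^+ 2).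
Proof. by move=> h0; rewrite /denr /kq /I2b /k2b /k2a /kqn /I2bn /I2a; field. Qed.

(** The exponent 12 of [A_x] is the sum of 1 for [W_v], 2 for [h], 4 for [I2b * h ^+ 2] and 5 for
    [kq * h ^+ 2]; the last also contributes the factor [C']. *)
Lemma tr_denr gj (v : R) th : gj 0%N 1%N 0%N 0%N != 0 -> gj 1%N 0%N 1%N 0%N != 0 -> th ch 0%N 0%N 0%N != 0 ->
  denr (pj gj v (gj 0%N 1%N 0%N 0%N)^-1 th) != 0 -> denr th != 0.
Proof.
move=> c0 a0 h0; have h0' : pj gj v (gj 0%N 1%N 0%N 0%N)^-1 th ch 0%N 0%N 0%N != 0.
  by rewrite (tr_h _ v) !mulf_neq0.
have -> : denr (pj gj v (gj 0%N 1%N 0%N 0%N)^-1 th) = denr th * (gj 0%N 1%N 0%N 0%N * gj 1%N 0%N 1%N 0%N ^+ 12).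
  by rewrite (denrE h0') (denrE h0) tr_Wv // tr_h // tr_I2a // tr_I2b // tr_kq //; ring.
by rewrite mulf_eq0 negb_or => /andP[].
Qed.

Lemma Rinv_S0 : Rinv 3 (@S0 R).
Proof.
have [_ H1] := iteratedR_Rat (iteratedR_nabla2 (@iteratedR_I1 R)).
have [_ H2] := iteratedR_Rat (iteratedR_nabla2 (@iteratedR_I2a R)).
have [_ H3] := iteratedR_Rat (iteratedR_nabla1 (@iteratedR_I2cr R)).
have J1 := Rinv_le (leqnSn 2) (@Rinv_I1 R); have J2 := Rinv_le (leqnSn 2) (@Rinv_I2a R).
move=> phi th th' E E' G pr d d'; rewrite /S0 /nI1 /nI2a /nI2c.
by rewrite (H1 _ _ _ E E' G pr d d') (H2 _ _ _ E E' G pr d d') (H3 _ _ _ E E' G pr d d') (J1 _ _ _ E E' G pr d d') (J2 _ _ _ E E' G pr d d').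
Qed.

Definition gaugej C A B p (t : jet R) : jet R :=
  Jet p (pj (fun k i j l => pderiv (nseq i iu ++ nseq j ix ++ nseq l iv) (gfun C A B k) p) (p 0 iv) (pd iu (hat1 C) p)^-1 t).

Lemma rel_sect_inv a phi psi s nu : in_G a phi -> in_G (phi a) psi ->
  (\forall p \near a, psi (phi p) = p) -> rel_sect (phi a) psi nu s -> rel_sect a phi s nu.
Proof.
move=> Gphi Gpsi pp rel.
near=> p => xi; have Gp : in_G p phi by near: p; exact: in_G_near.
have Gq : in_G (phi p) psi by near: p; exact: (in_G_cvg Gphi (in_G_near Gpsi)).
have r1 : forall xi : V, kundt (s ^~ (psi (phi p))) ('d psi (phi p) xi) = kundt (nu ^~ (phi p)) xi.
  by near: p; exact: (in_G_cvg Gphi rel).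
have np : \forall q \near p, psi (phi q) = q by near: p; exact: near2.
have [dc Hc] := @is_diff_comp _ _ _ _ phi _ psi _ p (differentiableP (in_G_diff Gp)) (differentiableP (in_G_diff Gq)).
rewrite -r1 (nbhs_singleton np); congr (kundt _ _).
rewrite -[LHS]/(('d psi (phi p) \o 'd phi p) xi) -Hc (near_eq_d xi (psi := id)) //.
by rewrite diff_val.
Unshelve. all: by end_near.
Qed.

(** The section is pulled back by the inverse transformation. It is then related to [s] by the
    transformation itself, so [pj_pull] gives the old jets in terms of the new ones. *)
Lemma push U C A B a s : gauge U C A B -> U a -> sol_near a s -> exists nu, [/\ sol_near (gmap C A B a) nu,
  rel_sect a (gmap C A B) s nu & \forall p \near a, jt s p = gaugej C A B p (jt nu (gmap C A B p))].
Proof.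
move=> G Ua sa; set phi := gmap C A B.
have Gphi : in_G a phi by apply/in_GP; exists U, C, A, B.
have [psi [Gpsi pp qq]] := in_G_inv Gphi; have pa := nbhs_singleton pp.
have sa' : sol_near (psi (phi a)) s by rewrite pa.
have [nu [sn rel sol]] := pull_ex Gpsi (sol_section sa'); have nsol := sol sa'.
have rel' := rel_sect_inv Gphi Gpsi pp rel.
exists nu; split=> //.
have [W [[oW sW _] EW Wa]] := nsol.
have [U1 [oU1 U1a H1]] := near_open (gmap_near G Ua (open_near oW Wa)).
have oU : open (U `&` U1) by apply: openI => //; case: G.
have GU : gauge (U `&` U1) C A B by apply: gauge_sub G => // p [].
have Ua1 : (U `&` U1) a by [].
have /near2 E := (rel_pull s nu GU Ua1 (fun p _ => erefl (gmap C A B p))).1 rel'.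
apply: filterS (filterI E (open_near oU Ua1)) => p [Ep Up].
rewrite (near_eq_jt Ep) /gaugej; congr Jet.
apply/funext => c; apply/funext => i; apply/funext => j; apply/funext => l.
by apply: (pj_pull c i j l GU Up oW) => // q [_ /H1].
Qed.

Lemma hderiv_nabla2r F p s : Rat 2 F -> sol_near p s -> denr (jt s p) != 0 ->
  pd iv (fun q => F (jt s q)) p = 0 ->
  hderiv (@nabla2r R) F (jt s p) = (jt s p cW 0%N 0%N 1%N)^-1 * pd ix (fun q => F (jt s q)) p.
Proof.
move=> HF sp d0 e; have E := hderiv_section (leqnn 2) HF (@nabla2r R) sp d0.
have n1 : nabla2r (jt s p) 0 iu = 0 by exact: row3u.
have n2 : nabla2r (jt s p) 0 ix = 1 / jt s p cW 0%N 0%N 1%N by exact: row3x.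
have K (x y z t w : R) : z = 0 -> x * 0 + y * (1 / w) + z * t = w^-1 * y by move=> ->; ring.
by rewrite E sum3 n1 n2; exact: K e.
Qed.

Lemma nI2a_sol p s : sol_near p s -> denr (jt s p) != 0 ->
  nI2a (jt s p) = (jt s p cW 0%N 0%N 1%N)^-1 * jt s p cH 0%N 1%N 2%N.
Proof.
move=> sp d0; apply: (hderiv_nabla2r (@Rat_I2a R 2 isT) sp d0).
by have [U [_ Es Up]] := sp; exact: (Es cH).
Qed.

(** If [k2b] vanishes, the numerator of [rho] is [I2b] times the left-hand side of the normalisation
    of v, and the denominator is [I2b] times the factor of v on the right. *)
Lemma k2a_rho p s : sol_near p s -> denr (jt s p) != 0 -> S0 (jt s p) != 0 -> k2b (jt s p) = 0 ->
  rho (jt s p) = p 0 iv <-> k2a (jt s p) - I2a (jt s p) * jt s p cW 0%N 0%N 0%N =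
     p 0 iv * (jt s p cH 0%N 1%N 2%N - I2a (jt s p) * jt s p cW 0%N 0%N 1%N).
Proof.
move=> sp d0 s0 k0; have [w0 h0 a0 b0 _] := denr_neq0 d0.
have e0 : nI2a (jt s p) - I2a (jt s p) != 0.
  by apply: contraNneq s0 => e0; rewrite /S0 e0 mulr0 mul0r.
rewrite /rho /kq k0; rewrite nI2a_sol // in e0 *.
move: (jt s p cH 0%N 1%N 2%N) (k2a _) (jt s p cW 0%N 0%N 0%N) (jt s p cW 0%N 0%N 1%N) w0 (I2a _) a0 e0 (I2b _) b0 (p 0 iv).
move=> hh ka W w w0 a a0 e0 b b0 v.
have E : w * (w^-1 * hh - a) = hh - a * w by field.
have e1 : hh - a * w != 0 by rewrite -E mulf_neq0.
have -> : (2 * a * 0 + b * ka - a * b * W) / (b * (w * (w^-1 * hh - a))) = (ka - a * W) / (hh - a * w).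
  by rewrite E; field; rewrite e1 b0.
by split=> [<-|->]; [rewrite divfK|rewrite mulfK].
Qed.

Lemma normal_rho nu U p : normal nu U -> U p -> rho (jt nu p) = p 0 iv.
Proof.
move=> N Up; have [_ _ _ j2 /(_ p Up)[v0 d0 s0]] := N.
have [jx ju] := normal_jxu N Up; apply/(k2a_rho (normal_sol N Up) d0 s0) => //; last exact: j2.
exact: nf_k2b d0 (normal_j1 N Up) ju.
Qed.

Lemma S0_near a s : sol_near a s -> denr (jt s a) != 0 -> S0 (jt s a) != 0 -> \forall p \near a, S0 (jt s p) != 0.
Proof.
move=> sa d0 s0.
have sS : smooth_near a (fun p => S0 (jt s p)).
  have N1 t F : iteratedR t F -> smooth_near a (fun p => F (jt s p)).
    by move=> /iteratedR_Rat[HR _]; have t2 : (2 <= t.+2)%N by []; exact: Rat_section t2 HR _ _ sa d0.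
  have M f g : smooth_near a f -> smooth_near a g -> smooth_near a (fun p => f p * g p).
    move=> /smooth_nearP[U1 [Uo1 a1 s1]] /smooth_nearP[U2 [Uo2 a2 s2]]; apply/smooth_nearP.
    exists (U1 `&` U2); split=> //; first exact: openI.
    apply: smooth_mul; [exact: openI|apply: smooth_sub s1|apply: smooth_sub s2]; by move=> p [].
  have S f g : smooth_near a f -> smooth_near a g -> smooth_near a (fun p => f p - g p).
    move=> /smooth_nearP[U1 [Uo1 a1 s1]] /smooth_nearP[U2 [Uo2 a2 s2]]; apply/smooth_nearP.
    have oo := openI Uo1 Uo2; exists (U1 `&` U2); split=> //.
    apply: smooth_add => //; [apply: smooth_sub s1|apply: smooth_opp => //; apply: smooth_sub s2]; by move=> p [].
  apply: (M _ _); last exact: (N1 _ _ (iteratedR_nabla1 (@iteratedR_I2cr R))).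
  apply: (M _ _); last by apply: (S _ _); [exact: (N1 _ _ (iteratedR_nabla2 (@iteratedR_I2a R)))|exact: (N1 _ _ (@iteratedR_I2a R))].
  apply: (M _ _); last exact: (N1 _ _ (@iteratedR_I2a R)).
  by apply: (M _ _); [exact: (N1 _ _ (iteratedR_nabla2 (@iteratedR_I1 R)))|exact: (N1 _ _ (@iteratedR_I1 R))].
have /smooth_nearP[U1 [Uo1 a1 s1]] := sS.
exact: (neq0_near (smooth_diff s1 a1) s0).
Qed.

(** [I1] is invariant and [rho] is scaled by [C'], so the two conditions on [A] and on the new v say
    that at the image point [I1] is x up to a constant and [rho] is v. *)
Lemma push_normal U C A B a s (c : R) : gauge U C A B -> U a -> sol_near a s ->
  denr (jt s a) != 0 -> S0 (jt s a) != 0 ->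
  (\forall p \near a, I1 (jt s p) = hat2 A p + c) ->
  (\forall p \near a, rho (jt s p) = pd iu (hat1 C) p * gmap C A B p 0 iv) ->
  exists nu W, [/\ normal nu W, W (gmap C A B a), forall n, prolong n (gmap C A B) (jt s a) (jt nu (gmap C A B a)) &
    \forall p \near a, jt s p = gaugej C A B p (jt nu (gmap C A B p))].
Proof.
move=> G Ua sa d0 s0 HI Hr; have [oU sC sA sB D0] := G.
have [nu [nsol rel J]] := push G Ua sa; set phi := gmap C A B in nsol rel J *.
have Gphi : in_G a phi by apply/in_GP; exists U, C, A, B.
have [psi [Gpsi pp qq]] := in_G_inv Gphi; have pa := nbhs_singleton pp.
have [W0 [[oW0 ss h0] Es W0a]] := nsol.
pose good p := [/\ sol_near p s, sol_near (phi p) nu, denr (jt s p) != 0 & S0 (jt s p) != 0].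
have ng : \forall p \near a, [/\ U p, sol_near p s, sol_near (phi p) nu & denr (jt s p) != 0] /\
   [/\ S0 (jt s p) != 0, I1 (jt s p) = hat2 A p + c, rho (jt s p) = pd iu (hat1 C) p * phi p 0 iv,
    jt s p = gaugej C A B p (jt nu (phi p)) & rel_sect p phi s nu].
  have nS := S0_near sa d0 s0.
  near=> p; split; split; near: p => //.
  - exact: open_near oU Ua.
  - exact: sol_near_near.
  - exact: (gmap_near G Ua (sol_near_near nsol)).
  - exact: denr_section.
  - exact: near2.
have := in_G_cvg Gpsi; rewrite -/phi => cv.
(* The conditions hold near [a]; the inverse [psi] carries them to a neighbourhood of the image,
   where normality has to be verified. *)
have ng' : \forall q \near phi a, [/\ W0 q, phi (psi q) = q & [/\ U (psi q), sol_near (psi q) s, sol_near (phi (psi q)) nu & denr (jt s (psi q)) != 0] /\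
   [/\ S0 (jt s (psi q)) != 0, I1 (jt s (psi q)) = hat2 A (psi q) + c,
     rho (jt s (psi q)) = pd iu (hat1 C) (psi q) * phi (psi q) 0 iv,
     jt s (psi q) = gaugej C A B (psi q) (jt nu (phi (psi q))) & rel_sect (psi q) phi s nu]].
  have ng2 := ng; rewrite -{1}pa in ng2; have := in_G_cvg Gpsi ng2 => ng3.
  near=> q; split; near: q => //; exact: open_near oW0 W0a.
have [W [oW Wa HW]] := near_open ng'.
have K q : W q -> [/\ denr (jt nu q) != 0, S0 (jt nu q) != 0, I1 (jt nu q) = q 0 ix + c & rho (jt nu q) = q 0 iv].
  move=> /HW[_ pq [[Up sp sn dp] [Sp Ip rp Jp relp]]]; rewrite pq in sn rp Jp.
  set p := psi q in pq Up sp dp Sp Ip rp Jp relp.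
  have [c0 a0] := D0 p Up.
  have Gp : in_G p phi by apply/in_GP; exists U, C, A, B.
  have hq : jt nu q ch 0%N 0%N 0%N != 0 by have [h _ _ _] := sol_near_eqE 0 sn; rewrite gt_eqF.
  pose gj k i j l := pderiv (nseq i iu ++ nseq j ix ++ nseq l iv) (gfun C A B k) p.
  have c0' : gj 0%N 1%N 0%N 0%N != 0 by [].
  have a0' : gj 1%N 0%N 1%N 0%N != 0 by [].
  have dq : denr (jt nu q) != 0.
    by apply: (@tr_denr gj (p 0 iv) _ c0' a0' hq); move: dp; rewrite Jp.
  have pr n : prolong n phi (jt s p) (jt nu q).
    rewrite -pq; apply: prolong_jt => //; first exact: sol_section.
    by rewrite pq; exact: sol_section.
  have Eq n := sol_near_eqE n sn; have Ep n := sol_near_eqE n sp.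
  have Sq : S0 (jt nu q) = S0 (jt s p) by apply: (Rinv_S0 (Ep 3) (Eq 3) Gp (pr 3)).
  have Iq : I1 (jt nu q) = I1 (jt s p) by exact: (@Rinv_I1 R _ _ _ (Ep 2) (Eq 2) Gp (pr 2)).
  split; [exact: dq|by rewrite Sq|by rewrite Iq Ip -pq row3x|].
  have [_ Rn] := iteratedR_Rat (iteratedR_nabla2 (@iteratedR_I2a R)).
  have nq : nI2a (jt nu q) = nI2a (jt s p) by exact: (Rn _ _ _ (Ep 3) (Eq 3) Gp (pr 3)).
  apply: (mulfI c0'); rewrite -rp /rho -nq.
  have e1 : kq (jt s p) = gj 0%N 1%N 0%N 0%N * gj 1%N 0%N 1%N 0%N * kq (jt nu q).
    by rewrite {1}Jp; exact: (@tr_kq R gj (p 0 iv) _ c0' a0' hq).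
  have e2 : I2b (jt s p) = I2b (jt nu q) by rewrite {1}Jp; exact: (@tr_I2b R gj (p 0 iv) _ c0' a0' hq).
  have e3 : I2a (jt s p) = I2a (jt nu q) by rewrite {1}Jp; exact: (@tr_I2a R gj (p 0 iv) _ c0').
  have e4 : jt s p cW 0%N 0%N 1%N = jt nu q cW 0%N 0%N 1%N * gj 1%N 0%N 1%N 0%N.
    by rewrite {1}Jp; exact: (@tr_Wv R gj (p 0 iv) _ c0').
  rewrite e1 e2 e3 e4; have [w0 _ aq b0 _] := denr_neq0 dq.
  have : S0 (jt nu q) != 0 by rewrite Sq.
  rewrite /S0 !mulf_eq0 !negb_or => /andP[/andP[_ e0] _].
  move: (gj 0%N 1%N 0%N 0%N) c0' (gj 1%N 0%N 1%N 0%N) a0' (kq (jt nu q)) (I2b (jt nu q)) b0 (nI2a (jt nu q) - I2a (jt nu q)) e0 (jt nu q cW 0%N 0%N 1%N) w0.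
  by move=> x x0 y y0 z t t0 e e0 w w0; field; rewrite t0 e0 w0 y0.
exists nu, W; split; last 1 first.
- by apply: filterS ng => p [_ [_ _ _ Jp _]]; exact: Jp.
- split.
  + by split=> // [c' q /HW[W0q _ _]|q /HW[W0q _ _]]; [exact: ss|exact: h0].
  + by move=> c' q /HW[W0q _ _]; exact: Es.
  + by exists c => q /K[].
  + move=> q Wq; have [dq Sq Iq rq] := K q Wq; have [W0q pq [[_ _ sn _] _]] := HW q Wq; rewrite pq in sn.
    have ssW : sect_on W nu by move=> c' r /HW[W0r _ _]; exact: ss.
    have hW r : W r -> jt nu r ch 0%N 0%N 0%N != 0 by move=> /HW[W0r _ _]; rewrite gt_eqF //; exact: h0.
    have [jx ju] := I1_affine_jets oW ssW (fun r Wr => let: And4 _ _ e _ := K r Wr in e) hW Wq.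
    apply/(k2a_rho sn dq Sq) => //; apply: nf_k2b dq _ ju.
    by rewrite /I1 divfK //; exact: hW.
  + move=> q Wq; have [dq Sq Iq rq] := K q Wq; split; [|exact: dq|exact: Sq]; rewrite -rq /rho.
    have [w0 _ _ b0 k0] := denr_neq0 dq.
    have e0 : nI2a (jt nu q) - I2a (jt nu q) != 0 by apply: contraNneq Sq => e0; rewrite /S0 e0 mulr0 mul0r.
    exact: mulf_neq0 k0 (invr_neq0 (mulf_neq0 b0 (mulf_neq0 w0 e0))).
- exact: Wa.
- by move=> n; apply: prolong_jt => //; exact: sol_section.
Unshelve. all: by end_near.
Qed.

End Pushforward.

(** * Primitives, boxes and flatness along a line *)

Section OneVariable.
Context {R : realType}.
Local Notation V := 'rV[R]_3.
Implicit Types (U : set V) (f : V -> R) (a p q : V).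

(** Halving the radius provides a compact interval on which [g] is continuous, hence integrable. *)
Lemma antiderivative (g : R -> R) (x0 d : R) : 0 < d -> (forall t, `|t - x0| < d -> {for t, continuous g}) ->
  exists G, G x0 = 0 /\ forall t : R, `|t - x0| < d / 2 -> is_derive t (1 : R) G (g t).
Proof.
move=> d0 cg; pose a := x0 - d / 2; pose u := x0 + d / 2.
have au : a < u by rewrite /a /u; lra.
have Hint : (@lebesgue_measure R).-integrable `[a, u] (EFin \o g).
  apply: continuous_compact_integrable; first exact: segment_compact.
  apply: continuous_in_subspaceT => t; rewrite inE /= in_itv /= => /andP[h1 h2].
  by apply: cg; rewrite ltr_norml; apply/andP; split; move: h1 h2; rewrite /a /u; lra.
pose F x := (\int[@lebesgue_measure R]_(t in `[a, x]) g t)%R.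
exists (fun x => F x - F x0); split; first by rewrite subrr.
move=> t; rewrite ltr_norml => /andP[t1 t2].
have h1 : a < t by rewrite /a; lra.
have h2 : t < u by rewrite /u; lra.
have ct : {for t, continuous g} by apply: cg; rewrite ltr_norml; apply/andP; split; lra.
have [dF eF] := continuous_FTC1_closed h2 Hint h1 ct.
have HF : is_derive t (1 : R) F (g t) by split; [exact: dF|rewrite -eF derive1E].
have H := is_deriveB HF (is_derive_cst (F x0) t (1 : R)).
by apply: (is_derive_eq H); rewrite subr0.
Qed.

Lemma pd_comp1 (G : R -> R) f p i (g' : R) : is_derive (f p) (1 : R) G g' -> differentiable f p ->
  differentiable (fun q => G (f q)) p /\ pd i (fun q => G (f q)) p = g' * pd i f p.
Proof.
move=> [dG eG] df; have dG' : differentiable G (f p) by apply/derivable1_diffP.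
have dGf : differentiable (fun q => G (f q)) p by exact: (differentiable_comp df dG').
split=> //; have H (h : V -> R) : differentiable h p ->
    derivable (fun t => h (upd i p t)) (p 0 i) 1 /\ derive1 (fun t => h (upd i p t)) (p 0 i) = pd i h p.
  move=> dh; split; last by rewrite -pd_slice.
  have : derivable h p (delta_mx 0 i) by exact: diff_derivable.
  rewrite /derivable; set F1 := (fun _ : R => _); set F2 := (fun _ : R => _).
  suff -> : F1 = F2 by [].
  by rewrite funeqE => t; rewrite /F1 /F2 /= /upd scalerDl addrCA subrK [t *: 1]mulr1.
have [d1 e1] := H f df; rewrite pd_slice.
have E : f (upd i p (p 0 i)) = f p by rewrite upd_id.
have dG1 : derivable G (f (upd i p (p 0 i))) 1 by rewrite E.
rewrite -[LHS]/(derive1 (G \o (fun t => f (upd i p t))) (p 0 i)) (derive1_comp d1 dG1) e1 E.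
by rewrite derive1E eG.
Qed.

Lemma smooth_primitive U f (G g : R -> R) : open U -> smooth_on U f -> smooth_on U (fun p => g (f p)) ->
  (forall p, U p -> is_derive (f p) (1 : R) G (g (f p))) ->
  smooth_on U (fun p => G (f p)) /\ forall p i, U p -> pd i (fun q => G (f q)) p = g (f p) * pd i f p.
Proof.
move=> oU sf sg dG; have H p i : U p -> _ := fun Up => pd_comp1 i (dG p Up) (smooth_diff sf Up).
split=> [|p i Up]; last by case: (H p i Up).
apply: (@falg_smooth _ U (fun h => smooth_on U h \/ h = fun p => G (f p))) => //; last by apply: falg_gen; right.
- move=> h [sh p Up|-> p Up]; first exact: smooth_diff sh Up.
  by case: (H p iu Up).
- move=> h [sh i|-> i]; first by apply: falg_gen; left; exact: smooth_pd.
  apply: (@falg_eq _ _ _ (fun p => g (f p) * pd i f p)); last by move=> p Up; case: (H p i Up).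
  by apply: falg_mul; apply: falg_gen; left => //; exact: smooth_pd.
Qed.

Lemma smooth_expR U f : open U -> smooth_on U f ->
  smooth_on U (fun p => expR (f p)) /\ forall p i, U p -> pd i (fun q => expR (f q)) p = expR (f p) * pd i f p.
Proof.
move=> oU sf; have H p i : U p -> _ := fun Up => pd_comp1 i (is_derive_expR (f p)) (smooth_diff sf Up).
split=> [|p i Up]; last by case: (H p i Up).
apply: (@falg_smooth _ U (fun h => smooth_on U h \/ h = fun p => expR (f p))) => //; last by apply: falg_gen; right.
- move=> h [sh p Up|-> p Up]; first exact: smooth_diff sh Up.
  by case: (H p iu Up).
- move=> h [sh i|-> i]; first by apply: falg_gen; left; exact: smooth_pd.
  apply: (@falg_eq _ _ _ (fun p => expR (f p) * pd i f p)); last by move=> p Up; case: (H p i Up).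
  by apply: falg_mul; apply: falg_gen; [right|left; exact: smooth_pd].
Qed.

Lemma box_near U a : open U -> U a -> exists2 d, 0 < d & forall p, (forall j, `|p 0 j - a 0 j| < d) -> U p.
Proof.
move=> oU Ua; have /nbhsE[d d0 Hd] := open_near oU Ua; exists d => // p Hp.
by rewrite -[p](addB_K a); apply: Hd; apply: norm_lt_coord => // j; rewrite coordB.
Qed.

Definition box a (d : R) : set V := [set p | forall j, `|p 0 j - a 0 j| < d].

Lemma open_box a d : open (box a d).
Proof.
rewrite openE => p Hp; apply/nbhsE.
pose e := Num.min (d - `|p 0 iu - a 0 iu|) (Num.min (d - `|p 0 ix - a 0 ix|) (d - `|p 0 iv - a 0 iv|)).
have e0 : 0 < e by rewrite /e !lt_min !subr_gt0 !Hp.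
exists e => // h he j; rewrite coordD addrAC.
have hj : `|h 0 j| < e by exact: le_lt_trans (norm_coord h j) he.
have He : e <= d - `|p 0 j - a 0 j|.
  by rewrite /e; case: (ax_cases j) => ->; rewrite !ge_min lexx ?orbT.
apply: le_lt_trans (ler_normD _ _) _; rewrite -ltrBrDl.
exact: lt_le_trans hj He.
Qed.

Lemma box_center a d : 0 < d -> box a d a.
Proof. by move=> d0 j; rewrite subrr normr0. Qed.

Lemma box_upd a d p i (t : R) : box a d p -> `|t - a 0 i| < d -> box a d (upd i p t).
Proof. by move=> Hp ht j; rewrite updE; case: eqP => [->|_]. Qed.

(** A box contains the segment between two of its points that differ in one coordinate, so a
    vanishing partial derivative yields independence of that coordinate. *)
Lemma box_slice U a d f p i (t : R) : box a d `<=` U -> smooth_on U f -> (forall q, U q -> pd i f q = 0) ->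
  box a d p -> `|t - a 0 i| < d -> f (upd i p t) = f p.
Proof.
move=> HU sf f0 Hp Ht.
have -> : upd i p t = p + (t - p 0 i) *: delta_mx 0 i by rewrite /upd scalerBl addrA addrAC.
apply: pd_eq0_line => s /andP[s0 s1].
have B : box a d (p + (s * (t - p 0 i)) *: delta_mx 0 i).
  move=> j; rewrite coordD mxE delta_coord eq_sym; case: (j =P i) => [->|_]; last by rewrite mulr0 addr0.
  rewrite mulr1; have := Hp i; move: Ht; rewrite !ltr_norml => /andP[h1 h2] /andP[h3 h4].
  have s1' : 0 <= 1 - s by rewrite subr_ge0.
  have [PT|/ltW PT] := lerP (p 0 i) t; move: PT; rewrite -subr_ge0 => PT;
    have := mulr_ge0 s0 PT; have := mulr_ge0 s1' PT => *; by apply/andP; split; lra.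
by split; [exact: smooth_diff sf (HU _ B)|exact: f0 (HU _ B)].
Qed.

(** Lines in direction u stay inside the plane where x has its value at [a], so vanishing on this
    plane near [a] is inherited by the u-derivative. *)
Lemma flat_u f a : (\forall q \near a, (q : V) 0 ix = a 0 ix -> f q = 0) -> forall i, pderiv (nseq i iu) f a = 0.
Proof.
move=> Hf i; suff H : \forall q \near a, (q : V) 0 ix = a 0 ix -> pderiv (nseq i iu) f q = 0.
  exact: (nbhs_singleton H erefl).
elim: i => [|i IH] //=; have := near2 IH; apply: filterS => q Hq qx.
rewrite -/(pd iu _ q) pd_slice (near_eq_derive1 (g := cst 0)); first exact: derive1_cst.
have /nbhsE[d d0 Hd] := Hq; apply/nbhs_ballP; exists d => // t /= Ht.
have E : upd iu q t = q + (t - q 0 iu) *: delta_mx 0 iu by rewrite /upd scalerBl addrA addrAC.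
have : q 0 ix = a 0 ix -> pderiv (nseq i iu) f (upd iu q t) = 0.
  move: (Hd ((t - q 0 iu) *: delta_mx 0 iu)); rewrite -E updE /=; apply.
  apply: norm_lt_coord => // j; rewrite mxE delta_coord; case: (iu == j).
    by rewrite mulr1 distrC; exact: Ht.
  by rewrite mulr0 normr0.
exact.
Qed.

End OneVariable.

(** * Quantities independent of v *)

Section VerticallyConstant.
Context {R : realType}.
Local Notation V := 'rV[R]_3.
Local Notation sect := (Defs.comp -> V -> R).
Variables (U : set V) (s : sect).
Hypotheses (oU : open U) (ss : sect_on U s) (Es : Esol U s).
Implicit Types (f g : V -> R) (p : V).

Definition vconst f := smooth_on U f /\ forall p, U p -> pd iv f p = 0.

Lemma vconst_cst (c : R) : vconst (fun=> c).
Proof. by split=> [|p _]; [exact: smooth_cst|exact: pd_cst]. Qed.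

Lemma vconst_add f g : vconst f -> vconst g -> vconst (fun p => f p + g p).
Proof.
by move=> [sf f0] [sg g0]; split=> [|p Up]; [exact: smooth_add|rewrite (on_pdD _ sf sg Up) f0 // g0 // addr0].
Qed.

Lemma vconst_mul f g : vconst f -> vconst g -> vconst (fun p => f p * g p).
Proof.
by move=> [sf f0] [sg g0]; split=> [|p Up]; [exact: smooth_mul|rewrite (on_pdM _ sf sg Up) f0 // g0 // !mulr0 addr0].
Qed.

Lemma vconst_opp f : vconst f -> vconst (fun p => - f p).
Proof.
move=> /(vconst_mul (vconst_cst (-1))); have -> // : (fun p => -1 * f p) = (fun p => - f p).
by apply/funext => p; rewrite mulN1r.
Qed.

Lemma vconst_inv f : vconst f -> (forall p, U p -> f p != 0) -> vconst (fun p => (f p)^-1).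
Proof.
move=> [sf f0] h; split=> [|p Up]; first exact: smooth_inv.
by rewrite (on_pdV _ sf Up (h p Up)) f0 // mulr0.
Qed.

Lemma vconst_jet c i j l : (axis c <= l.+1)%N -> vconst (fun p => jt s p c i j l).
Proof.
move=> h; split=> [|p Up]; first by apply: smooth_pderiv; exact: ss.
rewrite -[LHS]/(pderiv (iv :: (nseq i iu ++ nseq j ix ++ nseq l iv)) (s c) p).
apply: (Esol_pderiv oU ss Es Up); rewrite /= !count_cat !count_nseq /= !mul0n !add0n mul1n add1n.
exact: h.
Qed.

Lemma vconst_I1 : (forall p, U p -> denr (jt s p) != 0) -> vconst (fun p => I1 (jt s p)).
Proof.
move=> d0; have w := @vconst_jet cW 0 0 1 isT; apply: vconst_mul; first exact: (vconst_mul w w).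
by apply: vconst_inv => [|p /d0/denr_neq0[]//]; exact: (@vconst_jet ch 0 0 0 isT).
Qed.

Lemma vconst_I2b : (forall p, U p -> denr (jt s p) != 0) -> vconst (fun p => I2b (jt s p)).
Proof.
move=> d0; have w := @vconst_jet cW 0 0 1 isT; have h := @vconst_jet ch 0 0 0 isT.
have hx := @vconst_jet ch 0 1 0 isT; have wx := @vconst_jet cW 0 1 1 isT.
apply: vconst_mul; first by apply: vconst_add (vconst_mul w hx) (vconst_opp (vconst_mul (vconst_mul (vconst_cst 2) h) wx)).
apply: vconst_inv; first exact: (vconst_mul h h).
by move=> p /d0/denr_neq0[_ h0 _ _ _]; exact: expf_neq0.
Qed.

Lemma vconst_k2b : (forall p, U p -> denr (jt s p) != 0) -> vconst (fun p => k2b (jt s p)).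
Proof.
move=> d0; have w := @vconst_jet cW 0 0 1 isT; have h := @vconst_jet ch 0 0 0 isT.
have hu := @vconst_jet ch 1 0 0 isT; have wu := @vconst_jet cW 1 0 1 isT.
apply: vconst_mul; first by apply: vconst_add (vconst_mul w hu) (vconst_opp (vconst_mul (vconst_mul (vconst_cst 2) h) wu)).
by apply: vconst_inv => [|p /d0/denr_neq0[]].
Qed.

(** In [rho] only [H_xv] and [W] depend on v, both affinely. The v-derivative of the numerator is
    [I2b * H_xvv - I2a * I2b * W_v], which is the denominator, so the slope is 1. *)
Lemma rho_affine : (forall p, U p -> denr (jt s p) != 0) -> (forall p, U p -> S0 (jt s p) != 0) ->
  (forall p, U p -> sol_near p s) -> vconst (fun p => rho (jt s p) - p 0 iv).
Proof.
move=> d0 s0 sn; have b := vconst_I2b d0; have k := vconst_k2b d0; have a := @vconst_jet cH 0 0 2 isT.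
have w := @vconst_jet cW 0 0 1 isT; have hh := @vconst_jet cH 0 1 2 isT; have wu := @vconst_jet cW 1 0 1 isT.
pose K0 p : R := 2 * jt s p cH 0%N 0%N 2%N * k2b (jt s p) - I2b (jt s p) * jt s p cW 1%N 0%N 1%N.
pose K2 p : R := jt s p cH 0%N 0%N 2%N * I2b (jt s p).
pose D p : R := I2b (jt s p) * jt s p cH 0%N 1%N 2%N - K2 p * jt s p cW 0%N 0%N 1%N.
have v0 : vconst K0 by exact: vconst_add (vconst_mul (vconst_mul (vconst_cst 2) a) k) (vconst_opp (vconst_mul b wu)).
have v2 : vconst K2 by exact: vconst_mul a b.
have vD : vconst D by exact: vconst_add (vconst_mul b hh) (vconst_opp (vconst_mul v2 w)).
have DE p : U p -> D p = I2b (jt s p) * (jt s p cW 0%N 0%N 1%N * (nI2a (jt s p) - I2a (jt s p))).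
  move=> Up; have [w0 _ _ _ _] := denr_neq0 (d0 p Up); rewrite /D /K2 nI2a_sol //; [|exact: sn|exact: d0].
  rewrite -[I2a (jt s p)]/(jt s p cH 0%N 0%N 2%N).
  by move: (jt s p cW _ _ _) w0 (jt s p cH 0%N 0%N 2%N) (jt s p cH _ _ _) (I2b _) => ww ww0 *; field.
have D0 p : U p -> D p != 0.
  move=> Up; have [w0 _ _ b0 _] := denr_neq0 (d0 p Up); rewrite DE // mulf_neq0 // mulf_neq0 //.
  by apply: contraNneq (s0 p Up) => e0; rewrite /S0 e0 mulr0 mul0r.
have E p : U p -> (K0 p + I2b (jt s p) * jt s p cH 0%N 1%N 1%N - K2 p * jt s p cW 0%N 0%N 0%N) * (D p)^-1 - p 0 iv =
    rho (jt s p) - p 0 iv.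
  move=> Up; rewrite /rho -DE //; congr (_ / _ - _); rewrite /kq /K0 /K2 /k2a -[I2a (jt s p)]/(jt s p cH 0%N 0%N 2%N).
  by move: (I2b _) (k2b _) (jt s p cH _ _ _) (jt s p cH _ _ _) (jt s p cW _ _ _) (jt s p cW _ _ _) => *; ring.
have sH : smooth_on U (fun p => jt s p cH 0%N 1%N 1%N) by exact: smooth_pd ix (smooth_pd iv (ss cH)).
have sW : smooth_on U (fun p => jt s p cW 0%N 0%N 0%N) by exact: ss.
have vDi := vconst_inv vD D0.
have sbH := smooth_mul oU b.1 sH; have sKW := smooth_mul oU v2.1 sW.
have s1 : smooth_on U (fun p => K0 p + I2b (jt s p) * jt s p cH 0%N 1%N 1%N) by apply: smooth_add => //; exact: v0.1.
have s2 : smooth_on U (fun p => K0 p + I2b (jt s p) * jt s p cH 0%N 1%N 1%N - K2 p * jt s p cW 0%N 0%N 0%N).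
  by apply: smooth_add => //; exact: smooth_opp.
have s3 := smooth_mul oU s2 vDi.1; have sv := smooth_v oU.
have s4 : smooth_on U (fun p => (K0 p + I2b (jt s p) * jt s p cH 0%N 1%N 1%N - K2 p * jt s p cW 0%N 0%N 0%N) * (D p)^-1 - p 0 iv).
  by apply: smooth_add => //; exact: smooth_opp.
split=> [|p Up]; first exact: smooth_eq oU s4 E.
rewrite -(pd_eq_on iv oU E Up) (on_pdB _ s3 sv Up) (on_pdM _ s2 vDi.1 Up) (vDi.2 p Up) pd_coord.
rewrite (on_pdB _ s1 sKW Up) (on_pdD _ v0.1 sbH Up) (v0.2 p Up) (on_pdM _ b.1 sH Up) (b.2 p Up).
rewrite (on_pdM _ v2.1 sW Up) (v2.2 p Up).
have -> : pd iv (fun q => jt s q cH 0%N 1%N 1%N) p = jt s p cH 0%N 1%N 2%N.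
  by rewrite (on_pdC oU iv ix (smooth_pd iv (ss cH)) Up).
rewrite -[pd iv (fun q => jt s q cW 0%N 0%N 0%N) p]/(jt s p cW 0%N 0%N 1%N) eqxx.
have := D0 p Up; rewrite /D; move: (K2 p) (K0 p) (I2b _) (jt s p cH 0%N 1%N 2%N) (jt s p cW 0%N 0%N 1%N) => x y z t u e0.
by rewrite !mulr0 !addr0 !add0r mulrC mulfV // subrr.
Qed.

End VerticallyConstant.

(** * Bringing a generic solution to normal form *)

Section Normalisation.
Context {R : realType}.
Local Notation V := 'rV[R]_3.
Local Notation sect := (Defs.comp -> V -> R).
Implicit Types (th : jet R) (s nu : sect) (U W : set V) (a p q : V).

(** With [C] the identity, [A] is [I1] minus its value at [a], which sends [a] to [x = 0], and [B]
    is [rho - v]. *)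
Lemma normalise_xv a s : sol_near a s -> denr (jt s a) != 0 -> S0 (jt s a) != 0 ->
  exists phi nu W, [/\ in_G a phi, normal nu W, W (phi a), phi a 0 ix = 0 &
    forall n, prolong n phi (jt s a) (jt nu (phi a))].
Proof.
move=> sa d0 s0.
have [U [oU Ua HU]] := near_open (filterI (sol_near_near sa) (filterI (denr_section sa d0) (S0_near sa d0 s0))).
have [U1 [[oU1 ss1 h1] Es1 U1a]] := sa.
have oUU : open (U `&` U1) by exact: openI.
have ss : sect_on (U `&` U1) s by move=> c p [_]; exact: ss1.
have Es : Esol (U `&` U1) s by move=> c p [_]; exact: Es1.
have dU p : (U `&` U1) p -> denr (jt s p) != 0 by move=> [/HU[_ []]].
have sU p : (U `&` U1) p -> S0 (jt s p) != 0 by move=> [/HU[_ []]].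
have nU p : (U `&` U1) p -> sol_near p s by move=> [/HU[]].
have v1 := vconst_I1 oUU ss Es dU; have v2 := rho_affine oUU ss Es dU sU nU.
have [d dp Hd] := @box_near _ (U `&` U1) a oUU (conj Ua U1a).
set c := I1 (jt s a).
(* [I1] and [rho - v] do not depend on v, so evaluating them at the fixed height [a 0 iv] gives the
   functions of u and x that the pseudogroup requires. *)
pose A (x y : R) := I1 (jt s (row3 x y (a 0 iv))) - c.
pose B (x y : R) := rho (jt s (row3 x y (a 0 iv))) - a 0 iv.
have rE p : row3 (p 0 iu) (p 0 ix) (a 0 iv) = upd iv p (a 0 iv).
  by apply: eq_row3; rewrite row3E updE.
have av : `|a 0 iv - a 0 iv| < d by rewrite subrr normr0.
have AE p : box a d p -> hat2 A p = I1 (jt s p) - c.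
  by move=> Bp; rewrite /hat2 /A rE; congr (_ - _); exact: (box_slice Hd v1.1 v1.2 Bp av).
have BE p : box a d p -> hat2 B p = rho (jt s p) - p 0 iv.
  move=> Bp; have := box_slice Hd v2.1 v2.2 Bp av; rewrite updE /= => <-.
  by rewrite /hat2 /B rE.
have oB := @open_box R a d; have Ba := box_center a dp.
have s1 : smooth_on (box a d) (fun p => I1 (jt s p) - c).
  by apply: smooth_add => //; [exact: smooth_sub Hd v1.1|exact: smooth_cst].
have C1 : hat1 id = (fun p : V => p 0 iu) by [].
have G : gauge (box a d) id A B.
  split=> //.
  - by rewrite C1; exact: smooth_coord.
  - by apply: (smooth_eq oB s1) => p Bp; rewrite AE.
  - by apply: (smooth_eq oB (smooth_sub Hd v2.1)) => p Bp; rewrite BE.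
  move=> p Bp; rewrite C1 pd_coord oner_neq0; split=> //.
  have Up := Hd p Bp; rewrite (pd_eq_on ix oB AE Bp) (on_pdB _ (smooth_sub Hd v1.1) (smooth_cst c oB) Bp) pd_cst subr0.
  (* Up to [1 / W_v] the x-derivative of [I1] is [nI1], a factor of [S0], so it cannot vanish
     here. *)
  have := sU p Up; apply: contraNneq => e; rewrite /S0 /nI1 hderiv_nabla2r ?e ?mulr0 ?mul0r //.
  - exact: Rat_I1.
  - exact: nU.
  - exact: dU.
  - exact: v1.2.
have HI : \forall p \near a, I1 (jt s p) = hat2 A p + c.
  by apply: filterS (open_near oB Ba) => p Bp; rewrite AE // subrK.
have Hr : \forall p \near a, rho (jt s p) = pd iu (hat1 id) p * gmap id A B p 0 iv.
  by apply: filterS (open_near oB Ba) => p Bp; rewrite row3v C1 pd_coord mul1r divr1 BE // addrC subrK.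
have [nu [W [N Wa pr _]]] := push_normal G Ba sa d0 s0 HI Hr.
exists (gmap id A B), nu, W; split=> //.
  by apply/in_GP; exists (box a d), id, A, B.
by rewrite row3x AE // subrr.
Qed.

Lemma nH1E nu p : nH1 nu p = jt nu p cH 0%N 0%N 1%N - p 0 iv * jt nu p cH 0%N 0%N 2%N.
Proof. by []. Qed.

(** The inhomogeneous term in the second derivative of [C] is what makes it possible to remove
    [nH1]. *)
Lemma tr_Hv (gj : nat -> nat -> nat -> nat -> R) (v : R) th : gj 0%N 1%N 0%N 0%N != 0 -> gj 1%N 1%N 0%N 0%N = 0 ->
  pj gj v (gj 0%N 1%N 0%N 0%N)^-1 th cH 0%N 0%N 1%N =
  gj 0%N 1%N 0%N 0%N * th cH 0%N 0%N 1%N - gj 0%N 2%N 0%N 0%N / gj 0%N 1%N 0%N 0%N.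
Proof. by move=> c0 a0; cbn; rewrite a0; field. Qed.

(* The reparametrisation [C] of [u] with [C'' / C' = - nH1] along [x = 0] makes
   [nH1] vanish on this line. *)
Lemma normalise_u nu W a : normal nu W -> W a -> a 0 ix = 0 ->
  exists phi nu' W', [/\ in_G a phi, normal nu' W', W' (phi a), phi a = row3 0 0 1 &
    (forall i, pderiv (nseq i iu) (nH1 nu') (phi a) = 0) /\ forall n, prolong n phi (jt nu a) (jt nu' (phi a))].
Proof.
move=> N Wa ax0; have oW := normal_open N; have [d dp Hd] := box_near oW Wa.
have oB := @open_box R a d; have Ba := box_center a dp.
have [v0 dn0 sn0] := normal_pt N Wa.
(* As [nH1] is independent of v, its restriction to the plane [x = 0] near [a] is this function of
   u. *)
pose h1 (t : R) := nH1 nu (upd iu a t).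
have line p : box a d p -> box a d (upd iu a (p 0 iu)) by move=> Bp; apply: box_upd => //; exact: Bp.
have sh : smooth_on (box a d) (hat1 h1).
  apply: (@smooth_comp _ _ W (fun p => upd iu a (p 0 iu)) (nH1 nu)) => //; last exact: smooth_H1.
    by move=> p /line/Hd.
  move=> j; have [->|ji] := eqVneq j iu.
    by apply: (smooth_eq oB (smooth_coord iu oB)) => p _; rewrite updE eqxx.
  by apply: (smooth_eq oB (smooth_cst (a 0 j) oB)) => p _; rewrite updE (negbTE ji).
have ch1 (t : R) : `|t - a 0 iu| < d -> {for t, continuous h1}.
  move=> Ht; have Bt : box a d (upd iu a t) by exact: box_upd.
  have E (x : R) : upd iu a 0 + x *: delta_mx 0 iu = upd iu a x.
    by rewrite /upd scale0r addr0.
  have dt : differentiable (hat1 h1) (upd iu a 0 + t *: delta_mx 0 iu) by rewrite E; exact: smooth_diff sh Bt.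
  have [H _] := is_derive_line dt.
  have -> : h1 = (fun x : R => hat1 h1 (upd iu a 0 + x *: delta_mx 0 iu)).
    by apply/funext => x; rewrite E /hat1 updE eqxx.
  exact/differentiable_continuous/derivable1_diffP.
have [L [L0 dL]] := antiderivative dp ch1.
(* [E] will be the derivative of [C]: the exponential solves [E' = - h1 * E], and the factor
   [a 0 iv] makes the v-coordinate of the image of [a] equal to 1. *)
pose E (t : R) := a 0 iv * expR (- L t).
have dp2 : 0 < d / 2 by rewrite divr_gt0.
have oB2 := @open_box R a (d / 2).
have sub2 : box a (d / 2) `<=` box a d.
  by move=> p Hp j; apply: lt_trans (Hp j) _; rewrite ltr_pdivrMr // ltr_pMr // ltr1n.
have su := smooth_coord iu oB2.
have [sL eL] := smooth_primitive oB2 su (smooth_sub sub2 sh) (fun p Bp => dL (p 0 iu) (Bp iu)).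
have [sX eX] := smooth_expR oB2 (smooth_opp oB2 sL).
have sE : smooth_on (box a (d / 2)) (hat1 E) by apply: smooth_mul => //; exact: smooth_cst.
have cE (t : R) : `|t - a 0 iu| < d / 2 -> {for t, continuous E}.
  move=> Ht; have [dL' _] := dL t Ht.
  have cL : {for t, continuous L} by exact/differentiable_continuous/derivable1_diffP.
  apply: continuousM; first exact: cst_continuous.
  apply: continuous_comp; last exact: continuous_expR.
  exact: continuousN.
have [C [C0 dC]] := antiderivative dp2 cE.
have dp4 : 0 < d / 2 / 2 by rewrite divr_gt0.
set d4 := d / 2 / 2 in dC dp4; have oB4 := @open_box R a d4; have Ba4 := box_center a dp4.
have sub4 : box a d4 `<=` box a (d / 2).
  by move=> p Hp j; apply: lt_trans (Hp j) _; rewrite ltr_pdivrMr // ltr_pMr // ltr1n.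
have sE4 := smooth_sub sub4 sE.
have [sC eC] := smooth_primitive oB4 (smooth_coord iu oB4) sE4 (fun p Bp => dC (p 0 iu) (Bp iu)).
have e1 p : box a d4 p -> pd iu (hat1 C) p = E (p 0 iu) by move=> Bp; rewrite (eC p iu Bp) pd_coord mulr1.
have E0 (t : R) : E t != 0 by rewrite mulf_neq0 // gt_eqF // expR_gt0.
have e2 p : box a d4 p -> pd iu (pd iu (hat1 C)) p = - h1 (p 0 iu) * E (p 0 iu).
  move=> Bp; rewrite (pd_eq_on iu oB4 e1 Bp); have Bp2 := sub4 p Bp.
  rewrite (on_pdM _ (smooth_cst (a 0 iv) oB2) sX Bp2) pd_cst mulr0 addr0 (eX p iu Bp2).
  have -> : pd iu (fun q => - L (q 0 iu)) p = - h1 (p 0 iu).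
    have := on_pdB iu (smooth_cst 0 oB2) sL Bp2; under eq_fun do rewrite sub0r.
    by move=> ->; rewrite pd_cst sub0r (eL p iu Bp2) pd_coord mulr1.
  by rewrite /E; ring.
pose A (x y : R) := y; pose B (x y : R) := 0 : R.
have A1 : hat2 A = (fun p : V => p 0 ix) by [].
have B1 : hat2 B = (fun p : V => 0) by [].
have G : gauge (box a d4) C A B.
  split=> //.
  - by rewrite A1; exact: smooth_coord.
  - by rewrite B1; exact: smooth_cst.
  - by move=> p Bp; rewrite e1 // A1 pd_coord oner_neq0 E0.
have [[_ _ _] _ [c Ec] _ _] := N.
have HI : \forall p \near a, I1 (jt nu p) = hat2 A p + c.
  by apply: filterS (open_near oW Wa) => p; exact: Ec.
have Hr : \forall p \near a, rho (jt nu p) = pd iu (hat1 C) p * gmap C A B p 0 iv.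
  apply: filterS (filterI (open_near oW Wa) (open_near oB4 Ba4)) => p [Wp Bp].
  by rewrite (normal_rho N Wp) row3v B1 addr0 e1 // mulrC divfK.
have [nu' [W' [N' W'a pr J]]] := push_normal G Ba4 (normal_sol N Wa) dn0 sn0 HI Hr.
set phi := gmap C A B in W'a pr J *.
have phia : phi a = row3 0 0 1.
  apply: eq_row3; rewrite !row3E; [exact: C0|by rewrite A1|].
  by rewrite e1 // B1 addr0 /E L0 oppr0 expR0 mulr1 mulfV.
have Gphi : in_G a phi by apply/in_GP; exists (box a d4), C, A, B.
exists phi, nu', W'; split=> //; split=> //; apply: flat_u.
have [psi [Gpsi pp qq]] := in_G_inv Gphi; have pa := nbhs_singleton pp.
have K : \forall p \near psi (phi a), (p : V) 0 ix = 0 -> nH1 nu' (phi p) = 0.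
  rewrite pa; apply: filterS (filterI J (open_near oB4 Ba4)) => p [Jp Bp] px.
  have c0 : pd iu (hat1 C) p != 0 by rewrite e1.
  pose gj k i j l := pderiv (nseq i iu ++ nseq j ix ++ nseq l iv) (gfun C A B k) p.
  have au : gj 1%N 1%N 0%N 0%N = 0 by rewrite -[LHS]/(pd iu (hat2 A) p) A1 pd_coord.
  have := @tr_Hv gj (p 0 iv) (jt nu' (phi p)) c0 au.
  have := @tr_I2a R gj (p 0 iv) (jt nu' (phi p)) c0.
  rewrite /I2a -[pj _ _ _ _ cH 0%N 0%N 2%N]/(gaugej C A B p (jt nu' (phi p)) cH 0%N 0%N 2%N).
  rewrite -[pj _ _ _ _ cH 0%N 0%N 1%N]/(gaugej C A B p (jt nu' (phi p)) cH 0%N 0%N 1%N) -Jp => a2 a1.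
  have hE : nH1 nu p = h1 (p 0 iu).
    rewrite /h1 -(box_slice (i := iv) Hd (smooth_H1 N) (fun q => @H1_v R nu W q N) (sub2 _ (sub4 _ Bp)) (t := a 0 iv)).
      by congr (nH1 nu _); apply: eq_row3; rewrite !updE /=; [by []|by rewrite px ax0|by []].
    by rewrite subrr normr0.
  have c2 : gj 0%N 2%N 0%N 0%N = - h1 (p 0 iu) * gj 0%N 1%N 0%N 0%N.
    rewrite -[gj 0%N 2%N 0%N 0%N]/(pd iu (pd iu (hat1 C)) p) -[gj 0%N 1%N 0%N 0%N]/(pd iu (hat1 C) p) (e1 p Bp).
    exact: e2.
  have h' := nH1E nu' (phi p); have h := nH1E nu p.
  have pv : phi p 0 iv = p 0 iv / pd iu (hat1 C) p by rewrite row3v B1 addr0.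
  apply: (mulfI c0); rewrite mulr0 h' pv -a2.
  have -> : pd iu (hat1 C) p * (jt nu' (phi p) cH 0%N 0%N 1%N - p 0 iv / pd iu (hat1 C) p * jt nu p cH 0%N 0%N 2%N) =
     pd iu (hat1 C) p * jt nu' (phi p) cH 0%N 0%N 1%N - p 0 iv * jt nu p cH 0%N 0%N 2%N.
    by move: (pd iu _ p) c0 => x x0; field.
  have a1' : pd iu (hat1 C) p * jt nu' (phi p) cH 0%N 0%N 1%N = jt nu p cH 0%N 0%N 1%N - h1 (p 0 iu).
    by rewrite a1 c2 -[gj 0%N 1%N 0%N 0%N]/(pd iu (hat1 C) p) (mulfK c0) opprK addrK.
  by rewrite a1' -hE h addrAC subrr.
have K' := in_G_cvg Gpsi K.
apply: filterS (filterI K' qq) => q [Kq qE] qx.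
have := Kq _; rewrite qE; apply.
have : phi (psi q) 0 ix = psi q 0 ix by rewrite row3x.
by rewrite qE qx phia row3x => <-.
Qed.

Lemma jt_eta s th : (forall c i j l, jt s (jbase th) c i j l = th c i j l) -> jt s (jbase th) = th.
Proof.
case: th => b f H; rewrite /jt; congr Jet.
by apply/funext => c; apply/funext => i; apply/funext => j; apply/funext => l; exact: H.
Qed.

(** The two normalisations do not disturb each other: the second keeps x, has [B = 0], and rescales
    v by [1 / C'] exactly as it rescales [rho]. *)
Theorem normal_form th : eqEoo th -> denr th != 0 -> S0 th != 0 ->
  exists phi nu W, [/\ in_G (jbase th) phi, normal nu W, W (phi (jbase th)), phi (jbase th) = row3 0 0 1 &
    (forall i, pderiv (nseq i iu) (nH1 nu) (phi (jbase th)) = 0) /\ forall n, prolong n phi th (jt nu (phi (jbase th)))].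
Proof.
move=> /realize[s [sa /jt_eta E]] d0 s0; rewrite -E in d0 s0.
have [phi1 [nu1 [W1 [G1 N1 W1a x0 pr1]]]] := normalise_xv sa d0 s0.
have [phi2 [nu2 [W2 [G2 N2 W2a b0 [f2 pr2]]]]] := normalise_u N1 W1a x0.
exists (phi2 \o phi1), nu2, W2; split; [exact: in_G_comp|exact: N2|exact: W2a|exact: b0|].
split; first exact: f2.
move=> n; rewrite -[th in prolong _ _ th]E.
exact: (@prolong_comp R n phi1 phi2 (jt s (jbase th)) _ _ G1 G2 (pr1 n) (pr2 n)).
Qed.

End Normalisation.

(** * A jet at which all genericity conditions hold *)

Section GenericJet.
Context {R : realType}.
Local Notation V := 'rV[R]_3.

Lemma delta_uE i j : (delta_mx 0 i : V) 0 j = (j == i)%:R.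
Proof. by rewrite delta_coord eq_sym. Qed.

Lemma nI1_ex : nI1 (@jet_ex R) = -1.
Proof.
rewrite /nI1 /hderiv sum3 /nabla2r !row3E mul0r add0r.
have -> : k2a (@jet_ex R) = 0 by rewrite /k2a /= subrr.
rewrite mul0r oppr0 mulr0 mul0r addr0 /= divr1 mul1r /total_deriv.
have -> : (fun t : R => I1 (hline (@jet_ex R) (delta_mx 0 ix) t)) = (fun t => 1 / (1 + t) ^+ 1).
  apply/funext => t; rewrite /I1 /hline /= !delta_uE /=; congr (_ / _); rewrite ?expr1; ring.
have d1 : is_derive (0 : R) (1 : R) (fun t : R => 1 + t) (0 + 1) by exact: is_deriveD.
have d0 : is_derive (0 : R) (1 : R) (fun t : R => 1 : R) 0 by exact: is_derive_cst.
have n0 : (1 + 0 : R) != 0 by rewrite addr0 oner_neq0.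
have [_] := is_derive_quot 1 d0 d1 n0; rewrite derive1E => ->.
by rewrite !addr0 expr1n; field.
Qed.

Lemma nI2a_ex : nI2a (@jet_ex R) = 0.
Proof.
rewrite /nI2a /hderiv sum3 /nabla2r !row3E mul0r add0r.
have -> : k2a (@jet_ex R) = 0 by rewrite /k2a /= subrr.
rewrite mul0r oppr0 mulr0 mul0r addr0 /= divr1 mul1r /total_deriv.
have -> : (fun t : R => I2a (hline (@jet_ex R) (delta_mx 0 ix) t)) = cst 2.
  by apply/funext => t; rewrite /I2a /hline /= !delta_uE /=; ring.
exact: derive1_cst.
Qed.

Lemma nI2c_ex : nI2c (@jet_ex R) = 2.
Proof.
rewrite /nI2c /hderiv sum3 /nabla1r !row3E !mul0r !add0r.
have -> : I1 (@jet_ex R) / (I2a (@jet_ex R) * I2b (@jet_ex R)) * (Qr (@jet_ex R) / @jet_ex R cW 0%N 0%N 1%N) = -1.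
  by rewrite /Qr /kq /k2b /k2a /I2b /I1 /I2a /=; field.
rewrite mulN1r /total_deriv.
(* This quotient is [I2cr] along the line in direction v through [jet_ex]; it is valid for [t]
   different from -1, hence only near 0. *)
rewrite (near_eq_derive1 (g := fun t : R => (1/2 - t - t * t) / (1 + t) ^+ 2)).
  have di : is_derive (0 : R) (1 : R) (fun t : R => t) 1 by exact: is_derive_id.
  have d1 : is_derive (0 : R) (1 : R) (fun t : R => 1 + t) (0 + 1) by exact: is_deriveD.
  have d0 : is_derive (0 : R) (1 : R) (fun t : R => 1/2 - t - t * t) (0 - 1 - (0 *: 1 + 0 *: 1)).
    exact: (is_deriveB (is_deriveB (is_derive_cst (1 / 2 : R) (0 : R) (1 : R)) di) (is_deriveM di di)).
  have n0 : (1 + 0 : R) != 0 by rewrite addr0 oner_neq0.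
  have [_] := is_derive_quot 2 d0 d1 n0; rewrite derive1E => ->.
  by rewrite !addr0 expr1n !scale0r; field.
have n1 : \forall t \near (0 : R), 1 + t != 0.
  have d1 : is_derive (0 : R) (1 : R) (fun t : R => 1 + t) (0 + 1) by exact: is_deriveD.
  by apply: (derive_near_neq0 d1); rewrite addr0 oner_neq0.
apply: filterS n1 => t t0.
rewrite /I2cr /Nr /Qr /kq /k2b /k2a /I2b /I1 /I2a /hline /= !delta_uE /= ?mulr0n ?mulr1n.
by field; rewrite ?t0.
Qed.

Lemma S0_ex : S0 (@jet_ex R) != 0.
Proof.
rewrite /S0 nI1_ex nI2a_ex nI2c_ex /I1 /I2a /=.
have -> : -1 * (1 ^+ 2 / 1) * 2 * (0 - 2) * 2 = 8 :> R by field.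
by rewrite pnatr_eq0.
Qed.

End GenericJet.

(** * Generation and separation *)

Section Final.
Context {R : realType}.
Local Notation V := 'rV[R]_3.
Local Notation sect := (Defs.comp -> V -> R).
Implicit Types (th : jet R) (P Q F : jet R -> R) (s nu : sect) (U W : set V) (a p q : V) (phi psi : V -> V).

(** Lengths are recorded for the sake of the denominator in [generation], whose bound [m] has to be
    found before the invariant is given. *)
Definition IRm m F := exists2 t, (t <= m)%N & @iteratedR R t F.

Lemma subalg_IRm P : subalg (@IR R) P -> exists m, subalg (IRm m) P.
Proof.
elim=> {P} [F [t It]|c|F G _ [m Hm] _ [m' Hm']|F G _ [m Hm] _ [m' Hm']].
- by exists t; apply: subalg_gen; exists t.
- by exists 0%N; exact: subalg_cst.
- have H1 H : IRm m H -> IRm (m + m') H by move=> [t tm It]; exists t => //; apply: leq_trans tm _; exact: leq_addr.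
  have H2 H : IRm m' H -> IRm (m + m') H by move=> [t tm It]; exists t => //; apply: leq_trans tm _; exact: leq_addl.
  by exists (m + m')%N; apply: subalg_add; [exact: subalg_sub H1 Hm|exact: subalg_sub H2 Hm'].
- have H1 H : IRm m H -> IRm (m + m') H by move=> [t tm It]; exists t => //; apply: leq_trans tm _; exact: leq_addr.
  have H2 H : IRm m' H -> IRm (m + m') H by move=> [t tm It]; exists t => //; apply: leq_trans tm _; exact: leq_addl.
  by exists (m + m')%N; apply: subalg_mul; [exact: subalg_sub H1 Hm|exact: subalg_sub H2 Hm'].
Qed.

Lemma IRm_le m m' F : (m <= m')%N -> IRm m F -> IRm m' F.
Proof. by move=> mm [t tm It]; exists t => //; exact: leq_trans mm. Qed.

Lemma IRm_IR m F : IRm m F -> @IR R F.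
Proof. by move=> [t _ It]; exists t. Qed.

Lemma subalg_Rat P : subalg (@IR R) P -> exists2 k, (2 <= k)%N & Rat k P.
Proof.
elim=> {P} [F [t /iteratedR_Rat[HR _]]|c|F G _ [k k2 Hk] _ [k' k2' Hk']|F G _ [k k2 Hk] _ [k' k2' Hk']].
- by exists t.+2.
- by exists 2%N => //; exact: Rat_cst.
- have kk : (2 <= k + k')%N by apply: leq_trans k2 _; exact: leq_addr.
  exists (k + k')%N => //; apply: Rat_add => //; [apply: Rat_le Hk|apply: Rat_le Hk']; [exact: leq_addr|exact: leq_addl].
- have kk : (2 <= k + k')%N by apply: leq_trans k2 _; exact: leq_addr.
  exists (k + k')%N => //; apply: Rat_mul => //; [apply: Rat_le Hk|apply: Rat_le Hk']; [exact: leq_addr|exact: leq_addl].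
Qed.

Lemma subalg_Rinv P phi th th' : subalg (@IR R) P -> eqEoo th -> eqEoo th' -> in_G (jbase th) phi ->
  (forall n, prolong n phi th th') -> denr th != 0 -> denr th' != 0 -> P th' = P th.
Proof.
move=> HP E E' G pr d d'; elim: HP => {P} [F [t /iteratedR_Rat[_ HF]]|c|F F' _ e _ e'|F F' _ e _ e'] //.
- exact: HF _ _ _ (E _) (E' _) G (pr _) d d'.
- by rewrite e e'.
- by rewrite e e'.
Qed.

Lemma subalg_iterated (G G' : (jet R -> R) -> Prop) P : (forall F, G F -> exists2 F', G' F' & agree F' F) ->
  subalg G P -> exists2 P', subalg G' P' & agree P' P.
Proof.
move=> H; elim=> {P} [F /H[F' HF' A]|c|F F' _ [P sP A] _ [P' sP' A']|F F' _ [P sP A] _ [P' sP' A']].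
- by exists F' => //; exact: subalg_gen.
- by exists (fun=> c) => //; exact: subalg_cst.
- exists (fun th => P th + P' th); first exact: subalg_add.
  by move=> th w0 d0; rewrite A // A'.
- exists (fun th => P th * P' th); first exact: subalg_mul.
  by move=> th w0 d0; rewrite A // A'.
Qed.

Lemma bounded_choice (Q : nat -> nat -> Prop) N : (forall i m m', (m <= m')%N -> Q i m -> Q i m') ->
  (forall i, exists m, Q i m) -> exists m, forall i, (i <= N)%N -> Q i m.
Proof.
move=> mono H; elim: N => [|N [m Hm]].
  by have [m Hm] := H 0%N; exists m => i; rewrite leqn0 => /eqP ->.
have [m' Hm'] := H N.+1; exists (m + m')%N => i; rewrite leq_eqVlt => /orP[/eqP ->|].
  exact: mono (leq_addl _ _) Hm'.
by rewrite ltnS => /Hm; apply: mono; exact: leq_addr.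
Qed.

Definition flat_normal nu U p := [/\ normal nu U, U p, p = row3 0 0 1 & forall i, pderiv (nseq i iu) (nH1 nu) p = 0].

Definition expressible m Q := exists n P, subalg (IRm m) P /\
  forall nu U p, flat_normal nu U p -> Q (jt nu p) * S0 (jt nu p) ^+ n = P (jt nu p).

Lemma expressible_le m m' Q : (m <= m')%N -> expressible m Q -> expressible m' Q.
Proof.
by move=> mm [n [P [HP E]]]; exists n, P; split=> //; apply: subalg_sub HP => F; exact: IRm_le.
Qed.

(** Each coordinate has its own bound by [normal_jet]. Only finitely many coordinates have order at
    most [l], so one bound covers them all. *)
Lemma expressible_jets l : exists m, forall c i j k, (i + j + k <= l)%N -> expressible m (fun th => th c i j k).
Proof.
have H c i j k : exists m, expressible m (fun th => th c i j k).
  have [n [P [/subalg_IRm[m HP] E]]] := @normal_jet R c i j k; exists m, n, P; split=> // nu U p [N Up pE f].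
  by apply: (E nu U p N Up _ f); rewrite pE row3v.
have mono Q m m' : (m <= m')%N -> expressible m Q -> expressible m' Q by exact: expressible_le.
have H1 c i j : exists m, forall k, (k <= l)%N -> expressible m (fun th => th c i j k).
  by apply: (@bounded_choice (fun k m => expressible m (fun th => th c i j k))) => // k m m'; exact: mono.
have H2 c i : exists m, forall j, (j <= l)%N -> forall k, (k <= l)%N -> expressible m (fun th => th c i j k).
  apply: (@bounded_choice (fun j m => forall k, (k <= l)%N -> expressible m (fun th => th c i j k))) => // j m m' mm Hm k kl.
  by apply: mono mm _; exact: Hm.
have H3 c : exists m, forall i, (i <= l)%N -> forall j, (j <= l)%N -> forall k, (k <= l)%N -> expressible m (fun th => th c i j k).
  apply: (@bounded_choice (fun i m => forall j, (j <= l)%N -> forall k, (k <= l)%N -> expressible m (fun th => th c i j k))) => // i m m' mm Hm j jl k kl.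
  by apply: mono mm _; exact: Hm.
have [m1 E1] := H3 cH; have [m2 E2] := H3 cW; have [m3 E3] := H3 ch.
exists (m1 + m2 + m3)%N => c i j k ijk.
have il : (i <= l)%N by lia.
have jl : (j <= l)%N by lia.
have kl : (k <= l)%N by lia.
by case: c; [apply: mono (E1 _ il _ jl _ kl)|apply: mono (E2 _ il _ jl _ kl)|apply: mono (E3 _ il _ jl _ kl)]; lia.
Qed.

Lemma subalg_S0m m : (1 <= m)%N -> subalg (IRm m) (@S0 R).
Proof.
move=> m1; have H t F : (t <= 1)%N -> iteratedR t F -> subalg (IRm m) F.
  by move=> t1 It; apply: subalg_gen; exists t => //; exact: leq_trans m1.
have h1 := H 1%N _ isT (iteratedR_nabla2 (@iteratedR_I1 R)); have h2 := H 0%N _ isT (@iteratedR_I1 R).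
have h3 := H 0%N _ isT (@iteratedR_I2a R); have h4 := H 1%N _ isT (iteratedR_nabla2 (@iteratedR_I2a R)).
have h5 := H 1%N _ isT (iteratedR_nabla1 (@iteratedR_I2cr R)).
exact: (subalg_mul (subalg_mul (subalg_mul (subalg_mul h1 h2) h3) (subalg_add h4 (subalg_opp h3))) h5).
Qed.

Lemma expressible_poly m l Q : (1 <= m)%N ->
  (forall c i j k, (i + j + k <= l)%N -> expressible m (fun th => th c i j k)) -> jetpoly l Q -> expressible m Q.
Proof.
move=> m1 H; elim=> {Q} [f [[i ->]|[c [i [j [k [ijk ->]]]]]]|c|f g _ [n [P [HP E]]] _ [n' [P' [HP' E']]]|f g _ [n [P [HP E]]] _ [n' [P' [HP' E']]]].
- exists 0%N, (fun=> (row3 0 0 1 : V) 0 i); split; first exact: subalg_cst.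
  by move=> nu U p [_ _ -> _]; rewrite expr0 mulr1.
- exact: H.
- by exists 0%N, (fun=> c); split=> [|nu U p _]; [exact: subalg_cst|rewrite expr0 mulr1].
- exists (n + n')%N, (fun th => P th * S0 th ^+ n' + P' th * S0 th ^+ n); split.
    by apply: subalg_add; apply: subalg_mul => //; apply: subalg_exp; exact: subalg_S0m.
  by move=> nu U p N; rewrite -(E _ _ _ N) -(E' _ _ _ N) exprD; ring.
- exists (n + n')%N, (fun th => P th * P' th); split; first exact: subalg_mul.
  by move=> nu U p N; rewrite -(E _ _ _ N) -(E' _ _ _ N) exprD; ring.
Qed.

Lemma in_G_jet a phi c i j l : in_G a phi -> exists2 M, jetpoly (i + j + l) M &
  forall n th t, jbase th = a -> (i + j + l <= n)%N -> prolong n phi th t -> th c i j l = M t.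
Proof.
move=> /in_GP[U [C [A [B [G Ua pE]]]]]; have [M HM EM] := pull_jet c i j l G Ua; exists M => //.
move=> n th t bE ijl [s [s' [sn sn' js js' rel]]]; rewrite bE in sn sn' js js' rel.
have Es := near_eq_jt ((rel_pull s s' G Ua pE).1 rel).
have /section_nearP[W [oW ss' _] Wa] := sn'.
have [_ ->] := js; last exact: ijl.
rewrite -[LHS]/(jt s a c i j l) Es (EM s' W) // -pE //.
by apply/esym; apply: jetpoly_eqj HM _; apply: eqj_le ijl _; exact/is_jetE.
Qed.

(** For a fixed transformation the coordinates of the pulled back jet are polynomials in the jet at
    the image, of the same order. A denominator of bounded order therefore keeps its bound after the
    pullback. *)
Lemma in_G_poly a phi k P : in_G a phi -> jetpoly k P -> exists2 Q, jetpoly k Q &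
  forall th t, jbase th = a -> prolong k phi th t -> P th = Q t.
Proof.
move=> G; elim=> {P} [f [[i ->]|[c [i [j [l [ijl ->]]]]]]|c|f g _ [Q HQ E] _ [Q' HQ' E']|f g _ [Q HQ E] _ [Q' HQ' E']].
- by exists (fun=> a 0 i) => [|th t ->]; first exact: subalg_cst.
- have [M HM EM] := in_G_jet c i j l G; exists M; first exact: jetpoly_le ijl HM.
  by move=> th t bE pr; exact: EM bE ijl pr.
- by exists (fun=> c) => //; exact: subalg_cst.
- exists (fun t => Q t + Q' t); first exact: subalg_add.
  by move=> th t bE pr; rewrite (E th t) // (E' th t).
- exists (fun t => Q t * Q' t); first exact: subalg_mul.
  by move=> th t bE pr; rewrite (E th t) // (E' th t).
Qed.

Lemma pullback_jet a phi nu : in_G a phi -> sol_near (phi a) nu ->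
  exists th, [/\ eqEoo th, jbase th = a & forall n, prolong n phi th (jt nu (phi a))].
Proof.
move=> G sn; have [s [ss rel /(_ sn) sols]] := pull_ex G (sol_section sn).
exists (jt s a); split=> // [k|n]; first exact: sol_near_eqE.
by apply: prolong_jt => //; exact: sol_section.
Qed.

(** [S0] is only rational; clearing a power of [denr] turns the genericity conditions into the
    nonvanishing of one polynomial, tested at [jet_ex]. *)
Lemma generic_poly : exists2 k, (2 <= k)%N & exists T : jet R -> R, [/\ jetpoly k T, T (@jet_ex R) != 0 &
  forall th, eqEoo th -> T th != 0 -> [/\ th cW 0%N 0%N 0%N != 0, denr th != 0 & S0 th != 0]].
Proof.
have [k k2 [n [P [HP E]]]] := subalg_Rat (@subalg_S0 R).
exists k => //; exists (fun th => th cW 0%N 0%N 0%N * denr th * P th); split.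
- by apply: subalg_mul => //; apply: subalg_mul; [exact: jetpoly_coord|exact: jetpoly_denr].
- have d0 : denr (@jet_ex R) != 0 by rewrite jet_ex_denr oppr_eq0 pnatr_eq0.
  rewrite -E //; last exact: jet_ex_eqEoo.
  have w1 : @jet_ex R cW 0%N 0%N 0%N != 0 by exact: oner_neq0.
  exact: (mulf_neq0 (mulf_neq0 w1 d0) (mulf_neq0 S0_ex (expf_neq0 n d0))).
- move=> th Eth; rewrite mulf_eq0 negb_or => /andP[+ P0]; rewrite mulf_eq0 negb_or => /andP[w0 d0].
  split; [exact: w0|exact: d0|].
  by apply: contraNneq P0 => s0; rewrite -E // s0 mul0r.
Qed.

(** [F th] is computed at another point [th1] of the orbit, the pullback by [phi0] of the normal
    form of [th]. There [F] is the quotient of [QP] and [QS] at the normal jet, both of which are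
    expressed by iterated derivatives. *)
Lemma generation l : exists m : nat, forall F : jet R -> R, algA l F ->
  exists P S T : jet R -> R,
    [/\ subalg (fun G => exists t, iterated t G) P,
        subalg (fun G => exists2 t, (t <= m)%N & iterated t G) S,
        exists k, jetpoly k T, nonzero T &
        forall th, eqEoo th -> T th != 0 -> S th != 0 /\ F th = P th / S th].
Proof.
have [m Hm] := expressible_jets l; exists m.+1 => F [k [PF [SF [HPF HSF NS FE FI]]]].
have [k3 k32 [T3 [HT3 T3ex T3g]]] := generic_poly.
have NT3 : nonzero T3 by exists (@jet_ex R); split=> //; exact: jet_ex_eqEoo.
(* A generic point at which the denominator of [F] does not vanish; the transformation normalising
   it is the fixed [phi0]. *)
have [th0 [Eth0 TS0]] := nonzero_mul HT3 HSF NT3 NS.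
have : T3 th0 != 0 /\ SF th0 != 0 by move: TS0; rewrite mulf_eq0 negb_or => /andP.
move=> [T30 SF0] {TS0}; have [w0 d0 s0] := T3g th0 Eth0 T30.
have [phi0 [nu0 [W0 [G0 N0 W0a b0 [f0 pr0]]]]] := normal_form Eth0 d0 s0.
have [QP HQP EQP] := in_G_poly G0 HPF; have [QS HQS EQS] := in_G_poly G0 HSF.
(* [QS] has order at most [l], so its bound does not depend on [F], in contrast to that of [QP]. The
   successor leaves room for [S0], whose factors have length up to 1. *)
have [nS [S1 [HS1 ES1]]] : expressible m.+1 QS.
  apply: (@expressible_poly _ l) => //; last by apply: jetpoly_le HQS; exact: geq_minl.
  by move=> c i j r ijr; apply: expressible_le (leqnSn m) _; exact: Hm.
have [m' Hm'] := expressible_jets k.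
have [nP [P1 [HP1 EP1]]] : expressible m'.+1 QP.
  apply: (@expressible_poly _ k) => //.
  by move=> c i j r ijr; apply: expressible_le (leqnSn m') _; exact: Hm'.
have IS1 : subalg (@IR R) S1 by apply: subalg_sub HS1 => G; exact: IRm_IR.
have IP1 : subalg (@IR R) P1 by apply: subalg_sub HP1 => G; exact: IRm_IR.
(* From [QS * S0 ^+ nS = S1] and [QP * S0 ^+ nP = P1], the quotient of [QP] by [QS] is that of
   [P1 * S0 ^+ nS] by [S1 * S0 ^+ nP]. *)
have [S' HS' AS'] := subalg_iterated (G' := fun G => exists2 t, (t <= m.+1)%N & iterated t G)
  (fun G (H : IRm m.+1 G) => let: ex_intro2 t tm It := H in
     let: ex_intro2 G' IG' A := iteratedR_iterated It in ex_intro2 _ _ G' (ex_intro2 _ _ t tm IG') A)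
  (subalg_mul HS1 (subalg_exp nP (@subalg_S0m m.+1 isT))).
have [P' HP' AP'] := subalg_iterated (G' := fun G => exists t, iterated t G)
  (fun G (H : IR G) => let: ex_intro t It := H in
     let: ex_intro2 G' IG' A := iteratedR_iterated It in ex_intro2 _ _ G' (ex_intro _ t IG') A)
  (subalg_mul IP1 (subalg_exp nS (@subalg_S0 R))).
have [kS kS2 [n1 [PS1 [HPS1 EPS1]]]] := subalg_Rat IS1.
exists P', S', (fun th => T3 th * SF th * PS1 th); split=> //.
- exists (k3 + k + kS)%N; do 2?apply: subalg_mul.
  + by apply: jetpoly_le HT3; lia.
  + by apply: jetpoly_le HSF; lia.
  + by apply: jetpoly_le HPS1; lia.
(* At [th0] the invariant function [S1] can be evaluated on the normal form, where it is [QS] times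
   a power of [S0], and [QS] there is the value of [SF] at [th0]. *)
- exists th0; split=> //; rewrite !mulf_neq0 // -EPS1 // mulf_neq0 ?expf_neq0 //.
  have [_ dn _] := normal_pt N0 W0a.
  have E0 n := sol_near_eqE n (normal_sol N0 W0a).
  rewrite -(subalg_Rinv IS1 Eth0 E0 G0 pr0 d0 dn) -(ES1 nu0 W0) // mulf_neq0 //; last exact: S0n_neq0 N0 W0a.
  by rewrite -(EQS th0) //.
move=> th Eth; rewrite !mulf_eq0 !negb_or => /andP[/andP[T3th SFth] PSth].
have [w1 d1 s1] := T3g th Eth T3th.
have [phi [nu [W [G N Wa b [f pr]]]]] := normal_form Eth d1 s1.
have bb : phi (jbase th) = phi0 (jbase th0) by rewrite b b0.
have sn := normal_sol N Wa; have [_ dn sn0] := normal_pt N Wa; have En n := sol_near_eqE n sn.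
have sn' : sol_near (phi0 (jbase th0)) nu by rewrite -bb.
(* All flat normal forms have base point [(0, 0, 1)], so the inverse of [phi0] applies to the normal
   form of every generic [th]. *)
have [th1 [Eth1 b1 pr1]] := pullback_jet G0 sn'.
have [psi [Gpsi pp qq]] := in_G_inv G0.
have fl : flat_normal nu W (phi0 (jbase th0)) by rewrite -bb; split.
have Gpsi' : in_G (phi (jbase th)) psi by rewrite bb.
have prc n : prolong n (psi \o phi) th th1.
  apply: prolong_comp G Gpsi' (pr n) _; rewrite bb.
  by have := pr1 n; apply: prolong_inv; rewrite b1.
have S1th : S1 th != 0 by apply: contraNneq PSth => e; rewrite -EPS1 // e mul0r.
have eS : QS (jt nu (phi (jbase th))) * S0 th ^+ nS = S1 th.
  rewrite -(subalg_Rinv (@subalg_S0 R) Eth En G pr d1 dn) -(subalg_Rinv IS1 Eth En G pr d1 dn) bb.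
  exact: ES1 fl.
have eP : QP (jt nu (phi (jbase th))) * S0 th ^+ nP = P1 th.
  rewrite -(subalg_Rinv (@subalg_S0 R) Eth En G pr d1 dn) -(subalg_Rinv IP1 Eth En G pr d1 dn) bb.
  exact: EP1 fl.
have SF1 : SF th1 != 0.
  rewrite (EQS th1 (jt nu (phi0 (jbase th0)))) // -bb.
  by apply: contraNneq S1th => e; rewrite -eS e mul0r.
have -> : F th = F th1.
  by apply/esym; apply: (FI (psi \o phi)) => //; exact: in_G_comp.
rewrite FE // (EQS th1 (jt nu (phi0 (jbase th0)))) // (EQP th1 (jt nu (phi0 (jbase th0)))) // -bb.
have z n : S0 th ^+ n != 0 by exact: expf_neq0.
rewrite AS' // AP' //; split; first by rewrite mulf_neq0.
rewrite -eS -eP; have := S1th; rewrite -eS mulf_eq0 negb_or => /andP[q0 _].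
by move: (QP _) (QS _) q0 (S0 th ^+ nS) (z nS) (S0 th ^+ nP) (z nP) => x y y0 c c0 e e0; field; rewrite y0 c0 e0.
Qed.

(** By [normal_jet] equal iterated derivatives force the two flat normal forms to have equal jets;
    one normalisation followed by the inverse of the other then joins the points. *)
Lemma separation : exists (k : nat) (T : jet R -> R), [/\ jetpoly k T, nonzero T &
  forall th th' : jet R, eqEoo th -> eqEoo th' -> T th != 0 -> T th' != 0 ->
    (forall t F, iterated t F -> F th = F th') ->
    exists phi : V -> V, in_G (jbase th) phi /\ forall n, prolong n phi th th'].
Proof.
have [k k2 [T [HT Tex Tg]]] := generic_poly; exists k, T; split=> //.
  by exists (@jet_ex R); split=> //; exact: jet_ex_eqEoo.
move=> th th' E E' /(Tg th E)[w0 d0 s0] /(Tg th' E')[w0' d0' s0'] HF.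
have A P : subalg (@IR R) P -> P th = P th'.
  elim=> {P} [F [t /iteratedR_iterated[F' It AF]]|c|F F' _ e _ e'|F F' _ e _ e'] //.
  - by rewrite -!AF //; exact: HF It.
  - by rewrite e e'.
  - by rewrite e e'.
have [phi [nu [W [G N Wa b [f pr]]]]] := normal_form E d0 s0.
have [phi' [nu' [W' [G' N' W'a b' [f' pr']]]]] := normal_form E' d0' s0'.
have bb : phi (jbase th) = phi' (jbase th') by rewrite b b'.
have [_ dn sn] := normal_pt N Wa; have [_ dn' sn'] := normal_pt N' W'a.
have En n := sol_near_eqE n (normal_sol N Wa); have En' n := sol_near_eqE n (normal_sol N' W'a).
have eP P : subalg (@IR R) P -> P (jt nu (phi (jbase th))) = P (jt nu' (phi' (jbase th'))).
  move=> HP; rewrite (subalg_Rinv HP E En G pr d0 dn) (subalg_Rinv HP E' En' G' pr' d0' dn').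
  exact: A.
have eJ n : eqj n (jt nu' (phi' (jbase th'))) (jt nu (phi (jbase th))).
  split=> // c i j l _; have [r [P [HP EP]]] := @normal_jet R c i j l.
  have e1 := EP nu W (phi (jbase th)) N Wa _ f; have e2 := EP nu' W' (phi' (jbase th')) N' W'a _ f'.
  apply: (mulIf (S0n_neq0 r N' W'a)); rewrite e2 ?b' ?row3v // -b' -(eP _ HP) -(eP _ (@subalg_S0 R)).
  by rewrite e1 // b row3v.
have [psi [Gpsi pp qq]] := in_G_inv G'.
have Gpsi' : in_G (phi (jbase th)) psi by rewrite bb.
exists (psi \o phi); split; first exact: in_G_comp.
move=> n; apply: prolong_comp G Gpsi' (pr n) _.
by apply: prolong_eqj (eJ n) (eqj_refl _ _) _; exact: prolong_inv G' Gpsi pp qq (pr' n).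
Qed.

End Final.

Theorem theorem15 (R : realType) :
  (* the I_a are differential invariants, the nabla_b invariant derivations *)
  [/\ [/\ diff_invariant 1 1 (@I1 R), diff_invariant 2 2 (@I2a R) &
          diff_invariant 2 2 (@I2c R)],
      [/\ invariant_derivation 2 (@nabla1 R),
          invariant_derivation 2 (@nabla2 R) &
          invariant_derivation 2 (@nabla3 R)],
      (* their iterated derivatives belong to A *)
      forall (t : nat) (F : jet R -> R), iterated t F -> algA 2 F,
      (* A is generated by them: every F in A is a polynomial in the iterated
         derivatives, with coefficients rational in those of bounded length *)
      forall l : nat, exists m : nat, forall F : jet R -> R, algA l F ->
        exists P S T : jet R -> R,
          [/\ subalg (fun G => exists t, iterated t G) P,
              subalg (fun G => exists2 t, (t <= m)%N & iterated t G) S,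
              exists k, jetpoly k T, nonzero T &
              forall th, eqEoo th -> T th != 0 ->
                S th != 0 /\ F th = P th / S th] &
      (* and generic orbits on the infinite prolongation are separated *)
      exists (k : nat) (T : jet R -> R),
        [/\ jetpoly k T, nonzero T &
            forall th th' : jet R, eqEoo th -> eqEoo th' ->
              T th != 0 -> T th' != 0 ->
              (forall t F, iterated t F -> F th = F th') ->
              exists phi : 'rV[R]_3 -> 'rV[R]_3,
                in_G (jbase th) phi /\ forall n, prolong n phi th th']].
Proof.
split; [split|split| | |].
- exact: diff_invariant_I1.
- exact: diff_invariant_I2a.
- exact: diff_invariant_I2c.
- exact: invariant_nabla1.
- exact: invariant_nabla2.
- exact: invariant_nabla3.
- exact: iterated_algA.
- exact: generation.
- exact: separation.
Qed.
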